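(* Let $L>0$ and let $\gamma(s)=(x(s),y(s))$, $s\in[0,L]$, be a smooth, non-closed, simple planar curve parametrized with respect to its arc length, with $$x(L-s)=-x(s),\qquad y(L-s)=y(s),\qquad s\in\left[0,\tfrac{L}{2}\right].$$ Suppose that the signed curvature $k(s)=x'(s)y''(s)-y'(s)x''(s)$ of $\gamma$ is concave in $[0,L]$, let $\delta>0$ be such that $1+\delta k(s)>0$ for all $s\in[0,L]$, and suppose that $$D=\left\{(x(s)+ry'(s),\,y(s)-rx'(s)):\ s\in(0,L),\ r\in(0,\delta)\right\}$$ is simply connected. Set $$R=\frac{L^2}{\pi^2}\,\frac{\displaystyle\int_0^L\left(\int_0^\delta\cos^2\left(\frac{\pi}{L}s\right)(1+rk(s))\,dr\right)ds}{\displaystyle\int_0^L\left(\int_0^\delta\sin^2\left(\frac{\pi}{L}s\right)\frac{1}{1+rk(s)}\,dr\right)ds}.$$ Then $$\mu_1(D)=\mu_1^{odd}(D)$$ if one of the following alternatives holds: (1) $k(s)\ge0$ for all $s\in[0,L]$ and $$\max_{s\in[0,L]}\delta^2(2+\delta k(s))^2<R;$$ (2) $k(s)<0$ for all $s\in[0,L]$ and $$\max_{s\in[0,L]}\frac{4\delta^2}{(1+\delta k(s))^2}<R;$$ (3) $k(s)$ changes its sign in $[0,L]$ and $$\max\left\{\max_{s\in[0,L]}\delta^2(2+\delta k(s))^2,\ \max_{s\in[0,L]}\frac{4\delta^2}{(1+\delta k(s))^2}\right\}<R.$$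
   Context: For a bounded, connected, Lipschitz domain $D$, the Neumann eigenvalues of $D$ are the numbers $\mu$ for which the problem $-\Delta u=\mu u$ in $D$, $\partial u/\partial\mathbf{n}=0$ on $\partial D$ (with $\mathbf{n}$ the exterior unit normal) has a nonzero solution (an eigenfunction). All functions are real-valued. They are arranged in a non-decreasing sequence $0=\mu_0(D)\le\mu_1(D)\le\dots$, repeated according to multiplicity; $\mu_1(D)$ is the first nontrivial one, i.e. $\mu_1(D)=\min\left\{\int_D|\nabla\psi|^2/\int_D\psi^2:\ \psi\in H^1(D)\setminus\{0\},\ \int_D\psi=0\right\}$. $\mu_1^{odd}(D)$ denotes the smallest nontrivial (nonzero) Neumann eigenvalue of $D$ having a corresponding eigenfunction that is odd with respect to the $y$-axis, i.e. $u(-x,y)=-u(x,y)$. *)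

(* Defs.v *)
From HB Require Import structures.
From mathcomp Require Import all_boot all_order all_algebra.
From mathcomp Require Import all_classical all_reals all_analysis.

Set Implicit Arguments.
Unset Strict Implicit.
Unset Printing Implicit Defensive.

Import Order.TTheory GRing.Theory Num.Theory.
Import numFieldNormedType.Exports.

Local Open Scope classical_set_scope.
Local Open Scope ring_scope.

Section SimplyConnected.
Context {R : realType} {T : topologicalType}.
Implicit Types (D : set T) (g : R -> T).

Definition unit_itv : set R := `[0, 1].

Definition path_in D g := {within unit_itv, continuous g} /\ g @` unit_itv `<=` D.

Definition path_connected D :=
  forall p q, D p -> D q -> exists g, [/\ path_in D g, g 0 = p & g 1 = q].

Definition null_homotopic_in D g := exists H : R * R -> T,
  [/\ {within unit_itv `*` unit_itv, continuous H},
      H @` (unit_itv `*` unit_itv) `<=` D,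
      forall t, unit_itv t -> H (t, 0) = g t,
      forall t, unit_itv t -> H (t, 1) = g 0 &
      forall a, unit_itv a -> H (0, a) = g 0 /\ H (1, a) = g 0].

Definition simply_connected D := path_connected D /\
  forall g, path_in D g -> g 0 = g 1 -> null_homotopic_in D g.

End SimplyConnected.
Arguments simply_connected R {T} D.

Section Neumann.
Context {R : realType}.
Implicit Types (D : set (R * R)) (u v f phi : R * R -> R).

Definition lebesgue2 :
    {measure set (measurableTypeR R * measurableTypeR R) -> \bar R} :=
  (@lebesgue_measure R \x @lebesgue_measure R)%E.

Definition ex : R * R := (1, 0).
Definition ey : R * R := (0, 1).

Definition iter_derive (vs : seq (R * R)) f : R * R -> R :=
  foldr (fun e h p => 'D_e h p) f vs.

Definition smooth2 f := forall vs p, differentiable (iter_derive vs f) p.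

Definition test_function D phi :=
  [/\ smooth2 phi, compact (closure [set p | phi p != 0]) &
      closure [set p | phi p != 0] `<=` D].

(* The restriction [u \_ D] extends [u] by 0, so this is u in L^2(D). *)
Definition L2 D u := (u \_ D) \in Lfun lebesgue2 2%:E.

Definition weak_derivative D (e : R * R) u f := forall phi, test_function D phi ->
  \int[lebesgue2]_(p in D) (u p * 'D_e phi p) =
  - \int[lebesgue2]_(p in D) (f p * phi p).

(* u is in H^1(D) and its weak gradient is (ux, uy); all functions stand for
   their classes modulo equality almost everywhere in D. *)
Definition H1 D u ux uy :=
  [/\ L2 D u, L2 D ux, L2 D uy,
      weak_derivative D ex u ux & weak_derivative D ey u uy].

Definition null_on D u := {ae lebesgue2, forall p, D p -> u p = 0}.

(* Weak formulation of -Delta u = mu u in D, du/dn = 0 on the boundary of D. *)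
Definition neumann_eigenfunction D (mu : R) u := exists ux uy,
  [/\ H1 D u ux uy, ~ null_on D u &
      forall v vx vy, H1 D v vx vy ->
        \int[lebesgue2]_(p in D) (ux p * vx p + uy p * vy p) =
        mu * \int[lebesgue2]_(p in D) (u p * v p)].

Definition odd_wrt_y_axis D u :=
  {ae lebesgue2, forall p, D p -> u (- p.1, p.2) = - u p}.

Definition is_min (A : set R) (m : R) := A m /\ lbound A m.

Definition rayleigh_quotients D : set R := [set q | exists u ux uy,
  [/\ H1 D u ux uy, ~ null_on D u, \int[lebesgue2]_(p in D) u p = 0 &
      q = (\int[lebesgue2]_(p in D) (ux p ^+ 2 + uy p ^+ 2)) /
          (\int[lebesgue2]_(p in D) (u p ^+ 2))]].

Definition is_mu1 D (m : R) := is_min (rayleigh_quotients D) m.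

Definition is_mu1_odd D (m : R) := is_min
  [set mu | mu != 0 /\
     exists u, neumann_eigenfunction D mu u /\ odd_wrt_y_axis D u] m.

End Neumann.

Section Strip.
Context {R : realType}.
Implicit Types (x y k : R -> R) (L delta : R).

(* Smoothness up to the endpoints of [0, L], i.e. on an open interval
   containing [0, L]. *)
Definition smooth_on_segment L x := exists2 e : R, 0 < e &
  forall n s, - e < s < L + e -> derivable (derive1n n x) s 1.

Definition curvature x y (s : R) : R :=
  derive1 x s * derive1n 2 y s - derive1 y s * derive1n 2 x s.

Definition concave_on_segment L k := convex_function (`[0, L] : set R) (\- k).

Definition strip L delta x y : set (R * R) :=
  [set p | exists s r, [/\ 0 < s < L, 0 < r < delta &
     p = (x s + r * derive1 y s, y s - r * derive1 x s)]].

Definition max_on_segment L (f : R -> R) : R := sup (f @` `[0, L]).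

Definition strip_ratio L delta k : R :=
  L ^+ 2 / pi ^+ 2 *
  ((\int[lebesgue_measure]_(s in `[0, L]) \int[lebesgue_measure]_(r in `[0, delta])
      (cos (pi / L * s) ^+ 2 * (1 + r * k s))) /
   (\int[lebesgue_measure]_(s in `[0, L]) \int[lebesgue_measure]_(r in `[0, delta])
      (sin (pi / L * s) ^+ 2 * (1 / (1 + r * k s))))).

End Strip.

(* Main.v *)
(** In the coordinates [(s, r)] the strip is the rectangle ]0, L[ x ]0, delta[ with
    weight [h = 1 + r k], the Dirichlet form being [int (u_s^2 / h + h u_r^2)].  Simple
    connectedness rules out overlaps: an overlap would force the strip to wind around the
    centre of curvature of an endpoint.  Let [mu] be the infimum of the Rayleigh quotient over
    odd functions; by Poincare inequalities on the cells of a fine grid it is attained, and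
    the test function cos (pi s / L) gives [mu <= 1 / R].  If some even function of mean zero
    had a smaller quotient, take a near-minimizer [w].  On a slice [s = const] where [w]
    vanishes, the hypothesis on [delta] gives [int h w_r^2 >= mu int h w^2]; so, [k] being
    even, either every slice vanishes somewhere, a contradiction, or some slices [s] and [L - s]
    have a constant sign, say positive.  The negative part of [w] then splits into pieces to
    the left and to the right of the extreme signed slices, which extend to odd functions,
    and a middle piece made of vanishing slices: its quotient is at least [mu].  Hence the
    negative part of [w] is small, against the mean zero condition.  Transferring back to
    the strip requires the density of such functions in H1, obtained by mollification after
    contracting the rectangle. *)
From HB Require Import structures.
Require Import Defs.
From mathcomp Require Import all_boot all_order all_algebra.
From mathcomp Require Import all_classical all_reals all_analysis.
From mathcomp Require Import measurable_realfun ring lra.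
Import Order.TTheory GRing.Theory Num.Theory.
Import numFieldNormedType.Exports.
Local Open Scope classical_set_scope.
Local Open Scope ring_scope.
Set Implicit Arguments.
Unset Strict Implicit.
Unset Printing Implicit Defensive.

(** * Continuity and derivatives *)

(** The variational argument only handles functions that are C1 on the rectangle, and [mu] is an
    infimum over these; signs are read on single slices of continuous functions, so neither
    regularity nor nodal theory of eigenfunctions is involved. The price is that the even competitor
    has no minimizer at hand. A near-minimizer with defect [e ^ 2] satisfies the Euler equation up
    to [e], by Cauchy-Schwarz for the nonnegative form [QQ - nu * NN]; this makes the mass of the
    negative part of order [e]. The negative part is itself replaced by [psi e], whose derivative
    vanishes on nonnegative values, so that cutting at a signed slice keeps it C1. The bound on
    [delta] enters through one number per slice: if the slice inequality holds with constant
    [M < R], then [mu * M <= 1] because [mu <= 1 / R]. Concavity of the curvature enters through the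
    geometry: with the symmetry it makes [k] nonincreasing on the right half, so the tangent there
    turns one way and then the other, and [Phi] sends the two halves to opposite half planes. *)

Section Continuity.
Context {R : realType} {T U : topologicalType}.
Implicit Types f g : T -> R.

Lemma contD f g : continuous f -> continuous g -> continuous (fun x => f x + g x).
Proof. by move=> cf cg x; apply: cvgD; [exact: cf | exact: cg]. Qed.

Lemma contN f : continuous f -> continuous (fun x => - f x).
Proof. by move=> cf x; apply: cvgN; exact: cf. Qed.

Lemma contM f g : continuous f -> continuous g -> continuous (fun x => f x * g x).
Proof. by move=> cf cg x; apply: cvgM; [exact: cf | exact: cg]. Qed.

Lemma contX n f : continuous f -> continuous (fun x => f x ^+ n).
Proof.
move=> cf; elim: n => [|n IH].
  by rewrite (_ : (fun _ => _) = cst 1) //; exact: cst_continuous.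
by under eq_fun do rewrite exprS; exact: contM.
Qed.

Lemma contV f : (forall x, f x != 0) -> continuous f ->
  continuous (fun x => (f x)^-1).
Proof. by move=> f0 cf x; apply: cvgV; [exact: f0 | exact: cf]. Qed.

Lemma cont_comp {V : topologicalType} (f : U -> V) (g : T -> U) :
  continuous f -> continuous g -> continuous (fun x => f (g x)).
Proof. by move=> cf cg x; apply: (@continuous_comp _ _ _ g f); [exact: cg | exact: cf]. Qed.

Lemma cont_pair {V : topologicalType} (f : T -> U) (g : T -> V) :
  continuous f -> continuous g -> continuous (fun x => (f x, g x)).
Proof. by move=> cf cg x; apply: cvg_pair; [exact: cf | exact: cg]. Qed.

Lemma cont_min f g : continuous f -> continuous g ->
  continuous (fun x => Num.min (f x) (g x)).
Proof. by move=> cf cg x; apply: continuous_min; [exact: cf | exact: cg]. Qed.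

Lemma cont_max f g : continuous f -> continuous g ->
  continuous (fun x => Num.max (f x) (g x)).
Proof. by move=> cf cg x; apply: continuous_max; [exact: cf | exact: cg]. Qed.

Lemma cont_norm f : continuous f -> continuous (fun x => `|f x|).
Proof. by move=> cf x; apply: cvg_norm; exact: cf. Qed.

Lemma cont_within {V : topologicalType} (A : set T) (f : T -> V) :
  continuous f -> {within A, continuous f}.
Proof. exact: continuous_subspaceT. Qed.

End Continuity.

Lemma cont_fst {T U : topologicalType} : continuous (@fst T U).
Proof. by move=> x; exact: cvg_fst. Qed.

Lemma cont_snd {T U : topologicalType} : continuous (@snd T U).
Proof. by move=> x; exact: cvg_snd. Qed.

Lemma cont_id {T : topologicalType} : continuous (fun x : T => x).
Proof. by move=> x; exact: cvg_id. Qed.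

Lemma cont_cst {T U : topologicalType} (a : U) : continuous (fun _ : T => a).
Proof. exact: cst_continuous. Qed.

Create HintDb cont.

Ltac cts_step F := first [lazymatch F with
  | (fun x => x) => exact: cont_id
  | (fun x => @?f x + @?g x) => apply: (@contD _ _ f g)
  | (fun x => - @?f x) => apply: (@contN _ _ f)
  | (fun x => @?f x * @?g x) => apply: (@contM _ _ f g)
  | (fun x => @?f x ^+ ?n) => apply: (@contX _ _ n f)
  | (fun x => (@?f x, @?g x)) => apply: (@cont_pair _ _ _ f g)
  | (fun x => Num.min (@?f x) (@?g x)) => apply: (@cont_min _ _ f g)
  | (fun x => Num.max (@?f x) (@?g x)) => apply: (@cont_max _ _ f g)
  | (fun x => `|@?f x|) => apply: (@cont_norm _ _ f)
  | (fun x => sin (@?f x)) => apply: (@cont_comp _ _ _ sin f); [exact: continuous_sin|]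
  | (fun x => cos (@?f x)) => apply: (@cont_comp _ _ _ cos f); [exact: continuous_cos|]
  | (fun x => fst x) => exact: cont_fst
  | (fun x => snd x) => exact: cont_snd
  | (fun x => fst (@?f x)) => apply: (@cont_comp _ _ _ fst f); [exact: cont_fst|]
  | (fun x => snd (@?f x)) => apply: (@cont_comp _ _ _ snd f); [exact: cont_snd|]
  | (fun x => ?f x) =>
      let H := fresh in have H : continuous f by (assumption || auto with cont); exact: H
  | (fun x => ?f (@?g x)) =>
      apply: (@cont_comp _ _ _ f g); [solve [assumption | auto with cont]|]
  end | exact: cont_fst | exact: cont_snd | exact: cont_cst].
Ltac cts1 :=
  let y := fresh in intro y;
  lazymatch goal with |- @continuous_at _ _ _ ?F => revert y; cts_step F end.
Ltac cts := repeat first [assumption | cts1 | solve [auto with cont]].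

Section Derivatives.
Context {R : realType}.
Implicit Types (f g : R -> R) (x a b c : R).

Lemma der_eq f x a b : is_derive x 1 f a -> a = b -> is_derive x 1 f b.
Proof. by move=> + <-. Qed.

Lemma derD f g x a b : is_derive x 1 f a -> is_derive x 1 g b ->
  is_derive x 1 (fun x => f x + g x) (a + b).
Proof. by move=> df dg; exact: is_deriveD. Qed.

Lemma derN f x a : is_derive x 1 f a -> is_derive x 1 (fun x => - f x) (- a).
Proof. by move=> df; exact: is_deriveN. Qed.

Lemma derM f g x a b : is_derive x 1 f a -> is_derive x 1 g b ->
  is_derive x 1 (fun x => f x * g x) (f x * b + g x * a).
Proof. by move=> df dg; exact: is_deriveM. Qed.

Lemma derX n f x a : is_derive x 1 f a ->
  is_derive x 1 (fun x => f x ^+ n) (n%:R * f x ^+ n.-1 * a).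
Proof.
move=> df; elim: n => [|n IH].
  by apply: (der_eq (is_derive_cst _ _ _)); rewrite !mul0r.
rewrite (_ : (fun _ => _) = (fun y => f y * f y ^+ n)); last first.
  by apply/funext => y; rewrite exprS.
apply: (der_eq (derM df IH)).
by case: n {IH} => [|n]; rewrite /= ?expr0 ?exprS -?natr1; ring.
Qed.

Lemma derV f x a : f x != 0 -> is_derive x 1 f a ->
  is_derive x 1 (fun x => (f x)^-1) (- a / f x ^+ 2).
Proof.
move=> f0 df; apply: (der_eq (is_deriveV f0 df)).
by rewrite /GRing.scale /= -exprVn; ring.
Qed.

Lemma der_cst (c x : R) : is_derive x 1 (fun _ => c) 0.
Proof. exact: is_derive_cst. Qed.

Lemma der_id (x : R) : is_derive x 1 (fun y : R => y) 1.
Proof. exact: is_derive_id. Qed.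

Lemma der_comp f g x a b : is_derive (g x) 1 f a -> is_derive x 1 g b ->
  is_derive x 1 (fun y => f (g y)) (b * a).
Proof. by move=> df dg; apply: (der_eq (is_derive1_comp df dg)); rewrite mulrC. Qed.

Lemma der_sin f x a : is_derive x 1 f a ->
  is_derive x 1 (fun x => sin (f x)) (a * cos (f x)).
Proof. by move=> df; apply: der_comp. Qed.

Lemma der_cos f x a : is_derive x 1 f a ->
  is_derive x 1 (fun x => cos (f x)) (a * - sin (f x)).
Proof. by move=> df; apply: der_comp. Qed.

Lemma der_cont f x a : is_derive x 1 f a -> {for x, continuous f}.
Proof. by move=> df; apply: differentiable_continuous; apply/derivable1_diffP. Qed.

Lemma near_der f g (a b x c : R) : a < x < b ->
  (forall y, a < y < b -> f y = g y) ->
  is_derive x 1 f c -> is_derive x 1 g c.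
Proof.
move=> /andP[ax xb] fg df; apply: near_eq_is_derive df.
have : \forall y \near x, y \in `]a, b[ by apply: near_in_itvoo; rewrite in_itv /= ax.
by apply: filterS => y; rewrite in_itv /= => /fg ->.
Qed.

(** Continuity is required on the whole line, which the clamped functions used below provide, while
    differentiability is required inside the interval only. *)
Lemma der_le f f' a b : a <= b -> continuous f ->
  (forall x, a < x < b -> is_derive x 1 f (f' x)) ->
  (forall x, a < x < b -> 0 <= f' x) -> f a <= f b.
Proof.
rewrite le_eqVlt => /predU1P[-> //|ab] cf df f'0.
have dd x : x \in `]a, b[ -> is_derive x 1 f (f' x) by rewrite in_itv /=; exact: df.
have [c] := MVT ab dd (cont_within cf).
rewrite in_itv /= => cab e; rewrite -subr_ge0 e mulr_ge0 ?f'0 ?subr_ge0 //.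
exact: ltW.
Qed.

Lemma der_lt f f' a b : a < b -> continuous f ->
  (forall x, a < x < b -> is_derive x 1 f (f' x)) ->
  (forall x, a < x < b -> 0 < f' x) -> f a < f b.
Proof.
move=> ab cf df f'0.
have dd x : x \in `]a, b[ -> is_derive x 1 f (f' x) by rewrite in_itv /=; exact: df.
have [c] := MVT ab dd (cont_within cf).
rewrite in_itv /= => cab e; rewrite -subr_gt0 e mulr_gt0 ?f'0 ?subr_gt0 //.
Qed.

Lemma der0_eq f a b : a <= b -> continuous f ->
  (forall x, a < x < b -> is_derive x 1 f 0) -> f a = f b.
Proof.
move=> ab cf df; apply/eqP; rewrite eq_le (der_le ab cf df) //=.
rewrite -lerN2; apply: (@der_le (fun x => - f x) (fun _ => - 0) a b ab).
- by cts.
- by move=> x xab; exact: (derN (df _ xab)).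
- by move=> *; rewrite oppr0.
Qed.

End Derivatives.

(* The derivative is left as an evar, compared afterwards with the expected value. *)
Ltac drv := repeat first
  [ eassumption | notypeclasses refine (der_cst _ _) | notypeclasses refine (der_id _)
  | notypeclasses refine (derD _ _) | notypeclasses refine (derN _)
  | notypeclasses refine (derX _ _) | notypeclasses refine (derM _ _)
  | notypeclasses refine (der_sin _) | notypeclasses refine (der_cos _) ].

Ltac dereq := notypeclasses refine (der_eq _ _); [drv | cbv beta].

(** Only [z] has to lie in [A]: the compact covering provides one radius valid around all points of
    [A], also towards points outside it. Neighbours may therefore leave the compact set. *)
Lemma unif_cont_compact {R : realType} {T : pseudoMetricType R} (A : set T)
  (f : T -> R) (e : R) : compact A -> continuous f -> 0 < e ->
  exists2 d, 0 < d & forall z z', A z -> ball z d z' -> `|f z - f z'| < e.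
Proof.
move=> cA cf e0.
pose P (d : R) (z : T) := forall z', ball z d z' -> `|f z - f z'| < e.
have /compact_near_coveringP/(_ R (0^'+) P _) cov := cA.
have AP : \forall d \near 0^'+, A `<=` P d.
  apply: cov => z Az.
  have e20 : 0 < e / 2 by rewrite divr_gt0.
  have /cvgrPdist_lt/(_ _ e20) := cf z.
  move=> /nbhs_ballP[r /= r0 fr].
  have r20 : 0 < r / 2 by rewrite divr_gt0.
  exists (ball z (r / 2), [set d | 0 < d < r / 2]).
    split => /=; first exact: nbhsx_ballx.
    near=> d => /=; apply/andP; split; near: d.
      exact: nbhs_right_gt.
    exact: nbhs_right_lt.
  move=> [z1 d] /= [zz1 /andP[d0 dr]] z' z1z'.
  have zz' : ball z r z'.
    rewrite (splitr r); apply: ball_triangle zz1 _.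
    exact: le_ball (ltW dr) _ z1z'.
  have zz1' : ball z r z1 by apply: le_ball zz1; rewrite ler_pdivrMr // ler_peMr ?ltW // ltr1n.
  rewrite (splitr e).
  rewrite (_ : _ - _ = (f z - f z') - (f z - f z1)); last by ring.
  by rewrite (le_lt_trans (ler_normB _ _)) // ltrD // fr.
have [d [d0 hd]] := filter_ex (filterI (nbhs_right_gt (0 : R)) AP).
by exists d => // z z' /hd; exact.
Unshelve. all: by end_near. Qed.

(** * Winding of paths *)

Section Winding.
Context {R : realType}.
Implicit Types (p q c : R * R) (a b : R).

Definition dot p q := p.1 * q.1 + p.2 * q.2.
Definition crs p q := p.1 * q.2 - p.2 * q.1.
(** The signed angle from [p] to [q], meaningful when that angle is acute, that is when
    [dot p q > 0]. *)
Definition turn p q := atan (crs p q / dot p q).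
Definition has_angle p a := exists2 m, 0 < m & p = (m * cos a, m * sin a).

Lemma turn_bound p q : - (pi / 2) < turn p q < pi / 2.
Proof. by rewrite /turn atan_gtNpi2 atan_ltpi2. Qed.

Lemma turn_self p : turn p p = 0.
Proof. by rewrite /turn /crs [p.1 * p.2]mulrC subrr mul0r atan0. Qed.

Lemma has_angle_turn p q a : 0 < dot p q -> has_angle p a ->
  has_angle q (a + turn p q).
Proof.
move=> d0 [m m0 pE]; pose w := turn p q.
have cw : 0 < cos w by apply: cos_gt0_pihalf; exact: turn_bound.
have sw : sin w = cos w * (crs p q / dot p q).
  by rewrite -[crs p q / dot p q]atanK -/w /tan mulrC divfK // gt_eqF.
exists (dot p q / (m * cos w)); first by rewrite divr_gt0 // mulr_gt0.
rewrite -/w cosD sinD sw.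
have m0' : m != 0 by rewrite gt_eqF.
have cw' : cos w != 0 by rewrite gt_eqF.
have d0' : dot p q != 0 by rewrite gt_eqF.
have ca : cos a * cos a + sin a * sin a = 1 by rewrite -!expr2 cos2Dsin2.
rewrite [LHS]surjective_pairing; congr (_, _).
  rewrite [RHS](_ : _ = m^-1 * (dot p q * cos a - crs p q * sin a)); last by field; rewrite ?m0' ?cw' ?d0' //.
  rewrite /dot /crs pE /=.
  transitivity (q.1 * (cos a * cos a + sin a * sin a)); first by rewrite ca mulr1.
  by field; rewrite ?m0'.
rewrite [RHS](_ : _ = m^-1 * (dot p q * sin a + crs p q * cos a)); last by field; rewrite ?m0' ?cw' ?d0' //.
rewrite /dot /crs pE /=.
transitivity (q.2 * (cos a * cos a + sin a * sin a)); first by rewrite ca mulr1.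
by field; rewrite ?m0'.
Qed.

Lemma cos1_eq0 a : cos a = 1 -> `|a| < 2 * pi -> a = 0.
Proof.
move=> c1; wlog a0 : a c1 / 0 <= a.
  move=> H al; have [a0|/ltW a0] := leP 0 a; first exact: H.
  by apply/eqP; rewrite -oppr_eq0; apply/eqP/H; rewrite ?cosN ?normrN // oppr_ge0.
rewrite ger0_norm // => al; apply/eqP/negPn/negP => an0.
have ap : 0 < a by rewrite lt_neqAle eq_sym an0.
have s0 : 0 < sin (a / 2) by apply: sin_gt0_pi; apply/andP; split; lra.
have : cos (a / 2 + a / 2) = 1 by rewrite -splitr.
rewrite cosD -!expr2 cos2sin2 => /eqP; rewrite -subr_eq0 => /eqP e.
by have := exprn_gt0 2 s0; lra.
Qed.

(** Two arguments of one vector differ by a multiple of a full turn; the bound leaves only the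
    multiple 0. *)
Lemma has_angle_uniq p a b : has_angle p a -> has_angle p b ->
  `|a - b| < 2 * pi -> a = b.
Proof.
move=> [m m0 ->] [n n0 [e1 e2]] lt; apply/eqP; rewrite -subr_eq0; apply/eqP.
apply: cos1_eq0 lt.
have mn : m = n.
  apply/eqP; rewrite -(@eqrXn2 _ 2) ?ltW //; apply/eqP.
  have -> : m ^+ 2 = (m * cos a) ^+ 2 + (m * sin a) ^+ 2.
    by rewrite !exprMn -mulrDr cos2Dsin2 mulr1.
  by rewrite e1 e2 !exprMn -mulrDr cos2Dsin2 mulr1.
subst n; rewrite cosB.
have /mulfI mI : m != 0 by rewrite gt_eqF.
by rewrite (mI _ _ e1) (mI _ _ e2) -!expr2 cos2Dsin2.
Qed.

Variable (N : nat) (H : nat -> nat -> R * R) (al : nat -> R).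
Hypothesis H_h : forall i j, (i < N)%N -> (j <= N)%N -> 0 < dot (H i j) (H i.+1 j).
Hypothesis H_v : forall i j, (i <= N)%N -> (j < N)%N -> 0 < dot (H i j) (H i j.+1).
Hypothesis H_left : forall j, H 0 j = H 0 0.
Hypothesis H_right : forall j, H N j = H 0 0.
Hypothesis H_top : forall i, H i N = H 0 0.
Hypothesis al_angle : forall i, (i <= N)%N -> has_angle (H i 0) (al i).
Hypothesis al_step : forall i, (i < N)%N -> `|al i.+1 - al i| < pi / 2.

(** A lift of the argument along row [j] of the sampled homotopy: it starts from [al 0] on the
    constant left side and accumulates one acute angle per step. *)
Fixpoint row_angle (j i : nat) : R :=
  if i is i'.+1 then row_angle j i' + turn (H i' j) (H i j) else al 0.

Lemma row_angleP i j : (i <= N)%N -> (j <= N)%N -> has_angle (H i j) (row_angle j i).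
Proof.
move=> + jN; elim: i => [|i IH] iN /=.
  by rewrite H_left; exact: al_angle.
by apply: has_angle_turn; [exact: H_h | apply: IH; exact: ltnW].
Qed.

(** Both sides are arguments of the same vector. Around one cell they differ by four turns, each
    below [pi / 2] in absolute value, hence by less than a full turn. *)
Lemma row_angle_step i j : (i <= N)%N -> (j < N)%N ->
  row_angle j.+1 i = row_angle j i + turn (H i j) (H i j.+1).
Proof.
move=> + jN; elim: i => [|i IH] iN.
  by rewrite /= H_left (H_left j.+1) turn_self addr0.
have := @has_angle_uniq (H i.+1 j.+1) (row_angle j.+1 i.+1)
  (row_angle j i.+1 + turn (H i.+1 j) (H i.+1 j.+1)).
apply; first exact: row_angleP.
  by apply: has_angle_turn; [exact: H_v | apply: row_angleP => //; exact: ltnW].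
rewrite /= IH; last exact: ltnW.
have := turn_bound (H i j) (H i j.+1).
have := turn_bound (H i j.+1) (H i.+1 j.+1).
have := turn_bound (H i j) (H i.+1 j).
have := turn_bound (H i.+1 j) (H i.+1 j.+1).
by rewrite ltr_norml; lra.
Qed.

Lemma row_angle_right j : (j <= N)%N -> row_angle j N = row_angle 0 N.
Proof.
elim: j => // j IH jN; rewrite row_angle_step // !H_right turn_self addr0.
by apply: IH; exact: ltnW.
Qed.

Lemma row_angle_top i : row_angle N i = al 0.
Proof. by elim: i => //= i ->; rewrite !H_top turn_self addr0. Qed.

Lemma row_angle_al i : (i <= N)%N -> row_angle 0 i = al i.
Proof.
elim: i => // i IH iN; apply: has_angle_uniq (row_angleP iN (leq0n _)) (al_angle iN) _.
rewrite /= IH; last exact: ltnW.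
have := turn_bound (H i 0) (H i.+1 0); have := al_step iN.
have := pi_gt0 R.
by rewrite !ltr_norml; lra.
Qed.

(** Since the right side is constant, the lifted angle at the right end is the same for all rows; on
    the top row, where [H] is constant, nothing has been accumulated. *)
Lemma grid_winding : al N = al 0.
Proof. by rewrite -row_angle_al // -(row_angle_right (leqnn N)) row_angle_top. Qed.

End Winding.

Lemma within_cont_comp {T U V : topologicalType} (A : set U) (f : U -> V) (g : T -> U) :
  {within A, continuous f} -> continuous g -> (forall x, A (g x)) ->
  continuous (fun x => f (g x)).
Proof.
move=> /subspace_continuousP cf cg gA x.
apply: (cvg_comp g f _ (cf _ (gA x))) => B AB.
have : \forall y \near x, A (g y) -> B (g y) by exact: cg AB.
by apply: filterS => y; exact.
Qed.

Section Clamp.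
Context {R : realType}.
Implicit Types a b s : R.

Definition clamp a b s := Num.max a (Num.min s b).

Lemma clamp_cont a b : continuous (clamp a b).
Proof. by rewrite /clamp; cts. Qed.

Lemma clamp_in a b s : a <= b -> a <= clamp a b s <= b.
Proof. by move=> ab; rewrite /clamp le_max lexx /= ge_max ab ge_min lexx orbT. Qed.

Lemma clamp_id a b s : a <= s <= b -> clamp a b s = s.
Proof. by move=> /andP[sa sb]; rewrite /clamp (min_l sb) max_r. Qed.

End Clamp.
#[export] Hint Resolve clamp_cont : cont.

Section HomotopyWinding.
Context {R : realType}.
Implicit Types (g : R -> R * R) (D : set (R * R)).

(** Homotopy invariance of the winding number about a point outside [D], by sampling: on a fine
    enough grid, adjacent values of [H - c] make an acute angle and the argument lifts cell by
    cell. *)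
Lemma homotopy_winding D g (c : R * R) (al : R -> R) :
  null_homotopic_in D g -> ~ D c -> continuous al ->
  (forall t, 0 <= t <= 1 -> has_angle (g t - c) (al t)) -> al 1 = al 0.
Proof.
move=> [H [cH HD Hg H1 H0]] Dc cal gal.
have uI (t : R) : 0 <= t <= 1 -> @unit_itv R t by rewrite /unit_itv /= in_itv.
(* Clamping both variables makes the homotopy continuous on the whole plane, with values still in
   [D]. *)
pose F (z : R * R) := H (clamp 0 1 z.1, clamp 0 1 z.2) - c.
have cI (t : R) : 0 <= clamp 0 1 t <= 1 by apply: clamp_in; exact: ler01.
have cF : continuous F.
  move=> z; apply: cvgB; last exact: cvg_cst.
  apply: (@within_cont_comp _ _ _ _ H (fun z : R * R => (clamp 0 1 z.1, clamp 0 1 z.2)) cH).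
  - apply: cont_pair; apply: cont_comp; [exact: clamp_cont | cts | exact: clamp_cont | cts].
  - by move=> x /=; split; apply: uI.
have cF1 : continuous (fun z => (F z).1) by exact: cont_comp cont_fst cF.
have cF2 : continuous (fun z => (F z).2) by exact: cont_comp cont_snd cF.
have Fn0 z : 0 < dot (F z) (F z).
  rewrite /dot -!expr2 lt_neqAle addr_ge0 ?sqr_ge0 // andbT eq_sym paddr_eq0 ?sqr_ge0 // !sqrf_eq0.
  apply/negP => /andP[/eqP e1 /eqP e2]; apply: Dc.
  have e : H (clamp 0 1 z.1, clamp 0 1 z.2) = c.
    by apply/eqP; rewrite -subr_eq0 -/(F z) [F z]surjective_pairing e1 e2.
  rewrite -e; apply: HD; exists (clamp 0 1 z.1, clamp 0 1 z.2) => //.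
  by split => /=; apply: uI; exact: cI.
pose G (z : (R * R) * (R * R)) := dot (F z.1) (F z.2).
have cG : continuous G.
  rewrite /G /dot; apply: contD; apply: contM.
  - exact: (cont_comp cF1 cont_fst).
  - exact: (cont_comp cF1 cont_snd).
  - exact: (cont_comp cF2 cont_fst).
  - exact: (cont_comp cF2 cont_snd).
pose K : set (R * R) := `[0, 1] `*` `[0, 1].
have cK : compact K by apply: compact_setX; exact: segment_compact.
have cdia : continuous (fun z : R * R => (z, z)) by apply: cont_pair; cts.
pose Kd := (fun z => (z, z)) @` K.
have cKd : compact Kd by apply: continuous_compact => //; exact: cont_within.
have [z0 Kz0 minz] : exists2 z0, z0 \in K & forall z, z \in K -> dot (F z0) (F z0) <= dot (F z) (F z).
  apply: (@compact_EVT_min _ _ (fun z => G (z, z)) K) => //.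
    by exists (0, 0); rewrite /K /= !in_itv /= lexx ler01.
  by apply: cont_within; exact: cont_comp cG cdia.
(* The tolerance is the minimum of the squared norm of [F]: for neighbours, [dot (F z) (F z')]
   differs from [dot (F z) (F z)] by less than that, so it stays positive. *)
have [d d0 dG] := unif_cont_compact cKd cG (Fn0 z0).
have [d' d'0 dal] := unif_cont_compact (@segment_compact R 0 1) cal (@divr_gt0 _ _ _ (pi_gt0 R) (ltr0Sn _ 1)).
pose e := Num.min d d'.
have e0 : 0 < e by rewrite lt_min d0.
have [N N0 Ne] : exists2 N : nat, (0 < N)%N & N%:R^-1 < e.
  exists (Num.truncn (e^-1)).+1 => //.
  by rewrite invf_plt ?posrE // truncnS_gt.
pose t (i : nat) : R := i%:R / N%:R.
have NR0 : (0 : R) < N%:R by rewrite ltr0n.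
have tI i : (i <= N)%N -> 0 <= t i <= 1.
  move=> iN; rewrite divr_ge0 ?ler0n //= ler_pdivrMr // mul1r ler_nat //.
have tS i : `|t i - t i.+1| < e.
  rewrite /t -mulrBl -natr1 opprD addrA subrr sub0r mulN1r normrN gtr0_norm ?invr_gt0 //.
have t0 : t 0%N = 0 by rewrite /t mul0r.
have tN : t N = 1 by rewrite /t divff // gt_eqF.
pose HH i j := F (t i, t j).
have ball0 (a : R) (b : R) r : 0 < r -> ball (a, b) r (a, b) by move=> ?; exact: ballxx.
have close z z' : K z -> ball z d z' -> 0 < dot (F z) (F z').
  move=> Kz zz'.
  have : `|G (z, z) - G (z, z')| < dot (F z0) (F z0).
    by apply: dG; [exists z | split => //=; exact: ballxx].
  have : dot (F z0) (F z0) <= dot (F z) (F z) by apply: minz; rewrite inE.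
  rewrite /G ltr_norml /=; lra.
have Ft i j : (i <= N)%N -> (j <= N)%N -> HH i j = H (t i, t j) - c.
  by move=> iN jN; rewrite /HH /F /= !clamp_id // tI.
have I0 : 0 <= (0 : R) <= 1 by rewrite lexx ler01.
have I1 : 0 <= (1 : R) <= 1 by rewrite lexx ler01.
have H0l a : 0 <= a <= 1 -> H (0, a) = g 0 by move=> /uI /H0 [].
have H0r a : 0 <= a <= 1 -> H (1, a) = g 0 by move=> /uI /H0 [].
have Ht a : 0 <= a <= 1 -> H (a, 1) = g 0 by move=> /uI /H1.
have -> : 1 = t N by [].
rewrite -[in RHS]t0.
apply: (@grid_winding _ N HH (fun i => al (t i))).
- move=> i j iN jN; apply: close; first by split => /=; rewrite in_itv /= tI // ltnW.
  split => /=; last exact: ballxx.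
  by rewrite /ball /= (lt_le_trans (tS i)) // ge_min lexx.
- move=> i j iN jN; apply: close; first by split => /=; rewrite in_itv /= tI // ltnW.
  split => /=; first exact: ballxx.
  by rewrite /ball /= (lt_le_trans (tS j)) // ge_min lexx.
- move=> j; rewrite /HH /F /= t0 (@clamp_id _ 0 1 0) //.
  by rewrite !H0l.
- move=> j; rewrite /HH /F /= t0 tN (@clamp_id _ 0 1 0) // (@clamp_id _ 0 1 1) //.
  by rewrite H0r ?H0l.
- move=> i; rewrite /HH /F /= t0 tN (@clamp_id _ 0 1 0) // (@clamp_id _ 0 1 1) //.
  by rewrite Ht ?H0l.
- move=> i iN; rewrite Ft // t0 Hg; first exact/gal/tI.
  exact/uI/tI.
- move=> i iN; rewrite distrC; apply: dal; first by rewrite /= in_itv /= tI // ltnW.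
  by rewrite /ball /= (lt_le_trans (tS i)) // ge_min lexx orbT.
Qed.

End HomotopyWinding.

(** * Injectivity of the tubular coordinates *)

Module Tube.

Section Primitive.
Context {R : realType}.
Implicit Types a b c x v s : R.

Lemma primitive_exists (f : R -> R) a b : a < b -> continuous f ->
  exists2 F : R -> R, continuous F & forall x, a < x < b -> is_derive x 1 F (f x).
Proof.
move=> ab cf.
have fi u : (@lebesgue_measure R).-integrable `[a, u] (EFin \o f).
  apply: continuous_compact_integrable; first exact: segment_compact.
  exact: cont_within.
pose P x := (\int[lebesgue_measure]_(t in `[a, x]) f t)%R.
exists (fun x => P (clamp a b x)).
  apply: (within_cont_comp (A := `[a, b])); last first.
  - by move=> x; rewrite /= in_itv /= clamp_in // ltW.
  - exact: clamp_cont.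
  - exact: parameterized_integral_continuous (ltW ab) (fi b).
move=> x axb; apply: (@near_der _ P _ a b _ _ axb).
  by move=> y /andP[ay yb]; rewrite clamp_id // !ltW.
have /andP[ax xb] := axb.
have [dP <-] := continuous_FTC1_closed xb (fi b) ax (cf x).
by rewrite derive1E; exact: derivableP.
Qed.

Lemma cont_ge_left (f : R -> R) a b c : a < b -> continuous f ->
  (forall s, a < s <= b -> c <= f s) -> c <= f a.
Proof.
move=> ab cf fc; rewrite leNgt; apply/negP => fac.
have := cf a => /cvgrPdist_lt /(_ (c - f a)); rewrite subr_gt0 => /(_ fac).
move=> /nbhs_ballP[e /= e0 be].
pose s := Num.min b (a + e / 2).
have as' : a < s by rewrite lt_min ab ltrDl divr_gt0.
have sb : s <= b by rewrite ge_min lexx.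
have se : s <= a + e / 2 by rewrite ge_min lexx orbT.
have bs : ball a e s by rewrite /ball /= ltr_norml; lra.
have := be s bs; have := fc s; rewrite as' sb => /(_ isT) /=.
by rewrite ltr_norml; lra.
Qed.

Lemma IVT_cont (f : R -> R) a b v : a <= b -> continuous f ->
  Num.min (f a) (f b) <= v <= Num.max (f a) (f b) ->
  exists2 c, a <= c <= b & f c = v.
Proof.
move=> ab cf fv.
by have [c] := IVT ab (cont_within cf) fv; rewrite in_itv /=; exists c.
Qed.

End Primitive.

(* The curve with its parameter clamped to [0, L]: it is continuous on the whole line but
   differentiable on ]0, L[ only, and the unit speed is that of the clamped tangent. *)
Record centerline (R : realType) (L delta : R) := Centerline {
  cx : R -> R; cy : R -> R; cx1 : R -> R; cy1 : R -> R; ck : R -> R; ck1 : R -> R;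
  L_gt0 : 0 < L;
  delta_gt0 : 0 < delta;
  cx_cont : continuous cx;
  cy_cont : continuous cy;
  cx1_cont : continuous cx1;
  cy1_cont : continuous cy1;
  ck_cont : continuous ck;
  der_cx : forall s, 0 < s < L -> is_derive s 1 cx (cx1 s);
  der_cy : forall s, 0 < s < L -> is_derive s 1 cy (cy1 s);
  der_cx1 : forall s, 0 < s < L -> is_derive s 1 cx1 (- (ck s * cy1 s));
  der_cy1 : forall s, 0 < s < L -> is_derive s 1 cy1 (ck s * cx1 s);
  der_ck : forall s, 0 < s < L -> is_derive s 1 ck (ck1 s);
  unit_speed : forall s, cx1 s ^+ 2 + cy1 s ^+ 2 = 1;
  cx_sym : forall s, cx (L - s) = - cx s;
  cy_sym : forall s, cy (L - s) = cy s;
  cx1_sym : forall s, cx1 (L - s) = cx1 s;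
  cy1_sym : forall s, cy1 (L - s) = - cy1 s;
  ck_sym : forall s, ck (L - s) = ck s;
  ck1_le0 : forall s, L / 2 < s < L -> ck1 s <= 0;
  cx_neq0 : forall s, L / 2 < s <= L -> cx s <> 0;
  h_delta_gt0 : forall s, 0 < 1 + delta * ck s }.

#[export] Hint Extern 1 => (lazymatch goal with
  | |- context [@cx _ _ _ ?C] => exact: (@cx_cont _ _ _ C)
  | |- context [@cy _ _ _ ?C] => exact: (@cy_cont _ _ _ C)
  | |- context [@cx1 _ _ _ ?C] => exact: (@cx1_cont _ _ _ C)
  | |- context [@cy1 _ _ _ ?C] => exact: (@cy1_cont _ _ _ C)
  | |- context [@ck _ _ _ ?C] => exact: (@ck_cont _ _ _ C)
  end) : cont.

Definition Om {R : realType} (L delta : R) : set (R * R) :=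
  [set z | 0 < z.1 < L /\ 0 < z.2 < delta].

(** * The two halves of the curve and the y-axis *)

Section Geometry.
Context {R : realType} {L delta : R}.
Variable C : centerline L delta.
Local Notation x := (cx C).
Local Notation y := (cy C).
Local Notation x1 := (cx1 C).
Local Notation y1 := (cy1 C).
Local Notation k := (ck C).
Local Notation k1 := (ck1 C).
Implicit Types s r : R.

(** The Jacobian of the tubular coordinates [Phi]. *)
Definition hh (z : R * R) := 1 + z.2 * k z.1.
Definition Phi (z : R * R) := (x z.1 + z.2 * y1 z.1, y z.1 - z.2 * x1 z.1).

Let L0 : 0 < L := L_gt0 C.
Let d0 : 0 < delta := delta_gt0 C.

Lemma hh_gt0 s r : 0 <= r <= delta -> 0 < hh (s, r).
Proof.
move=> /andP[r0 rd]; have := h_delta_gt0 C s; rewrite /hh /=.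
have [k0|k0] := leP 0 (k s).
  by have := mulr_ge0 r0 k0; lra.
have : delta * k s <= r * k s by rewrite ler_wnM2r // ltW.
lra.
Qed.

Lemma y1_mid : y1 (L / 2) = 0.
Proof.
have := cy1_sym C (L / 2); rewrite (_ : L - L / 2 = L / 2); last by field.
lra.
Qed.

Lemma x_mid : x (L / 2) = 0.
Proof.
have := cx_sym C (L / 2); rewrite (_ : L - L / 2 = L / 2); last by field.
lra.
Qed.

(** Equal to 1 or -1: the direction in which the curve crosses the y-axis, where its tangent is
    horizontal. Multiplying by it treats both orientations at once. *)
Definition sg := x1 (L / 2).

Lemma sg2 : sg * sg = 1.
Proof. by have := unit_speed C (L / 2); rewrite y1_mid expr0n addr0 expr2. Qed.

Let in0L s : L / 2 < s < L -> 0 < s < L.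
Proof. by move=> /andP[a b]; rewrite b andbT (lt_trans _ a) // divr_gt0. Qed.

(** At [L / 2] the derivative of [sg * x] is 1, so this function first becomes positive; a later
    nonpositive value would give a zero of [x], which [cx_neq0] excludes. *)
Lemma sgx_gt0 s : L / 2 < s <= L -> 0 < sg * x s.
Proof.
move=> sr; have /andP[s1 s2] := sr.
have cs : continuous (fun t => sg * x t) by cts.
rewrite ltNge; apply/negP => sx0.
have c1 : continuous (fun t => sg * x1 t) by cts.
have := c1 (L / 2) => /cvgrPdist_lt /(_ 1 ltr01) /nbhs_ballP[e /= e0 be].
rewrite -/sg sg2 in be.
pose t := Num.min s (L / 2 + e / 2).
have lt : L / 2 < t by rewrite lt_min s1 ltrDl divr_gt0.
have ts : t <= s by rewrite ge_min lexx.
have te : t <= L / 2 + e / 2 by rewrite ge_min lexx orbT.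
have tpos : 0 < sg * x t.
  have -> : 0 = sg * x (L / 2) by rewrite x_mid mulr0.
  apply: (@der_lt _ (fun t => sg * x t) (fun t => sg * x1 t)) => //.
    move=> u /andP[u1 u2].
    have dx := der_cx C (in0L (introT andP (conj u1 (lt_le_trans u2 (le_trans ts s2))))).
    by dereq; rewrite mulr0 addr0.
  move=> u /andP[u1 u2].
  have bu : ball (L / 2) e u by rewrite /ball /= ltr_norml; lra.
  by have := be u bu; rewrite /= ltr_norml; lra.
have [c /andP[c1' c2] cz] : exists2 c, t <= c <= s & sg * x c = 0.
  by apply: IVT_cont => //; rewrite ge_min le_max sx0 (ltW tpos) /= orbT.
have : x c = 0 by rewrite -[x c]mul1r -sg2 -mulrA cz mulr0.
by apply: (@cx_neq0 _ _ _ C); lra.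
Qed.

(** The derivative is [- k1 s * (sg * x s)], nonnegative because [k] is nonincreasing on the right
    half and [sg * x] is positive there; the initial value is 0. *)
Lemma sgG_ge0 s : L / 2 <= s <= L -> 0 <= sg * (y1 s - k s * x s).
Proof.
move=> /andP[s1 s2].
have -> : 0 = sg * (y1 (L / 2) - k (L / 2) * x (L / 2)) by rewrite x_mid y1_mid; ring.
apply: (@der_le _ (fun s => sg * (y1 s - k s * x s)) (fun s => - k1 s * (sg * x s))) => //.
- by cts.
- move=> u /andP[u1 u2].
  have u0L : 0 < u < L by apply: in0L; rewrite u1 (lt_le_trans u2).
  have dx := der_cx C u0L; have dy1 := der_cy1 C u0L; have dk := der_ck C u0L.
  by dereq; ring.
- move=> u /andP[u1 u2]; rewrite mulr_ge0 // ?oppr_ge0.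
    by apply: (@ck1_le0 _ _ _ C); rewrite u1 (lt_le_trans u2).
  by rewrite ltW // sgx_gt0 // u1 (le_trans (ltW u2)).
Qed.

(* [sg * (y1 s - k s * x s) >= 0] yields [sg * X >= sg * x s * (1 + r * k s)]. *)
Lemma sgX_gt0 s r : L / 2 < s <= L -> 0 <= r <= delta -> 0 < sg * (Phi (s, r)).1.
Proof.
move=> sr rd; have /andP[s1 s2] := sr; have /andP[r0 _] := rd.
have H1 : 0 < sg * x s * hh (s, r) by rewrite mulr_gt0 ?sgx_gt0 ?hh_gt0.
have H2 : 0 <= r * (sg * (y1 s - k s * x s)).
  by rewrite mulr_ge0 // sgG_ge0 // (ltW s1) s2.
by move: H1 H2; rewrite /hh /Phi /=; lra.
Qed.

Lemma Phi_sym s r : Phi (L - s, r) = (- (Phi (s, r)).1, (Phi (s, r)).2).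
Proof. by rewrite /Phi /= cx_sym cy_sym cx1_sym cy1_sym; congr (_, _); ring. Qed.

Lemma sgX_mid r : (Phi (L / 2, r)).1 = 0.
Proof. by rewrite /Phi /= x_mid y1_mid mulr0 addr0. Qed.

Lemma sgX_lt0 s r : 0 <= s < L / 2 -> 0 <= r <= delta -> sg * (Phi (s, r)).1 < 0.
Proof.
move=> /andP[s1 s2] rd.
have : 0 < sg * (Phi (L - s, r)).1 by apply: sgX_gt0 => //; lra.
by rewrite Phi_sym /= mulrN oppr_gt0.
Qed.

Lemma k_decr s t : L / 2 <= s -> s <= t -> t <= L -> k t <= k s.
Proof.
move=> s1 st tL; rewrite -lerN2.
apply: (@der_le _ (fun s => - k s) (fun s => - k1 s)) => //; first by cts.
  move=> u /andP[u1 u2].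
  have dk : is_derive u 1 k (k1 u) by apply/der_ck/in0L; lra.
  by dereq.
by move=> u /andP[u1 u2]; rewrite oppr_ge0; apply: (@ck1_le0 _ _ _ C); lra.
Qed.

End Geometry.

End Tube.
Export Tube.

(** * Turning of the tangent and absence of overlaps *)

Section Injectivity.
Context {R : realType} {L delta : R}.
Variable C : centerline L delta.
Local Notation x := (cx C).
Local Notation y := (cy C).
Local Notation x1 := (cx1 C).
Local Notation y1 := (cy1 C).
Local Notation k := (ck C).
Local Notation k1 := (ck1 C).
Local Notation sg := (sg C).
Local Notation Phi := (Phi C).
Local Notation hh := (hh C).
Implicit Types s r t u : R.

Let L0 : 0 < L := L_gt0 C.
Let d0 : 0 < delta := delta_gt0 C.

Let in0L s : L / 2 < s < L -> 0 < s < L.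
Proof. by move=> /andP[a b]; rewrite b andbT (lt_trans _ a) // divr_gt0. Qed.

(** [th] is a primitive of the curvature, normalized by the direction 0 or [pi] of the tangent at
    [L / 2]. The dot and cross products of the tangent with [(cos th, sin th)] have derivative 0, so
    the two vectors stay equal. *)
Lemma angle_exists : exists th : R -> R, exists kap : R,
  [/\ continuous th, th (L / 2) = kap, cos kap = sg, sin kap = 0 &
   (forall s, 0 < s < L -> is_derive s 1 th (k s)) /\
   (forall s, L / 2 <= s <= L -> x1 s = cos (th s) /\ y1 s = sin (th s))].
Proof.
have [F cF dF] := primitive_exists L0 (@ck_cont _ _ _ C).
have [kap ck' sk'] : exists2 kap : R, cos kap = sg & sin kap = 0.
  have : (sg - 1) * (sg + 1) = 0 by rewrite -(subrr (sg * sg)) {2}sg2; ring.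
  move=> /eqP; rewrite mulf_eq0 subr_eq0 addr_eq0 => /orP[/eqP ->|/eqP ->].
    by exists 0; [exact: cos0 | exact: sin0].
  by exists pi; [exact: cospi | exact: sinpi].
pose th s := F s + (kap - F (L / 2)).
have thm : th (L / 2) = kap by rewrite /th; ring.
have cth : continuous th by rewrite /th; cts.
have dth s : 0 < s < L -> is_derive s 1 th (k s).
  by move=> sL; have dFs := dF _ sL; rewrite /th; dereq; rewrite addr0.
exists th, kap; split => //; split=> // s /andP[s1 s2].
have cs u : cos u * cos u + sin u * sin u = 1 by rewrite -!expr2 cos2Dsin2.
have e1 : x1 (L / 2) * cos (th (L / 2)) + y1 (L / 2) * sin (th (L / 2)) =
          x1 s * cos (th s) + y1 s * sin (th s).
  apply: (@der0_eq _ (fun s => x1 s * cos (th s) + y1 s * sin (th s)) _ _ s1); first by cts.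
  move=> u u12; have u0L : 0 < u < L by apply: in0L; lra.
  have dt := dth _ u0L; have dx1 := der_cx1 C u0L; have dy1 := der_cy1 C u0L.
  by dereq; ring.
have e2 : y1 (L / 2) * cos (th (L / 2)) - x1 (L / 2) * sin (th (L / 2)) =
          y1 s * cos (th s) - x1 s * sin (th s).
  apply: (@der0_eq _ (fun s => y1 s * cos (th s) - x1 s * sin (th s)) _ _ s1); first by cts.
  move=> u u12; have u0L : 0 < u < L by apply: in0L; lra.
  have dt := dth _ u0L; have dx1 := der_cx1 C u0L; have dy1 := der_cy1 C u0L.
  by dereq; ring.
move: e1 e2; rewrite thm ck' sk' y1_mid -/(sg) sg2 !mulr0 !mul0r addr0 subr0 => e1 e2.
split.
  rewrite -[LHS]mulr1 -(cs (th s)).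
  transitivity (cos (th s) * (x1 s * cos (th s) + y1 s * sin (th s)) -
     sin (th s) * (y1 s * cos (th s) - x1 s * sin (th s))); first by ring.
  by rewrite -e1 -e2; ring.
rewrite -[LHS]mulr1 -(cs (th s)).
transitivity (sin (th s) * (x1 s * cos (th s) + y1 s * sin (th s)) +
   cos (th s) * (y1 s * cos (th s) - x1 s * sin (th s))); first by ring.
by rewrite -e1 -e2; ring.
Qed.

(** As [k] is nonincreasing on the right half, its sign changes at most once. The midpoint is put
    into [S] by hand to make it nonempty when [k] is negative throughout. *)
Lemma last_nonneg_curvature : exists t, [/\ L / 2 <= t <= L,
  forall s, L / 2 <= s < t -> 0 <= k s & forall s, t < s <= L -> k s < 0].
Proof.
pose S : set R := [set s | s = L / 2 \/ (L / 2 <= s <= L /\ 0 <= k s)].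
have S0 : S (L / 2) by left.
have Lh : L / 2 <= L by have := L0; lra.
have Sub : ubound S L by move=> s [->|[/andP[_ ]]].
have hS : has_sup S by split; [exists (L / 2) | exists L].
exists (sup S); split.
- by rewrite ub_le_sup //=; [exact: sup_le_ub (proj1 hS) Sub | exact: proj2 hS].
- move=> s /andP[s1 s2].
  have ss : 0 < sup S - s by rewrite subr_gt0.
  have [u Su] := sup_adherent ss hS.
  rewrite opprB addrCA subrr addr0 => su.
  case: Su => [ue|[u12 ku]]; first by move: s1; rewrite -ue leNgt su.
  by apply: le_trans ku _; apply: k_decr => //; [exact: ltW | move/andP: u12 => []].
- move=> s /andP[s1 s2]; rewrite ltNge; apply/negP => ks.
  have : S s by right; rewrite s2 andbT ks (le_trans _ (ltW s1)) // ub_le_sup //; exact: proj2 hS.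
  by move=> /(ub_le_sup (proj2 hS)); rewrite leNgt s1.
Qed.

Lemma dot_unit_le1 s t : x1 s * x1 t + y1 s * y1 t <= 1.
Proof.
have := unit_speed C s; have := unit_speed C t.
have := sqr_ge0 (x1 s - x1 t); have := sqr_ge0 (y1 s - y1 t).
by rewrite !sqrrB; lra.
Qed.

Section WithAngle.
Variables (th : R -> R) (kap : R).
Hypothesis th_cont : continuous th.
Hypothesis th_mid : th (L / 2) = kap.
Hypothesis cos_kap : cos kap = sg.
Hypothesis sin_kap : sin kap = 0.
Hypothesis der_th : forall s, 0 < s < L -> is_derive s 1 th (k s).
Hypothesis x1E : forall s, L / 2 <= s <= L -> x1 s = cos (th s).
Hypothesis y1E : forall s, L / 2 <= s <= L -> y1 s = sin (th s).

(** Along a parallel curve, the component in direction [e] has derivative [hh * cos (th - e)],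
    positive as long as the tangent stays within a right angle of [e]. *)
Lemma projection_incr e r a b : L / 2 <= a -> a < b -> b <= L ->
  0 <= r <= delta -> (forall s, a <= s <= b -> - (pi / 2) < th s - e < pi / 2) ->
  cos e * (Phi (a, r)).1 + sin e * (Phi (a, r)).2 <
  cos e * (Phi (b, r)).1 + sin e * (Phi (b, r)).2.
Proof.
move=> La ab bL rd he.
apply: (@der_lt _ (fun s => cos e * (x s + r * y1 s) + sin e * (y s - r * x1 s))
   (fun s => hh (s, r) * cos (th s - e)) a b ab).
- by cts.
- move=> u /andP[u1 u2]; have u0L : 0 < u < L by apply: in0L; lra.
  have dx := der_cx C u0L; have dy := der_cy C u0L.
  have dx1 := der_cx1 C u0L; have dy1 := der_cy1 C u0L.
  dereq; rewrite cosB -x1E; last lra.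
  by rewrite -y1E; [rewrite /Tube.hh /=; ring | lra].
- move=> u /andP[u1 u2]; rewrite mulr_gt0 ?hh_gt0 //.
  by apply: cos_gt0_pihalf; apply: he; rewrite !ltW.
Qed.

Lemma projection_normal e s r r' : L / 2 <= s <= L ->
  cos e * (Phi (s, r')).1 + sin e * (Phi (s, r')).2 =
  cos e * (Phi (s, r)).1 + sin e * (Phi (s, r)).2 + (r' - r) * sin (th s - e).
Proof. by move=> sL; rewrite sinB -x1E // -y1E // /Phi /=; ring. Qed.

(** The direction [e] lies halfway between the extreme tangent angles, so the projection increases
    along every parallel curve. The change of depth from [r1] to [r2] is made where it does not
    decrease the projection: at the maximal angle [th sm] if [r1 <= r2], at the end with minimal
    angle otherwise. *)
Lemma Phi_neq_small_turn s1 s2 sm m r1 r2 : L / 2 <= s1 -> s1 < s2 -> s2 <= L ->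
  s1 <= sm <= s2 -> (forall s, s1 <= s <= s2 -> m <= th s <= th sm) ->
  m = th s1 \/ m = th s2 -> th sm - m < pi ->
  0 <= r1 <= delta -> 0 <= r2 <= delta -> Phi (s1, r1) <> Phi (s2, r2).
Proof.
move=> Ls1 s12 s2L /andP[sm1 sm2] thb mE turn_lt rd1 rd2 PhiE.
pose e := (th sm + m) / 2.
have he s : s1 <= s <= s2 -> - (pi / 2) < th s - e < pi / 2.
  by move=> /thb; rewrite /e; lra.
pose E s r := cos e * (Phi (s, r)).1 + sin e * (Phi (s, r)).2.
have Elt a b r : s1 <= a -> a < b -> b <= s2 -> 0 <= r <= delta -> E a r < E b r.
  move=> sa ab bs rd; apply: projection_incr => //; try lra.
  by move=> s sab; apply: he; lra.
have Ele a b r : s1 <= a -> a <= b -> b <= s2 -> 0 <= r <= delta -> E a r <= E b r.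
  by move=> sa; rewrite le_eqVlt => /predU1P[->//|ab bs rd]; exact/ltW/Elt.
have En s r r' : s1 <= s <= s2 -> E s r' = E s r + (r' - r) * sin (th s - e).
  by move=> ss; apply: projection_normal; lra.
have mM : m <= th sm by have /andP[] := thb sm (introT andP (conj sm1 sm2)).
have sinM : 0 <= sin (th sm - e) by apply: sin_ge0_pi; rewrite /e; lra.
have sinm : sin (m - e) <= 0.
  by rewrite -oppr_ge0 -sinN; apply: sin_ge0_pi; rewrite /e; lra.
suff : E s1 r1 < E s2 r2 by rewrite /E PhiE ltxx.
have [r12|r21] := leP r1 r2.
  have : E sm r1 <= E sm r2.
    by rewrite (En sm r1 r2) ?sm1 // lerDl mulr_ge0 // subr_ge0.
  have [sms1|] := eqVneq sm s1.
    by move=> h; rewrite sms1 in h; apply: le_lt_trans h _; apply: Elt.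
  move=> ne h; have sl : s1 < sm by rewrite lt_neqAle eq_sym ne.
  apply: (@lt_le_trans _ _ (E sm r1)); first exact: Elt.
  by apply: le_trans h _; apply: Ele.
case: mE => mE.
  apply: (@le_lt_trans _ _ (E s1 r2)); last exact: Elt.
  have h1 : s1 <= s1 <= s2 by rewrite lexx ltW.
  rewrite (En _ r1 r2 h1) lerDl -mE mulr_le0 //; lra.
apply: (@lt_le_trans _ _ (E s2 r1)); first exact: Elt.
have h2 : s1 <= s2 <= s2 by rewrite lexx ltW.
rewrite (En _ r1 r2 h2) lerDl -mE mulr_le0 //; lra.
Qed.

Variable t : R.
Hypothesis tL : L / 2 <= t <= L.
Hypothesis k_ge0 : forall s, L / 2 <= s < t -> 0 <= k s.
Hypothesis k_lt0 : forall s, t < s <= L -> k s < 0.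

Let Lt : L / 2 <= t. Proof. by case/andP: tL. Qed.
Let tL' : t <= L. Proof. by case/andP: tL. Qed.

Lemma th_incr a b : L / 2 <= a -> a <= b -> b <= t -> th a <= th b.
Proof.
move=> La ab bt; apply: (@der_le _ th k) => //.
  by move=> u u12; apply/der_th/in0L; have := tL'; lra.
by move=> u u12; apply: k_ge0; lra.
Qed.

Lemma th_decr a b : t <= a -> a <= b -> b <= L -> th b <= th a.
Proof.
move=> ta ab bL; rewrite -lerN2; apply: (@der_le _ (fun s => - th s) (fun s => - k s)) => //.
- by cts.
- move=> u u12; have dt : is_derive u 1 th (k u) by apply/der_th/in0L; have := Lt; lra.
  by dereq.
- by move=> u u12; rewrite oppr_ge0 ltW // k_lt0 //; lra.
Qed.

(** While [k >= 0], [sgG_ge0] and [sgx_gt0] give [sg * y1 >= 0], that is [sin (th - kap) >= 0]. An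
    excess beyond [kap + pi] would produce a point where this sine is negative. *)
Lemma th_first_part s : L / 2 <= s <= t -> kap <= th s <= kap + pi.
Proof.
move=> /andP[Ls st]; have sL : s <= L by have := tL'; lra.
rewrite -{1}th_mid th_incr //= leNgt; apply/negP => sp.
(* Capping the excess at a quarter turn fixes the sign of [sin (v - kap)]. *)
pose v := Num.min (th s) (kap + pi + pi / 2).
have p0 := @pi_gt0 R.
have v1 : kap + pi < v by rewrite lt_min sp ltrDl divr_gt0.
have v2 : v <= kap + pi + pi / 2 by rewrite ge_min lexx orbT.
have v3 : v <= th s by rewrite ge_min lexx.
have [u /andP[Lu us] uv] : exists2 u, L / 2 <= u <= s & th u = v.
  apply: IVT_cont => //; rewrite th_mid ge_min le_max v3 orbT andbT.
  by apply/orP; left; lra.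
have ku : 0 <= k u \/ u = t.
  have [ut|] := ltP u t; first by left; apply: k_ge0; rewrite Lu.
  by move=> tu; right; apply/eqP; rewrite eq_le tu andbT (le_trans us).
have Lu' : L / 2 < u.
  by rewrite lt_neqAle Lu andbT; apply: contraTneq v1 => ue; rewrite -uv -ue th_mid -leNgt; lra.
have k0 : 0 <= k u.
  (* At [u = t] the sign of [k] is obtained by continuity from the left. *)
  case: ku => // ue; rewrite -[X in k X]subr0; apply: (@cont_ge_left _ (fun w => k (u - w)) 0 (u - L / 2) 0) => //.
  - by rewrite subr_gt0.
  - by cts.
  by move=> w w12; rewrite k_ge0 //; lra.
have : 0 <= sg * y1 u.
  have h1 := @sgG_ge0 _ _ _ C u; have h2 := @sgx_gt0 _ _ _ C u.
  have {}h1 : 0 <= sg * (y1 u - k u * x u) by apply: h1; lra.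
  have {}h2 : 0 < sg * x u by apply: h2; lra.
  by have := mulr_ge0 k0 (ltW h2); lra.
rewrite y1E; last lra.
have -> : sg * sin (th u) = sin (th u - kap) by rewrite sinB cos_kap sin_kap; ring.
rewrite uv leNgt => /negP; apply.
have -> : sin (v - kap) = - sin (v - kap - pi) by rewrite [in RHS]sinB cospi sinpi; ring.
by rewrite oppr_lt0 sin_gt0_pi //; lra.
Qed.

(** A turn of [pi] would require [th s = kap]; by the mean value theorem [k] then vanishes before
    [s], is nonpositive afterwards, and [th] cannot grow any more. *)
Lemma th_first_part_lt s : L / 2 < s <= t -> th t - th s < pi.
Proof.
move=> /andP[Ls st].
have p0 := @pi_gt0 R.
have := @th_first_part t; rewrite Lt lexx => /(_ isT) /andP[_ tht].
have := @th_first_part s; rewrite (ltW Ls) st => /(_ isT) /andP[ths _].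
have [sk|sk] := eqVneq (th s) kap; last first.
  have : kap < th s by rewrite lt_neqAle eq_sym sk.
  lra.
have [c] : exists2 c, c \in `]L / 2, s[ & th s - th (L / 2) = k c * (s - L / 2).
  apply: MVT => //; last exact: cont_within.
  by move=> u; rewrite in_itv /= => u12; apply/der_th/in0L; have := tL'; lra.
rewrite in_itv /= => /andP[c1 c2]; rewrite sk th_mid subrr => /esym/eqP.
rewrite mulf_eq0 subr_eq0 (gt_eqF Ls) orbF => /eqP kc.
suff : - th s <= - th t by rewrite sk; lra.
apply: (@der_le _ (fun s => - th s) (fun s => - k s)) => //; first by cts.
  move=> u u12; have dt : is_derive u 1 th (k u) by apply/der_th/in0L; have := tL'; lra.
  by dereq.
move=> u u12; rewrite oppr_ge0 -kc; apply: k_decr; have := tL'; lra.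
Qed.

(** * Winding around the centre of curvature at the end *)

Section Center.
Hypothesis t_lt_L : t < L.

Let rho := - (k L)^-1.
(** This is the point at depth [rho] on the normal at [L], where the Jacobian [1 + r * k L]
    vanishes; [rho] exceeds [delta]. *)
Definition center := (x L + rho * y1 L, y L - rho * x1 L).

Let kL : k L < 0. Proof. by apply: k_lt0; rewrite t_lt_L lexx. Qed.

Lemma rho_gt_delta : delta < rho.
Proof.
have := h_delta_gt0 C L; rewrite /rho -invrN -[_^-1]mul1r ltr_pdivlMr ?oppr_gt0 //.
lra.
Qed.

Let sup_n s := (center.1 - x s) * y1 s - (center.2 - y s) * x1 s.

(* Along the evolute [c_u], [u] in [t, L], the difference between the depth of [c_u] below
   the tangent line at [s] and the radius of curvature at [u] is nondecreasing. *)
Lemma center_depth s : t <= s <= L -> rho <= sup_n s.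
Proof.
have main u : t < u <= L -> rho <= sup_n u.
  move=> /andP[tu uL].
  pose K w := k (clamp u L w).
  have K0 w : K w < 0 by apply: k_lt0; have := @clamp_in _ u L w uL; lra.
  pose rh w := - (K w)^-1.
  have crh : continuous rh.
    rewrite /rh; apply: contN; apply: contV; first by move=> w; rewrite lt_eqF.
    by rewrite /K; cts.
  pose W w := (x w + rh w * y1 w - x u) * y1 u - (y w - rh w * x1 w - y u) * x1 u - rh w.
  (* The derivative is the product of the derivative of the radius of curvature and of a scalar
     product of unit tangents minus 1. Both factors are nonpositive. *)
  have := @der_le _ W (fun w => k1 w / k w ^+ 2 * (x1 w * x1 u + y1 w * y1 u - 1)) u L uL.
  have -> : W u = 0.
    transitivity (rh u * ((x1 u ^+ 2 + y1 u ^+ 2) - 1)); first by rewrite /W; ring.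
    by rewrite unit_speed subrr mulr0.
  have -> : W L = sup_n u - rho.
    by rewrite /W /sup_n /rh /K /rho /center /= clamp_id ?uL ?lexx.
  rewrite subr_ge0; apply.
  - by rewrite /W; cts.
  - move=> w w12; have w0L : 0 < w < L by apply: in0L; have := Lt; lra.
    have kw : k w < 0 by apply: k_lt0; lra.
    have dx := der_cx C w0L; have dy := der_cy C w0L.
    have dx1 := der_cx1 C w0L; have dy1 := der_cy1 C w0L.
    have drh : is_derive w 1 rh (k1 w / k w ^+ 2).
      apply: (@near_der _ (fun w => - (k w)^-1) _ u L _ _ w12).
        by move=> v v12; rewrite /rh /K clamp_id //; lra.
      have dk := derV (ltr0_neq0 kw) (der_ck C w0L).
      by dereq; rewrite mulNr opprK.
    have rhE : rh w = - (k w)^-1 by rewrite /rh /K clamp_id //; lra.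
    by rewrite /W; dereq; rewrite rhE; field; rewrite lt_eqF.
  - move=> w w12; rewrite -mulrNN -mulNr mulr_ge0 //.
      rewrite divr_ge0 ?sqr_ge0 // oppr_ge0.
      by apply: (@ck1_le0 _ _ _ C); have := Lt; lra.
    by rewrite opprB subr_ge0; exact: dot_unit_le1.
move=> /andP[ts sL]; have [st|] := eqVneq s t; last first.
  by move=> ne; apply: main; rewrite sL andbT lt_neqAle eq_sym ne.
(* At [t] itself [k] may vanish and leave no radius of curvature; the bound is passed to the limit
   from the right. *)
rewrite st; apply: (@cont_ge_left _ sup_n t L rho t_lt_L); first by rewrite /sup_n; cts.
exact: main.
Qed.

(** Direction of a moving frame: that of the tangent after [t], frozen before. [uu] and [vv] are the
    normal and tangential coordinates of [Phi - center] in it; once [uu] is known to be positive,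
    the argument of [Phi - center] stays within a right angle of the normal. *)
Let th' s := th (Num.max s t).
Let uu s r := ((Phi (s, r)).2 - center.2) * cos (th' s) - ((Phi (s, r)).1 - center.1) * sin (th' s).
Let vv s r := ((Phi (s, r)).1 - center.1) * cos (th' s) + ((Phi (s, r)).2 - center.2) * sin (th' s).

(** After [t], the centre is at depth at least [rho > delta] below the tangent line. Before [t], the
    curve turns by at most [pi] up to [t], hence stays on the far side of the tangent at [t], and
    the offset costs at most [r] since the tangents are unit vectors. *)
Lemma depth_gt0 s r : L / 2 <= s <= L -> 0 <= r <= delta -> 0 < uu s r.
Proof.
move=> /andP[Ls sL] /andP[r0 rd]; have rrho := rho_gt_delta.
have [ts|st] := leP t s.
  rewrite /uu /th' max_l // -x1E ?Ls // -y1E ?Ls //.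
  have := @center_depth s; rewrite ts sL => /(_ isT).
  have -> : ((Phi (s, r)).2 - center.2) * x1 s - ((Phi (s, r)).1 - center.1) * y1 s =
      sup_n s - r * (x1 s ^+ 2 + y1 s ^+ 2) by rewrite /sup_n /Tube.Phi /=; ring.
  by rewrite unit_speed; lra.
rewrite /uu /th' max_r ?(ltW st) // -x1E // -y1E //.
have h1 : rho <= sup_n t by apply: center_depth; rewrite lexx tL'.
have h2 : x s * y1 t - y s * x1 t <= x t * y1 t - y t * x1 t.
  apply: (@der_le _ (fun s => x s * y1 t - y s * x1 t) (fun s => x1 s * y1 t - y1 s * x1 t)).
  - exact: ltW.
  - by cts.
  - move=> w w12; have w0L : 0 < w < L by apply: in0L; have := tL'; lra.
    have dx := der_cx C w0L; have dy := der_cy C w0L.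
    by dereq; ring.
  move=> w w12; have wt : L / 2 <= w <= L by have := tL'; lra.
  rewrite x1E // y1E // x1E // y1E //.
  have -> : cos (th w) * sin (th t) - sin (th w) * cos (th t) = sin (th t - th w).
    by rewrite sinB; ring.
  apply: sin_ge0_pi.
  have /andP[a1 a2] : kap <= th w <= kap + pi by apply: th_first_part; lra.
  have /andP[b1 b2] : kap <= th t <= kap + pi by apply: th_first_part; have := Lt; lra.
  by have := @th_incr w t; lra.
have h3 := dot_unit_le1 s t.
have h4 : r * (x1 s * x1 t + y1 s * y1 t) <= r * 1 by rewrite ler_wpM2l.
by move: h1 h2 h4; rewrite /sup_n /Tube.Phi /=; lra.
Qed.

(** On the right half, [uu] would be 0. The left half is sent strictly into one half plane, while
    [sgG_ge0] at [L] puts the centre in the opposite closed one. *)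
Lemma center_notin : ~ [set Phi z | z in Om L delta] center.
Proof.
move=> [[s r] [/= s12 r12] e].
have rd : 0 <= r <= delta by lra.
have [Ls|sL] := leP (L / 2) s.
  have sL : L / 2 <= s <= L by lra.
  by have := depth_gt0 sL rd; rewrite /uu e !subrr !mul0r subrr ltxx.
have h1 : sg * (Phi (s, r)).1 < 0 by apply: sgX_lt0 => //; lra.
have h2 : 0 <= sg * center.1.
  rewrite /center /=.
  have h3 : 0 <= sg * (y1 L - k L * x L) by apply: sgG_ge0; have := L0; lra.
  have -> : sg * (x L + rho * y1 L) = rho * (sg * (y1 L - k L * x L)).
    by rewrite /rho; field; rewrite lt_eqF.
  by rewrite mulr_ge0 //; have := rho_gt_delta; have := d0; lra.
by move: h1; rewrite e; lra.
Qed.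

(** An overlap closes the image of a segment of parameters into a loop of the strip, whose winding
    number about [center] is 0. The argument follows the frame with an error below [pi / 2] at each
    end, so the frame has turned by less than [pi]. *)
Lemma no_winding s1 r1 s2 r2 : simply_connected R [set Phi z | z in Om L delta] ->
  L / 2 <= s1 -> s1 < s2 -> s2 < L -> 0 < r1 < delta -> 0 < r2 < delta ->
  Phi (s1, r1) = Phi (s2, r2) -> th (Num.max s1 t) - th (Num.max s2 t) < pi.
Proof.
move=> [_ sc] Ls1 s12 s2L rd1 rd2 PhiE.
pose q (a : R) := clamp 0 1 a; have qI (a : R) : 0 <= q a <= 1 by apply: clamp_in; exact: ler01.
have cq : continuous q by exact: clamp_cont.
pose S (a : R) := s1 + q a * (s2 - s1); pose r (a : R) := r1 + q a * (r2 - r1).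
have SI a : s1 <= S a <= s2.
  rewrite /S; have /andP[q0 q1] := qI a.
  have a1 : 0 <= q a * (s2 - s1) by rewrite mulr_ge0 //; lra.
  have a2 : q a * (s2 - s1) <= 1 * (s2 - s1) by rewrite ler_wpM2r //; lra.
  lra.
have rI a : 0 < r a < delta.
  have /andP[q0 q1] := qI a; have /andP[h1 h2] := rd1; have /andP[h3 h4] := rd2.
  have -> : r a = (1 - q a) * r1 + q a * r2 by rewrite /r; ring.
  have [->|qn] := eqVneq (q a) 0; first by rewrite subr0 mul1r mul0r addr0.
  have qp : 0 < q a by rewrite lt_neqAle eq_sym qn.
  have e1 : q a * r2 < q a * delta by rewrite ltr_pM2l.
  have q1' : 0 <= 1 - q a by lra.
  have e2 : (1 - q a) * r1 <= (1 - q a) * delta by apply: ler_wpM2l => //; exact: ltW.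
  have e3 : 0 < q a * r2 by rewrite mulr_gt0.
  have e4 : 0 <= (1 - q a) * r1 by apply: mulr_ge0 => //; exact: ltW.
  lra.
have cS : continuous S by rewrite /S; cts.
have cr : continuous r by rewrite /r; cts.
pose g a := Phi (S a, r a).
have cg : continuous g by rewrite /g /Tube.Phi /=; cts.
have q0 : q 0 = 0 by rewrite /q clamp_id // lexx ler01.
have q1 : q 1 = 1 by rewrite /q clamp_id // lexx ler01.
have g0 : g 0 = Phi (s1, r1) by rewrite /g /S /r q0 !mul0r !addr0.
have g1 : g 1 = Phi (s2, r2) by rewrite /g /S /r q1 !mul1r; congr (Phi (_, _)); ring.
have gD : path_in [set Phi z | z in Om L delta] g.
  split; first exact: cont_within.
  move=> _ [a _ <-]; exists (S a, r a) => //; split => /=; last exact: rI.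
  by have := SI a; have := L0; lra.
have u0 a : 0 < uu (S a) (r a).
  by apply: depth_gt0; have := SI a; have := rI a; lra.
(* An argument of [g a - center]: the normal of the frame, corrected by the angle between the normal
   and this vector. *)
pose al a := th' (S a) + pi / 2 - atan (vv (S a) (r a) / uu (S a) (r a)).
have cal : continuous al.
  have cth' : continuous (fun a => th' (S a)) by rewrite /th'; cts.
  have cu : continuous (fun a => uu (S a) (r a)) by rewrite /uu /Tube.Phi /=; cts.
  have cv : continuous (fun a => vv (S a) (r a)) by rewrite /vv /Tube.Phi /=; cts.
  rewrite /al; apply: contD; first by cts.
  apply: contN; apply: (@cont_comp _ _ _ atan); first exact: continuous_atan.
  by apply: contM => //; apply: contV => // a; rewrite gt_eqF.
have hom := sc g gD (etrans g0 (etrans PhiE (esym g1))).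
have := homotopy_winding hom center_notin cal.
have h : forall a, 0 <= a <= 1 -> has_angle (g a - center) (al a).
  move=> a _; have ua := u0 a; pose b := atan (vv (S a) (r a) / uu (S a) (r a)).
  have cb : 0 < cos b by apply: cos_gt0_pihalf; rewrite atan_gtNpi2 atan_ltpi2.
  have sb : sin b = cos b * (vv (S a) (r a) / uu (S a) (r a)).
    by rewrite -[vv _ _ / _]atanK -/b /tan mulrC divfK // gt_eqF.
  exists (uu (S a) (r a) / cos b); first by rewrite divr_gt0.
  have -> : al a = (th' (S a) - b) + pi / 2 by rewrite /al -/b; ring.
  have cs : cos (th' (S a)) * cos (th' (S a)) + sin (th' (S a)) * sin (th' (S a)) = 1.
    by rewrite -!expr2 cos2Dsin2.
  rewrite cosDpihalf sinDpihalf sinB cosB sb /g.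
  rewrite [LHS]surjective_pairing /=; congr (_, _).
    transitivity (((Phi (S a, r a)).1 - center.1) * (cos (th' (S a)) * cos (th' (S a)) + sin (th' (S a)) * sin (th' (S a)))).
      by rewrite cs mulr1.
    transitivity (- uu (S a) (r a) * sin (th' (S a)) + vv (S a) (r a) * cos (th' (S a))).
      by rewrite /uu /vv; ring.
    by field; rewrite !gt_eqF.
  transitivity (((Phi (S a, r a)).2 - center.2) * (cos (th' (S a)) * cos (th' (S a)) + sin (th' (S a)) * sin (th' (S a)))).
    by rewrite cs mulr1.
  transitivity (uu (S a) (r a) * cos (th' (S a)) + vv (S a) (r a) * sin (th' (S a))).
    by rewrite /uu /vv; ring.
  by field; rewrite !gt_eqF.
move=> /(_ h); rewrite /al.
have S0 : S 0 = s1 by rewrite /S q0 mul0r addr0.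
have S1 : S 1 = s2 by rewrite /S q1 mul1r; ring.
rewrite S0 S1 -/(th' s1) -/(th' s2).
have := atan_ltpi2 (vv s1 (r 0) / uu s1 (r 0)); have := atan_gtNpi2 (vv s1 (r 0) / uu s1 (r 0)).
have := atan_ltpi2 (vv s2 (r 1) / uu s2 (r 1)); have := atan_gtNpi2 (vv s2 (r 1) / uu s2 (r 1)).
lra.
Qed.

End Center.

(** The angle [th] increases up to [t] and decreases afterwards, so its maximum is at [s2], [t] or
    [s1] and its minimum at an end. The turn is below [pi] by [th_first_part_lt] on the increasing
    side and by [no_winding] on the decreasing one. *)
Lemma Phi_neq_right s1 s2 r1 r2 : simply_connected R [set Phi z | z in Om L delta] ->
  L / 2 < s1 -> s1 < s2 -> s2 < L -> 0 < r1 < delta -> 0 < r2 < delta ->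
  Phi (s1, r1) <> Phi (s2, r2).
Proof.
move=> sc Ls1 s12 s2L rd1 rd2 PhiE.
have c1 : 0 <= r1 <= delta by lra.
have c2 : 0 <= r2 <= delta by lra.
have p0 := @pi_gt0 R.
suff [sm [m [sm12 thb mE lt_pi]]] : exists sm m, [/\ s1 <= sm <= s2,
    forall s, s1 <= s <= s2 -> m <= th s <= th sm, m = th s1 \/ m = th s2 & th sm - m < pi].
  exact: (@Phi_neq_small_turn s1 s2 sm m r1 r2 (ltW Ls1) s12 (ltW s2L) sm12 thb mE lt_pi c1 c2 PhiE).
have incr := th_incr; have decr := th_decr.
have [s2t|ts2] := leP s2 t.
  exists s2, (th s1); split; [by rewrite lexx ltW | | by left | ].
    move=> s s12'; have h1 : th s1 <= th s by apply: incr; lra.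
    have h2 : th s <= th s2 by apply: incr; lra.
    by rewrite h1 h2.
  have h1 := @th_first_part_lt s1; have h2 := incr s2 t.
  have {}h1 : th t - th s1 < pi by apply: h1; lra.
  have {}h2 : th s2 <= th t by apply: h2; lra.
  lra.
have tltL : t < L by lra.
have := no_winding tltL sc (ltW Ls1) s12 s2L rd1 rd2 PhiE.
rewrite (max_l (ltW ts2)).
have [s1t|ts1] := leP s1 t.
  move=> w; exists t, (Num.min (th s1) (th s2)); split.
  - by rewrite s1t ltW.
  - move=> s /andP[a1 a2]; have [st|ts] := leP s t.
      have h1 : th s1 <= th s by apply: incr; lra.
      have h2 : th s <= th t by apply: incr; lra.
      by rewrite ge_min h1 h2.
    have h1 : th s2 <= th s by apply: decr; lra.
    have h2 : th s <= th t by apply: decr; lra.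
    by rewrite ge_min h1 h2 orbT.
  - by rewrite minEle; case: ifP; [left | right].
  - have := @th_first_part_lt s1; rewrite Ls1 s1t => /(_ isT).
    by rewrite minEle; case: ifP.
move=> w; exists s1, (th s2); split; [by rewrite lexx ltW | | by right | exact: w].
move=> s s12'; have h1 : th s2 <= th s by apply: decr; lra.
have h2 : th s <= th s1 by apply: decr; lra.
by rewrite h1 h2.
Qed.

End WithAngle.

(** Parameters on different sides of [L / 2] land in different half planes, and the reflection
    reduces the left half to the right one. For equal [s] both points lie on one normal segment. *)
Lemma Phi_inj z z' : simply_connected R [set Phi z | z in Om L delta] ->
  Om L delta z -> Om L delta z' -> Phi z = Phi z' -> z = z'.
Proof.
move=> sc; have [th [kap [cth thm ckap skap [dth thE]]]] := angle_exists.
have [t [tL k_ge0 k_lt0]] := last_nonneg_curvature.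
have right s1 s2 r1 r2 : L / 2 < s1 -> s1 < s2 -> s2 < L ->
    0 < r1 < delta -> 0 < r2 < delta -> Phi (s1, r1) <> Phi (s2, r2).
  apply: (@Phi_neq_right th kap cth thm ckap skap dth _ _ t tL k_ge0 k_lt0 _ _ _ _ sc).
    by move=> s /thE[].
  by move=> s /thE[].
have lt s1 s2 r1 r2 : 0 < s1 -> s1 < s2 -> s2 < L ->
    0 < r1 < delta -> 0 < r2 < delta -> Phi (s1, r1) <> Phi (s2, r2).
  move=> s10 s12 s2L rd1 rd2 e.
  have c1 : 0 <= r1 <= delta by lra.
  have c2 : 0 <= r2 <= delta by lra.
  have [h1|h1] := ltP (L / 2) s1; first exact: (right s1 s2 r1 r2).
  have [h2|h2] := leP (L / 2) s2; last first.
    have : Phi (L - s2, r2) = Phi (L - s1, r1) by rewrite !Phi_sym e.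
    by apply: right => //; lra.
  have p1 : sg * (Phi (s1, r1)).1 <= 0.
    move: h1; rewrite le_eqVlt => /predU1P[->|h1]; first by rewrite sgX_mid mulr0.
    by apply/ltW/sgX_lt0 => //; rewrite ltW.
  have p2 : 0 <= sg * (Phi (s2, r2)).1.
    move: h2; rewrite le_eqVlt => /predU1P[<-|h2]; first by rewrite sgX_mid mulr0.
    by apply/ltW/sgX_gt0 => //; rewrite h2 ltW.
  have [e1|n1] := eqVneq s1 (L / 2).
    have : 0 < sg * (Phi (s2, r2)).1 by apply: sgX_gt0 => //; lra.
    by rewrite -e e1 sgX_mid mulr0 ltxx.
  have : sg * (Phi (s1, r1)).1 < 0.
    apply: sgX_lt0 => //; rewrite ltW //= lt_neqAle n1; lra.
  by rewrite e; lra.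
case: z z' => [s1 r1] [s2 r2] [/= /andP[s10 s1L] rd1] [/= /andP[s20 s2L] rd2] e.
have [s12|s21|s12] := ltgtP s1 s2.
- by case: (lt s1 s2 r1 r2).
- by case: (lt s2 s1 r2 r1).
subst s2; congr (_, _).
move: e; rewrite /Tube.Phi /= => -[e1 e2].
have u := unit_speed C s1.
have a1 : (r1 - r2) * y1 s1 = 0 by lra.
have a2 : (r1 - r2) * x1 s1 = 0 by lra.
suff : r1 - r2 = 0 by lra.
by rewrite -[LHS]mulr1 -u mulrDr !expr2 !mulrA a1 a2 !mul0r addr0.
Qed.

End Injectivity.

Notation plane R := (measurableTypeR R * measurableTypeR R)%type.
Notation leb := (@lebesgue_measure _).

(** * Change of variables *)

Section PlaneMeasurability.
Context {R : realType}.
Local Notation pl := (plane R).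

Lemma ball_box (p q : R * R) e :
  ball p e q <-> `|p.1 - q.1| < e /\ `|p.2 - q.2| < e.
Proof. by []. Qed.

(** Measurability refers to the product sigma-algebra; open sets belong to it as countable unions of
    rational boxes. *)
Lemma open_measurable_plane (U : set (R * R)) : open U -> measurable (U : set pl).
Proof.
move=> oU.
pose box (a b c d : rat) : set pl :=
  [set z : R * R | ratr a < z.1 < ratr b /\ ratr c < z.2 < ratr d].
pose F a b c d : set pl := if `[< box a b c d `<=` U >] then box a b c d else set0.
have mF a b c d : measurable (F a b c d).
  rewrite /F; case: ifP => _; last exact: measurable0.
  have -> : box a b c d = (`](ratr a : R), ratr b[ `*` `](ratr c : R), ratr d[)%classic.
    by apply/seteqP; split => z; rewrite /box /= !in_itv /=.
  by apply: measurableX; exact: measurable_itv.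
have -> : (U : set pl) = \bigcup_a \bigcup_b \bigcup_c \bigcup_d F a b c d; last first.
  by do 4 (apply: bigcupT_measurable_rat => ?).
apply/seteqP; split => [z Uz|z [a _ [b _ [c _ [d _]]]]]; last first.
  by rewrite /F; case: asboolP => // + Bz; apply.
have /nbhs_ballP[e /= e0 eU] := open_nbhs_nbhs (conj oU Uz).
have e1 (u : R) : u - e < u by rewrite ltrBlDr ltrDl.
have e2 (u : R) : u < u + e by rewrite ltrDl.
have [a] := rat_in_itvoo (e1 z.1); rewrite in_itv /= => /andP[a1 a2].
have [b] := rat_in_itvoo (e2 z.1); rewrite in_itv /= => /andP[b1 b2].
have [c] := rat_in_itvoo (e1 z.2); rewrite in_itv /= => /andP[c1 c2].
have [d] := rat_in_itvoo (e2 z.2); rewrite in_itv /= => /andP[d1 d2].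
exists a => //; exists b => //; exists c => //; exists d => //.
have bU : box a b c d `<=` U.
  move=> w [/andP[w1 w2] /andP[w3 w4]]; apply: eU; apply/ball_box.
  by split; rewrite ltr_norml; lra.
by rewrite /F asboolT //; split; apply/andP; split.
Qed.

Lemma open_cont_measurable (D : set (R * R)) (f : R * R -> R) : open D ->
  (forall p, D p -> {for p, continuous f}) -> measurable_fun (D : set pl) (f : pl -> R).
Proof.
move=> oD cf; apply: (measurability _ (measurable_realfun.RGenOpens.measurableE R)).
move=> _ [_ [a [b ->] <-]].
apply: open_measurable_plane; rewrite openE => p [Dp /=].
rewrite in_itv /= => /andP[fa fb].
have h1 : \forall q \near p, D q by move: oD; rewrite openE => /(_ p Dp).
have h2 : \forall q \near p, a < f q by have := cf p Dp => /cvgr_gt /(_ a fa).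
have h3 : \forall q \near p, f q < b by have := cf p Dp => /cvgr_lt /(_ b fb).
rewrite /interior; apply: filterS3 h1 h2 h3 => q Dq fq fq'.
by split => //=; rewrite in_itv /= fq.
Qed.

Lemma cont_measurable (f : R * R -> R) : continuous f ->
  measurable_fun setT (f : pl -> R).
Proof. by move=> cf; apply: open_cont_measurable => [|p _]; [exact: openT | exact: cf]. Qed.

End PlaneMeasurability.

(** * Openness of the tubular coordinates and continuity of their inverse *)

Section OpenMap.
Context {R : realType} {L delta : R}.
Variable C : centerline L delta.
Local Notation x := (cx C).
Local Notation y := (cy C).
Local Notation x1 := (cx1 C).
Local Notation y1 := (cy1 C).
Local Notation k := (ck C).
Local Notation Phi := (Phi C).
Local Notation hh := (hh C).
Local Notation Om := (Om L delta).
Implicit Types s r t u : R.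

(** The squared Euclidean distance, which unlike the maximum norm of the product can be
    differentiated at a minimum. *)
Definition dist2 (p q : R * R) := (p.1 - q.1) ^+ 2 + (p.2 - q.2) ^+ 2.

Lemma dist2_tri (p q u : R * R) : dist2 p u <= 2 * dist2 p q + 2 * dist2 q u.
Proof.
rewrite /dist2; have := sqr_ge0 (p.1 - q.1 - (q.1 - u.1)).
by have := sqr_ge0 (p.2 - q.2 - (q.2 - u.2)); lra.
Qed.

Lemma dist2_ge0 p q : 0 <= dist2 p q.
Proof. by rewrite addr_ge0 ?sqr_ge0. Qed.

Lemma dist2_eq0 p q : dist2 p q = 0 -> p = q.
Proof.
move/eqP; rewrite paddr_eq0 ?sqr_ge0 // !sqrf_eq0 !subr_eq0 => /andP[/eqP e1 /eqP e2].
by rewrite (surjective_pairing p) e1 e2 -surjective_pairing.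
Qed.

Lemma Phi_cont : continuous Phi.
Proof. by rewrite /Tube.Phi; cts. Qed.

Lemma hh_cont : continuous hh.
Proof. by rewrite /Tube.hh; cts. Qed.

Lemma Om_open : open Om.
Proof.
have -> : Om = fst @^-1` `]0, L[%classic `&` snd @^-1` `]0, delta[%classic.
  by apply/seteqP; split => z; rewrite /Tube.Om /= !in_itv.
apply: openI; apply: open_comp => [z _|]; try exact: interval_open.
  exact: cont_fst.
exact: cont_snd.
Qed.

Hypothesis inj : forall z z', Om z -> Om z' -> Phi z = Phi z' -> z = z'.

(* A minimum of [dist2 (Phi z) q] over a small closed ball is interior; the first-order
   conditions there force [Phi z = q], the Jacobian [hh] being positive. *)
Lemma Phi_open_at z0 (e : R) : Om z0 -> 0 < e ->
  exists2 eta, 0 < eta &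
    forall q, ball (Phi z0) eta q -> exists z, [/\ Om z, ball z0 e z & Phi z = q].
Proof.
move=> Oz0 e0.
have /nbhs_ballP[e1 /= e10 e1O] := open_nbhs_nbhs (conj Om_open Oz0).
pose rho := Num.min e e1 / 2.
have me : 0 < Num.min e e1 by rewrite lt_min e0.
have rho0 : 0 < rho by rewrite divr_gt0.
have mle : Num.min e e1 <= e by rewrite ge_min lexx.
have mle1 : Num.min e e1 <= e1 by rewrite ge_min lexx orbT.
have rhoe : rho < e by rewrite /rho; lra.
have rhoe1 : rho < e1 by rewrite /rho; lra.
pose B : set (R * R) := `[z0.1 - rho, z0.1 + rho] `*` `[z0.2 - rho, z0.2 + rho].
have BP z : B z <-> `|z0.1 - z.1| <= rho /\ `|z0.2 - z.2| <= rho.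
  by rewrite /B /= !in_itv /= !ler_norml; split => -[]; lra.
have cB : compact B by apply: compact_setX; exact: segment_compact.
have BO : B `<=` Om.
  by move=> z /BP[b1 b2]; apply: e1O; apply/ball_box; split; exact: le_lt_trans rhoe1.
have Bz0 : B z0 by apply/BP; rewrite !subrr normr0 ltW.
pose g (z : R * R) : R := Num.max `|z0.1 - z.1| `|z0.2 - z.2|.
have cg : continuous g.
  by rewrite /g; cts.
pose S := B `&` g @^-1` [set rho].
have cS : compact S.
  by apply: compact_closedI => //; apply: preimage_closed.
pose f q z := dist2 (Phi z) q.
have cf q : continuous (f q).
  by rewrite /f /dist2 /Tube.Phi /=; cts.
have [m m0 mS] : exists2 m, 0 < m & forall z, S z -> m <= f (Phi z0) z.
  have [S0|S0] := pselect (S !=set0); last first.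
    by exists 1 => // z Sz; exfalso; apply: S0; exists z.
  have [z1] := compact_EVT_min S0 cS (cont_within (cf (Phi z0))).
  rewrite inE => Sz1 min1; exists (f (Phi z0) z1); last by move=> z Sz; apply: min1; rewrite inE.
  rewrite lt_neqAle dist2_ge0 andbT eq_sym; apply/eqP => /dist2_eq0 e1'.
  have zz : z1 = z0 by apply: inj => //; apply: BO; case: Sz1.
  case: Sz1 => _; rewrite /= zz /g !subrr normr0 maxxx => e2.
  by move: rho0; rewrite -e2 ltxx.
have m80 : 0 < m / 8 by rewrite divr_gt0.
(* This gives [f q z0 < m / 4]. By [dist2_tri], a point of [S] where [f q < m / 4] would be at
   squared distance below [m] from [Phi z0]; so the minimum of [f q] is interior. *)
exists (Num.min 1 (m / 8)); first by rewrite lt_min ltr01.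
move=> q /ball_box[]; rewrite !lt_min => /andP[q1 q1m] /andP[q2 q2m].
have dq : f q z0 < m / 4.
  have sq (a : R) : `|a| < 1 -> `|a| < m / 8 -> a ^+ 2 < m / 8.
    move=> a1 am; rewrite -real_normK ?num_real // expr2.
    have : `|a| * `|a| <= `|a| * 1 by rewrite ler_wpM2l // ltW.
    lra.
  by have := sq _ q1 q1m; have := sq _ q2 q2m; rewrite /f /dist2; lra.
have [z1] := compact_EVT_min (ex_intro _ _ Bz0) cB (cont_within (cf q)).
rewrite inE => Bz1 min1.
have fz1 : f q z1 < m / 4 by apply: le_lt_trans dq; apply: min1; rewrite inE.
have nS : ~ S z1.
  move=> /mS; have := dist2_tri (Phi z1) q (Phi z0).
  have -> : dist2 q (Phi z0) = f q z0 by rewrite /f /dist2; ring.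
  by move: fz1 dq; rewrite /f; lra.
have [b1 b2] := (BP z1).1 Bz1.
have gz1 : g z1 < rho.
  rewrite lt_neqAle ge_max b1 b2 !andbT; apply/eqP => ge; exact: nS.
move: gz1; rewrite gt_max => /andP[i1 i2].
have Oz1 := BO _ Bz1; have [/andP[s0 sL] /andP[r0 rd]] := Oz1.
have Bs s : z0.1 - rho < s < z0.1 + rho -> B (s, z1.2).
  by move=> ss; apply/BP => /=; split => //; rewrite ler_norml; lra.
have Br r : z0.2 - rho < r < z0.2 + rho -> B (z1.1, r).
  by move=> ss; apply/BP => /=; split => //; rewrite ler_norml; lra.
have in_s s : z0.1 - rho < s < z0.1 + rho -> 0 < s < L by move=> /Bs /BO [].
have ds s : z0.1 - rho < s < z0.1 + rho ->
    is_derive s 1 (fun s => f q (s, z1.2)) (2 * hh (s, z1.2) *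
     (((Phi (s, z1.2)).1 - q.1) * x1 s + ((Phi (s, z1.2)).2 - q.2) * y1 s)).
  move=> ss; have s0L := in_s s ss.
  have dx := der_cx C s0L; have dy := der_cy C s0L.
  have dx1 := der_cx1 C s0L; have dy1 := der_cy1 C s0L.
  by rewrite /f /dist2 /Tube.Phi /=; dereq; rewrite /Tube.hh /= expr1; ring.
have dr r : is_derive r 1 (fun r => f q (z1.1, r))
     (2 * (((Phi (z1.1, r)).1 - q.1) * y1 z1.1 - ((Phi (z1.1, r)).2 - q.2) * x1 z1.1)).
  by rewrite /f /dist2 /Tube.Phi /=; dereq; rewrite expr1; ring.
have z1E : z1 = (z1.1, z1.2) by rewrite -surjective_pairing.
move: i1 i2; rewrite !ltr_norml => i1 i2.
have a1 : ((Phi z1).1 - q.1) * x1 z1.1 + ((Phi z1).2 - q.2) * y1 z1.1 = 0.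
  have z1i : z1.1 \in `]z0.1 - rho, z0.1 + rho[ by rewrite in_itv /=; lra.
  have := @derive1_at_min _ (fun s => f q (s, z1.2)) (z0.1 - rho) (z0.1 + rho) z1.1.
  case=> //; first by lra.
  - by move=> s; rewrite in_itv /= => /ds[].
  - move=> s; rewrite in_itv /= => /Bs Bss /=; rewrite -z1E.
    by apply: min1; rewrite inE.
  move=> _ e3.
  have [_] : is_derive z1.1 1 (fun s => f q (s, z1.2)) _ := ds z1.1 ltac:(rewrite in_itv /= in z1i; exact: z1i).
  rewrite e3 -z1E => /esym/eqP; rewrite -mulrA !mulf_eq0 pnatr_eq0 /= => /orP[|/eqP //].
  by rewrite gt_eqF // [z1]z1E hh_gt0 // !ltW.
have a2 : ((Phi z1).1 - q.1) * y1 z1.1 - ((Phi z1).2 - q.2) * x1 z1.1 = 0.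
  have z1i : z1.2 \in `]z0.2 - rho, z0.2 + rho[ by rewrite in_itv /=; lra.
  have := @derive1_at_min _ (fun r => f q (z1.1, r)) (z0.2 - rho) (z0.2 + rho) z1.2.
  case=> //; first by lra.
  - move=> s; rewrite in_itv /= => /Br Bss /=; rewrite -z1E.
    by apply: min1; rewrite inE.
  move=> _ e3.
  have [_] := dr z1.2; rewrite e3 -z1E => /esym/eqP; rewrite mulf_eq0 pnatr_eq0 /=.
  by move=> /eqP.
exists z1; split => //.
  by apply/ball_box; rewrite !ltr_norml; lra.
apply: dist2_eq0.
have e3 : 0 = dist2 (Phi z1) q * (x1 z1.1 ^+ 2 + y1 z1.1 ^+ 2).
  transitivity ((((Phi z1).1 - q.1) * x1 z1.1 + ((Phi z1).2 - q.2) * y1 z1.1) ^+ 2 +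
   (((Phi z1).1 - q.1) * y1 z1.1 - ((Phi z1).2 - q.2) * x1 z1.1) ^+ 2).
    by rewrite a1 a2 expr0n addr0.
  by rewrite /dist2; ring.
by move: e3; rewrite unit_speed mulr1.
Qed.

Definition Dom : set (R * R) := [set Phi z | z in Om].

Lemma Dom_open : open Dom.
Proof.
rewrite openE => _ [z Oz <-].
have [eta eta0 He] := Phi_open_at Oz ltr01.
apply/nbhs_ballP; exists eta => // q /He[z' [Oz' _ <-]].
by exists z'.
Qed.

Definition Psi (p : R * R) : R * R := xget (0, 0) [set z | Om z /\ Phi z = p].

Lemma PsiP p : Dom p -> Om (Psi p) /\ Phi (Psi p) = p.
Proof.
move=> [z Oz e]; rewrite /Psi.
have : [set z | Om z /\ Phi z = p] z by [].
by move=> /(xgetI (0, 0)).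
Qed.

Lemma PhiK z : Om z -> Psi (Phi z) = z.
Proof.
move=> Oz; have Dz : Dom (Phi z) by exists z.
by have [Oz' e] := PsiP Dz; apply: inj.
Qed.

Lemma Psi_cont p : Dom p -> {for p, continuous Psi}.
Proof.
move=> Dp; have [Oz e] := PsiP Dp.
apply/cvgrPdist_lt => eps eps0 /=.
have [eta eta0 He] := Phi_open_at Oz eps0.
suff : nbhs p (fun q => `|Psi p - Psi q| < eps) by [].
apply/nbhs_ballP; exists eta => // q pq /=.
rewrite e in He; have [z [Oz' /ball_box[b1 b2] <-]] := He q pq.
by rewrite PhiK // prod_normE gt_max b1.
Qed.

(** If a boundary point had the same image as an interior point [z1], interior points near it would
    be mapped near [Phi z1] and, by openness, would have second preimages near [z1]. This is what
    makes test functions vanish on the image of the boundary. *)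
Lemma Phi_boundary_notin (z : R * R) : 0 <= z.1 <= L -> 0 <= z.2 <= delta ->
  ~ Om z -> ~ Dom (Phi z).
Proof.
move=> zs zr nO [z1 Oz1 e].
have L0 := L_gt0 C; have d0 := delta_gt0 C.
have [e1 e10 sep] : exists2 e1, 0 < e1 & ~ ball z1 e1 z.
  have [zz|zz] := eqVneq z1 z; first by exfalso; apply: nO; rewrite -zz.
  have [z11|z11] := eqVneq z1.1 z.1.
    exists `|z1.2 - z.2|; last by move=> /ball_box[_]; rewrite ltxx.
    rewrite normr_gt0 subr_eq0; apply: contra zz => /eqP z2.
    by rewrite (surjective_pairing z1) z11 z2 -surjective_pairing.
  exists `|z1.1 - z.1|; last by move=> /ball_box[]; rewrite ltxx.
  by rewrite normr_gt0 subr_eq0.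
have e20 : 0 < e1 / 2 by rewrite divr_gt0.
have [eta eta0 He] := Phi_open_at Oz1 e20.
have := @Phi_cont z => /cvgrPdist_lt /(_ eta eta0) /nbhs_ballP[d /= dd0 Hd].
pose t := Num.min (Num.min d e1 / (2 * (L + delta))) (1 / 2).
have Ld : 0 < L + delta by rewrite addr_gt0.
have t0 : 0 < t by rewrite lt_min; apply/andP; split; rewrite divr_gt0 ?mulr_gt0 // lt_min dd0.
have t1 : t <= 1 / 2 by rewrite ge_min lexx orbT.
have tL : t * (L + delta) <= Num.min d e1 / 2.
  have : t <= Num.min d e1 / (2 * (L + delta)) by rewrite ge_min lexx.
  rewrite ler_pdivlMr ?mulr_gt0 // ler_pdivlMr //; lra.
have dmin : Num.min d e1 <= d by rewrite ge_min lexx.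
have emin : Num.min d e1 <= e1 by rewrite ge_min lexx orbT.
(* The point [z] moved slightly towards the centre of the rectangle: it lies in [Om] and is as close
   to [z] as desired. *)
pose w : R * R := (z.1 + t * (L / 2 - z.1), z.2 + t * (delta / 2 - z.2)).
have tLp : 0 < t * L by rewrite mulr_gt0.
have tdp : 0 < t * delta by rewrite mulr_gt0.
have tge0 : 0 <= t := ltW t0.
have tc : 0 <= 1 - t by lra.
have /andP[z10 z1L] := zs; have /andP[z20 z2d] := zr.
have tz1 : 0 <= t * z.1 by rewrite mulr_ge0.
have tz2 : 0 <= t * z.2 by rewrite mulr_ge0.
have tz1' : t * z.1 <= t * L by rewrite ler_wpM2l.
have tz2' : t * z.2 <= t * delta by rewrite ler_wpM2l.
have u1 : 0 <= (1 - t) * z.1 by rewrite mulr_ge0.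
have u2 : 0 <= (1 - t) * z.2 by rewrite mulr_ge0.
have u3 : (1 - t) * z.1 <= (1 - t) * L by rewrite ler_wpM2l.
have u4 : (1 - t) * z.2 <= (1 - t) * delta by rewrite ler_wpM2l.
have Ow : Om w by rewrite /Tube.Om /w /=; lra.
have wz (a : R) : Num.min d e1 <= a -> ball z a w.
  by move=> ma; apply/ball_box; rewrite /w /= !ltr_norml; lra.
have dw := Hd w (wz d dmin).
have [w' [Ow' b' e']] : exists z', [/\ Om z', ball z1 (e1 / 2) z' & Phi z' = Phi w].
  by apply: He; rewrite e; move: dw; rewrite prod_normE gt_max => /andP[]; split.
have ww : w' = w by apply: inj.
apply: sep; rewrite (splitr e1); rewrite ww in b'; apply: ball_triangle b' _.
by apply/ball_box; rewrite /w /= !ltr_norml; lra.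
Qed.

End OpenMap.

(** * Transport of integrals by a weighted map *)

Section Transfer.
Import HBNNSimple.
Local Open Scope ereal_scope.
Context d1 d2 (T1 : measurableType d1) (T2 : measurableType d2) (R : realType).
Variables (m1 : {measure set T1 -> \bar R}) (m2 : {measure set T2 -> \bar R}).
Variables (phi : T1 -> T2) (w : T1 -> R) (D2 : set T2).
Hypothesis mphi : measurable_fun setT phi.
Hypothesis mw : measurable_fun setT w.
Hypothesis w0 : forall x, (0 <= w x)%R.
Hypothesis mD2 : measurable D2.

Lemma measurable_weighted (f : T2 -> \bar R) : measurable_fun setT f ->
  measurable_fun setT (fun x => (w x)%:E * f (phi x)).
Proof.
move=> mf; apply: emeasurable_funM => //; first exact/measurable_EFinP.
exact: (measurableT_comp mf mphi).
Qed.

Hypothesis indic_transfer : forall A, measurable A ->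
  \int[m1]_x ((w x)%:E * (\1_A (phi x))%:E) = m2 (A `&` D2).

(** From indicators to simple functions by linearity, then to nonnegative measurable functions by
    monotone convergence. *)
Lemma ge0_integral_transfer (f : T2 -> \bar R) : measurable_fun setT f ->
  (forall y, 0 <= f y) ->
  \int[m1]_x ((w x)%:E * f (phi x)) = \int[m2]_(y in D2) f y.
Proof.
move=> mf f0.
pose g := nnsfun_approx measurableT mf.
have gf x : (g n x)%:E @[n --> \oo] --> f x by exact: cvg_nnsfun_approx.
have ndg : nondecreasing_seq (g : (T2 -> R)^nat) by exact: nd_nnsfun_approx.
have simple n : \int[m1]_x ((w x)%:E * (g n (phi x))%:E) = \int[m2]_(y in D2) (g n y)%:E.
  under eq_integral.
    move=> x _; rewrite fimfunE -fsumEFin // ge0_mule_fsumr; last first.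
      by move=> r; rewrite EFinM nnfun_muleindic_ge0.
    over.
  rewrite ge0_integral_fsum //; last 2 first.
  - move=> r; apply: (measurable_weighted (f := fun y => (r * \1_(g n @^-1` [set r]) y)%:E)).
    by apply/measurable_EFinP/measurable_funM.
  - by move=> r x _; rewrite mule_ge0 ?lee_fin // -lee_fin EFinM nnfun_muleindic_ge0.
  under [RHS]eq_integral.
    by move=> y _; rewrite fimfunE -fsumEFin //; over.
  rewrite ge0_integral_fsum //; last 2 first.
  - by move=> r; apply/measurable_EFinP/measurable_funTS/measurable_funM.
  - by move=> r y _; rewrite EFinM nnfun_muleindic_ge0.
  apply: eq_fsbigr => r; rewrite inE => -[y _ <-].
  have gy0 : 0 <= (g n y)%:E by rewrite lee_fin; exact: fun_ge0.
  transitivity ((g n y)%:E * \int[m1]_x ((w x)%:E * (\1_(g n @^-1` [set g n y]) (phi x))%:E)).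
    rewrite -ge0_integralZl//; last 2 first.
    - apply: (measurable_weighted (f := fun y' => (\1_(g n @^-1` [set g n y]) y')%:E)).
      exact/measurable_EFinP.
    - by move=> x _; rewrite mule_ge0 ?lee_fin.
    by apply: eq_integral => x _; rewrite EFinM muleCA.
  rewrite indic_transfer // -integral_indic // -ge0_integralZl//.
  exact/measurable_EFinP/measurable_funTS.
transitivity (\int[m1]_x (limn (fun n => (w x)%:E * (g n (phi x))%:E))).
  apply: eq_integral => x _; apply/esym/cvg_lim => //.
  by apply: cvgeZl => //; exact: gf.
rewrite monotone_convergence //; last 3 first.
- by move=> n; apply: (measurable_weighted (f := fun y => (g n y)%:E)); exact/measurable_EFinP.
- by move=> n x _; rewrite mule_ge0 ?lee_fin //; exact: fun_ge0.
- by move=> x _ m n mn; rewrite lee_wpmul2l ?lee_fin //; exact/lefP/ndg.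
transitivity (\int[m2]_(y in D2) (limn (fun n => (g n y)%:E))); last first.
  by apply: eq_integral => y _; apply/cvg_lim => //; exact: gf.
rewrite monotone_convergence //; last 3 first.
- by move=> n; apply/measurable_EFinP/measurable_funTS.
- by move=> n y _; rewrite lee_fin; exact: fun_ge0.
- by move=> y _ m n mn; rewrite lee_fin; exact/lefP/ndg.
by congr (limn _); apply/funext.
Qed.

End Transfer.

Section WeightedPushforward.
Local Open Scope ereal_scope.
Context d1 d2 (T1 : measurableType d1) (T2 : measurableType d2) (R : realType).
Variables (m : {measure set T1 -> \bar R}) (phi : T1 -> T2) (w : T1 -> R).
Hypothesis mphi : measurable_fun setT phi.
Hypothesis mw : measurable_fun setT w.
Hypothesis w0 : forall x, (0 <= w x)%R.

(* The proofs are arguments so that the measure instance can be inferred from the term. *)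
Definition wpush of measurable_fun setT phi & measurable_fun setT w
    & (forall x, (0 <= w x)%R) : set T2 -> \bar R :=
  fun A => \int[m]_(x in phi @^-1` A) (w x)%:E.

Let nu := wpush mphi mw w0.

Let mpre A : measurable A -> measurable (phi @^-1` A).
Proof. by move=> mA; rewrite -[X in measurable X]setTI; exact: mphi. Qed.

Let nu_set0 : nu set0 = 0.
Proof. by rewrite /nu /wpush preimage_set0 integral_set0. Qed.

Let nu_ge0 A : 0 <= nu A.
Proof. by apply: integral_ge0 => x _; rewrite lee_fin. Qed.

Let nu_sigma_additive : semi_sigma_additive nu.
Proof.
move=> F mF tF mUF; rewrite /nu /wpush; apply: cvg_toP.
  apply: ereal_nondecreasing_is_cvgn => i j ij.
  apply: lee_sum_nneg_natr => // k _ _; exact: nu_ge0.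
rewrite preimage_bigcup ge0_integral_bigcup//=.
- by move=> k; exact: mpre.
- exact/measurable_EFinP/measurable_funTS.
- by move=> x _; rewrite lee_fin.
- apply/trivIsetP => /= i j _ _ ij; rewrite -preimage_setI.
  by move/trivIsetP : tF => /(_ _ _ _ _ ij) ->//; rewrite preimage_set0.
Qed.

HB.instance Definition _ := isMeasure.Build _ _ _ (wpush mphi mw w0)
  nu_set0 nu_ge0 nu_sigma_additive.

Lemma wpushE A : measurable A ->
  wpush mphi mw w0 A = \int[m]_x ((w x)%:E * (\1_A (phi x))%:E).
Proof.
move=> mA; rewrite /wpush integral_mkcond; apply: eq_integral => x _.
rewrite patchE indicE (_ : (x \in phi @^-1` A) = (phi x \in A)); last first.
  by apply/idP/idP; rewrite !inE.
case: ifP => _.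
  by rewrite mule1.
by rewrite mule0.
Qed.

End WeightedPushforward.

(** * Substitution in one variable for measurable functions *)

Section Substitution.
Local Open Scope ereal_scope.
Context {R : realType}.
Local Notation mR := (measurableTypeR R).
Implicit Types (f : mR -> \bar R) (p q : R).

Lemma integral_reflection f : measurable_fun setT f -> (forall t, 0 <= f t) ->
  \int[leb]_t f (- t)%R = \int[leb]_t f t.
Proof.
move=> mf f0.
have mN : measurable_fun setT (-%R : mR -> mR).
  by apply: continuous_measurable_fun; exact: opp_continuous.
have := @ge0_integral_pushforward _ _ mR mR R _ mN leb setT f measurableT mf.
rewrite preimage_setT => <-; last by move=> t _; exact: f0.
by apply: eq_measure_integral => A mA _; exact: lebesgue_measureN.
Qed.

Lemma FTC_cc (F F' : R -> R) (a b : R) : (a < b)%R -> continuous F' -> continuous F ->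
  (forall s, (a < s < b)%R -> is_derive s 1%R F (F' s)) ->
  \int[leb]_(x in `[a, b]) (F' x)%:E = (F b - F a)%:E.
Proof.
move=> ab cF' cF dF; rewrite EFinB; apply: continuous_FTC2 => //.
- exact: cont_within.
- split.
  + by move=> x; rewrite in_itv /= => /dF [].
  + exact/cvg_at_right_filter/cF.
  + exact/cvg_at_left_filter/cF.
- by move=> x; rewrite in_itv /= => /dF [_ <-]; rewrite derive1E.
Qed.

(** The image by [g] of the measure of density [g1], completed by Lebesgue measure outside []g p, g
    q]], agrees with Lebesgue measure on half-open intervals by the fundamental theorem of calculus.
    Uniqueness of Lebesgue measure then covers every measurable [f]. *)
Lemma substitution_incr (g g1 : R -> R) p q f : (p < q)%R -> continuous g -> continuous g1 ->
  (forall s, (p < s < q)%R -> is_derive s 1%R g (g1 s)) ->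
  (forall s, (p < s < q)%R -> (0 < g1 s)%R) ->
  measurable_fun setT f -> (forall t, 0 <= f t) ->
  (forall t, f t != 0 -> exists2 s, (p < s < q)%R & g s = t) ->
  \int[leb]_(s in `]p, q[) ((g1 s)%:E * f (g s)) = \int[leb]_t f t.
Proof.
move=> pq cg cg1 dg g1_gt0 mf f0 fsupp.
have incr a b : (p <= a)%R -> (a < b)%R -> (b <= q)%R -> (g a < g b)%R.
  move=> pa ab bq; apply: (@der_lt _ g g1) => //.
    by move=> s /andP[s1 s2]; apply: dg; lra.
  by move=> s /andP[s1 s2]; apply: g1_gt0; lra.
have incrE a b : (p <= a <= q)%R -> (p <= b <= q)%R -> (g a < g b)%R = (a < b)%R.
  move=> /andP[pa aq] /andP[pb bq].
  have [ab|ba|->] := ltgtP a b; last by rewrite ltxx.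
    by rewrite incr.
  by apply/negbTE; rewrite -leNgt ltW // incr.
pose w : mR -> R := g1 \_ `]p, q].
have g1q : (0 <= g1 q)%R.
  have := @cont_ge_left _ (fun s => g1 (q - s)%R) 0%R (q - p)%R 0%R.
  rewrite subr0; apply; first by rewrite subr_gt0.
    by cts.
  move=> s /andP[s1 s2]; have [e|ne] := eqVneq s (q - p)%R; last first.
    have ne' : (s < q - p)%R by rewrite lt_neqAle ne.
    by apply/ltW/g1_gt0; lra.
  have -> : (q - s = p)%R by rewrite e; ring.
  apply: (@cont_ge_left _ g1 p ((p + q) / 2)%R 0%R) => //; first lra.
  by move=> u u12; apply/ltW/g1_gt0; lra.
have w0 x : (0 <= w x)%R.
  rewrite /w patchE; case: ifPn => //; rewrite inE /= in_itv /= => /andP[px].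
  by rewrite le_eqVlt => /predU1P[->//|xq]; rewrite ltW // g1_gt0 // px.
have mg : measurable_fun setT (g : mR -> mR) by exact: continuous_measurable_fun.
have mw : measurable_fun setT w.
  apply/(measurable_restrictT _ _).1; first exact: measurable_itv.
  by apply: measurable_funTS; exact: continuous_measurable_fun.
have mI : measurable (`]g p, g q]%classic : set mR) by exact: measurable_itv.
have gpq : (g p < g q)%R by exact: incr.
pose nu := wpush leb mg mw w0.
have nuE A : measurable A -> nu A = leb (A `&` `]g p, g q]).
  move=> mA.
  have mIC : measurable (~` `]g p, g q]%classic : set mR) by exact: measurableC.
  pose mu := measure_add nu (mrestr leb mIC).
  have muD X : mu X = nu X + leb (X `&` ~` `]g p, g q]) by exact: measure_addE.
  have muE : forall X, measurable X -> leb X = mu X.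
    apply: lebesgue_measure_unique => _ [[a b] /= _ <-].
    apply: etrans (esym (muD _)).
    have mab : measurable (`]a, b]%classic : set mR) by exact: measurable_itv.
    rewrite [LHS](measureDI leb mab mI) setDE addeC; congr (_ + _).
    rewrite /nu /wpush.
    have [dc|cd] := leP (Num.min b (g q)) (Num.max a (g p)).
      rewrite (_ : `]a, b]%classic `&` `]g p, g q]%classic = set0); last first.
        apply/seteqP; split => // t /=; rewrite !in_itv /= => -[/andP[a1 a2] /andP[a3 a4]].
        by exfalso; move: dc; rewrite ge_min !le_max; lra.
      rewrite measure0; apply/esym/integral0_eq => x /=; rewrite in_itv /= => /andP[a1 a2].
      rewrite /w patchE; case: ifPn => //; rewrite inE /= in_itv /= => /andP[px xq].
      have b1 : (g p < g x)%R by exact: incr.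
      have b2 : (g x <= g q)%R.
        by move: xq; rewrite le_eqVlt => /predU1P[->//|xq]; apply/ltW/incr => //; exact: ltW.
      by exfalso; move: dc; rewrite ge_min !le_max; lra.
    have [s1 /andP[ps1 s1q] gs1] : exists2 c, (p <= c <= q)%R & g c = Num.max a (g p).
      apply: IVT_cont => //; [exact: ltW|].
      rewrite (min_l (ltW gpq)) (max_r (ltW gpq)) le_max lexx orbT /=.
      by rewrite (le_trans (ltW cd)) // ge_min lexx orbT.
    have [s2 /andP[ps2 s2q] gs2] : exists2 c, (p <= c <= q)%R & g c = Num.min b (g q).
      apply: IVT_cont => //; [exact: ltW|].
      rewrite (min_l (ltW gpq)) (max_r (ltW gpq)) ge_min lexx orbT andbT.
      by rewrite (le_trans _ (ltW cd)) // le_max lexx orbT.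
    have s12 : (s1 < s2)%R by rewrite -incrE ?ps1 ?ps2 // gs1 gs2.
    rewrite (_ : `]a, b]%classic `&` `]g p, g q]%classic = `]g s1, g s2]%classic); last first.
      apply/seteqP; split => t /=; rewrite !in_itv /= gs1 gs2 le_min gt_max.
        by move=> [/andP[-> ->] /andP[-> ->]].
      by move=> /andP[/andP[-> ->] /andP[-> ->]].
    transitivity ((g s2 - g s1)%:E).
      apply: etrans (lebesgue_measure_itv _) _.
      by rewrite /= lte_fin gs1 gs2 cd.
    transitivity (\int[leb]_(x in `]s1, s2]) (g1 x)%:E).
      rewrite integral_itv_obnd_cbnd; last first.
        by apply: measurable_funTS; apply/measurable_EFinP; exact: continuous_measurable_fun.
      by apply/esym/FTC_cc => // s /andP[a1 a2]; apply: dg; lra.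
    rewrite [LHS]integral_mkcond [RHS]integral_mkcond; apply: eq_integral => x _.
    have memE (B : set mR) y : (y \in B) = `[< B y >] by [].
    rewrite !patchE /w patchE !memE /= !in_itv /= !asboolb.
    have [/andP[px xq]|nx] := boolP (p < x <= q)%R; last first.
      rewrite if_same; case: ifP => // /andP[a1 a2]; exfalso; move/negP: nx; apply.
      by rewrite (le_lt_trans ps1) // (le_trans a2).
    congr (if _ then _ else _); rewrite -(incrE s1 x) ?ps1 ?px ?(ltW px) ?xq //.
    have -> : (x <= s2)%R = (g x <= g s2)%R by rewrite !leNgt incrE ?ps2 ?s2q ?(ltW px) ?xq.
    rewrite gs1 gs2 le_min gt_max.
    have -> : (g p < g x)%R by exact: incr.
    have -> : (g x <= g q)%R by rewrite leNgt incrE ?lexx ?(ltW pq) ?(ltW px) ?xq // -leNgt.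
    by rewrite !andbT.
  rewrite muE; last exact: measurableI.
  apply: etrans (esym (muD _)).
  rewrite -setIA setICr setI0 measure0 adde0.
  rewrite /nu /wpush [LHS]integral_mkcond [RHS]integral_mkcond; apply: eq_integral => x _.
  rewrite !patchE /w patchE.
  have [px|nx] := boolP (x \in (`]p, q]%classic : set R)); last by rewrite !if_same.
  congr (if _ then _ else _); apply/idP/idP; rewrite !inE /=; last by case.
  move=> Ax; split => //; move: px; rewrite inE /= !in_itv /= => /andP[px xq].
  rewrite incr //=; move: xq; rewrite le_eqVlt => /predU1P[->//|xq].
  by apply/ltW/incr => //; exact: ltW.
transitivity (\int[leb]_x ((w x)%:E * f (g x))).
  rewrite integral_mkcond; apply: eq_integral => x _.
  rewrite patchE /w patchE.
  case: ifPn => [|nx].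
    by rewrite inE /= in_itv /= => /andP[px xq]; rewrite mem_set //= in_itv /= px ltW.
  case: ifPn => [|_]; last by apply/esym/mul0e.
  rewrite inE /= in_itv /= => /andP[px xq].
  have xqe : x = q.
    apply/eqP; rewrite eq_le xq /= leNgt; apply/negP => xq'.
    by move/negP : nx; apply; rewrite inE /= in_itv /= px.
  have [->|] := eqVneq (f (g x)) 0; first by rewrite mule0.
  move=> /fsupp[s /andP[s1 s2]] e; exfalso.
  have : (g s < g q)%R by apply: incr => //; exact: ltW.
  by rewrite e xqe ltxx.
rewrite (@ge0_integral_transfer _ _ mR mR R leb leb g w `]g p, g q]) //.
  rewrite integral_mkcond; apply: eq_integral => t _; rewrite patchE.
  case: ifPn => // nt; have [->//|/fsupp[s /andP[s1 s2] e]] := eqVneq (f t) 0.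
  exfalso; move/negP: nt; apply; rewrite inE /= in_itv /= -e incr ?lexx ?(ltW s2) //=.
  by apply/ltW/incr; rewrite ?(ltW s1).
move=> A mA; apply: etrans (nuE A mA).
by apply/esym/wpushE.
Qed.

Lemma substitution (g g1 : R -> R) p q f : (p < q)%R -> continuous g -> continuous g1 ->
  (forall s, (p < s < q)%R -> is_derive s 1%R g (g1 s)) ->
  (forall s, (p < s < q)%R -> (0 < g1 s)%R) \/ (forall s, (p < s < q)%R -> (g1 s < 0)%R) ->
  measurable_fun setT f -> (forall t, 0 <= f t) ->
  (forall t, f t != 0 -> exists2 s, (p < s < q)%R & g s = t) ->
  \int[leb]_(s in `]p, q[) (`|g1 s|%:E * f (g s)) = \int[leb]_t f t.
Proof.
move=> pq cg cg1 dg [g1_gt0|g1_lt0] mf f0 fsupp.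
  rewrite -(substitution_incr pq cg cg1 dg g1_gt0 mf f0 fsupp).
  apply: eq_integral => s; rewrite inE /= in_itv /= => /g1_gt0 h.
  by rewrite gtr0_norm.
rewrite -integral_reflection //.
apply: etrans (_ : _ = \int[leb]_(s in `]p, q[) ((- g1 s)%:E * f (- - g s)%R)) _; last first.
  apply: (@substitution_incr (fun s => - g s)%R (fun s => - g1 s)%R p q
    (fun t => f (- t)%R)) => //.
  - by cts.
  - by cts.
  - by move=> s spq; have dgs := dg s spq; dereq.
  - by move=> s spq; rewrite oppr_gt0; exact: g1_lt0.
  - apply: (measurableT_comp mf); apply: continuous_measurable_fun.
    exact: opp_continuous.
  - by move=> t /fsupp[s spq e]; exists s => //; rewrite e opprK.
apply: eq_integral => s; rewrite inE /= in_itv /= => /g1_lt0 h.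
by rewrite ltr0_norm // opprK.
Qed.

End Substitution.

(** * Area formula on a slab transversal to one axis *)

Section TubeArea.
Local Open Scope ereal_scope.
Context {R : realType}.
Local Notation mR := (measurableTypeR R).
Variables (a b c d k : R -> R) (sg p q delta : R).
Hypothesis sg2 : (sg * sg = 1)%R.
Hypothesis pq : (p < q)%R.
Hypotheses (ca : continuous a) (cb : continuous b) (cc : continuous c) (cd : continuous d)
  (ck : continuous k).
Hypothesis bd1 : forall s, (b s * b s + d s * d s = 1)%R.
Hypothesis da : forall s, (p < s < q)%R -> is_derive s 1%R a (- (sg * d s))%R.
Hypothesis db : forall s, (p < s < q)%R -> is_derive s 1%R b (- (sg * (k s * d s)))%R.
Hypothesis dc : forall s, (p < s < q)%R -> is_derive s 1%R c (sg * b s)%R.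
Hypothesis dd : forall s, (p < s < q)%R -> is_derive s 1%R d (sg * (k s * b s))%R.

(** Up to the factor [sg / b t ^ 2], the derivative at [t] of the function [g xi] below, for
    [xi = a s + r * b s]. Its constant sign is the transversality of the slab. *)
Let F (s r t : R) : R := (b t + (a s + r * b s - a t) * k t)%R.

Hypothesis Fsign :
  (forall s r t : R, (p <= s <= q)%R -> (0 < r < delta)%R -> (p <= t <= q)%R -> (0 < F s r t)%R) \/
  (forall s r t : R, (p <= s <= q)%R -> (0 < r < delta)%R -> (p <= t <= q)%R -> (F s r t < 0)%R).
Hypothesis delta_gt0 : (0 < delta)%R.

Let cl := clamp p q.
Let clE s : (p < s < q)%R -> cl s = s.
Proof. by move=> /andP[s1 s2]; rewrite /cl clamp_id // !ltW. Qed.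
Let cl_in s : (p <= cl s <= q)%R. Proof. exact/clamp_in/ltW. Qed.
Let cl_cont : continuous cl. Proof. exact: clamp_cont. Qed.

Let b_neq0 s : (b (cl s) != 0)%R.
Proof.
apply/eqP => b0; have d0 := delta_gt0; have hr : (0 < delta / 2 < delta)%R by apply/andP; split; lra.
have e : F (cl s) (delta / 2) (cl s) = 0%R by rewrite /F b0; ring.
by case: Fsign => /(_ (cl s) (delta / 2)%R (cl s) (cl_in s) hr (cl_in s)); rewrite e ltxx.
Qed.

(** The ordinate at which the normal line of parameter [t] meets the line of abscissa [xi]. For
    fixed [xi] it is strictly monotone in [t] as soon as this line meets the slab. *)
Let g xi t := (c (cl t) + (xi - a (cl t)) / b (cl t) * d (cl t))%R.
Let g1 xi t := (sg * (b (cl t) + (xi - a (cl t)) * k (cl t)) / (b (cl t) * b (cl t)))%R.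

Let cV : continuous (fun t => (b (cl t))^-1)%R.
Proof. by apply: contV => //; exact: (cont_comp cb cl_cont). Qed.

Let cg xi : continuous (g xi). Proof. by rewrite /g; cts. Qed.
Let cg1 xi : continuous (g1 xi).
Proof.
rewrite /g1; apply: contM; first by cts.
by apply: contV => [t|]; [rewrite mulf_neq0 | cts].
Qed.

Let dg xi s : (p < s < q)%R -> is_derive s 1%R (g xi) (g1 xi s).
Proof.
move=> spq; have da' := da spq; have db' := db spq; have dc' := dc spq; have dd' := dd spq.
have bs : (b s != 0)%R by have := b_neq0 s; rewrite clE.
have dv := derV bs db'.
apply: (@near_der _ (fun t => c t + (xi - a t) / b t * d t)%R _ p q) => //.
  by move=> t tpq; rewrite /g clE.
dereq; rewrite /g1 clE //.
have u := bd1 s.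
apply: (@mulIf _ (b s * b s)%R); first by rewrite mulf_neq0.
rewrite divfK ?mulf_neq0 // expr2 -[in RHS](mulr1 (b s + _)%R) -u.
by field.
Qed.

Let g1_sign xi s r : (p < s < q)%R -> (0 < r < delta)%R -> xi = (a s + r * b s)%R ->
  (forall t, (p < t < q)%R -> (0 < g1 xi t)%R) \/ (forall t, (p < t < q)%R -> (g1 xi t < 0)%R).
Proof.
move=> /andP[ps sq] r0 ->.
have b2 t : (0 < (b (cl t) * b (cl t))^-1)%R.
  by rewrite invr_gt0 lt_neqAle eq_sym mulf_neq0 //= -expr2 sqr_ge0.
have hs : (p <= s <= q)%R by rewrite !ltW.
have sgE : (sg = 1 \/ sg = -1)%R.
  have : ((sg - 1) * (sg + 1) == 0)%R by apply/eqP; have := sg2; lra.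
  by rewrite mulf_eq0 => /orP[]/eqP ?; [left|right]; lra.
case: Fsign => Fs; case: sgE => e; [left|right|right|left] => t _;
  have := Fs s r (cl t) hs r0 (cl_in t); rewrite /g1 /F e => h.
- by apply: mulr_gt0 => //; rewrite mul1r.
- by rewrite pmulr_llt0 // mulN1r oppr_lt0.
- by rewrite pmulr_llt0 // mul1r.
- by apply: mulr_gt0 => //; rewrite mulN1r oppr_gt0.
Qed.

Let g_inj xi s r t : (p < s < q)%R -> (0 < r < delta)%R -> xi = (a s + r * b s)%R ->
  (p < t < q)%R -> g xi t = g xi s -> t = s.
Proof.
move=> spq r0 e tpq ge; have h := g1_sign spq r0 e; apply/eqP; apply: contraTT isT => ne.
have lt u v : (p < u < q)%R -> (p < v < q)%R -> (u < v)%R -> g xi u <> g xi v.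
  move=> /andP[u1 u2] /andP[v1 v2] uv; case: h => hs.
    have : (g xi u < g xi v)%R; last by move=> + e0; rewrite e0 ltxx.
    apply: (@der_lt _ _ (g1 xi)) => // w /andP[w1 w2].
      by apply: dg; lra.
    by apply: hs; lra.
  have : (- g xi u < - g xi v)%R; last by move=> + e0; rewrite e0 ltxx.
  apply: (@der_lt _ (fun w => - g xi w)%R (fun w => - g1 xi w)%R) => //.
  - by apply: contN; exact: cg.
  - by move=> w /andP[w1 w2]; apply: derN; apply: dg; lra.
  - by move=> w /andP[w1 w2]; rewrite oppr_gt0; apply: hs; lra.
by move: ne; rewrite neq_lt => /orP[ts|st]; [case: (lt _ _ tpq spq ts)|case: (lt _ _ spq tpq st)].
Qed.

Variable f : R * R -> \bar R.
Hypothesis mf : measurable_fun setT (f : plane R -> \bar R).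
Hypothesis f0 : forall z, 0 <= f z.
Hypothesis fsupp : forall z, f z != 0 ->
  exists s r, [/\ (p < s < q)%R, (0 < r < delta)%R & z = (a s + r * b s, c s + r * d s)%R].

Let gE s r : (p < s < q)%R -> g (a s + r * b s)%R s = (c s + r * d s)%R.
Proof.
move=> spq; have := b_neq0 s; rewrite /g clE // => bs.
by field.
Qed.

Let G (z : R * R) : \bar R := (`|g1 z.2 z.1| * \1_(`]p, q[ : set R) z.1)%:E * f (z.2, g z.2 z.1).

Let mg : continuous (fun z : R * R => g z.2 z.1).
Proof.
have cv : continuous (fun z : R * R => (b (cl z.1))^-1)%R by exact: (cont_comp cV cont_fst).
by rewrite /g; cts.
Qed.

Let mg1 : continuous (fun z : R * R => g1 z.2 z.1).
Proof.
rewrite /g1; apply: contM; first by cts.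
by apply: contV => [t|]; [rewrite mulf_neq0 | cts].
Qed.

Let mG : measurable_fun setT (G : plane R -> \bar R).
Proof.
apply: emeasurable_funM.
  apply/measurable_EFinP; apply: measurable_funM.
    by apply: cont_measurable; apply: cont_norm; exact: mg1.
  have mi : measurable_fun setT (\1_(`]p, q[ : set mR) : mR -> R).
    by apply: measurable_indic; exact: measurable_itv.
  exact: (measurableT_comp mi (@measurable_fst _ _ mR mR)).
have mh : measurable_fun setT (fun z : plane R => (z.2, g z.2 z.1) : plane R).
  by apply: measurable_fun_pair; [exact: measurable_snd|exact: cont_measurable].
exact: (measurableT_comp mf mh).
Qed.

(** Two substitutions in one variable: [eta = g xi s] for fixed [xi], then, after Tonelli,
    [xi = a s + r * b s] for fixed [s]. The product of the two derivatives is
    [sg * (1 + r * k s)]. *)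
Lemma tube_change_of_variables :
  \int[@lebesgue_measure R]_xi \int[@lebesgue_measure R]_eta f (xi, eta) =
  \int[@lebesgue_measure R]_(s in (`]p, q[ : set mR)) \int[@lebesgue_measure R]_(r in (`]0%R, delta[ : set mR))
    (`|1 + r * k s|%:E * f (a s + r * b s, c s + r * d s)%R).
Proof.
have G0 z : 0 <= G z by rewrite mule_ge0 ?lee_fin ?mulr_ge0.
have msec xi : measurable_fun setT (fun eta : mR => f (xi, eta)).
  have mh : measurable_fun setT (fun eta : mR => (xi, eta) : plane R).
    by apply: measurable_fun_pair; [exact: measurable_cst|exact: measurable_id].
  exact: (measurableT_comp mf mh).
transitivity (\int[@lebesgue_measure R]_xi \int[@lebesgue_measure R]_s G (s, xi)).
  apply: eq_integral => xi _.
  transitivity (\int[@lebesgue_measure R]_(s in (`]p, q[ : set mR)) (`|g1 xi s|%:E * f (xi, g xi s))); last first.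
    rewrite [LHS]integral_mkcond; apply: eq_integral => s _.
    rewrite /G patchE indicE /=; case: ifP => _; first by rewrite mulr1.
    by rewrite mulr0 mul0e.
  (* The sign of [g1 xi] is known only if the line of abscissa [xi] meets the slab; otherwise both
     sides are 0. *)
  have [[s [r [spq r0 e]]]|no] :=
      pselect (exists s r, [/\ (p < s < q)%R, (0 < r < delta)%R & xi = a s + r * b s]%R).
    apply/esym; apply: (@substitution _ (g xi) (g1 xi) p q (fun eta => f (xi, eta))) => //.
    - by move=> t tpq; exact: dg.
    - exact: g1_sign spq r0 e.
    - move=> t /fsupp[s' [r' [spq' r0' [-> ->]]]]; exists s' => //.
      exact: gE.
  have fz eta : f (xi, eta) = 0.
    apply/eqP; apply: contra_notT no => /fsupp[s [r [? ? [? ?]]]]; by exists s, r.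
  by rewrite !integral0_eq // => s _; rewrite fz ?mule0.
transitivity (\int[@lebesgue_measure R]_s \int[@lebesgue_measure R]_xi G (s, xi)).
  by apply/esym; apply: fubini_tonelli.
rewrite [RHS]integral_mkcond; apply: eq_integral => s _.
rewrite patchE; case: ifPn => [|ns]; last first.
  apply: integral0_eq => xi _; rewrite /G /= indicE (negbTE ns) mulr0 mul0e //.
rewrite inE /= in_itv /= => spq.
transitivity (\int[@lebesgue_measure R]_xi (`|g1 xi s|%:E * f (xi, g xi s))).
  apply: eq_integral => xi _; rewrite /G /= indicE mem_set ?mulr1 //=.
have bs : (b s != 0)%R by have := b_neq0 s; rewrite clE.
have cpair : continuous (fun xi : R => (s, xi)) by cts.
transitivity (\int[@lebesgue_measure R]_(r in (`]0%R, delta[ : set mR)) (`|b s|%:E *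
    (`|g1 (a s + r * b s) s|%:E * f (a s + r * b s, g (a s + r * b s) s)%R))).
  apply/esym; apply: (@substitution _ (fun r => a s + r * b s)%R (fun=> b s) 0%R delta
     (fun xi => `|g1 xi s|%:E * f (xi, g xi s))) => //.
  - by cts.
  - by cts.
  - by move=> r _; dereq; ring.
  - move: bs; rewrite neq_lt => /orP[]; by [right|left].
  - apply: emeasurable_funM.
      apply/measurable_EFinP; apply: continuous_measurable_fun.
      by apply: cont_norm; exact: (cont_comp mg1 cpair).
    have mgs : measurable_fun setT (fun xi : mR => g xi s : mR).
      by apply: continuous_measurable_fun; exact: (cont_comp mg cpair).
    have mh : measurable_fun setT (fun xi : mR => (xi, g xi s) : plane R).
      by apply: measurable_fun_pair; first exact: measurable_id.
    exact: (measurableT_comp mf mh).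
  - by move=> t; rewrite mule_ge0 ?lee_fin.
  move=> xi; have [->|fn _] := eqVneq (f (xi, g xi s)) 0; first by rewrite mule0 eqxx.
  have [s' [r [spq' r0 [e1 e2]]]] := fsupp fn.
  exists r => //.
  have -> : s = s'; last by [].
  apply: (g_inj spq' r0 e1) => //.
  by rewrite e2 e1 gE.
apply: eq_integral => r; rewrite inE /= in_itv /= => r0.
rewrite gE // muleA -EFinM -normrM; congr (_%:E * _).
have -> : (b s * g1 (a s + r * b s) s = sg * (1 + r * k s))%R.
  by rewrite /g1 clE //; field.
rewrite normrM (_ : `|sg| = 1)%R ?mul1r //.
by apply/eqP; rewrite -(@eqrXn2 _ 2) // expr1n -normrX expr2 sg2 normr1.
Qed.

End TubeArea.

(** * Area formula on the whole strip *)

Section ChangeOfVariables.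
Local Open Scope ereal_scope.
Context {R : realType} {L delta : R}.
Variable C : centerline L delta.
Local Notation mR := (measurableTypeR R).
Local Notation lebR := (@lebesgue_measure R).
Local Notation leb2 := (@lebesgue2 R).
Local Notation x := (cx C).
Local Notation y := (cy C).
Local Notation x1 := (cx1 C).
Local Notation y1 := (cy1 C).
Local Notation k := (ck C).
Local Notation Phi := (Phi C).
Local Notation hh := (hh C).
Local Notation Om := (Om L delta).
Implicit Types (f : R * R -> \bar R).

Lemma measurable_Om : measurable (Om : set (plane R)).
Proof. by apply: open_measurable_plane; exact: Om_open. Qed.

Lemma measurable_Phi : measurable_fun setT (Phi : plane R -> plane R).
Proof.
have cP := @Phi_cont _ _ _ C.
apply/measurable_fun_pairP; split; apply: cont_measurable.
  exact: (cont_comp cont_fst cP).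
exact: (cont_comp cont_snd cP).
Qed.

Lemma measurable_hh : measurable_fun setT (hh : plane R -> R).
Proof. by apply: cont_measurable; exact: hh_cont. Qed.

Lemma measurable_patch (A : set (plane R)) f : measurable A ->
  measurable_fun setT (f : plane R -> \bar R) ->
  measurable_fun setT ((f : plane R -> \bar R) \_ A).
Proof. by move=> mA mf; apply/(measurable_restrictT _ _).1 => //; exact: measurable_funTS. Qed.

Lemma hh_bounds : exists c0 c1 : R, [/\ (0 < c0)%R, (0 < c1)%R &
  forall z, (0 <= z.1 <= L)%R -> (0 <= z.2 <= delta)%R -> (c0 <= hh z <= c1)%R].
Proof.
have L0 := L_gt0 C; have d0 := delta_gt0 C.
have cF : continuous (fun s => 1 + delta * k s)%R by cts.
have [a _ amin] := EVT_min (ltW L0) (cont_within cF).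
have [b _ bmax] := EVT_max (ltW L0) (cont_within cF).
have pa := h_delta_gt0 C a.
have pb := h_delta_gt0 C b.
exists (Num.min 1 (1 + delta * k a))%R, (Num.max 1 (1 + delta * k b))%R; split.
- by rewrite lt_min ltr01.
- by rewrite lt_max ltr01.
move=> [s r] /= ss /andP[r0 rd].
have h1 := amin s ss; have h2 := bmax s ss; rewrite /hh /=.
rewrite ge_min le_max.
have [k0|k0] := leP 0%R (k s).
  have e1 : (0 <= r * k s)%R by exact: mulr_ge0.
  have e2 : (r * k s <= delta * k s)%R by rewrite ler_wpM2r.
  by apply/andP; split; apply/orP; [left|right]; lra.
have e1 : (r * k s <= 0)%R by rewrite nmulr_lle0.
have e2 : (delta * k s <= r * k s)%R by rewrite ler_wnM2r // ltW.
by apply/andP; split; apply/orP; [right|left]; lra.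
Qed.

Lemma tonelli1 f : measurable_fun setT (f : plane R -> \bar R) -> (forall z, 0 <= f z) ->
  \int[leb2]_z f z = \int[lebR]_s \int[lebR]_r f (s, r).
Proof. by move=> mf f0; rewrite /lebesgue2 fubini_tonelli1. Qed.

Lemma tonelli2 f : measurable_fun setT (f : plane R -> \bar R) -> (forall z, 0 <= f z) ->
  \int[leb2]_z f z = \int[lebR]_r \int[lebR]_s f (s, r).
Proof. by move=> mf f0; rewrite /lebesgue2 fubini_tonelli2. Qed.

Lemma integral_Om f : measurable_fun setT (f : plane R -> \bar R) -> (forall z, 0 <= f z) ->
  \int[leb2]_(z in Om) f z =
  \int[lebR]_(s in (`]0%R, L[ : set mR)) \int[lebR]_(r in (`]0%R, delta[ : set mR)) f (s, r).
Proof.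
move=> mf f0.
have mOm := measurable_Om.
rewrite [LHS]integral_mkcond.
have m' : measurable_fun setT ((f : plane R -> \bar R) \_ Om).
  exact: measurable_patch.
have f0' z : 0 <= (f \_ Om) z by apply: erestrict_ge0 => ? _; exact: f0.
rewrite (tonelli1 m' f0') [RHS]integral_mkcond.
apply: eq_integral => s _; rewrite patchE; case: ifPn => hs; last first.
  apply: integral0_eq => r _; rewrite patchE ifF //; apply/negbTE.
  move: hs; apply: contra; rewrite !inE /= in_itv /= => -[]//.
rewrite [RHS]integral_mkcond; apply: eq_integral => r _.
rewrite !patchE; congr (if _ then _ else _).
move: hs; rewrite inE /= in_itv /= => hs.
by apply/idP/idP; rewrite !inE /= in_itv /=; [case|].
Qed.

(** [X] and [Y] are the transversality functions for the two choices of axis. For equal parameters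
    they reduce to [y1 * hh] and [- x1 * hh]. *)
Let X (z : R * (R * R)) : R := (y1 z.2.2 + (x z.1 + z.2.1 * y1 z.1 - x z.2.2) * k z.2.2)%R.
Let Y (z : R * (R * R)) : R := (- x1 z.2.2 + (y z.1 + z.2.1 * - x1 z.1 - y z.2.2) * k z.2.2)%R.

(** The tangent being a unit vector, one of the two diagonal values is at least [c0 / 2] in absolute
    value; uniform continuity up to [c0 / 4] keeps its sign on a slab whose width does not depend on
    [c]. *)
Let slab_sign : exists2 e : R, (0 < e)%R & forall c, (0 <= c <= L)%R ->
  let sgn (F : R * (R * R) -> R) :=
    (forall s r t, (c - e <= s <= c + e)%R -> (0 < r < delta)%R -> (c - e <= t <= c + e)%R ->
      (0 < F (s, (r, t)))%R) \/
    (forall s r t, (c - e <= s <= c + e)%R -> (0 < r < delta)%R -> (c - e <= t <= c + e)%R ->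
      (F (s, (r, t)) < 0)%R) in
  sgn X \/ sgn Y.
Proof.
have [c0 [c1 [c00 _ hb]]] := hh_bounds.
pose K : set (R * (R * R)) := (`[0%R, L] `*` (`[0%R, delta] `*` `[0%R, L]))%classic.
have cK : compact K by apply: compact_setX; [|apply: compact_setX]; exact: segment_compact.
have cX : continuous X by rewrite /X; cts.
have cY : continuous Y by rewrite /Y; cts.
have c02 : (0 < c0 / 4)%R by lra.
have [dX dX0 uX] := unif_cont_compact cK cX c02.
have [dY dY0 uY] := unif_cont_compact cK cY c02.
exists (Num.min dX dY / 2)%R; first by rewrite divr_gt0 // lt_min dX0.
move=> c cL /=; set e := (Num.min dX dY / 2)%R.
have e0 : (0 < e)%R by rewrite divr_gt0 // lt_min dX0.
have close (F : R * (R * R) -> R) d : (e < d)%R ->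
   (forall z z', K z -> ball z d z' -> `|F z - F z'| < c0 / 4)%R ->
   forall s r t, (c - e <= s <= c + e)%R -> (0 < r < delta)%R -> (c - e <= t <= c + e)%R ->
   (`|F (c, (r, c)) - F (s, (r, t))| < c0 / 4)%R.
  move=> ed uF s r t /andP[s1 s2] /andP[r1 r2] /andP[t1 t2]; apply: uF.
    by rewrite /K /= !in_itv /= cL !ltW.
  have d0 : (0 < d)%R by exact: lt_trans ed.
  split => /=; last split => /=; rewrite /ball /= ?subrr ?normr0 // ltr_norml; apply/andP; split; lra.
have diag r : (0 < r < delta)%R ->
    (X (c, (r, c)) = y1 c * hh (c, r) /\ Y (c, (r, c)) = - x1 c * hh (c, r) /\ c0 <= hh (c, r))%R.
  move=> /andP[r0 rd]; split; first by rewrite /X /hh /=; ring.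
  split; first by rewrite /Y /hh /=; ring.
  have := hb (c, r); rewrite /= cL (ltW r0) (ltW rd) => /(_ isT isT) /andP[] //.
have edX : (e < dX)%R.
  by rewrite /e ltr_pdivrMr // (le_lt_trans (_ : _ <= dX)%R) ?ge_min ?lexx // ltr_pMr // ltr1n.
have edY : (e < dY)%R.
  by rewrite /e ltr_pdivrMr // (le_lt_trans (_ : _ <= dY)%R) ?ge_min ?lexx ?orbT // ltr_pMr // ltr1n.
have big (u : R) : (1 / 4 <= u * u)%R -> (1 / 2 <= u)%R \/ (u <= - (1 / 2))%R.
  move=> u2; have [u0|u0] := leP 0%R u; [left|right]; nra.
have main (F : R * (R * R) -> R) (u : R) : (1 / 4 <= u * u)%R ->
  (forall s r t, (c - e <= s <= c + e)%R -> (0 < r < delta)%R -> (c - e <= t <= c + e)%R ->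
    (`|F (c, (r, c)) - F (s, (r, t))| < c0 / 4)%R) ->
  (forall r, (0 < r < delta)%R -> F (c, (r, c)) = (u * hh (c, r))%R /\ (c0 <= hh (c, r))%R) ->
  (forall s r t, (c - e <= s <= c + e)%R -> (0 < r < delta)%R -> (c - e <= t <= c + e)%R ->
      (0 < F (s, (r, t)))%R) \/
    (forall s r t, (c - e <= s <= c + e)%R -> (0 < r < delta)%R -> (c - e <= t <= c + e)%R ->
      (F (s, (r, t)) < 0)%R).
  move=> /big[u2|u2] cF dF; [left|right] => s r t hs hr ht;
    have := cF s r t hs hr ht; have [-> hc] := dF r hr; rewrite ltr_norml => /andP[f1 f2].
    have h1 : (c0 / 2 <= u * hh (c, r))%R by nra.
    lra.
  have h1 : (u * hh (c, r) <= - (c0 / 2))%R by nra.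
  lra.
have us : (x1 c * x1 c + y1 c * y1 c = 1)%R by have := unit_speed C c; rewrite !expr2.
have [hy|hy] := leP (1 / 4)%R (y1 c * y1 c)%R.
  left; apply: (main X (y1 c)) => //; first exact: close edX uX.
  by move=> r /diag[? []].
right; apply: (main Y (- x1 c)%R).
- by rewrite mulrNN; lra.
- exact: close edY uY.
- by move=> r /diag[? []].
Qed.

Hypothesis inj : forall z z', Om z -> Om z' -> Phi z = Phi z' -> z = z'.

Let good (A : set (R * R)) := forall f, measurable_fun setT (f : plane R -> \bar R) ->
  (forall z, 0 <= f z) -> (forall z, f z != 0 -> (Phi @` (Om `&` A)) z) ->
  \int[leb2]_z f z = \int[leb2]_(z in Om) ((hh z)%:E * f (Phi z)).

Let mright f : measurable_fun setT (f : plane R -> \bar R) ->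
  measurable_fun setT (fun z : plane R => (`|hh z|)%:E * f (Phi z)).
Proof.
move=> mf; apply: emeasurable_funM.
  by apply/measurable_EFinP; apply: cont_measurable; apply: cont_norm; exact: hh_cont.
exact: (measurableT_comp mf measurable_Phi).
Qed.

Let hhE z : Om z -> (0 < hh z)%R.
Proof. by case: z => s r [_ /andP[r0 rd]]; apply: hh_gt0; rewrite !ltW. Qed.

Let good_slab : exists2 e : R, (0 < e)%R &
  forall c, (0 <= c <= L)%R -> good [set z | (c - e < z.1 < c + e)%R].
Proof.
have [e e0 se] := slab_sign; exists e => // c cL f mf f0 fsupp.
have L0 := L_gt0 C; have d0 := delta_gt0 C.
have /andP[c0 cl] := cL.
pose p := Num.max 0%R (c - e)%R; pose q := Num.min L (c + e)%R.
have pq : (p < q)%R by rewrite gt_max !lt_min; apply/andP; split; apply/andP; split; lra.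
have pqE s : (p < s < q)%R = ((0 < s < L) && (c - e < s < c + e))%R.
  by rewrite gt_max lt_min andbACA.
have pqL s : (p < s < q)%R -> (0 < s < L)%R by rewrite pqE => /andP[].
have pqS s : (p <= s <= q)%R -> (c - e <= s <= c + e)%R.
  by rewrite ge_max le_min => /andP[/andP[_ ->] /andP[_ ->]].
have fsupp' z : f z != 0 -> exists s r, [/\ (p < s < q)%R, (0 < r < delta)%R & z = Phi (s, r)].
  by move=> /fsupp[[s r] [[Os Or] /= cs] <-]; exists s, r; rewrite pqE Os cs.
have RE : \int[leb2]_(z in Om) ((hh z)%:E * f (Phi z)) =
    \int[lebR]_(s in (`]p, q[ : set mR)) \int[lebR]_(r in (`]0%R, delta[ : set mR))
    (`|1 + r * k s|%:E * f (Phi (s, r))).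
  transitivity (\int[leb2]_(z in Om) (`|hh z|%:E * f (Phi z))).
    by apply: eq_integral => z; rewrite inE => Oz; rewrite gtr0_norm // hhE.
  rewrite integral_Om; [|exact: mright|by move=> z; rewrite mule_ge0 ?lee_fin].
  rewrite [LHS]integral_mkcond [RHS]integral_mkcond; apply: eq_integral => s _.
  rewrite !patchE; case: ifPn => hs; case: ifPn => hs' //; last first.
    exfalso; move/negP: hs; apply; move: hs'; rewrite !inE /= !in_itv /=; exact: pqL.
  apply: integral0_eq => r; rewrite /= in_itv /= => hr.
  have [->|/fsupp[[s' r'] [Oz cz] e1]] := eqVneq (f (Phi (s, r))) 0; first by rewrite mule0.
  have hs1 : (0 < s < L)%R by move: hs; rewrite inE /= in_itv.
  have [e2 _] : (s', r') = (s, r) by apply: inj => //; split.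
  have hs2 : (p < s < q)%R by rewrite (pqE s) hs1 -e2; exact: cz.
  by exfalso; move/negP: hs'; apply; rewrite inE /= in_itv.
rewrite RE.
have [sx|sy] := se c cL.
  rewrite (tonelli1 mf f0).
  transitivity (\int[lebR]_(s in (`]p, q[ : set mR)) \int[lebR]_(r in (`]0%R, delta[ : set mR))
      (`|1 + r * k s|%:E * f (x s + r * y1 s, y s + r * - x1 s)%R)); last first.
    apply: eq_integral => s _; apply: eq_integral => r _; congr (_ * f _).
    by rewrite /Phi /=; congr pair; ring.
  apply: (@tube_change_of_variables R x y1 y (fun s => - x1 s)%R k 1%R p q delta) => //.
  - by rewrite mulr1.
  - by cts.
  - by cts.
  - by cts.
  - by cts.
  - by cts.
  - by move=> s; have := unit_speed C s; rewrite !expr2 mulrNN addrC.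
  - by move=> s /pqL/(der_cx C) h; apply: der_eq h _; rewrite mul1r opprK.
  - by move=> s /pqL/(der_cy1 C) h; apply: der_eq h _; ring.
  - by move=> s /pqL/(der_cy C) h; apply: der_eq h _; rewrite mul1r.
  - by move=> s /pqL/(der_cx1 C) h; dereq; ring.
  - by case: sx => sx; [left|right] => s r t hs hr ht; apply: sx; rewrite ?pqS.
  - by move=> z /fsupp'[s [r [hs hr ->]]]; exists s, r; split => //; rewrite /Phi /=; congr pair; ring.
(* The axes are exchanged, which reverses the orientation: hence [sg = -1]. *)
rewrite (tonelli2 mf f0).
have mswap : measurable_fun setT (fun z : plane R => (z.2, z.1) : plane R).
  by apply: measurable_fun_pair; [exact: measurable_snd|exact: measurable_fst].
transitivity (\int[lebR]_(s in (`]p, q[ : set mR)) \int[lebR]_(r in (`]0%R, delta[ : set mR))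
    (`|1 + r * k s|%:E * (fun z => f (z.2, z.1)) (y s + r * - x1 s, x s + r * y1 s)%R)); last first.
  apply: eq_integral => s _; apply: eq_integral => r _; congr (_ * f _).
  by rewrite /Phi /=; congr pair; ring.
apply: (@tube_change_of_variables R y (fun s => - x1 s)%R x y1 k (-1)%R p q delta
   _ _ _ _ _ _ _ _ _ _ _ _ _ _ (fun z => f (z.2, z.1))) => //.
- by rewrite mulrNN mulr1.
- by cts.
- by cts.
- by cts.
- by cts.
- by cts.
- by move=> s; have := unit_speed C s; rewrite !expr2 mulrNN.
- by move=> s /pqL/(der_cy C) h; apply: der_eq h _; ring.
- by move=> s /pqL/(der_cx1 C) h; dereq; ring.
- by move=> s /pqL/(der_cx C) h; apply: der_eq h _; ring.
- by move=> s /pqL/(der_cy1 C) h; apply: der_eq h _; ring.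
- by case: sy => sy; [left|right] => s r t hs hr ht; apply: sy; rewrite ?pqS.
- exact: (measurableT_comp mf mswap).
- move=> [z1 z2] /fsupp'[s [r [hs hr [-> ->]]]]; exists s, r; split => //.
  by congr pair; ring.
Qed.

Let mPhi_left t : measurable (Phi @` (Om `&` [set z | (z.1 < t)%R]) : set (plane R)).
Proof.
apply: open_measurable_plane; rewrite openE => _ [z [Oz zt] <-].
have zt' : (0 < t - z.1)%R by rewrite subr_gt0.
have [eta eta0 He] := Phi_open_at inj Oz zt'.
apply/nbhs_ballP; exists eta => // q /He[z' [Oz' /ball_box[b1 _] <-]].
by exists z' => //; split => //=; move: b1; rewrite ltr_norml => /andP[b1 b2]; lra.
Qed.

(** Induction over slabs of width [e]: the function is cut along the image of [s < n * e]. The part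
    inside falls under the induction hypothesis, the rest is supported in a single slab. *)
Lemma change_of_variables f : measurable_fun setT (f : plane R -> \bar R) ->
  (forall z, 0 <= f z) ->
  \int[leb2]_(z in Dom C) f z = \int[leb2]_(z in Om) ((hh z)%:E * f (Phi z)).
Proof.
move=> mf f0.
have [e e0 ge] := good_slab.
have L0 := L_gt0 C.
have step n : (n%:R * e <= L + e)%R -> good [set z | (z.1 < n%:R * e)%R].
  elim: n => [_|n IH nL] g mg g0 gsupp.
    have gz z : g z = 0.
      apply/eqP; apply: contraT => /gsupp[u [[/andP[u0 _] _] /= ul] _].
      by exfalso; move: ul; rewrite mul0r; lra.
    by rewrite !integral0_eq // => z _; rewrite gz ?mule0.
  have nL' : (n%:R * e <= L)%R by move: nL; rewrite -natr1 mulrDl mul1r lerD2r.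
  set t := (n%:R * e)%R in IH nL'.
  have t0 : (0 <= t)%R by rewrite mulr_ge0 // ltW.
  pose A : set (R * R) := Phi @` (Om `&` [set z | (z.1 < t)%R]).
  have mA : measurable (A : set (plane R)) by exact: mPhi_left.
  have mCA : measurable (~` A : set (plane R)) by exact: measurableC.
  pose g1 := (g \_ A : R * R -> \bar R); pose g2 := (g \_ (~` A) : R * R -> \bar R).
  have gE z : g z = g1 z + g2 z.
    rewrite /g1 /g2 !patchE in_setC; case: (z \in A) => /=; first by rewrite adde0.
    by rewrite add0e.
  have g10 z : 0 <= g1 z by apply: erestrict_ge0.
  have g20 z : 0 <= g2 z by apply: erestrict_ge0.
  have mg1 : measurable_fun setT (g1 : plane R -> \bar R).
    exact: measurable_patch.
  have mg2 : measurable_fun setT (g2 : plane R -> \bar R).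
    exact: measurable_patch.
  have s1 z : g1 z != 0 -> (Phi @` (Om `&` [set z | (z.1 < t)%R])) z.
    by rewrite /g1 patchE; case: ifPn; [rewrite inE|rewrite eqxx].
  have s2 z : g2 z != 0 -> (Phi @` (Om `&` [set z | (t - e < z.1 < t + e)%R])) z.
    rewrite /g2 patchE; case: ifPn; [rewrite inE => nA|by rewrite eqxx].
    move=> /gsupp[u [Ou ut] eu]; exists u => //; split => //=.
    have tu : (t <= u.1)%R by rewrite leNgt; apply/negP => ut'; apply: nA; exists u.
    move: ut => /=; rewrite -natr1 mulrDl mul1r -/t => ut.
    by apply/andP; split; lra.
  have mR1 (g' : R * R -> \bar R) : measurable_fun setT (g' : plane R -> \bar R) ->
      measurable_fun Om ((fun z => (hh z)%:E * g' (Phi z)) : plane R -> \bar R).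
    move=> mg'; apply: measurable_funTS; apply: emeasurable_funM.
      by apply/measurable_EFinP; exact: measurable_hh.
    exact: (measurableT_comp mg' measurable_Phi).
  have h0 (g' : R * R -> \bar R) z : (forall z, 0 <= g' z) -> Om z -> 0 <= (hh z)%:E * g' (Phi z).
    by move=> g'0 Oz; rewrite mule_ge0 // lee_fin ltW // hhE.
  transitivity (\int[leb2]_z (g1 z + g2 z)); first by apply: eq_integral => z _.
  rewrite ge0_integralD //.
  transitivity (\int[leb2]_(z in Om) ((hh z)%:E * g1 (Phi z) + (hh z)%:E * g2 (Phi z))).
    rewrite ge0_integralD //; [|exact: measurable_Om|by move=> z; exact: h0|exact: mR1|
      by move=> z; exact: h0|exact: mR1].
    congr (_ + _); first by apply: IH => //; rewrite (le_trans nL') // lerDl ltW.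
    by apply: (ge t) => //; rewrite t0.
  by apply: eq_integral => z; rewrite inE => Oz; rewrite gE ge0_muleDr.
have mD : measurable (Dom C : set (plane R)) by apply: open_measurable_plane; exact: Dom_open.
(* The least [n] with [L < n * e]: by minimality [n * e <= L + e], so every slab is centred in
   [[0, L]]. *)
have [n /andP[n1 n2]] : exists n, (L < n%:R * e <= L + e)%R.
  have := archi_boundP (divr_ge0 (ltW L0) (ltW e0)).
  rewrite ltr_pdivrMr // => ex.
  have exn : exists n, (L < n%:R * e)%R by exists (Num.Def.archi_bound (L / e)).
  exists (ex_minn exn); case: ex_minnP => -[|m] mP mmin.
    by move: mP; rewrite mul0r ltNge ltW.
  rewrite mP /= -natr1 mulrDl mul1r lerD2r leNgt; apply/negP => /mmin.
  by rewrite ltnn.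
rewrite integral_mkcond (step n n2).
- apply: eq_integral => z; rewrite inE => Oz; congr (_ * _); rewrite patchE mem_set //.
  by exists z.
- exact: measurable_patch.
- by move=> z; apply: erestrict_ge0.
move=> z; rewrite patchE; case: ifPn => [|]; last by rewrite eqxx.
rewrite inE => -[u Ou <-] _; exists u => //; split => //=.
by apply: lt_trans n1; case: Ou => /andP[].
Qed.

End ChangeOfVariables.

(** * Square-integrable functions *)

Section SquareIntegrable.
Context d (T : measurableType d) (R : realType).
Variables (m : {measure set T -> \bar R}) (D : set T).
Hypothesis mD : measurable D.
Implicit Types (f g k u : T -> R).

(** Square integrability is stated for functions and not for classes modulo null sets, so that
    pointwise symmetries can be followed through limits. *)
Definition sq f := measurable_fun D f /\ m.-integrable D (fun x => (f x ^+ 2)%:E).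

Definition ip f g := \int[m]_(x in D) (f x * g x).

Lemma integrable_bound f g : measurable_fun D f ->
  m.-integrable D (EFin \o g) -> (forall x, D x -> `|f x| <= g x) ->
  m.-integrable D (EFin \o f).
Proof.
move=> mf ig fg; apply: (le_integrable mD _ _ ig).
  exact/measurable_EFinP.
by move=> x Dx /=; rewrite lee_fin (le_trans (fg x Dx)) // ler_norm.
Qed.

Lemma integrable_lin f g (a b : R) :
  m.-integrable D (EFin \o f) -> m.-integrable D (EFin \o g) ->
  m.-integrable D (EFin \o (fun x => a * f x + b * g x)).
Proof.
move=> i1 i2; have := integrableD mD (integrableZl mD a i1) (integrableZl mD b i2).
by apply: eq_integrable => // x _ /=; rewrite EFinD !EFinM.
Qed.

Lemma Rintegral_lin f g (a b : R) :
  m.-integrable D (EFin \o f) -> m.-integrable D (EFin \o g) ->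
  \int[m]_(x in D) (a * f x + b * g x) =
  a * \int[m]_(x in D) f x + b * \int[m]_(x in D) g x.
Proof.
move=> i1 i2.
have i1' : m.-integrable D (EFin \o (fun x => a * f x)).
  by have := integrableZl mD a i1; apply: eq_integrable => // x _ /=; rewrite EFinM.
have i2' : m.-integrable D (EFin \o (fun x => b * g x)).
  by have := integrableZl mD b i2; apply: eq_integrable => // x _ /=; rewrite EFinM.
by rewrite RintegralD // !RintegralZl.
Qed.

Lemma sq_integrable f g : sq f -> sq g -> m.-integrable D (EFin \o (fun x => f x * g x)).
Proof.
move=> [mf if2] [mg ig2]; apply: (@integrable_bound _ (fun x => 1 * f x ^+ 2 + 1 * g x ^+ 2)).
- exact: measurable_funM.
- exact: integrable_lin.
move=> x _; rewrite !mul1r ler_norml.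
have := sqr_ge0 (f x + g x); have := sqr_ge0 (f x - g x).
have := sqr_ge0 (f x); have := sqr_ge0 (g x).
by rewrite !expr2 => *; apply/andP; split; nra.
Qed.

Lemma sq_lin f g a b : sq f -> sq g -> sq (fun x => a * f x + b * g x).
Proof.
move=> sf sg; have [mf if2] := sf; have [mg ig2] := sg; split.
  by apply: measurable_funD; apply: measurable_funM => //; exact: measurable_cst.
have ifg := sq_integrable sf sg.
have := integrable_lin 1 1 (integrable_lin (a ^+ 2) (b ^+ 2) if2 ig2)
  (integrable_lin (2 * a * b) 0 ifg ifg).
by apply: eq_integrable => // x _ /=; congr (_%:E); ring.
Qed.

Lemma sq_eq f g : (forall x, D x -> f x = g x) -> sq f -> sq g.
Proof.
move=> fg [mf i2]; split.
  by apply: eq_measurable_fun mf => x; rewrite inE; exact: fg.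
by apply: eq_integrable i2 => // x; rewrite inE => /fg ->.
Qed.

Lemma sqZ f a : sq f -> sq (fun x => a * f x).
Proof.
by move=> sf; apply: sq_eq (sq_lin a 0 sf sf) => x _; rewrite mul0r addr0.
Qed.

Lemma sqB f g : sq f -> sq g -> sq (fun x => f x - g x).
Proof. by move=> sf sg; apply: sq_eq (sq_lin 1 (-1) sf sg) => x _; rewrite mul1r mulN1r. Qed.

Lemma sq_bound f g (M : R) : measurable_fun D f -> sq g ->
  (forall x, D x -> `|f x| <= M * `|g x|) -> sq f.
Proof.
move=> mf [mg ig2] fg; split=> //.
have := @integrable_bound (fun x => f x ^+ 2) (fun x => M ^+ 2 * (g x ^+ 2) + 0 * (g x ^+ 2)).
apply.
- exact: measurable_funX.
- exact: integrable_lin.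
move=> x Dx; rewrite mul0r addr0 ger0_norm ?sqr_ge0 // -(real_normK (num_real (f x))).
rewrite -(real_normK (num_real (g x))) -exprMn.
by rewrite lerXn2r ?nnegrE // ?(le_trans _ (fg x Dx)) // fg.
Qed.

Lemma ipC f g : ip f g = ip g f.
Proof. by apply: eq_Rintegral => x _; rewrite mulrC. Qed.

Lemma ip_eq f f' g g' : (forall x, D x -> f x = f' x) -> (forall x, D x -> g x = g' x) ->
  ip f g = ip f' g'.
Proof. by move=> ef eg; apply: eq_Rintegral => x; rewrite inE => Dx; rewrite ef // eg. Qed.

Lemma ip_lin f g k a b : sq f -> sq g -> sq k ->
  ip (fun x => a * f x + b * g x) k = a * ip f k + b * ip g k.
Proof.
move=> sf sg sk; rewrite /ip -Rintegral_lin; [|exact: sq_integrable|exact: sq_integrable].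
by apply: eq_Rintegral => x _; ring.
Qed.

Lemma ipB f g k : sq f -> sq g -> sq k -> ip (fun x => f x - g x) k = ip f k - ip g k.
Proof.
move=> sf sg sk; rewrite -[ip f k]mul1r -mulN1r -ip_lin //.
by apply: ip_eq => // x _; rewrite !mul1r mulN1r.
Qed.

Lemma ipZ f k a : sq f -> sq k -> ip (fun x => a * f x) k = a * ip f k.
Proof.
move=> sf sk; rewrite -[RHS]addr0 -[in RHS](mul0r (ip f k)) -ip_lin //.
by apply: ip_eq => // x _; rewrite mul0r addr0.
Qed.

Lemma ip_ge0 f : 0 <= ip f f.
Proof. by apply: Rintegral_ge0 => x _; rewrite -expr2 sqr_ge0. Qed.

Lemma ip_lin2 f g a b : sq f -> sq g ->
  ip (fun x => a * f x + b * g x) (fun x => a * f x + b * g x) =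
  a ^+ 2 * ip f f + 2 * a * b * ip f g + b ^+ 2 * ip g g.
Proof.
move=> sf sg; have sk := sq_lin a b sf sg.
rewrite ip_lin // (ipC f) (ipC g) !ip_lin // (ipC g f).
by ring.
Qed.

Lemma ipDx2_le f g : sq f -> sq g ->
  ip (fun x => f x + g x) (fun x => f x + g x) <= 2 * ip f f + 2 * ip g g.
Proof.
move=> sf sg; have e1 := ip_lin2 1 1 sf sg; have e2 := ip_lin2 1 (-1) sf sg.
have p2 := ip_ge0 (fun x => 1 * f x + -1 * g x); rewrite e2 in p2.
rewrite (@ip_eq _ (fun x => 1 * f x + 1 * g x) _ (fun x => 1 * f x + 1 * g x)).
- by rewrite e1; lra.
- by move=> x _; ring.
- by move=> x _; ring.
Qed.

(** The discriminant of a nonnegative quadratic polynomial. Abstract coefficients let it serve for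
    forms such as [QQ - mu * NN], which are nonnegative on a subspace only. *)
Lemma cauchy_schwarz_form (A B C : R) :
  (forall t : R, 0 <= A + 2 * t * B + t ^+ 2 * C) -> 0 <= C -> B ^+ 2 <= A * C.
Proof.
move=> pos; rewrite le_eqVlt => /predU1P[C0|C0].
  rewrite -C0 mulr0; have [->|B0] := eqVneq B 0; first by rewrite expr0n.
  exfalso; have := pos (- (A + 1) / (2 * B)); rewrite -C0 mulr0 addr0.
  have -> : A + 2 * (- (A + 1) / (2 * B)) * B = - 1 by field.
  by lra.
have := pos (- B / C).
have -> : A + 2 * (- B / C) * B + (- B / C) ^+ 2 * C = (A * C - B ^+ 2) / C.
  by field; rewrite gt_eqF.
by rewrite pmulr_lge0 ?invr_gt0 // subr_ge0.
Qed.

Lemma ip_cauchy_schwarz f g : sq f -> sq g -> ip f g ^+ 2 <= ip f f * ip g g.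
Proof.
move=> sf sg; apply: cauchy_schwarz_form; last exact: ip_ge0.
move=> t; have := ip_lin2 1 t sf sg; have := ip_ge0 (fun x => 1 * f x + t * g x).
by move=> + e; rewrite e; lra.
Qed.

Lemma ip_eq0 f : sq f -> ip f f = 0 -> {ae m, forall x, D x -> f x = 0}.
Proof.
move=> sf; have [mf i2] := sf; rewrite /ip /Rintegral => e.
have fn : (\int[m]_(x in D) (f x * f x)%:E)%E \is a fin_num.
  by apply: integrable_fin_num => //; exact: sq_integrable.
have e0 : (\int[m]_(x in D) `|(f x * f x)%:E| = 0)%E.
  rewrite -[RHS](_ : (fine (\int[m]_(x in D) (f x * f x)%:E))%:E = 0%E)%E; last by rewrite e.
  rewrite fineK //; apply: eq_integral => x _ /=.
  by rewrite ger0_norm // -expr2 sqr_ge0.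
have mff : measurable_fun D (fun x => (f x * f x)%:E).
  by apply/measurable_EFinP; exact: measurable_funM.
have := (ae_eq_integral_abs m mD mff).1 e0.
apply: filterS => x h Dx; have := h Dx => -[] /eqP.
by rewrite mulf_eq0 orbb => /eqP.
Qed.

(** * Completeness of L2 with pointwise antisymmetry *)

Section Completeness.
Variable f : (T -> R)^nat.
Hypothesis sf : forall n, sq (f n).
Hypothesis cauchy : forall e, 0 < e -> exists N, forall i j, (N <= i)%N -> (N <= j)%N ->
  ip (fun x => f i x - f j x) (fun x => f i x - f j x) <= e.

(** Riesz-Fischer: a fast subsequence converges pointwise off a null set, and Fatou's lemma gives
    mean-square convergence of the whole sequence. The limit is an explicit pointwise limit, set to
    0 where the series [G] is infinite, so antisymmetry between two points passes to it everywhere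
    and not just almost everywhere. *)
Lemma square_integrable_complete : exists u : T -> R, [/\ sq u,
  (forall e, 0 < e -> exists N, forall n, (N <= n)%N ->
    ip (fun x => f n x - u x) (fun x => f n x - u x) <= e) &
  (forall x y, D x -> D y -> (forall n, f n x = - f n y) -> u x = - u y)].
Proof.
(* Chosen so that the squared increments, weighted by [2 ^+ n] in [G], have integrals at most
   [1 / 2 ^ n.+1], a summable sequence. *)
pose ee n : R := 1 / (2 ^+ n * (2 ^ n.+1)%:R).
have e4 n : 0 < ee n.
  by rewrite divr_gt0 // mulr_gt0 ?exprn_gt0 // ltr0n expn_gt0.
have [N HN] := choice (fun n => cauchy (e4 n)).
(* A sum in place of a maximum: [psi n] bounds every [N j] with [j <= n]. *)
pose psi n := (n + \sum_(j < n.+1) N j)%N.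
have leq_psi n : (n <= psi n)%N by exact: leq_addr.
have Npsi (n j : nat) : (j <= n)%N -> (N j <= psi n)%N.
  move=> jn; rewrite /psi (bigD1 (Ordinal (jn : (j < n.+1)%N))) //= addnCA.
  exact: leq_addr.
pose dd n x := f (psi n.+1) x - f (psi n) x.
have sd n : sq (dd n) by exact: sqB.
have dn n : ip (dd n) (dd n) <= ee n by apply: HN; apply: Npsi.
pose g n x : \bar R := (2 ^+ n * dd n x ^+ 2)%:E.
have g0 n x : (0 <= g n x)%E by rewrite lee_fin mulr_ge0 ?sqr_ge0 // exprn_ge0.
have mg n : measurable_fun D (g n).
  apply/measurable_EFinP; apply: measurable_funM; first exact: measurable_cst.
  by apply: measurable_funX; have [] := sd n.
pose G x := (\sum_(n <oo) g n x)%E.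
have G0 x : (0 <= G x)%E by apply: nneseries_ge0 => n _ _; exact: g0.
have mG : measurable_fun D G.
  by apply: ge0_emeasurable_sum => // n x _ _; exact: g0.
have ltG : (\int[m]_(x in D) G x < +oo)%E.
  rewrite integral_nneseries //.
  apply: (@le_lt_trans _ _ (\sum_(n <oo) (1 / (2 ^ (n + 1))%:R)%:E)%E).
    apply: lee_nneseries => n; first by move=> _ _; apply: integral_ge0 => x _; exact: g0.
    move=> _.
    have [md i2] := sd n.
    under eq_integral do rewrite /g EFinM.
    rewrite ge0_integralZl //; last 2 first.
    + by apply/measurable_EFinP; exact: measurable_funX.
    + by move=> x _; rewrite lee_fin sqr_ge0.
    have := dn n; rewrite /ip /Rintegral.
    under eq_integral do rewrite -expr2.
    rewrite -lee_fin fineK; last exact: integrable_fin_num.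
    have p2 : (0 <= (2 ^+ n : R)%:E)%E by rewrite lee_fin exprn_ge0.
    move=> /(lee_wpmul2l p2) h; apply: le_trans h _.
    by rewrite -EFinM lee_fin /ee !div1r invfM mulrA divff ?expf_neq0 // mul1r addn1.
  have := @cvg_geometric_eseries_half R 1 0; rewrite /eseries.
  by move=> /cvg_lim -> //; rewrite ltry.
have iG : m.-integrable D G.
  apply/integrableP; split => //; rewrite (eq_integral G) // => x _.
  by rewrite gee0_abs.
pose E := D `&` G @^-1` (~` [set +oo%E]).
have mE : measurable E by apply: mG => //; apply: measurableC; exact: emeasurable_set1.
have ED : E `<=` D by move=> x [].
have DE0 : m (D `\` E) = 0%E.
  have [Z [mZ Z0 sZ]] := integrable_ae mD iG.
  apply/eqP; rewrite eq_le measure_ge0 andbT -Z0; apply: le_measure; rewrite ?inE //.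
    exact: measurableD.
  move=> x [Dx nEx]; apply: sZ => /= h; apply: nEx; split => //= e.
  by have := h Dx; rewrite e.
have geo n : \sum_(0 <= j < n) (1 / 2 ^+ j : R) <= 2.
  have -> : \sum_(0 <= j < n) (1 / 2 ^+ j : R) = 2 - 2 / 2 ^+ n.
    elim: n => [|n IH]; first by rewrite big_nil expr0 divr1 subrr.
    by rewrite big_nat_recr //= IH exprS; field; rewrite expf_neq0.
  by rewrite gerBl divr_ge0 // exprn_ge0.
have cvgE x : E x -> cvgn (fun n => f (psi n) x).
  move=> [Dx /= Gx].
  have Gf : G x \is a fin_num by rewrite ge0_fin_numE // ltey; apply/eqP.
  have : cvgn (series (fun n => dd n x)).
    apply: normed_cvg; apply: nondecreasing_is_cvgn.
      by apply: nondecreasing_series => n _ _; exact: normr_ge0.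
    exists (fine (G x) + 2) => _ [n _ <-]; rewrite /series /=.
    (* By [|b| <= 2 ^+ j * b ^+ 2 + 1 / 2 ^+ j], the increments are absolutely summable wherever [G]
       is finite. *)
    apply: (@le_trans _ _ (\sum_(0 <= j < n) (2 ^+ j * dd j x ^+ 2 + 1 / 2 ^+ j))).
      apply: ler_sum => j _; rewrite ler_norml.
      set b := dd j x; have a0 : 0 < 2 ^+ j :> R by rewrite exprn_gt0.
      have -> : 2 ^+ j * b ^+ 2 + 1 / 2 ^+ j = (b ^+ 2 * (2 ^+ j) ^+ 2 + 1) / 2 ^+ j.
        by field; rewrite expf_neq0.
      rewrite lerNl !ler_pdivlMr //.
      have h1 := sqr_ge0 (b * 2 ^+ j + 1); have h2 := sqr_ge0 (b * 2 ^+ j - 1).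
      have h3 := sqr_ge0 (b * 2 ^+ j).
      by rewrite -exprMn; apply/andP; split; nra.
    rewrite big_split /= lerD // -lee_fin fineK // -sumEFin.
    by apply: nneseries_lim_ge => j _ _; exact: g0.
  move=> cs; have -> : (fun n => f (psi n) x) = (fun n => f (psi 0) x + series (fun n => dd n x) n).
    apply/funext => n; rewrite /series /= telescope_sumr // addrC subrK //.
  by apply: is_cvgD => //; exact: is_cvg_cst.
pose u := (fun x => limn (fun n => f (psi n) x)) \_ E.
have uE x : E x -> (fun n => f (psi n) x) @ \oo --> u x.
  by move=> Ex; rewrite /u patchE mem_set //; exact: cvgE.
have mu : measurable_fun D u.
  apply/measurable_EFinP.
  apply: (@emeasurable_fun_cvg _ _ _ _ (fun n x => ((f (psi n) \_ E) x)%:E)).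
    move=> n; apply/measurable_EFinP; apply/(measurable_restrict _ mE) => //.
    by apply: measurable_funS (sf (psi n)).1.
  move=> x Dx; apply: cvg_EFin; first by apply: nearW.
  have [Ex|nEx] := pselect (E x).
    have := uE x Ex; apply: cvg_trans; apply: near_eq_cvg; apply: nearW => n /=.
    by rewrite patchE mem_set.
  rewrite /u patchE memNset //=.
  rewrite (_ : fine \o _ = (fun=> point)); first exact: cvg_cst.
  by apply/funext => n /=; rewrite patchE memNset.
(* Fatou's lemma in the index of the subsequence, with [n] fixed, turns the Cauchy bound into a
   bound on the distance to the limit. *)
have fatou_bound (n : nat) (e : R) (k0 : nat) : (forall j, (k0 <= j)%N ->
    ip (fun x => f n x - f (psi j) x) (fun x => f n x - f (psi j) x) <= e) ->
  (\int[m]_(x in D) ((f n x - u x) ^+ 2)%:E <= e%:E)%E.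
  move=> He.
  have mfu : measurable_fun D (fun x => ((f n x - u x) ^+ 2)%:E).
    apply/measurable_EFinP; apply: measurable_funX; apply: measurable_funB => //.
    exact: (sf n).1.
  have mF j : measurable_fun D (fun x => ((f n x - f (psi j) x) ^+ 2)%:E).
    apply/measurable_EFinP; apply: measurable_funX; apply: measurable_funB => //.
      exact: (sf n).1.
    exact: (sf (psi j)).1.
  rewrite (@ge0_negligible_integral _ _ _ m D (D `\` E)) //; last 2 first.
  - exact: measurableD.
  - by move=> x _; rewrite lee_fin sqr_ge0.
  have -> : D `\` (D `\` E) = E by rewrite setDD; apply/setIidPr.
  pose F j x := ((f n x - f (psi j) x) ^+ 2)%:E.
  apply: (@le_trans _ _ (\int[m]_(x in E) limn_einf (F ^~ x))%E).
    rewrite le_eqVlt; apply/orP; left; apply/eqP.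
    apply: eq_integral => x; rewrite inE => Ex.
    have : (F ^~ x) @ \oo --> ((f n x - u x) ^+ 2)%:E.
      apply: cvg_EFin; first by apply: nearW.
      have c1 : (fun j => f n x - f (psi j) x) @ \oo --> f n x - u x.
        by apply: cvgB; [exact: cvg_cst|exact: uE].
      rewrite expr2 (_ : fine \o _ = (fun j => (f n x - f (psi j) x) * (f n x - f (psi j) x))).
        exact: cvgM.
      by apply/funext => j /=; rewrite expr2.
    by move=> /cvg_limn_einf_sup[->].
  apply: le_trans (fatou m mE _ _) _.
  - by move=> j; apply: measurable_funS (mF j).
  - by move=> j x _; rewrite lee_fin sqr_ge0.
  rewrite limn_einf_lim; apply: lime_le; first exact: is_cvg_einfs.
  apply: nearW => k1 /=.
  apply: (@le_trans _ _ (\int[m]_(x in E) F (maxn k0 k1) x)%E).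
    by apply: ereal_inf_lbound; exists (maxn k0 k1) => //=; exact: leq_maxr.
  apply: (@le_trans _ _ (\int[m]_(x in D) F (maxn k0 k1) x)%E).
    apply: ge0_subset_integral => //; first exact: mF.
    by move=> x _; rewrite lee_fin sqr_ge0.
  have := He _ (leq_maxl k0 k1); rewrite -lee_fin /ip /Rintegral fineK; last first.
    by apply: integrable_fin_num => //; apply: sq_integrable; exact: sqB.
  by under eq_integral do rewrite -expr2.
have cau e : 0 < e -> exists N0, forall n, (N0 <= n)%N ->
    (\int[m]_(x in D) ((f n x - u x) ^+ 2)%:E <= e%:E)%E.
  move=> e0; have [N0 HN0] := cauchy e0.
  exists N0 => n nN; apply: (fatou_bound n e N0) => j jN; apply: HN0 => //.
  exact: leq_trans (leq_psi j).
have sfu n : (exists e : R, (\int[m]_(x in D) ((f n x - u x) ^+ 2)%:E <= e%:E)%E) ->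
    sq (fun x => f n x - u x).
  move=> [e He]; have mfu : measurable_fun D (fun x => f n x - u x).
    by apply: measurable_funB => //; exact: (sf n).1.
  split => //; apply/integrableP; split.
    by apply/measurable_EFinP; exact: measurable_funX.
  apply: le_lt_trans (_ : _ <= e%:E)%E _; last exact: ltry.
  apply: le_trans He; rewrite le_eqVlt; apply/orP; left; apply/eqP.
  by apply: eq_integral => x _; rewrite /= ger0_norm // sqr_ge0.
have [N1 HN1] := cau 1 ltr01.
have su : sq u.
  have := sqB (sf N1) (sfu N1 (ex_intro _ 1 (HN1 _ (leqnn _)))).
  by apply: sq_eq => x _; rewrite opprB addrC subrK.
exists u; split => //.
  move=> e e0; have [N0 HN0] := cau e e0; exists N0 => n nN.
  have := HN0 n nN; rewrite -lee_fin /ip /Rintegral fineK; last first.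
    by apply: integrable_fin_num => //; apply: sq_integrable; exact: sqB.
  by under eq_integral do rewrite expr2.
move=> x y Dx Dy fxy.
(* [G] only involves squares of increments, so [x] and [y] lie both in [E] or both outside. *)
have Gxy : G x = G y.
  rewrite /G; apply: eq_eseriesr => n _; rewrite /g /dd !fxy.
  by congr (_%:E); ring.
have Exy : (x \in E) = (y \in E).
  by apply/idP/idP; rewrite !inE => -[_ /= h]; split => //=; rewrite ?Gxy // -Gxy.
rewrite /u !patchE Exy; case: ifPn; last by rewrite oppr0.
rewrite inE => Ey; rewrite (_ : (fun n => f (psi n) x) = (fun n => - f (psi n) y)).
  by apply: limN; exact: cvgE.
by apply/funext => n; exact: fxy.
Qed.

End Completeness.

End SquareIntegrable.

Section L2Plane.
Context {R : realType}.
Local Notation leb2 := (@lebesgue2 R).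
Implicit Types (D : set (R * R)) (u : R * R -> R).

Lemma L2P D u : measurable (D : set (measurableTypeR R * measurableTypeR R)) ->
  L2 D u <-> sq leb2 D u.
Proof.
move=> mD; rewrite /L2 /sq; split => [h|[mu i2]].
  have i2 := Lfun2_integrable_sqr h.
  have mu : measurable_fun setT ((u : measurableTypeR R * measurableTypeR R -> R) \_ D).
    by move: h; rewrite inE => /andP[]; rewrite inE.
  split; first by apply/(measurable_restrictT _ _).2.
  apply/(integrable_mkcond _ mD); apply: eq_integrable i2 => // x _ /=.
  by rewrite !patchE; case: ifP => // _; rewrite expr2 mulr0.
have mu' : measurable_fun setT ((u : measurableTypeR R * measurableTypeR R -> R) \_ D).
  by apply/(measurable_restrictT _ _).1.
rewrite inE; apply/andP; split; first by rewrite inE.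
rewrite inE /= /finite_norm unlock /= poweR_lty //.
move/(integrable_mkcond _ mD) : i2 => /integrableP[_]; apply: le_lt_trans.
rewrite le_eqVlt; apply/orP; left; apply/eqP; apply: eq_integral => x _ /=.
rewrite !patchE; case: ifP => _; last first.
  by rewrite (_ : point = 0 :> R) // (_ : point = 0%E :> \bar R) // normr0 abse0 powR0.
by rewrite gee0_abs ?lee_fin ?sqr_ge0 // powR_mulrn // real_normK ?num_real.
Qed.

End L2Plane.

(** * Integrals on rectangles *)

Section LineIntegral.
Context {R : realType}.
Local Notation mR := (measurableTypeR R).
Local Notation leb := (@lebesgue_measure R).
Implicit Types (a b c d x y : R) (g h : R -> R).

(** Half-open, so that cutting at an intermediate point leaves disjoint intervals; the endpoints do
    not affect the integrals. *)
Definition Io a b : set mR := `]a, b]%classic.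

Lemma measurable_Io a b : measurable (Io a b).
Proof. exact: measurable_itv. Qed.

Lemma Io_measure a b : a <= b -> fine (leb (Io a b)) = b - a.
Proof.
move=> ab; rewrite (_ : leb (Io a b) = (b - a)%:E) //.
apply: etrans (lebesgue_measure_itv _) _; rewrite /= lte_fin.
by case: ltgtP ab => // -> _; rewrite subrr.
Qed.

Lemma cont_integrable a b g : continuous g -> leb.-integrable (Io a b) (EFin \o g).
Proof.
move=> cg; have := @continuous_compact_integrable R g `[a, b]%classic (@segment_compact _ a b)
  (cont_within cg).
apply: integrableS; [exact: measurable_itv|exact: measurable_Io|].
by move=> x; rewrite /Io /= !in_itv /= => /andP[/ltW-> ->].
Qed.

Lemma Rintegral_der a b g h : a <= b -> continuous g -> continuous h ->
  (forall s, a < s < b -> is_derive s 1 g (h s)) ->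
  \int[leb]_(s in Io a b) h s = g b - g a.
Proof.
rewrite le_eqVlt => /predU1P[-> _ _ _|ab cg ch dg].
  rewrite /Io set_itv_ge ?Rintegral_set0 ?subrr //.
  by rewrite bnd_simp ltxx.
rewrite /Io Rintegral_itv_obnd_cbnd; last exact: cont_integrable.
by rewrite /Rintegral FTC_cc.
Qed.

Lemma Rintegral_Io_cst a b (u : R) : a <= b -> \int[leb]_(s in Io a b) u = u * (b - a).
Proof. by move=> ab; rewrite Rintegral_cst ?Io_measure //; exact: measurable_Io. Qed.

Lemma Rintegral_Io_lin a b g h (u v : R) : continuous g -> continuous h ->
  \int[leb]_(s in Io a b) (u * g s + v * h s) =
  u * \int[leb]_(s in Io a b) g s + v * \int[leb]_(s in Io a b) h s.
Proof.
by move=> cg ch; apply: Rintegral_lin; [exact: measurable_Io| |]; exact: cont_integrable.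
Qed.

Lemma Rintegral_Io_le a b g h : continuous g -> continuous h ->
  (forall s, a < s < b -> g s <= h s) ->
  \int[leb]_(s in Io a b) g s <= \int[leb]_(s in Io a b) h s.
Proof.
move=> cg ch gh.
have oo u : continuous u -> leb.-integrable `]a, b[%classic (EFin \o u).
  move=> cu; apply: integrableS (cont_integrable a b cu); [exact: measurable_Io|
    exact: measurable_itv|].
  by move=> x; rewrite /Io /= !in_itv /= => /andP[-> /ltW->].
rewrite /Io -!Rintegral_itv_bndo_bndc; [|exact: oo|exact: oo].
apply: le_Rintegral; [exact: measurable_itv|exact: oo|exact: oo|].
by move=> x; rewrite /= in_itv /=; exact: gh.
Qed.

Lemma Rintegral_Io_le_cst a b g (K : R) : a <= b -> continuous g ->
  (forall s, a < s < b -> g s <= K) -> \int[leb]_(s in Io a b) g s <= K * (b - a).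
Proof.
move=> ab cg gK; rewrite -Rintegral_Io_cst //.
exact: (@Rintegral_Io_le a b g (fun=> K) cg (@cont_cst R R K) gK).
Qed.

Lemma cont_sq a b g : continuous g -> sq leb (Io a b) g.
Proof.
move=> cg; split; first by apply: measurable_funTS; exact: continuous_measurable_fun.
by apply: cont_integrable; cts.
Qed.

Lemma line_cauchy_schwarz a b g : a <= b -> continuous g ->
  (\int[leb]_(s in Io a b) g s) ^+ 2 <= (b - a) * \int[leb]_(s in Io a b) (g s ^+ 2).
Proof.
move=> ab cg.
have := ip_cauchy_schwarz (measurable_Io a b) (cont_sq a b cg) (cont_sq a b (@cont_cst R R 1)).
have -> : ip leb (Io a b) g (fun=> 1) = \int[leb]_(s in Io a b) g s.
  by apply: eq_Rintegral => s _; rewrite mulr1.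
have -> : ip leb (Io a b) g g = \int[leb]_(s in Io a b) (g s ^+ 2).
  by apply: eq_Rintegral => s _; rewrite expr2.
by rewrite /ip Rintegral_Io_cst // !mul1r mulrC.
Qed.

(** The fundamental theorem of calculus and Cauchy-Schwarz; integrating over the whole interval
    makes the bound uniform in [x] and [y]. *)
Lemma osc_der a b x y g h : continuous g -> continuous h ->
  (forall s, a < s < b -> is_derive s 1 g (h s)) -> a <= x <= b -> a <= y <= b ->
  (g x - g y) ^+ 2 <= (b - a) * \int[leb]_(s in Io a b) (h s ^+ 2).
Proof.
move=> cg ch dg; wlog xy : x y / y <= x => [H|] xab yab.
  have [yx|/ltW xy] := leP y x; first exact: H.
  by rewrite -sqrrN opprB; exact: H.
have /andP[ax xb] := xab; have /andP[ay yb] := yab.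
have dg' s : y < s < x -> is_derive s 1 g (h s).
  by move=> /andP[s1 s2]; apply: dg; apply/andP; split; lra.
have e := Rintegral_der xy cg ch dg'; rewrite -e.
apply: le_trans (line_cauchy_schwarz xy ch) _.
have sub : \int[leb]_(s in Io y x) (h s ^+ 2) <= \int[leb]_(s in Io a b) (h s ^+ 2).
  have ch2 : continuous (fun s => h s ^+ 2) by cts.
  apply: fine_le.
  - by apply: integrable_fin_num; [exact: measurable_Io|exact: cont_integrable ch2].
  - by apply: integrable_fin_num; [exact: measurable_Io|exact: cont_integrable ch2].
  apply: ge0_subset_integral; [exact: measurable_Io|exact: measurable_Io| | |].
  - by apply/measurable_EFinP; apply: measurable_funTS; exact: continuous_measurable_fun.
  - by move=> s _; rewrite lee_fin sqr_ge0.
  - by move=> s; rewrite /Io /= !in_itv /= => /andP[s1 s2]; apply/andP; split; lra.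
apply: ler_pM => //; [lra| |lra].
by apply: Rintegral_ge0 => s _; rewrite sqr_ge0.
Qed.

(** The integral of the square splits into the mean term and the variance, and a deviation from the
    mean is an average of differences [g x - g y]. *)
Lemma variance_le a b g (K : R) : a < b -> continuous g ->
  (forall x y, a <= x <= b -> a <= y <= b -> (g x - g y) ^+ 2 <= K) ->
  \int[leb]_(s in Io a b) (g s ^+ 2) <=
  (\int[leb]_(s in Io a b) g s) ^+ 2 / (b - a) + (b - a) * K.
Proof.
move=> ab cg gK; have ba : 0 < b - a by rewrite subr_gt0.
set G := \int[leb]_(s in Io a b) g s.
pose mm := G / (b - a).
have K0 : 0 <= K by apply: le_trans (gK a a _ _); rewrite ?subrr ?expr0n // lexx ltW.
have dev x : a <= x <= b -> (g x - mm) ^+ 2 <= K.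
  move=> xab.
  have e : (b - a) * (g x - mm) = \int[leb]_(s in Io a b) (g x * 1 + (-1) * g s).
    rewrite Rintegral_Io_lin //; last exact: cont_cst.
    rewrite (Rintegral_Io_cst _ (ltW ab)) -/G /mm.
    by field; rewrite gt_eqF.
  have := line_cauchy_schwarz (ltW ab) (_ : continuous (fun s => g x * 1 + (-1) * g s)).
  rewrite -e => /(_ ltac:(by cts)) h.
  have h2 : \int[leb]_(s in Io a b) ((g x * 1 + -1 * g s) ^+ 2) <= K * (b - a).
    apply: Rintegral_Io_le_cst; [exact: ltW|by cts|].
    move=> s /andP[s1 s2]; rewrite mulr1 mulN1r; apply: gK => //.
    by apply/andP; split; lra.
  have h3 : ((b - a) * (g x - mm)) ^+ 2 <= (b - a) * (K * (b - a)).
    by apply: le_trans h _; rewrite ler_pM2l.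
  rewrite exprMn in h3.
  have b2 : 0 < (b - a) ^+ 2 by rewrite exprn_gt0.
  rewrite -(ler_pM2l b2) (le_trans h3) // le_eqVlt; apply/orP; left; apply/eqP.
  by rewrite expr2; ring.
have e : \int[leb]_(s in Io a b) (g s ^+ 2) =
    \int[leb]_(s in Io a b) (1 * (g s - mm) ^+ 2 + 1 * ((2 * mm) * g s + (- mm ^+ 2) * 1)).
  by apply: eq_Rintegral => s _; ring.
rewrite e Rintegral_Io_lin; [|by cts|by cts].
rewrite Rintegral_Io_lin //; last exact: cont_cst.
rewrite (Rintegral_Io_cst _ (ltW ab)) -/G.
have : \int[leb]_(s in Io a b) ((g s - mm) ^+ 2) <= K * (b - a).
  apply: Rintegral_Io_le_cst; [exact: ltW|by cts|].
  by move=> s /andP[s1 s2]; apply: dev; apply/andP; split; lra.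
have -> : G ^+ 2 / (b - a) = 2 * mm * G + - mm ^+ 2 * (1 * (b - a)).
  by rewrite /mm; field; rewrite gt_eqF.
by rewrite !mul1r => h; rewrite addrC lerD2l mulrC; exact: h.
Qed.

End LineIntegral.

(** * Double integrals and Poincare inequalities on cells *)

Section RectangleIntegral.
Context {R : realType}.
Local Notation mR := (measurableTypeR R).
Local Notation leb := (@lebesgue_measure R).
Local Notation leb2 := (@lebesgue2 R).
Implicit Types (a b c d x y : R) (F G : R * R -> R).

Definition Rc a b c d : set (plane R) := Io a b `*` Io c d.
Definition RI a b c d F := \int[leb2]_(z in Rc a b c d) F z.

Lemma measurable_Rc a b c d : measurable (Rc a b c d).
Proof. by apply: measurableX; exact: measurable_Io. Qed.

Lemma RcE a b c d (z : R * R) : Rc a b c d z <-> a < z.1 <= b /\ c < z.2 <= d.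
Proof. by rewrite /Rc /Io /= !in_itv. Qed.

Lemma cont_bounded (A : set (R * R)) F : compact A -> continuous F ->
  exists2 M, 0 < M & forall z, A z -> `|F z| <= M.
Proof.
move=> cA cF; have := compact_bounded (continuous_compact (cont_within cF) cA).
move=> [M [_ HM]]; exists (`|M| + 1); first by rewrite ltr_wpDl.
move=> z Az; apply: HM; last by exists z.
by rewrite (le_lt_trans (ler_norm M)) // ltrDl.
Qed.

Lemma compact_box a b c d : compact (`[a, b] `*` `[c, d] : set (R * R)).
Proof. by apply: compact_setX; exact: segment_compact. Qed.

Lemma Rc_fin a b c d : (leb2 (Rc a b c d) < +oo)%E.
Proof.
have -> : leb2 (Rc a b c d) = (leb (Io a b) * leb (Io c d))%E.
  by apply: product_measure1E; exact: measurable_Io.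
rewrite lte_mul_pinfty //.
  apply/fin_numPlt; rewrite (lt_le_trans _ (measure_ge0 _ _)) ?ltNye //=.
  by apply: le_lt_trans (_ : _ <= leb `[a, b]%classic)%E _; [apply: le_measure; rewrite ?inE;
    [exact: measurable_Io|exact: measurable_itv|
     by move=> x; rewrite /Io /= !in_itv /= => /andP[/ltW-> ->]]|
    exact: (compact_finite_measure (@segment_compact R a b))].
by apply: le_lt_trans (_ : _ <= leb `[c, d]%classic)%E _; [apply: le_measure; rewrite ?inE;
    [exact: measurable_Io|exact: measurable_itv|
     by move=> x; rewrite /Io /= !in_itv /= => /andP[/ltW-> ->]]|
    exact: (compact_finite_measure (@segment_compact R c d))].
Qed.

Lemma RI_integrable a b c d F : continuous F -> leb2.-integrable (Rc a b c d) (EFin \o F).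
Proof.
move=> cF; apply: measurable_bounded_integrable.
- exact: measurable_Rc.
- exact: Rc_fin.
- by apply: measurable_funTS; exact: cont_measurable.
have [M _ HM] := cont_bounded (@compact_box a b c d) cF.
exists M; split; first exact: num_real.
move=> u Mu z /RcE[/andP[z1 z2] /andP[z3 z4]].
apply: le_trans (HM z _) (ltW Mu).
by split; rewrite /= in_itv /= ?z2 ?z4 ltW.
Qed.

Lemma RI_lin a b c d F G (u v : R) : continuous F -> continuous G ->
  RI a b c d (fun z => u * F z + v * G z) = u * RI a b c d F + v * RI a b c d G.
Proof.
by move=> cF cG; apply: Rintegral_lin; [exact: measurable_Rc| |]; exact: RI_integrable.
Qed.

Lemma RI_le a b c d F G : continuous F -> continuous G ->
  (forall z, a < z.1 <= b -> c < z.2 <= d -> F z <= G z) -> RI a b c d F <= RI a b c d G.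
Proof.
move=> cF cG FG; apply: le_Rintegral; [exact: measurable_Rc|exact: RI_integrable|
  exact: RI_integrable|].
by move=> z /RcE[]; exact: FG.
Qed.

Lemma RI_eq a b c d F G : (forall z, a < z.1 <= b -> c < z.2 <= d -> F z = G z) ->
  RI a b c d F = RI a b c d G.
Proof. by move=> FG; apply: eq_Rintegral => z; rewrite inE => /RcE[]; exact: FG. Qed.

Lemma RI_ge0 a b c d F : (forall z, 0 <= F z) -> 0 <= RI a b c d F.
Proof. by move=> F0; apply: Rintegral_ge0. Qed.

Lemma cont_row F s : continuous F -> continuous (fun r => F (s, r)).
Proof. move=> cF; have cp : continuous (fun r : R => (s, r)) by cts. exact: (cont_comp cF cp). Qed.

Lemma cont_col F r : continuous F -> continuous (fun s => F (s, r)).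
Proof. move=> cF; have cp : continuous (fun s : R => (s, r)) by cts. exact: (cont_comp cF cp). Qed.

Lemma RI_fubini1 a b c d F : continuous F ->
  RI a b c d F = \int[leb]_(s in Io a b) \int[leb]_(r in Io c d) F (s, r).
Proof.
move=> cF; pose f : plane R -> \bar R := (EFin \o F) \_ (Rc a b c d).
have intf : leb2.-integrable setT f.
  by apply/(integrable_mkcond _ (measurable_Rc a b c d)); exact: RI_integrable.
rewrite /RI /Rintegral; congr fine.
rewrite [LHS]integral_mkcond -/f /lebesgue2 -integral12_prod_meas1 // [RHS]integral_mkcond.
apply: eq_integral => s _; rewrite patchE; case: ifPn => hs.
  rewrite /= fineK; last first.
    have h := cont_integrable c d (@cont_row F s cF).
    exact: (integrable_fin_num (measurable_Io c d) h).
  rewrite [RHS]integral_mkcond; apply: eq_integral => r _; rewrite /f !patchE.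
  congr (if _ then _ else _); apply/idP/idP; rewrite !inE.
    by case.
  by move=> hr; split => //; move: hs; rewrite inE.
apply: integral0_eq => r _; rewrite /f patchE ifF //; apply/negbTE.
by move: hs; apply: contra; rewrite !inE => -[].
Qed.

Lemma RI_fubini2 a b c d F : continuous F ->
  RI a b c d F = \int[leb]_(r in Io c d) \int[leb]_(s in Io a b) F (s, r).
Proof.
move=> cF; pose f : plane R -> \bar R := (EFin \o F) \_ (Rc a b c d).
have intf : leb2.-integrable setT f.
  by apply/(integrable_mkcond _ (measurable_Rc a b c d)); exact: RI_integrable.
rewrite /RI /Rintegral; congr fine.
rewrite [LHS]integral_mkcond -/f /lebesgue2 -integral21_prod_meas1 // [RHS]integral_mkcond.
apply: eq_integral => r _; rewrite patchE; case: ifPn => hs.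
  rewrite /= fineK; last first.
    have h := cont_integrable a b (@cont_col F r cF).
    exact: (integrable_fin_num (measurable_Io a b) h).
  rewrite [RHS]integral_mkcond; apply: eq_integral => s _; rewrite /f !patchE.
  congr (if _ then _ else _); apply/idP/idP; rewrite !inE.
    by case.
  by move=> hr; split => //; move: hs; rewrite inE.
apply: integral0_eq => s _; rewrite /f patchE ifF //; apply/negbTE.
by move: hs; apply: contra; rewrite !inE => -[].
Qed.

Lemma slice_cont (c d : R) (H : R -> R -> R) : c <= d -> (continuous (fun z : R * R => H z.1 z.2)) ->
  continuous (fun s => \int[leb]_(r in Io c d) H s r).
Proof.
move=> cd cH s; apply/cvgrPdist_le => e e0.
have e1 : 0 < e / (d - c + 1) by rewrite divr_gt0 //; lra.
have cA : compact ([set s] `*` `[c, d] : set (R * R)).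
  by apply: compact_setX; [exact: compact_set1|exact: segment_compact].
have [dl dl0 Hd] := unif_cont_compact cA cH e1.
have cs t : continuous (H t).
  by apply: (cont_comp (f := fun z : R * R => H z.1 z.2) cH (g := fun r => (t, r))); cts.
suff : nbhs s (fun t => `|\int[leb]_(r in Io c d) H s r - \int[leb]_(r in Io c d) H t r| <= e) by [].
apply/nbhs_ballP; exists dl => // t st /=.
have -> : \int[leb]_(r in Io c d) H s r - \int[leb]_(r in Io c d) H t r =
    \int[leb]_(r in Io c d) (1 * H s r + (-1) * H t r).
  by rewrite Rintegral_Io_lin //; lra.
have cd' : continuous (fun r => 1 * H s r + (-1) * H t r).
  by have c1 := cs s; have c2 := cs t; cts.
apply: le_trans (le_normr_Rintegral (measurable_Io c d) (cont_integrable _ _ cd')) _.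
apply: le_trans (_ : _ <= e / (d - c + 1) * (d - c)) _.
  apply: Rintegral_Io_le_cst => //; first by cts.
  move=> r /andP[r1 r2]; rewrite mul1r mulN1r ltW //.
  apply: (Hd (s, r) (t, r)); first by split => //=; rewrite in_itv /= !ltW.
  by split => //=; exact: ballxx.
by rewrite mulrAC ler_pdivrMr; [apply: ler_wpM2l|]; lra.
Qed.

Lemma RI_slice_le1 a b c d F G : c <= d -> continuous F -> continuous G ->
  (forall s, a < s < b ->
    \int[leb]_(r in Io c d) F (s, r) <= \int[leb]_(r in Io c d) G (s, r)) ->
  RI a b c d F <= RI a b c d G.
Proof.
move=> cd cF cG FG; rewrite !RI_fubini1 //; apply: Rintegral_Io_le => //.
- by apply: (slice_cont (H := fun s r => F (s, r)) cd); apply: (cont_comp cF); cts.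
- by apply: (slice_cont (H := fun s r => G (s, r)) cd); apply: (cont_comp cG); cts.
Qed.

Lemma RI_slice_le2 a b c d F G : a <= b -> continuous F -> continuous G ->
  (forall r, c < r < d ->
    \int[leb]_(s in Io a b) F (s, r) <= \int[leb]_(s in Io a b) G (s, r)) ->
  RI a b c d F <= RI a b c d G.
Proof.
move=> ab cF cG FG; rewrite !RI_fubini2 //; apply: Rintegral_Io_le => //.
- by apply: (slice_cont (H := fun r s => F (s, r)) ab); apply: (cont_comp cF); cts.
- by apply: (slice_cont (H := fun r s => G (s, r)) ab); apply: (cont_comp cG); cts.
Qed.

Lemma RI_split1 a m b c d F : a <= m <= b -> continuous F ->
  RI a b c d F = RI a m c d F + RI m b c d F.
Proof.
move=> /andP[am mb] cF; rewrite /RI -Rintegral_setU; last 4 first.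
- exact: measurable_Rc.
- exact: measurable_Rc.
- apply: integrableS (RI_integrable a b c d cF); [exact: measurable_Rc|
   by apply: measurableU; exact: measurable_Rc|].
  by move=> z [] /RcE[/andP[z1 z2] z34]; apply/RcE; split => //; apply/andP; split; lra.
- apply/disj_setPS => z [] /RcE[/andP[_ z1] _] /RcE[/andP[z2 _] _].
  by move: (lt_le_trans z2 z1); rewrite ltxx.
congr (Rintegral _ _ _); apply/seteqP; split => z.
  move=> /RcE[/andP[z1 z2] z34].
  by have [zm|zm] := leP z.1 m; [left|right]; apply/RcE; split => //; apply/andP; split.
by move=> [] /RcE[/andP[z1 z2] z34]; apply/RcE; split => //; apply/andP; split; lra.
Qed.

Lemma RI_split2 a b c m d F : c <= m <= d -> continuous F ->
  RI a b c d F = RI a b c m F + RI a b m d F.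
Proof.
move=> /andP[am mb] cF; rewrite /RI -Rintegral_setU; last 4 first.
- exact: measurable_Rc.
- exact: measurable_Rc.
- apply: integrableS (RI_integrable a b c d cF); [exact: measurable_Rc|
   by apply: measurableU; exact: measurable_Rc|].
  by move=> z [] /RcE[z12 /andP[z3 z4]]; apply/RcE; split => //; apply/andP; split; lra.
- apply/disj_setPS => z [] /RcE[_ /andP[_ z1]] /RcE[_ /andP[z2 _]].
  by move: (lt_le_trans z2 z1); rewrite ltxx.
congr (Rintegral _ _ _); apply/seteqP; split => z.
  move=> /RcE[z12 /andP[z3 z4]].
  by have [zm|zm] := leP z.2 m; [left|right]; apply/RcE; split => //; apply/andP; split.
by move=> [] /RcE[z12 /andP[z3 z4]]; apply/RcE; split => //; apply/andP; split; lra.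
Qed.

(** [variance_le] is applied on each segment in the first variable, then to the segment integrals
    [G], whose oscillation is controlled by [fr]. The mean term is kept on the right: no
    normalization of [f] is assumed. *)
Lemma poincare_rectangle a b c d (f fs fr : R * R -> R) : a < b -> c < d ->
  continuous f -> continuous fs -> continuous fr ->
  (forall s r, a < s < b -> c < r < d -> is_derive s 1 (fun t => f (t, r)) (fs (s, r))) ->
  (forall s r, a < s < b -> c < r < d -> is_derive r 1 (fun t => f (s, t)) (fr (s, r))) ->
  RI a b c d (fun z => f z ^+ 2) <= (RI a b c d f) ^+ 2 / ((b - a) * (d - c)) +
    (b - a) ^+ 2 * RI a b c d (fun z => fs z ^+ 2) +
    (d - c) ^+ 2 * RI a b c d (fun z => fr z ^+ 2).
Proof.
move=> ab cd cf cfs cfr ds dr.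
have ba : 0 < b - a by rewrite subr_gt0.
have dc : 0 < d - c by rewrite subr_gt0.
pose G r := \int[leb]_(s in Io a b) f (s, r).
have cG : continuous G.
  by apply: (slice_cont (H := fun r s => f (s, r)) (ltW ab)); apply: (cont_comp cf); cts.
have cfs2 : continuous (fun z => fs z ^+ 2) by cts.
have cfr2 : continuous (fun z => fr z ^+ 2) by cts.
have cG2 : continuous (fun z : R * R => G z.2 ^+ 2).
  by have cGs : continuous (fun z : R * R => G z.2) := cont_comp cG cont_snd; cts.
have step1 : RI a b c d (fun z => f z ^+ 2) <=
    RI a b c d (fun z => ((b - a) ^+ 2)^-1 * G z.2 ^+ 2 + (b - a) ^+ 2 * fs z ^+ 2).
  apply: RI_slice_le2; [exact: ltW|by cts|by cts|].
  move=> r rcd /=.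
  rewrite (Rintegral_Io_lin a b _ _ (@cont_cst R R (G r ^+ 2)) (@cont_col _ r cfs2)).
  rewrite (Rintegral_Io_cst _ (ltW ab)).
  have := variance_le ab (@cont_col _ r cf) (K := (b - a) * \int[leb]_(s in Io a b) (fs (s, r) ^+ 2)).
  move=> h; apply: le_trans (h _) _ => {h}.
    move=> x y xab yab; apply: (osc_der (@cont_col _ r cf) (@cont_col _ r cfs)) => //.
    by move=> s sab; exact: ds.
  rewrite -/(G r) le_eqVlt; apply/orP; left; apply/eqP.
  by field; rewrite gt_eqF.
apply: le_trans step1 _; rewrite RI_lin //.
have -> : RI a b c d (fun z => G z.2 ^+ 2) = (b - a) * \int[leb]_(r in Io c d) (G r ^+ 2).
  rewrite RI_fubini2 //=.
  have -> : \int[leb]_(r in Io c d) \int[leb]_(s in Io a b) (G r ^+ 2) =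
      \int[leb]_(r in Io c d) ((b - a) * (G r ^+ 2) + 0 * (G r ^+ 2)).
    apply: eq_Rintegral => r _; rewrite (Rintegral_Io_cst _ (ltW ab)).
    by rewrite mul0r addr0 mulrC.
  have cGr : continuous (fun r => G r ^+ 2) by cts.
  by rewrite (Rintegral_Io_lin c d _ _ cGr cGr) mul0r addr0.
have step2 : \int[leb]_(r in Io c d) (G r ^+ 2) <= (RI a b c d f) ^+ 2 / (d - c) +
    (d - c) * ((b - a) * (d - c) * RI a b c d (fun z => fr z ^+ 2)).
  rewrite (RI_fubini2 a b c d cf); apply: variance_le => // x y xcd ycd.
  have cxy : continuous (fun s => 1 * f (s, x) + (-1) * f (s, y)).
    by have c1 := @cont_col _ x cf; have c2 := @cont_col _ y cf; cts.
  have -> : G x - G y = \int[leb]_(s in Io a b) (1 * f (s, x) + (-1) * f (s, y)).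
    by rewrite (Rintegral_Io_lin a b _ _ (@cont_col _ x cf) (@cont_col _ y cf)); rewrite -/(G x) -/(G y); lra.
  apply: le_trans (line_cauchy_schwarz (ltW ab) cxy) _.
  rewrite -!mulrA ler_pM2l // RI_fubini1 //.
  pose S s := \int[leb]_(r in Io c d) (fr (s, r) ^+ 2).
  have cS : continuous S.
    by apply: (slice_cont (H := fun s r => fr (s, r) ^+ 2) (ltW cd));
      have c1 : continuous (fun z : R * R => fr (z.1, z.2)) by [apply: (cont_comp cfr); cts]; cts.
  have -> : (d - c) * \int[leb]_(s in Io a b) \int[leb]_(r in Io c d) (fr (s, r) ^+ 2) =
      \int[leb]_(s in Io a b) ((d - c) * S s + 0 * S s).
    by rewrite (Rintegral_Io_lin a b _ _ cS cS) mul0r addr0.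
  apply: Rintegral_Io_le; [by cts|by cts|] => s sab.
  rewrite mul0r addr0 mul1r mulN1r.
  apply: (osc_der (@cont_row _ s cf) (@cont_row _ s cfr)) => // r rcd.
  exact: dr.
have h : (b - a) ^- 2 * ((b - a) * \int[leb]_(r in Io c d) (G r ^+ 2)) <=
    (b - a) ^- 2 * ((b - a) * ((RI a b c d f) ^+ 2 / (d - c) +
    (d - c) * ((b - a) * (d - c) * RI a b c d (fun z => fr z ^+ 2)))).
  by rewrite ler_pM2l ?invr_gt0 ?exprn_gt0 // ler_pM2l.
have e : (b - a) ^- 2 * ((b - a) * ((RI a b c d f) ^+ 2 / (d - c) +
    (d - c) * ((b - a) * (d - c) * RI a b c d (fun z => fr z ^+ 2)))) =
  (RI a b c d f) ^+ 2 / ((b - a) * (d - c)) + (d - c) ^+ 2 * RI a b c d (fun z => fr z ^+ 2).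
  by field; rewrite !gt_eqF.
rewrite e in h; lra.
Qed.

Definition box : Type := (R * R) * (R * R).
Definition BI (B : box) F := RI B.1.1 B.1.2 B.2.1 B.2.2 F.
Definition area (B : box) := (B.1.2 - B.1.1) * (B.2.2 - B.2.1).
Definition subbox (B : box) a b c d :=
  [/\ a <= B.1.1, B.1.1 < B.1.2, B.1.2 <= b & [/\ c <= B.2.1, B.2.1 < B.2.2 & B.2.2 <= d]].

(** The cells come from [n] successive quarterings, each dividing the gradient terms by 4. The list
    [Bs] is chosen before [f]: finitely many averages control the mass of all functions, up to a
    small multiple of the energy. *)
Lemma poincare_grid n a b c d : a < b -> c < d -> exists2 Bs : seq box,
  forall B, List.In B Bs -> subbox B a b c d &
  forall f fs fr : R * R -> R, continuous f -> continuous fs -> continuous fr ->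
  (forall s r, a < s < b -> c < r < d -> is_derive s 1 (fun t => f (t, r)) (fs (s, r))) ->
  (forall s r, a < s < b -> c < r < d -> is_derive r 1 (fun t => f (s, t)) (fr (s, r))) ->
  RI a b c d (fun z => f z ^+ 2) <= \sum_(B <- Bs) (BI B f) ^+ 2 / area B +
    4 ^- n * ((b - a) ^+ 2 * RI a b c d (fun z => fs z ^+ 2) +
              (d - c) ^+ 2 * RI a b c d (fun z => fr z ^+ 2)).
Proof.
elim: n a b c d => [|n IH] a b c d ab cd.
  exists [:: ((a, b), (c, d))].
    by move=> B [<-|//]; split => //; split.
  move=> f fs fr cf cfs cfr ds dr; rewrite big_seq1 expr0 invr1 mul1r /BI /area /= addrA.
  exact: poincare_rectangle.
pose m := (a + b) / 2; pose q := (c + d) / 2.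
have am : a < m by rewrite /m; lra.
have mb : m < b by rewrite /m; lra.
have cq : c < q by rewrite /q; lra.
have qd : q < d by rewrite /q; lra.
have [B1 S1 H1] := IH a m c q am cq.
have [B2 S2 H2] := IH m b c q mb cq.
have [B3 S3 H3] := IH a m q d am qd.
have [B4 S4 H4] := IH m b q d mb qd.
exists (B1 ++ B2 ++ B3 ++ B4).
  move=> B; rewrite !List.in_app_iff.
  by move=> [/S1|[/S2|[/S3|/S4]]] [h1 h2 h3 [h4 h5 h6]]; split => //; try split => //; lra.
move=> f fs fr cf cfs cfr ds dr; rewrite !big_cat /=.
have split4 F : continuous F -> RI a b c d F =
    RI a m c q F + RI m b c q F + RI a m q d F + RI m b q d F.
  move=> cF; rewrite (@RI_split1 a m b c d F) //; last by apply/andP; split; exact: ltW.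
  rewrite (@RI_split2 a m c q d F) //; last by apply/andP; split; exact: ltW.
  rewrite (@RI_split2 m b c q d F) //; last by apply/andP; split; exact: ltW.
  by ring.
rewrite !split4; [|by cts|by cts|by cts].
have loc (a' b' c' d' : R) : a <= a' -> b' <= b -> c <= c' -> d' <= d ->
  (forall s r, a' < s < b' -> c' < r < d' -> is_derive s 1 (fun t => f (t, r)) (fs (s, r))) /\
  (forall s r, a' < s < b' -> c' < r < d' -> is_derive r 1 (fun t => f (s, t)) (fr (s, r))).
  move=> h1 h2 h3 h4; split=> s r /andP[s1 s2] /andP[r1 r2]; [apply: ds|apply: dr];
    by rewrite ?(le_lt_trans h1 s1) ?(lt_le_trans s2 h2) ?(le_lt_trans h3 r1) ?(lt_le_trans r2 h4).
have [d1 e1] := loc a m c q (lexx _) (ltW mb) (lexx _) (ltW qd).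
have [d2 e2] := loc m b c q (ltW am) (lexx _) (lexx _) (ltW qd).
have [d3 e3] := loc a m q d (lexx _) (ltW mb) (ltW cq) (lexx _).
have [d4 e4] := loc m b q d (ltW am) (lexx _) (ltW cq) (lexx _).
have := H1 f fs fr cf cfs cfr d1 e1.
have := H2 f fs fr cf cfs cfr d2 e2.
have := H3 f fs fr cf cfs cfr d3 e3.
have := H4 f fs fr cf cfs cfr d4 e4.
have ma : m - a = (b - a) / 2 by rewrite /m; lra.
have bm : b - m = (b - a) / 2 by rewrite /m; lra.
have qc : q - c = (d - c) / 2 by rewrite /q; lra.
have dq : d - q = (d - c) / 2 by rewrite /q; lra.
have p4 : 4 ^- n.+1 = 4^-1 * 4 ^- n :> R by rewrite exprS invfM.
have q4 X Y : 4 ^- n * (((b - a) / 2) ^+ 2 * X + ((d - c) / 2) ^+ 2 * Y) =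
    4 ^- n.+1 * ((b - a) ^+ 2 * X + (d - c) ^+ 2 * Y) by rewrite p4; field; rewrite expf_neq0.
rewrite ma bm qc dq; rewrite !q4.
move=> {}H4 {}H3 {}H2 {}H1.
apply: le_trans (lerD (lerD (lerD H1 H2) H3) H4) _.
rewrite le_eqVlt; apply/orP; left; apply/eqP; ring.
Qed.

Lemma BI_le B a b c d f : subbox B a b c d -> continuous f ->
  (BI B f) ^+ 2 <= area B * RI a b c d (fun z => f z ^+ 2).
Proof.
move=> [h1 h2 h3 [h4 h5 h6]] cf.
have cf2 : continuous (fun z => f z ^+ 2) by cts.
have sc F : continuous F -> sq leb2 (Rc B.1.1 B.1.2 B.2.1 B.2.2) F.
  move=> cF; split; first by apply: measurable_funTS; exact: cont_measurable.
  by apply: (@RI_integrable _ _ _ _ (fun z => F z ^+ 2)); cts.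
have := ip_cauchy_schwarz (@measurable_Rc _ _ _ _) (sc f cf) (sc (fun=> 1) (@cont_cst _ R 1)).
have -> : ip leb2 (Rc B.1.1 B.1.2 B.2.1 B.2.2) f (fun=> 1) = BI B f.
  by apply: eq_Rintegral => z _; rewrite mulr1.
rewrite /ip => h; apply: le_trans h _.
have -> : \int[leb2]_(x in Rc B.1.1 B.1.2 B.2.1 B.2.2) (1 * 1) = area B.
  have e := @RI_fubini1 B.1.1 B.1.2 B.2.1 B.2.2 (fun=> 1 * 1) (@cont_cst _ R _).
  rewrite /RI in e; rewrite e.
  under eq_Rintegral do rewrite (Rintegral_Io_cst _ (ltW h5)).
  by rewrite (Rintegral_Io_cst _ (ltW h2)) /area !mul1r mulrC.
have a0 : 0 < area B by rewrite /area mulr_gt0 ?subr_gt0.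
rewrite mulrC ler_pM2l // /RI.
apply: fine_le.
- by apply: integrable_fin_num; [exact: measurable_Rc|
    apply: (@RI_integrable _ _ _ _ (fun z => f z * f z)); cts].
- by apply: integrable_fin_num; [exact: measurable_Rc|exact: RI_integrable].
under eq_integral do rewrite -expr2.
apply: ge0_subset_integral; [exact: measurable_Rc|exact: measurable_Rc| | |].
- by apply/measurable_EFinP; apply: measurable_funTS; exact: cont_measurable.
- by move=> z _; rewrite lee_fin sqr_ge0.
- by move=> z /RcE[/andP[z1 z2] /andP[z3 z4]]; apply/RcE; split; apply/andP; split; lra.
Qed.

End RectangleIntegral.

(** * Rayleigh quotients on the rectangle *)

Module Energy.

(** The function and both partial derivatives are continuous on the whole plane, so integrals up to
    the boundary need no limiting argument. Off the open rectangle [vs] and [vr] need not be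
    derivatives of [v0]. *)
Record c1fun (R : realType) (L delta : R) := C1fun {
  v0 : R * R -> R; vs : R * R -> R; vr : R * R -> R;
  cont_v0 : continuous v0; cont_vs : continuous vs; cont_vr : continuous vr;
  der_vs : forall s r, 0 < s < L -> 0 < r < delta ->
    is_derive s 1 (fun t => v0 (t, r)) (vs (s, r));
  der_vr : forall s r, 0 < s < L -> 0 < r < delta ->
    is_derive r 1 (fun t => v0 (s, t)) (vr (s, r)) }.

#[export] Hint Extern 1 => (lazymatch goal with
  | |- context [@v0 _ _ _ ?C] => exact: (@cont_v0 _ _ _ C)
  | |- context [@vs _ _ _ ?C] => exact: (@cont_vs _ _ _ C)
  | |- context [@vr _ _ _ ?C] => exact: (@cont_vr _ _ _ C)
  end) : cont.

Section C1Algebra.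
Context {R : realType} {L delta : R}.
Local Notation c1 := (c1fun L delta).
Implicit Types (V W : c1) (a b : R).

Program Definition c1lin a V b W : c1 := @C1fun _ _ _
  (fun z => a * v0 V z + b * v0 W z) (fun z => a * vs V z + b * vs W z)
  (fun z => a * vr V z + b * vr W z) _ _ _ _ _.
Next Obligation. by move=> a V b W; cts. Qed.
Next Obligation. by move=> a V b W; cts. Qed.
Next Obligation. by move=> a V b W; cts. Qed.
Next Obligation.
move=> a V b W s r hs hr; have h1 := der_vs V hs hr; have h2 := der_vs W hs hr.
by dereq; ring.
Qed.
Next Obligation.
move=> a V b W s r hs hr; have h1 := der_vr V hs hr; have h2 := der_vr W hs hr.
by dereq; ring.
Qed.

Program Definition c1cst a : c1 := @C1fun _ _ _ (fun=> a) (fun=> 0) (fun=> 0) _ _ _ _ _.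
Next Obligation. by move=> *; exact: cont_cst. Qed.
Next Obligation. by move=> *; exact: cont_cst. Qed.
Next Obligation. by move=> *; exact: cont_cst. Qed.
Next Obligation. by move=> *; dereq. Qed.
Next Obligation. by move=> *; dereq. Qed.

(** By [Phi_sym], the reflection across the y-axis read in the tubular coordinates. *)
Definition flip (z : R * R) : R * R := (L - z.1, z.2).

Lemma flip_cont : continuous flip. Proof. by rewrite /flip; cts. Qed.

Lemma flipK z : flip (flip z) = z.
Proof. by case: z => s r; rewrite /flip /= subKr. Qed.

Program Definition c1flip V : c1 := @C1fun _ _ _ (fun z => v0 V (flip z))
  (fun z => - vs V (flip z)) (fun z => vr V (flip z)) _ _ _ _ _.
Next Obligation. by move=> *; apply: (cont_comp (@cont_v0 _ _ _ _) flip_cont). Qed.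
Next Obligation. by move=> *; apply: contN; apply: (cont_comp (@cont_vs _ _ _ _) flip_cont). Qed.
Next Obligation. by move=> *; apply: (cont_comp (@cont_vr _ _ _ _) flip_cont). Qed.
Next Obligation.
move=> V s r hs hr; have hs' : 0 < L - s < L by move: hs => /andP[? ?]; apply/andP; split; lra.
have h1 := der_vs V hs' hr.
have h2 : is_derive s 1 (fun t => L - t) (-1) by dereq; ring.
by apply: der_eq (@der_comp _ (fun t => v0 V (t, r)) (fun t => L - t) s _ _ h1 h2) _; ring.
Qed.
Next Obligation.
move=> V s r hs hr; have hs' : 0 < L - s < L by move: hs => /andP[? ?]; apply/andP; split; lra.
exact: (der_vr V hs' hr).
Qed.

(** The parities of [vs] and [vr] are imposed because these fields are not determined by [v0] off
    the open rectangle. *)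
Definition c1odd V := [/\ forall z, v0 V (flip z) = - v0 V z,
  forall z, vs V (flip z) = vs V z & forall z, vr V (flip z) = - vr V z].
Definition c1even V := [/\ forall z, v0 V (flip z) = v0 V z,
  forall z, vs V (flip z) = - vs V z & forall z, vr V (flip z) = vr V z].

Lemma c1odd_lin a V b W : c1odd V -> c1odd W -> c1odd (c1lin a V b W).
Proof.
by move=> [v1 v2 v3] [w1 w2 w3]; split => z /=; rewrite ?v1 ?v2 ?v3 ?w1 ?w2 ?w3 //; ring.
Qed.

Lemma c1even_lin a V b W : c1even V -> c1even W -> c1even (c1lin a V b W).
Proof.
by move=> [v1 v2 v3] [w1 w2 w3]; split => z /=; rewrite ?v1 ?v2 ?v3 ?w1 ?w2 ?w3 //; ring.
Qed.

Lemma c1even_cst a : c1even (c1cst a).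
Proof. by split => z //=; rewrite oppr0. Qed.

Definition c1oddpart V := c1lin (1 / 2) V (- (1 / 2)) (c1flip V).
Definition c1evenpart V := c1lin (1 / 2) V (1 / 2) (c1flip V).

Lemma c1oddpart_odd V : c1odd (c1oddpart V).
Proof. by split => z /=; rewrite flipK; ring. Qed.

Lemma c1evenpart_even V : c1even (c1evenpart V).
Proof. by split => z /=; rewrite flipK; ring. Qed.

End C1Algebra.

Section Cluster.
Context {R : realType}.

(** Bolzano-Weierstrass. The only property kept of an extraction is [i <= phi i], which is enough
    for limits along it. *)
Lemma bounded_cauchy_subsequence (x : nat -> R) (M : R) : (forall n, `|x n| <= M) ->
  exists2 phi : nat -> nat, (forall i, (i <= phi i)%N) &
  forall e, 0 < e -> exists I, forall i j, (I <= i)%N -> (I <= j)%N ->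
    `|x (phi i) - x (phi j)| <= e.
Proof.
move=> xM.
have cK := @segment_compact R (- M) M.
have [|p [_ clp]] := cK (x @ \oo) _.
  by exists 0%N => // n _ /=; rewrite in_itv /= -ler_norml.
have ex i : exists n, (i <= n)%N /\ `|p - x n| < i.+1%:R^-1.
  have A : (x @ \oo) (x @` [set n | (i <= n)%N]).
    by exists i => // n /= ni; exists n.
  have e0 : 0 < i.+1%:R^-1 :> R by rewrite invr_gt0.
  have [_ [[n /= ni <-] bn]] := clp _ _ A (nbhsx_ballx p _ e0).
  by exists n.
have [phi Hphi] := choice ex; exists phi; first by move=> i; have [] := Hphi i.
move=> e e0; have e2 : 0 < e / 2 by rewrite divr_gt0.
exists (Num.Def.archi_bound (e / 2)^-1).
have small i : (Num.Def.archi_bound (e / 2)^-1 <= i)%N -> `|p - x (phi i)| <= e / 2.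
  move=> Ii; have [_ /ltW h] := Hphi i; apply: le_trans h _.
  rewrite -[e / 2]invrK lef_pV2 ?posrE ?invr_gt0 //.
  apply: (le_trans (ltW (archi_boundP (ltW _)))); first by rewrite invr_gt0.
  by rewrite ler_nat leqW.
move=> i j /small hi /small hj.
have -> : x (phi i) - x (phi j) = (p - x (phi j)) - (p - x (phi i)) by ring.
by apply: le_trans (ler_normB _ _) _; lra.
Qed.

Lemma bounded_cauchy_subsequences (T : Type) (l : seq T) (x : T -> nat -> R) (M : R) :
  (forall t n, List.In t l -> `|x t n| <= M) ->
  exists2 phi : nat -> nat, (forall i, (i <= phi i)%N) &
  forall e, 0 < e -> exists I, forall i j, (I <= i)%N -> (I <= j)%N ->
    forall t, List.In t l -> `|x t (phi i) - x t (phi j)| <= e.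
Proof.
elim: l => [_|t l IH xM]; first by exists id => // e _; exists 0%N.
have [phi phi_ge Hphi] : exists2 phi : nat -> nat, (forall i, (i <= phi i)%N) &
  forall e, 0 < e -> exists I, forall i j, (I <= i)%N -> (I <= j)%N ->
    forall t, List.In t l -> `|x t (phi i) - x t (phi j)| <= e.
  by apply: IH => t' n h; apply: xM; right.
have [psi psi_ge Hpsi] := @bounded_cauchy_subsequence (fun n => x t (phi n)) M
  (fun n => xM t (phi n) (or_introl erefl)).
exists (fun i => phi (psi i)).
  by move=> i; rewrite (leq_trans (psi_ge i)).
move=> e e0; have [I1 H1] := Hphi e e0; have [I2 H2] := Hpsi e e0.
exists (maxn I1 I2) => i j; rewrite !geq_max => /andP[i1 i2] /andP[j1 j2] t' [<-|ht].
  exact: H2.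
by apply: H1 => //; rewrite (leq_trans _ (psi_ge _)).
Qed.

End Cluster.

(** * The energy and mass forms of the weighted rectangle *)

Section Forms.
Context {R : realType} {L delta : R}.
Hypotheses (L0 : 0 < L) (d0 : 0 < delta).
Variable H : R * R -> R.
Hypothesis cH : continuous H.
Hypothesis H_gt0 : forall z, 0 < H z.
Hypothesis H_flip : forall z, H (@flip _ L z) = H z.
Local Notation c1 := (c1fun L delta).
Local Notation J := (RI 0 L 0 delta).
Local Notation leb := (@lebesgue_measure R).
Implicit Types (V W U : c1) (F G : R * R -> R) (a b e : R).

Let cHV : continuous (fun z => (H z)^-1).
Proof. by apply: contV => // z; rewrite gt_eqF. Qed.

Definition qd V W z := vs V z * vs W z / H z + H z * (vr V z * vr W z).
Definition nd V W z := H z * (v0 V z * v0 W z).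
Definition QQ V W := J (qd V W).
Definition NN V W := J (nd V W).

Lemma qd_cont V W : continuous (qd V W). Proof. by rewrite /qd; cts. Qed.
Lemma nd_cont V W : continuous (nd V W). Proof. by rewrite /nd; cts. Qed.

Lemma QQ_lin a V b W U : QQ (c1lin a V b W) U = a * QQ V U + b * QQ W U.
Proof.
rewrite /QQ -RI_lin; [|exact: qd_cont|exact: qd_cont].
by apply: RI_eq => z _ _; rewrite /qd /=; ring.
Qed.

Lemma NN_lin a V b W U : NN (c1lin a V b W) U = a * NN V U + b * NN W U.
Proof.
rewrite /NN -RI_lin; [|exact: nd_cont|exact: nd_cont].
by apply: RI_eq => z _ _; rewrite /nd /=; ring.
Qed.

Lemma QQC V W : QQ V W = QQ W V.
Proof. by apply: RI_eq => z _ _; rewrite /qd; ring. Qed.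
Lemma NNC V W : NN V W = NN W V.
Proof. by apply: RI_eq => z _ _; rewrite /nd; ring. Qed.

Lemma QQ_linr a V b W U : QQ U (c1lin a V b W) = a * QQ U V + b * QQ U W.
Proof. by rewrite QQC QQ_lin ![QQ _ U]QQC. Qed.
Lemma NN_linr a V b W U : NN U (c1lin a V b W) = a * NN U V + b * NN U W.
Proof. by rewrite NNC NN_lin ![NN _ U]NNC. Qed.

Lemma qd_ge0 V z : 0 <= qd V V z.
Proof.
rewrite /qd -!expr2; have h := ltW (H_gt0 z).
by apply: addr_ge0; [apply: divr_ge0|apply: mulr_ge0]; rewrite ?sqr_ge0.
Qed.
Lemma nd_ge0 V z : 0 <= nd V V z.
Proof. by rewrite /nd -expr2 mulr_ge0 ?sqr_ge0 // ltW. Qed.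
Lemma QQ_ge0 V : 0 <= QQ V V. Proof. by apply: RI_ge0; exact: qd_ge0. Qed.
Lemma NN_ge0 V : 0 <= NN V V. Proof. by apply: RI_ge0; exact: nd_ge0. Qed.

Lemma QQ_cst a V : QQ (c1cst a) V = 0.
Proof.
rewrite (_ : QQ _ _ = QQ (c1lin 0 V 0 V) V); first by rewrite QQ_lin !mul0r addr0.
by apply: RI_eq => z _ _; rewrite /qd /=; ring.
Qed.

Lemma RI_flip F : continuous F -> J (fun z => F (@flip _ L z)) = J F.
Proof.
move=> cF; have cFf : continuous (fun z => F (@flip _ L z)).
  exact: (cont_comp cF (@flip_cont _ L)).
rewrite (RI_fubini2 _ _ _ _ cFf) (RI_fubini2 _ _ _ _ cF); apply: eq_Rintegral => r _ /=.
have cg := @cont_col _ F r cF.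
have [P cP dP] := primitive_exists L0 cg.
have cPL : continuous (fun s => - P (L - s)).
  have cl : continuous (fun s : R => L - s) by cts.
  by apply: contN; exact: (cont_comp cP cl).
have cgL : continuous (fun s => F (L - s, r)) by exact: (@cont_col _ (fun z => F (flip z)) r cFf).
have dPL s : 0 < s < L -> is_derive s 1 (fun s => - P (L - s)) (F (L - s, r)).
  move=> hs; have hs' : 0 < L - s < L by move: hs => /andP[? ?]; apply/andP; split; lra.
  have h1 := dP _ hs'.
  have h2 : is_derive s 1 (fun t => L - t) (-1) by dereq; ring.
  have h3 := @der_comp _ P (fun t => L - t) s _ _ h1 h2.
  by apply: der_eq (derN h3) _; ring.
have e1 := Rintegral_der (ltW L0) cP cg dP.
have e2 := Rintegral_der (ltW L0) cPL cgL dPL.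
rewrite [LHS]e2 [RHS]e1 subrr subr0; ring.
Qed.

Lemma RI_odd0 F : continuous F -> (forall z, F (@flip _ L z) = - F z) -> J F = 0.
Proof.
move=> cF Fo; have := RI_flip cF.
rewrite (_ : J (fun z => F (flip z)) = J (fun z => (-1) * F z + 0 * F z)); last first.
  by apply: RI_eq => z _ _; rewrite Fo; ring.
by rewrite RI_lin // mul0r addr0; lra.
Qed.

Lemma QQ_odd_even V W : c1odd V -> c1even W -> QQ V W = 0.
Proof.
move=> [v1 v2 v3] [w1 w2 w3]; apply: RI_odd0; first exact: qd_cont.
by move=> z; rewrite /qd v2 v3 w2 w3 H_flip; ring.
Qed.

Lemma NN_odd_even V W : c1odd V -> c1even W -> NN V W = 0.
Proof.
move=> [v1 v2 v3] [w1 w2 w3]; apply: RI_odd0; first exact: nd_cont.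
by move=> z; rewrite /nd v1 w1 H_flip; ring.
Qed.

Lemma oddpart_evenpart (B : c1 -> c1 -> R) :
  (forall a V b W U, B (c1lin a V b W) U = a * B V U + b * B W U) ->
  (forall V W, B V W = B W V) -> (forall V, B (c1oddpart V) (c1evenpart V) = 0) ->
  (forall V, B (c1flip V) (c1flip V) = B V V) -> forall V,
  B V V = B (c1oddpart V) (c1oddpart V) + B (c1evenpart V) (c1evenpart V).
Proof.
move=> Bl BC Bo Bf V.
have Br a V1 b W U : B U (c1lin a V1 b W) = a * B U V1 + b * B U W.
  by rewrite BC Bl ![B _ U]BC.
rewrite /c1oddpart /c1evenpart !Bl !Br Bf (BC (c1flip V) V).
by field.
Qed.

Lemma QQ_flip V : QQ (c1flip V) (c1flip V) = QQ V V.
Proof.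
rewrite -[RHS](RI_flip (@qd_cont V V)); apply: RI_eq => z _ _; rewrite /qd H_flip /=.
by ring.
Qed.

Lemma NN_flip V : NN (c1flip V) (c1flip V) = NN V V.
Proof.
by rewrite -[RHS](RI_flip (@nd_cont V V)); apply: RI_eq => z _ _; rewrite /nd H_flip.
Qed.

Lemma H_bounds : exists c0 c1, [/\ 0 < c0, 0 < c1 &
  forall z, 0 < z.1 <= L -> 0 < z.2 <= delta -> c0 <= H z <= c1].
Proof.
have [M1 M10 H1] := cont_bounded (@compact_box _ 0 L 0 delta) cH.
have [M2 M20 H2] := cont_bounded (@compact_box _ 0 L 0 delta) cHV.
exists M2^-1, M1; split => //; first by rewrite invr_gt0.
move=> z /andP[z1 z2] /andP[z3 z4].
have bz : (`[0, L] `*` `[0, delta]) z by split; rewrite /= in_itv /= ?z2 ?z4 ltW.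
have := H1 z bz; have := H2 z bz; rewrite !gtr0_norm ?invr_gt0 // => h1 ->.
by rewrite andbT -[H z]invrK lef_pV2 ?posrE ?invr_gt0.
Qed.

(** A quantitative substitute for Rellich's compactness theorem: the mass is controlled by finitely
    many cell averages, up to an arbitrarily small fraction of the energy. *)
Lemma grid_bound e : 0 < e -> exists c1 (Bs : seq (box (R := R))), [/\ 0 < c1,
  (forall B, List.In B Bs -> subbox B 0 L 0 delta) &
  forall V, NN V V <= c1 * \sum_(B <- Bs) (BI B (v0 V)) ^+ 2 / area B + e * QQ V V].
Proof.
move=> e0; have [c0 [c1 [c00 c10 hb]]] := H_bounds.
pose K := c1 * (L ^+ 2 * c1 + delta ^+ 2 / c0).
have K0 : 0 < K.
  by rewrite mulr_gt0 // addr_gt0 ?divr_gt0 ?mulr_gt0 ?exprn_gt0.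
pose n := Num.Def.archi_bound (K / e).
have hn : K * 4 ^- n <= e.
  have h1 := archi_boundP (divr_ge0 (ltW K0) (ltW e0)); rewrite -/n in h1.
  have h2 : n%:R <= 4 ^+ n :> R.
    by rewrite -natrX ler_nat ltnW // ltn_expl.
  rewrite ler_pdivrMr ?exprn_gt0 //; rewrite ltr_pdivrMr // in h1.
  by rewrite (le_trans (ltW h1)) // mulrC ler_pM2l.
have [Bs sB HB] := poincare_grid n L0 d0.
exists c1, Bs; split => // V.
have h := HB (v0 V) (vs V) (vr V) (@cont_v0 _ _ _ V) (@cont_vs _ _ _ V) (@cont_vr _ _ _ V)
  (@der_vs _ _ _ V) (@der_vr _ _ _ V).
have h1 : NN V V <= c1 * J (fun z => v0 V z ^+ 2).
  rewrite (_ : c1 * _ = J (fun z => c1 * v0 V z ^+ 2 + 0 * v0 V z ^+ 2)); last first.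
    by rewrite RI_lin ?mul0r ?addr0 //; cts.
  apply: RI_le; [exact: nd_cont|by cts|].
  move=> z z1 z2; have /andP[_ h'] := hb z z1 z2.
  by rewrite mul0r addr0 /nd -expr2 ler_wpM2r ?sqr_ge0.
have h2 : J (fun z => vs V z ^+ 2) <= c1 * QQ V V.
  rewrite (_ : c1 * _ = J (fun z => c1 * qd V V z + 0 * qd V V z)); last first.
    by have := @qd_cont V V => ?; rewrite RI_lin ?mul0r ?addr0.
  have cq := @qd_cont V V; apply: RI_le; [by cts|by cts|].
  move=> z z1 z2; have /andP[h3 h4] := hb z z1 z2; have Hz := H_gt0 z.
  rewrite mul0r addr0 /qd -!expr2.
  have p1 : 0 <= H z * vr V z ^+ 2 by rewrite mulr_ge0 ?sqr_ge0 // ltW.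
  have p2 : vs V z ^+ 2 <= c1 * (vs V z ^+ 2 / H z).
    by rewrite mulrCA ler_peMr ?sqr_ge0 // ler_pdivlMr // mul1r.
  have p3 : 0 <= c1 * (H z * vr V z ^+ 2) by rewrite mulr_ge0 // ltW.
  by rewrite mulrDr; lra.
have h3 : J (fun z => vr V z ^+ 2) <= c0^-1 * QQ V V.
  rewrite (_ : c0^-1 * _ = J (fun z => c0^-1 * qd V V z + 0 * qd V V z)); last first.
    by have := @qd_cont V V => ?; rewrite RI_lin ?mul0r ?addr0.
  have cq := @qd_cont V V; apply: RI_le; [by cts|by cts|].
  move=> z z1 z2; have /andP[h3 h4] := hb z z1 z2; have Hz := H_gt0 z.
  rewrite mul0r addr0 /qd -!expr2 [leRHS]mulrC ler_pdivlMr //.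
  have p1 : 0 <= vs V z ^+ 2 / H z by rewrite divr_ge0 ?sqr_ge0 // ltW.
  have p2 : vr V z ^+ 2 * c0 <= H z * vr V z ^+ 2 by rewrite mulrC ler_wpM2r ?sqr_ge0.
  by lra.
apply: le_trans h1 _; rewrite !subr0 in h.
apply: le_trans (_ : _ <= c1 * (\sum_(B <- Bs) (BI B (v0 V)) ^+ 2 / area B +
  4 ^- n * (L ^+ 2 * (c1 * QQ V V) + delta ^+ 2 * (c0^-1 * QQ V V)))) _.
  rewrite ler_pM2l //; apply: le_trans h _; rewrite lerD2l.
  rewrite ler_pM2l ?invr_gt0 ?exprn_gt0 //.
  by rewrite lerD // ler_pM2l ?exprn_gt0.
rewrite mulrDr lerD2l.
have -> : c1 * (4 ^- n * (L ^+ 2 * (c1 * QQ V V) + delta ^+ 2 * (c0^-1 * QQ V V))) =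
  (K * 4 ^- n) * QQ V V by rewrite /K; ring.
by rewrite ler_wpM2r // QQ_ge0.
Qed.

Definition spectral_values : set R := [set q | exists V, [/\ c1odd V, NN V V = 1 & q = QQ V V]].
(** An infimum over odd functions that are C1 on the rectangle; the inequalities reach H1 later, by
    density. *)
Definition mu := inf spectral_values.

Hypothesis spectral_nonempty : exists V, c1odd V /\ 0 < NN V V.

Lemma NN_scale a V : NN (c1lin a V 0 V) (c1lin a V 0 V) = a ^+ 2 * NN V V.
Proof. by rewrite NN_lin !NN_linr; ring. Qed.
Lemma QQ_scale a V : QQ (c1lin a V 0 V) (c1lin a V 0 V) = a ^+ 2 * QQ V V.
Proof. by rewrite QQ_lin !QQ_linr; ring. Qed.

Lemma normalize V : 0 < NN V V -> exists2 a, a ^+ 2 * NN V V = 1 & a ^+ 2 = (NN V V)^-1.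
Proof.
move=> n0; exists (Num.sqrt (NN V V)^-1); rewrite sqr_sqrtr ?invr_ge0 ?ltW //.
by rewrite mulVf // gt_eqF.
Qed.

Lemma spectral_has_inf : has_inf spectral_values.
Proof.
split; last by exists 0 => _ [V [_ _ ->]]; exact: QQ_ge0.
have [V [oV n0]] := spectral_nonempty; have [a a1 _] := normalize n0.
exists (QQ (c1lin a V 0 V) (c1lin a V 0 V)), (c1lin a V 0 V).
by split => //; [exact: c1odd_lin|rewrite NN_scale].
Qed.

Lemma mu_le V : c1odd V -> mu * NN V V <= QQ V V.
Proof.
move=> oV; have [n0|n0] := ltP 0 (NN V V); last first.
  have -> : NN V V = 0 by apply/eqP; rewrite eq_le n0 NN_ge0.
  by rewrite mulr0 QQ_ge0.
have [a a1 a2] := normalize n0.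
have : mu <= QQ (c1lin a V 0 V) (c1lin a V 0 V).
  apply: ge_inf; first by have [] := spectral_has_inf.
  by exists (c1lin a V 0 V); split => //; [exact: c1odd_lin|rewrite NN_scale].
by rewrite QQ_scale a2 mulrC ler_pdivlMr.
Qed.

Lemma mu_ge0 : 0 <= mu.
Proof.
apply: lb_le_inf; first by have [] := spectral_has_inf.
by move=> _ [V [_ _ ->]]; exact: QQ_ge0.
Qed.

(** Along a subsequence the finitely many cell averages converge, so [grid_bound] controls the mass
    of a difference by its energy, while near-minimality controls the energy by the mass. The
    fraction chosen in [grid_bound] makes the two estimates close up. *)
Lemma minimizing_sequence : exists W : nat -> c1, [/\ forall i, c1odd (W i),
  forall i, NN (W i) (W i) = 1,
  forall e, 0 < e -> exists I, forall i, (I <= i)%N -> QQ (W i) (W i) <= mu + e &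
  forall e, 0 < e -> exists I, forall i j, (I <= i)%N -> (I <= j)%N ->
    let d := c1lin 1 (W i) (-1) (W j) in NN d d <= e /\ QQ d d <= e].
Proof.
have ex (n : nat) : exists V, [/\ c1odd V, NN V V = 1 & QQ V V <= mu + n.+1%:R^-1].
  have n0 : 0 < n.+1%:R^-1 :> R by rewrite invr_gt0.
  have [_ [V [oV nV ->]] h] := inf_adherent n0 spectral_has_inf.
  by exists V; split => //; exact: ltW.
have [V HV] := choice ex.
have m0 := mu_ge0.
(* With this fraction the term [mu * NN d d] of the energy contributes at most half of [NN d d],
   which is absorbed. *)
have e1 : 0 < 1 / (2 * (mu + 1)) by rewrite divr_gt0 //; lra.
have [c1 [Bs [c10 sB HB]]] := grid_bound e1.
have [c0 [c2 [c00 c20 hb]]] := H_bounds.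
pose A := \sum_(B <- Bs) (area B + (area B)^-1).
have A0 B : List.In B Bs -> 0 < area B.
  by move=> /sB[_ h1 _ [_ h2 _]]; rewrite /area mulr_gt0 ?subr_gt0.
have Apos (l : seq (box (R := R))) : (forall B, List.In B l -> 0 < area B) ->
   0 <= \sum_(B <- l) (area B + (area B)^-1) /\
   forall B, List.In B l -> area B <= \sum_(B <- l) (area B + (area B)^-1).
  elim: l => [|B l IH] hl; first by rewrite big_nil.
  have [i1 i2] := IH (fun B h => hl B (or_intror h)).
  have aB := hl B (or_introl erefl).
  have aV : 0 < (area B)^-1 by rewrite invr_gt0.
  rewrite big_cons; split; first by lra.
  by move=> B' [<-|/i2 h]; lra.
have [A00 AB] := Apos Bs A0.
have bnd B n : List.In B Bs -> `|BI B (v0 (V n))| <= 1 + A / c0.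
  move=> hB; have [_ nV _] := HV n.
  have h := BI_le (sB B hB) (@cont_v0 _ _ _ (V n)).
  have h2 : J (fun z => v0 (V n) z ^+ 2) <= c0^-1.
    rewrite -[leRHS]mulr1 -nV.
    rewrite (_ : c0^-1 * _ = J (fun z => c0^-1 * nd (V n) (V n) z + 0 * nd (V n) (V n) z)); last first.
      by have := @nd_cont (V n) (V n) => ?; rewrite RI_lin ?mul0r ?addr0.
    have cn := @nd_cont (V n) (V n).
    apply: RI_le; [by cts|by cts|] => z z1 z2; have /andP[h3 _] := hb z z1 z2.
    rewrite mul0r addr0 /nd -expr2 [leRHS]mulrC ler_pdivlMr // mulrC.
    by rewrite ler_wpM2r ?sqr_ge0.
  have h3 : (BI B (v0 (V n))) ^+ 2 <= A / c0.
    apply: le_trans h _; apply: ler_pM => //; [exact/ltW/A0| |exact: AB].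
    by apply: RI_ge0 => z; exact: sqr_ge0.
  rewrite -(real_normK (num_real _)) in h3.
  have h4 := normr_ge0 (BI B (v0 (V n))).
  by nra.
have [phi phi_ge Hphi] := bounded_cauchy_subsequences bnd.
have inv_small (e : R) : 0 < e -> exists I : nat, forall i, (I <= i)%N -> (phi i).+1%:R^-1 <= e.
  move=> e0; exists (Num.Def.archi_bound e^-1) => i Ii.
  rewrite -[leRHS]invrK lef_pV2 ?posrE ?invr_gt0 //.
  apply: (le_trans (ltW (archi_boundP (ltW _)))); first by rewrite invr_gt0.
  by rewrite ler_nat leqW // (leq_trans Ii).
exists (fun i => V (phi i)); split.
- by move=> i; have [] := HV (phi i).
- by move=> i; have [] := HV (phi i).
- move=> e e0; have [I HI] := inv_small e e0; exists I => i Ii.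
  by have [_ _ h] := HV (phi i); apply: le_trans h _; rewrite lerD2l HI.
move=> e e0.
pose A1 := \sum_(B <- Bs) (area B)^-1.
have A10 : 0 <= A1.
  rewrite /A1; elim: (Bs) (A0) => [|B l IH] hl; first by rewrite big_nil.
  rewrite big_cons addr_ge0 //; first by rewrite invr_ge0 ltW // hl //; left.
  by apply: IH => B' h; apply: hl; right.
(* Room for the final bounds: [6 * eta] on the mass of the difference and [4 * eta + 6 * (mu * eta)]
   on its energy. *)
have [eta eta0 ee] : exists2 eta, 0 < eta & e = 16 * (mu * eta) + 16 * eta.
  exists (e / (16 * (mu + 1))); first by rewrite divr_gt0 //; lra.
  by field; rewrite gt_eqF //; lra.
(* The cap 1 gives [e2 ^+ 2 <= e2]; the other term makes the weighted sum of squared averages at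
   most [eta]. *)
pose e2 := Num.min 1 (eta / (c1 * A1 + 1)).
have ca : 0 <= c1 * A1 by rewrite mulr_ge0 // ltW.
have e20 : 0 < e2 by rewrite lt_min ltr01 divr_gt0 //; lra.
have [I1 H1] := inv_small eta eta0; have [I2 H2] := Hphi e2 e20.
exists (maxn I1 I2) => i j; rewrite !geq_max => /andP[i1 i2] /andP[j1 j2].
set d := c1lin 1 (V (phi i)) (-1) (V (phi j)); move=> /=.
have [oi ni qi] := HV (phi i); have [oj nj qj] := HV (phi j).
have ii := H1 i i1; have jj := H1 j j1.
(* Parallelogram identity: the sum [S] is odd, so [mu_le] bounds its energy from below; what remains
   is [mu * NN d d] and twice the two defects. *)
have qd1 : QQ d d <= 4 * eta + mu * NN d d.
  have := mu_le (c1odd_lin 1 1 oi oj); set S := c1lin _ _ _ _ => hS.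
  have eQ : QQ d d = 2 * QQ (V (phi i)) (V (phi i)) + 2 * QQ (V (phi j)) (V (phi j)) - QQ S S.
    by rewrite /d /S !QQ_lin !QQ_linr; ring.
  have eN : NN d d = 4 - NN S S by rewrite /d /S !NN_lin !NN_linr ni nj; ring.
  have lin (m q1 q2 q3 n t u1 u2 : R) : m * n <= q3 -> q1 <= m + u1 -> q2 <= m + u2 ->
      u1 <= t -> u2 <= t -> 2 * q1 + 2 * q2 - q3 <= 4 * t + (m * 4 - m * n).
    by clear; move=> *; lra.
  by rewrite eQ eN mulrBr; exact: lin hS qi qj ii jj.
have nd1 : NN d d <= eta + 1 / (2 * (mu + 1)) * QQ d d.
  apply: le_trans (HB d) _; rewrite lerD2r.
  apply: le_trans (_ : _ <= c1 * (A1 * e2)) _.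
    rewrite ler_pM2l // /A1 mulr_suml.
    have Hs : forall B, List.In B Bs -> (BI B (v0 d)) ^+ 2 / area B <= (area B)^-1 * e2.
      move=> B hB; rewrite mulrC ler_pM2l ?invr_gt0 ?A0 //.
      have -> : BI B (v0 d) = BI B (v0 (V (phi i))) - BI B (v0 (V (phi j))).
        by rewrite /BI RI_lin; [ring|by cts|by cts].
      have h := H2 i j i2 j2 B hB.
      have h1 : e2 <= 1 by rewrite ge_min lexx.
      rewrite -(real_normK (num_real _)); have := normr_ge0 (BI B (v0 (V (phi i))) - BI B (v0 (V (phi j)))).
      by nra.
    elim: (Bs) Hs => [|B l IH] Hs; first by rewrite !big_nil.
    rewrite !big_cons lerD //; first by apply: Hs; left.
    by apply: IH => B' h; apply: Hs; right.
  apply: le_trans (_ : _ <= c1 * A1 * (eta / (c1 * A1 + 1))) _.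
    by rewrite mulrA ler_wpM2l // ge_min lexx orbT.
  rewrite mulrA ler_pdivrMr; last by lra.
  by rewrite mulrC ler_pM2l //; lra.
have mu1 : 0 < mu + 1 by lra.
have q0 := QQ_ge0 d; have n0 := NN_ge0 d.
have k1 : 1 / (2 * (mu + 1)) * QQ d d <= 1 / (2 * (mu + 1)) * (4 * eta + mu * NN d d).
  by rewrite ler_pM2l.
have k2 : 1 / (2 * (mu + 1)) * (4 * eta + mu * NN d d) <= 2 * eta + NN d d / 2.
  rewrite mulrC mul1r ler_pdivrMr; last by lra.
  have : 0 <= mu * eta by rewrite mulr_ge0 // ltW.
  by lra.
have nd2 : NN d d <= 6 * eta by lra.
have me : 0 <= mu * eta by rewrite mulr_ge0 // ltW.
split; first by lra.
have : mu * NN d d <= mu * (6 * eta) by rewrite ler_wpM2l.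
by lra.
Qed.

(* A continuously differentiable approximation of the negative part, as [e] tends to 0. *)
Definition psi e (t : R) := Num.max (- t) 0 ^+ 2 / (Num.max (- t) 0 + e).
Definition dpsi e (t : R) :=
  - (Num.max (- t) 0 ^+ 2 + 2 * Num.max (- t) 0 * e) / (Num.max (- t) 0 + e) ^+ 2.

Let m_ge0 (t : R) : 0 <= Num.max (- t) 0. Proof. by rewrite le_max lexx orbT. Qed.

Let me_neq0 e (t : R) : 0 < e -> Num.max (- t) 0 + e != 0.
Proof. by move=> e0; rewrite gt_eqF // ltr_wpDl. Qed.

Lemma psi_cont e : 0 < e -> continuous (psi e).
Proof.
move=> e0; rewrite /psi; apply: contM; first by cts.
by apply: contV => [t|]; [exact: me_neq0|cts].
Qed.

Lemma dpsi_cont e : 0 < e -> continuous (dpsi e).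
Proof.
move=> e0; rewrite /dpsi; apply: contM; first by cts.
by apply: contV => [t|]; [rewrite expf_neq0 // me_neq0|cts].
Qed.

Lemma psi_nneg e (t : R) : 0 <= t -> psi e t = 0 /\ dpsi e t = 0.
Proof.
move=> t0; rewrite /psi /dpsi max_r; last by rewrite oppr_le0.
by rewrite expr0n /= mulr0 !mul0r addr0 oppr0 mul0r.
Qed.

Lemma psi_bounds e (t : R) : 0 < e -> [/\ 0 <= psi e t, psi e t <= Num.max (- t) 0,
  Num.max (- t) 0 - e <= psi e t & -1 <= dpsi e t <= 0].
Proof.
move=> e0; rewrite /psi /dpsi; set m := Num.max (- t) 0; have m0 : 0 <= m by exact: m_ge0.
have me : 0 < m + e by lra.
have me2 : 0 < (m + e) ^+ 2 by rewrite exprn_gt0.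
split.
- by rewrite divr_ge0 ?sqr_ge0 // ltW.
- by rewrite ler_pdivrMr // expr2 ler_wpM2l //; lra.
- by rewrite ler_pdivlMr //; rewrite expr2; have := sqr_ge0 e; rewrite expr2; lra.
have me0 : 0 <= m * e by rewrite mulr_ge0 // ltW.
have ee0 : 0 <= e * e by rewrite mulr_ge0 // ltW.
have mm0 : 0 <= m * m by rewrite mulr_ge0.
by rewrite ler_pdivlMr // ler_pdivrMr // !expr2; apply/andP; split; lra.
Qed.

(** The difference quotient of [f] at 0 is [g]. This handles the gluing point of functions defined
    by cases. *)
Lemma der_at0 (f g : R -> R) : (forall t, f t = t * g t) -> {for (0 : R), continuous g} ->
  is_derive (0 : R) 1 f (g 0).
Proof.
move=> fg cg.
have c : h^-1 *: (f (h *: 1 + 0) - f 0) @[h --> 0^'] --> g 0.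
  have : g h @[h --> 0^'] --> g 0 by apply: cvg_within_filter; exact: cg.
  apply: cvg_trans; apply: near_eq_cvg; near=> h.
  have h0 : h != 0 by near: h; exact: nbhs_dnbhs_neq.
  by rewrite addr0 !fg mul0r subr0 /GRing.scale /= mulr1 mulrA mulVf // mul1r.
have -> : g 0 = 'D_1 f 0 by apply/esym/cvg_lim => //; under eq_fun do rewrite [_ + 0]addrC addrC.
by apply: derivableP; apply/cvg_ex; exists (g 0).
Unshelve. all: by end_near.
Qed.

Lemma der_psi e (t : R) : 0 < e -> is_derive t 1 (psi e) (dpsi e t).
Proof.
move=> e0; have [t0|t0|t0] := ltgtP t 0.
- have et : e - t != 0 by rewrite gt_eqF //; lra.
  have d1 : is_derive t 1 (fun u => e - u) (-1) by dereq; ring.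
  have d2 := @derV _ (fun u => e - u) t (-1) et d1.
  apply: (@near_der _ (fun u => u ^+ 2 / (e - u)) _ (t - 1) 0); first by apply/andP; split; lra.
    move=> u /andP[_ u0]; rewrite /psi max_l; last by lra.
    by rewrite sqrrN addrC.
  dereq; rewrite /dpsi max_l; last by lra.
  have -> : - t + e = e - t by rewrite addrC.
  by field.
- have [_ ->] := psi_nneg e (ltW t0).
  apply: (@near_der _ (fun=> 0) _ 0 (t + 1)); first by apply/andP; split; lra.
    by move=> u /andP[u0 _]; have [-> _] := psi_nneg e (ltW u0).
rewrite {t}t0.
pose g u := Num.min u 0 / (Num.max (- u) 0 + e).
have -> : dpsi e 0 = g 0 by rewrite (psi_nneg e (lexx 0)).2 /g minxx mul0r.
apply: der_at0.
  move=> u; rewrite /psi /g; have [u0|u0] := leP u 0.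
    by rewrite max_l; [rewrite sqrrN expr2 mulrA|lra].
  by rewrite max_r; [rewrite expr0n /= !mul0r mulr0|lra].
have cg : continuous g.
  rewrite /g; apply: contM; first by cts.
  by apply: contV => [u|]; [exact: me_neq0|cts].
exact: cg.
Qed.

(** Freezing [f] beyond a point where its derivative vanishes keeps it differentiable: at [s0] the
    quotients tend to 0 on the left and are 0 on the right. *)
Lemma der_stop (f f' : R -> R) a b (s0 s : R) : a <= s0 <= b -> a < s < b ->
  (forall t, a < t < b -> is_derive t 1 f (f' t)) -> f' s0 = 0 ->
  is_derive s 1 (fun t => f (Num.min t s0)) (f' (Num.min s s0)).
Proof.
move=> /andP[as0 s0b] /andP[as' sb] df f0; have [ss|ss|ss] := ltgtP s s0.
- apply: (@near_der _ f _ a s0); first by rewrite as'.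
    by move=> t /andP[_ ts]; rewrite min_l // ltW.
  by apply: df; rewrite as'.
- rewrite f0; apply: (@near_der _ (fun=> f s0) _ s0 b); first by rewrite ss.
    by move=> t /andP[ts _]; rewrite min_r // ltW.
rewrite ss f0; have /df : a < s0 < b by rewrite -ss as'.
rewrite f0 => -[dv e0].
have c0 : h^-1 *: (f (h *: 1 + s0) - f s0) @[h --> 0^'] --> 'D_1 f s0 by exact: dv.
rewrite e0 in c0.
have c : h^-1 *: (f (Num.min (h *: 1 + s0) s0) - f (Num.min s0 s0)) @[h --> 0^'] --> 0.
  apply/cvgrPdist_le => e e1; move/cvgrPdist_le : c0 => /(_ e e1).
  apply: filterS => h /=; rewrite minxx.
  have [h0|h0] := leP (h *: 1 + s0) s0; first by [].
  by rewrite subrr scaler0 subrr normr0 => _; exact: ltW.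
have -> : 0 = 'D_1 (fun t : R => f (Num.min t s0)) s0 by apply/esym/cvg_lim.
by apply: derivableP; apply/cvg_ex; exists 0.
Qed.

Program Definition c1psi e (e0 : 0 < e) V : c1 := @C1fun _ _ _ (fun z => psi e (v0 V z))
  (fun z => dpsi e (v0 V z) * vs V z) (fun z => dpsi e (v0 V z) * vr V z) _ _ _ _ _.
Next Obligation. by move=> e e0 V; apply: (cont_comp (psi_cont e0) (@cont_v0 _ _ _ V)). Qed.
Next Obligation.
move=> e e0 V; have c := cont_comp (dpsi_cont e0) (@cont_v0 _ _ _ V).
by apply: contM => //; exact: cont_vs.
Qed.
Next Obligation.
move=> e e0 V; have c := cont_comp (dpsi_cont e0) (@cont_v0 _ _ _ V).
by apply: contM => //; exact: cont_vr.
Qed.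
Next Obligation.
move=> e e0 V s r hs hr.
apply: der_eq (@der_comp _ (psi e) (fun t => v0 V (t, r)) s _ _ (der_psi _ e0) (der_vs V hs hr)) _.
by rewrite /=; ring.
Qed.
Next Obligation.
move=> e e0 V s r hs hr.
apply: der_eq (@der_comp _ (psi e) (fun t => v0 V (s, t)) r _ _ (der_psi _ e0) (der_vr V hs hr)) _.
by rewrite /=; ring.
Qed.

Lemma c1psi_even e (e0 : 0 < e) V : c1even V -> c1even (c1psi e0 V).
Proof. by move=> [v1 v2 v3]; split => z /=; rewrite ?v1 ?v2 ?v3 ?mulrN. Qed.

(** * Cutting the negative part at a signed slice *)

Section Stop.
Variables (e : R) (e0 : 0 < e) (V : c1) (s0 : R).
Hypothesis s0L : 0 <= s0 <= L / 2.
Hypothesis V_ge0 : forall r, 0 <= r <= delta -> 0 <= v0 V (s0, r).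

(** The second coordinate is clamped because [V_ge0] only speaks of the rectangle, whereas the
    truncated function has to vanish at every height to the right of [s0]. *)
Let p (z : R * R) : R * R := (Num.min z.1 s0, clamp 0 delta z.2).
Let p_cont : continuous p.
Proof.
by apply: cont_pair; [cts|exact: (cont_comp (@clamp_cont _ 0 delta) cont_snd)].
Qed.
Let W := c1psi e0 V.
Let clr r : 0 <= clamp 0 delta r <= delta. Proof. exact/clamp_in/ltW. Qed.
Let W0 r : v0 W (s0, clamp 0 delta r) = 0.
Proof. by rewrite /= (psi_nneg e (V_ge0 (clr r))).1. Qed.
Let W1 r : vs W (s0, clamp 0 delta r) = 0.
Proof. by rewrite /= (psi_nneg e (V_ge0 (clr r))).2 mul0r. Qed.
Let W2 r : vr W (s0, clamp 0 delta r) = 0.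
Proof. by rewrite /= (psi_nneg e (V_ge0 (clr r))).2 mul0r. Qed.
Let clE r : 0 < r < delta -> clamp 0 delta r = r.
Proof. by move=> /andP[r1 r2]; rewrite clamp_id // !ltW. Qed.

(** On the slice [s0], where [V >= 0], the smoothed negative part vanishes with its derivatives; the
    part to the left, continued by 0, is therefore still C1. *)
Program Definition c1stop : c1 := @C1fun _ _ _ (fun z => v0 W (p z))
  (fun z => vs W (p z)) (fun z => vr W (p z)) _ _ _ _ _.
Next Obligation. exact: (cont_comp (@cont_v0 _ _ _ W) p_cont). Qed.
Next Obligation. exact: (cont_comp (@cont_vs _ _ _ W) p_cont). Qed.
Next Obligation. exact: (cont_comp (@cont_vr _ _ _ W) p_cont). Qed.
Next Obligation.
move=> s r hs hr; rewrite /p /=.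
have s0b : 0 <= s0 <= L by move: s0L L0 => /andP[? ?] ?; apply/andP; split; lra.
have dW t : 0 < t < L -> is_derive t 1 (fun t => v0 W (t, clamp 0 delta r))
    (vs W (t, clamp 0 delta r)).
  by move=> ht; rewrite clE //; exact: (der_vs W ht hr).
exact: (@der_stop (fun t => v0 W (t, clamp 0 delta r)) _ 0 L s0 s s0b hs dW (W1 r)).
Qed.
Next Obligation.
move=> s r hs hr; have [ss|ss] := leP s0 s.
  have e1 t : p (s, t) = (s0, clamp 0 delta t) by rewrite /p /= min_r.
  have ef : (fun t => v0 W (p (s, t))) = fun=> 0 by apply/funext => t; rewrite e1; exact: W0.
  have ev : vr W (p (s, r)) = 0 by rewrite e1; exact: W2.
  apply: (@der_eq _ (fun t => v0 W (p (s, t))) r 0 _ _ (esym ev)).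
  by rewrite ef; exact: der_cst.
have e2 t : 0 < t < delta -> p (s, t) = (s, t).
  by move=> ht; rewrite /p /= (min_l (ltW ss)) clE.
apply: (@near_der _ (fun t => v0 W (s, t)) _ 0 delta) => //.
  by move=> t ht; rewrite e2.
by rewrite e2 //; exact: (der_vr W hs hr).
Qed.

Lemma c1stop_left z : z.1 <= s0 -> 0 <= z.2 <= delta ->
  [/\ v0 c1stop z = v0 W z, vs c1stop z = vs W z & vr c1stop z = vr W z].
Proof. by case: z => s r /= h hr; rewrite /p /= min_l // clamp_id. Qed.

Lemma c1stop_right z : s0 <= z.1 ->
  [/\ v0 c1stop z = 0, vs c1stop z = 0 & vr c1stop z = 0].
Proof.
case: z => s r /= h; rewrite /p /= min_r //.
by split; [exact: W0|exact: W1|exact: W2].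
Qed.

Definition rayl U z := qd U U z - mu * nd U U z.

Lemma rayl_cont U : continuous (rayl U).
Proof. by have h1 := @qd_cont U U; have h2 := @nd_cont U U; rewrite /rayl; cts. Qed.

Lemma RI_rayl U : J (rayl U) = QQ U U - mu * NN U U.
Proof.
rewrite /rayl (_ : J _ = J (fun z => 1 * qd U U z + (- mu) * nd U U z)); last first.
  by apply: RI_eq => z _ _; ring.
by rewrite RI_lin; [rewrite mul1r mulNr|exact: qd_cont|exact: nd_cont].
Qed.

Lemma RI_zero a b (c d : R) F : (forall z, a < z.1 <= b -> c < z.2 <= d -> F z = 0) ->
  RI a b c d F = 0.
Proof.
move=> F0; rewrite (_ : RI a b c d F = RI a b c d (fun=> 0 * 1 + 0 * 1)).
  by rewrite RI_lin ?mul0r ?addr0 //; exact: cont_cst.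
by apply: RI_eq => z z1 z2; rewrite F0 // mul0r addr0.
Qed.

(** The truncation vanishes beyond [s0 <= L / 2], so it does not interact with its reflection: its
    odd extension [O] is admissible for [mu], and each form of [O] is twice that of the
    truncation. *)
Lemma c1stop_rayl : 0 <= J (rayl c1stop).
Proof.
pose O := c1lin 1 c1stop (-1) (c1flip c1stop).
have oO : c1odd O by split => z; rewrite /O [LHS]/= [in RHS]/=; rewrite !flipK; ring.
have cross z : 0 < z.1 <= L -> nd c1stop (c1flip c1stop) z = 0 /\ qd c1stop (c1flip c1stop) z = 0.
  move=> zL; have [h|h] := leP s0 z.1.
    by have [e1 e2 e3] := c1stop_right h; rewrite /nd /qd e1 e2 e3; split; ring.
  have h' : s0 <= (@flip _ L z).1 by move: s0L => /andP[_ ?]; rewrite /flip /=; lra.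
  have [e1 e2 e3] := c1stop_right h'.
  have E0 : v0 (c1flip c1stop) z = 0 := e1.
  have E1 : vs (c1flip c1stop) z = 0 := etrans (congr1 -%R e2) (oppr0 _).
  have E2 : vr (c1flip c1stop) z = 0 := e3.
  by rewrite /nd /qd E0 E1 E2; split; ring.
have eN : NN c1stop (c1flip c1stop) = 0 by apply: RI_zero => z /cross[].
have eQ : QQ c1stop (c1flip c1stop) = 0 by apply: RI_zero => z /cross[].
have := mu_le oO; rewrite /O NN_lin QQ_lin !NN_linr !QQ_linr NN_flip QQ_flip.
rewrite (NNC (c1flip _) c1stop) (QQC (c1flip _) c1stop) eN eQ RI_rayl => h.
rewrite subr_ge0; nra.
Qed.

End Stop.

(** The smallness of [delta] in abstract form: on a slice where the function has a zero, the normal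
    derivative alone pays for the mass. *)
Hypothesis Hslice : forall s (g g1 : R -> R), 0 < s < L -> continuous g -> continuous g1 ->
  (forall r, 0 < r < delta -> is_derive r 1 g (g1 r)) ->
  (exists2 r0, 0 <= r0 <= delta & g r0 = 0) ->
  mu * \int[leb]_(r in Io 0 delta) (H (s, r) * g r ^+ 2) <=
  \int[leb]_(r in Io 0 delta) (H (s, r) * g1 r ^+ 2).

(** The tangential part of the energy is dropped and [Hslice] is integrated over the slices. *)
Lemma rayl_slices a b V : 0 <= a -> a <= b -> b <= L ->
  (forall s, a < s < b -> exists2 r0, 0 <= r0 <= delta & v0 V (s, r0) = 0) ->
  0 <= RI a b 0 delta (rayl V).
Proof.
move=> a0 ab bL Z.
have cn := @nd_cont V V.
have cHr : continuous (fun z => H z * vr V z ^+ 2) by cts.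
have cr := @rayl_cont V.
have h : RI a b 0 delta (fun z => mu * nd V V z + 0 * nd V V z) <=
    RI a b 0 delta (fun z => H z * vr V z ^+ 2).
  apply: RI_slice_le1; [exact: ltW|by cts|exact: cHr|].
  move=> s /andP[s1 s2] /=.
  have cr1 := @cont_row _ (fun z => nd V V z) s cn.
  rewrite (Rintegral_Io_lin 0 delta _ _ cr1 cr1) mul0r addr0.
  rewrite (_ : \int[leb]_(r in Io 0 delta) nd V V (s, r) =
    \int[leb]_(r in Io 0 delta) (H (s, r) * v0 V (s, r) ^+ 2)); last first.
    by apply: eq_Rintegral => r _; rewrite /nd expr2.
  have hs : 0 < s < L by apply/andP; split; lra.
  apply: (Hslice hs (@cont_row _ (v0 V) s (@cont_v0 _ _ _ V))
    (@cont_row _ (vr V) s (@cont_vr _ _ _ V))).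
    by move=> r hr; exact: (der_vr V hs hr).
  by apply: Z; rewrite s1.
apply: le_trans (_ : RI a b 0 delta (fun z => 1 * (H z * vr V z ^+ 2) +
   (-1) * (mu * nd V V z + 0 * nd V V z)) <= _).
  by rewrite RI_lin; [lra|exact: cHr|by cts].
apply: RI_le; [by cts|exact: cr|].
move=> z _ _; rewrite /rayl /qd -!expr2.
have : 0 <= vs V z ^+ 2 / H z by rewrite divr_ge0 ?sqr_ge0 // ltW.
by lra.
Qed.

(** Zeros of [V] are zeros of its smoothed negative part, so [rayl_slices] covers the middle;
    evenness identifies the outer parts with [c1stop] and its reflection. *)
Lemma rayl_psi e (e0 : 0 < e) V (s0 : R) : 0 <= s0 <= L / 2 -> c1even V ->
  (forall r, 0 <= r <= delta -> 0 <= v0 V (s0, r)) ->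
  (forall s, s0 < s <= L / 2 -> exists2 r0, 0 <= r0 <= delta & v0 V (s, r0) = 0) ->
  mu * NN (c1psi e0 V) (c1psi e0 V) <= QQ (c1psi e0 V) (c1psi e0 V).
Proof.
move=> s0L eV V0 Z; set W := c1psi e0 V; have eW : c1even W := c1psi_even e0 eV.
have /andP[s00 s0l] := s0L; have L0' := L0.
rewrite -subr_ge0 -RI_rayl; have cr := @rayl_cont W.
pose S := c1stop e0 s0L V0; have cS := @rayl_cont S; have cF := @rayl_cont (c1flip S).
have rS := c1stop_rayl e0 s0L V0; rewrite -/S in rS.
have rF : 0 <= J (rayl (c1flip S)) by rewrite RI_rayl QQ_flip NN_flip -RI_rayl.
rewrite (@RI_split1 _ 0 s0 L) //; last by apply/andP; split; lra.
rewrite (@RI_split1 _ s0 (L - s0) L) //; last by apply/andP; split; lra.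
have A1 : RI 0 s0 0 delta (rayl W) = J (rayl S).
  rewrite [RHS](@RI_split1 _ 0 s0 L) //; last by apply/andP; split; lra.
  rewrite [X in _ = _ + X]RI_zero ?addr0; last first.
    move=> z /andP[/ltW z1 _] _; have [e1 e2 e3] := c1stop_right e0 s0L V0 z1.
    by rewrite /rayl /qd /nd e1 e2 e3; ring.
  apply: RI_eq => z /andP[_ z1] /andP[/ltW z2 z3].
  have z23 : 0 <= z.2 <= delta by rewrite z2.
  have [e1 e2 e3] := c1stop_left e0 s0L V0 z1 z23.
  by rewrite /rayl /qd /nd e1 e2 e3.
have A3 : RI (L - s0) L 0 delta (rayl W) = J (rayl (c1flip S)).
  rewrite [RHS](@RI_split1 _ 0 (L - s0) L) //; last by apply/andP; split; lra.
  rewrite [X in _ = X + _]RI_zero ?add0r; last first.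
    move=> z /andP[_ z1] _; have z1' : s0 <= (@flip _ L z).1 by rewrite /flip /=; lra.
    have [e1 e2 e3] := c1stop_right e0 s0L V0 z1'.
    have E0 : v0 (c1flip S) z = 0 := e1.
    have E1 : vs (c1flip S) z = 0 := etrans (congr1 -%R e2) (oppr0 _).
    have E2 : vr (c1flip S) z = 0 := e3.
    by rewrite /rayl /qd /nd E0 E1 E2; ring.
  apply: RI_eq => z /andP[z1 _] /andP[/ltW z2 z3].
  have z23 : 0 <= (@flip _ L z).2 <= delta by rewrite /= z2.
  have z1' : (@flip _ L z).1 <= s0 by rewrite /flip /=; lra.
  have [e1 e2 e3] := c1stop_left e0 s0L V0 z1' z23.
  have [w1 w2 w3] := eW.
  have E0 : v0 (c1flip S) z = v0 W z := etrans e1 (w1 z).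
  have E1 : vs (c1flip S) z = vs W z := etrans (congr1 -%R (etrans e2 (w2 z))) (opprK _).
  have E2 : vr (c1flip S) z = vr W z := etrans e3 (w3 z).
  by rewrite /rayl /qd /nd E0 E1 E2.
have A2 : 0 <= RI s0 (L - s0) 0 delta (rayl W).
  apply: rayl_slices; [lra|lra|lra|] => s /andP[s1 s2].
  have [r0 hr0 e1] : exists2 r0, 0 <= r0 <= delta & v0 V (s, r0) = 0.
    have [sl|sl] := leP s (L / 2); first by apply: Z; rewrite s1.
    have [|r0 hr0 e1] := Z (L - s); first by apply/andP; split; lra.
    exists r0 => //; have [w1 _ _] := eV.
    by have := w1 (s, r0); rewrite /flip /= e1.
  by exists r0 => //=; rewrite e1 (psi_nneg e (lexx 0)).1.
by rewrite A1 A3; lra.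
Qed.

Definition mean V := NN V (c1cst 1).

Lemma NN_cauchy_schwarz V W : NN V W ^+ 2 <= NN V V * NN W W.
Proof.
apply: cauchy_schwarz_form; last exact: NN_ge0.
move=> t; have := NN_ge0 (c1lin 1 V t W); rewrite NN_lin !NN_linr (NNC W V).
by congr (_ <= _); ring.
Qed.

Lemma signed_slices V :
  (forall s, 0 < s <= L / 2 -> exists2 r0, 0 <= r0 <= delta & v0 V (s, r0) = 0) \/
   exists s0, [/\ 0 <= s0 <= L / 2,
     (forall s, s0 < s <= L / 2 -> exists2 r0, 0 <= r0 <= delta & v0 V (s, r0) = 0) &
     (forall r, 0 <= r <= delta -> 0 <= v0 V (s0, r)) \/
     (forall r, 0 <= r <= delta -> v0 V (s0, r) <= 0)].
Proof.
pose sgn s := (forall r, 0 <= r <= delta -> 0 <= v0 V (s, r)) \/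
     (forall r, 0 <= r <= delta -> v0 V (s, r) <= 0).
have cV s := @cont_row _ (v0 V) s (@cont_v0 _ _ _ V).
have mixed s : ~ sgn s -> exists r1 r2, [/\ 0 <= r1 <= delta, 0 <= r2 <= delta,
    v0 V (s, r1) < 0 & 0 < v0 V (s, r2)].
  move=> /not_orP[/existsNP[r1 /not_implyP[h1 /negP n1]] /existsNP[r2 /not_implyP[h2 /negP n2]]].
  by exists r1, r2; split => //; rewrite ltNge.
have zero s : ~ sgn s -> exists2 r0, 0 <= r0 <= delta & v0 V (s, r0) = 0.
  move=> /mixed[r1 [r2 [h1 h2 n1 n2]]].
  have [r12|r21] := leP r1 r2.
    have [|r0 /andP[a1 a2] e] := @IVT_cont _ (fun r => v0 V (s, r)) r1 r2 0 r12 (cV s).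
      by rewrite ge_min le_max (ltW n1) (ltW n2) orbT.
    by exists r0 => //; move: h1 h2 => /andP[? ?] /andP[? ?]; apply/andP; split; lra.
  have [|r0 /andP[a1 a2] e] := @IVT_cont _ (fun r => v0 V (s, r)) r2 r1 0 (ltW r21) (cV s).
    by rewrite ge_min le_max (ltW n1) (ltW n2) orbT.
  by exists r0 => //; move: h1 h2 => /andP[? ?] /andP[? ?]; apply/andP; split; lra.
pose A := [set s | 0 <= s <= L / 2 /\ sgn s].
have [[a Aa]|nA] := pselect (A !=set0); last first.
  left => s /andP[s1 s2]; apply: zero => ss; apply: nA; exists s; split => //.
  by rewrite s2 ltW.
have hA : has_sup A by split; [exists a | exists (L / 2) => s [/andP[]]].
right; exists (sup A).
have A0 : 0 <= sup A by apply: le_trans (_ : a <= _); [case: Aa => /andP[]|apply: ub_le_sup Aa; case: hA].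
have Al : sup A <= L / 2 by apply: ge_sup; [exists a|move=> s [/andP[]]].
have zr s : sup A < s <= L / 2 -> exists2 r0, 0 <= r0 <= delta & v0 V (s, r0) = 0.
  move=> /andP[s1 s2]; apply: zero => ss; have sp : 0 <= s by lra.
  move: s1; rewrite ltNge => /negP; apply; apply: ub_le_sup; first by case: hA.
  by split => //; rewrite sp.
split => //; first by rewrite A0.
have [//|/mixed[r1 [r2 [h1 h2 n1 n2]]]] := pselect (sgn (sup A)).
have c1 := @cont_col _ (v0 V) r1 (@cont_v0 _ _ _ V) (sup A).
have c2 := @cont_col _ (v0 V) r2 (@cont_v0 _ _ _ V) (sup A).
have f1 : \forall s \near sup A, v0 V (s, r1) < 0 by move/cvgr_lt : c1 => /(_ 0 n1).
have f2 : \forall s \near sup A, 0 < v0 V (s, r2) by move/cvgr_gt : c2 => /(_ 0 n2).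
have /nbhs_ballP[e /= e0 He] : nbhs (sup A) (fun s => v0 V (s, r1) < 0 /\ 0 < v0 V (s, r2)).
  by apply: filterS2 f1 f2 => s.
have [s [sl ss] sA] := sup_adherent e0 hA.
have sA' : s <= sup A by apply: ub_le_sup; [case: hA|].
have [b1 b2] : v0 V (s, r1) < 0 /\ 0 < v0 V (s, r2).
  by apply: He; rewrite /ball /= ger0_norm ?subr_ge0 //; lra.
by exfalso; case: ss => h; [have := h r1 h1|have := h r2 h2]; lra.
Qed.

(** The gradient of the smoothed negative part is [dpsi] times that of [V]; both bounds follow
    pointwise from [-1 <= dpsi <= 0], the first through [dpsi <= - dpsi ^ 2]. *)
Lemma QQ_psi e (e0 : 0 < e) V : QQ V (c1psi e0 V) <= - QQ (c1psi e0 V) (c1psi e0 V) /\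
  QQ (c1psi e0 V) (c1psi e0 V) <= QQ V V.
Proof.
set W := c1psi e0 V.
have c1 := @qd_cont V W; have c2 := @qd_cont W W; have c3 := @qd_cont V V.
have d01 z : -1 <= dpsi e (v0 V z) <= 0 by have [] := psi_bounds (v0 V z) e0.
split.
  rewrite -[- QQ W W]add0r -[0](mul0r (QQ W W)) -mulN1r /QQ -RI_lin //.
  apply: RI_le => //; first by cts.
  move=> z _ _; have := qd_ge0 V z; have /andP[] := d01 z.
  rewrite /qd /=; set p := dpsi e (v0 V z) => p1 p0 q0.
  have -> : 0 * (p * vs V z * (p * vs V z) / H z + H z * (p * vr V z * (p * vr V z))) +
    -1 * (p * vs V z * (p * vs V z) / H z + H z * (p * vr V z * (p * vr V z))) =
    (- p ^+ 2) * (vs V z * vs V z / H z + H z * (vr V z * vr V z)) by ring.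
  have -> : vs V z * (p * vs V z) / H z + H z * (vr V z * (p * vr V z)) =
     p * (vs V z * vs V z / H z + H z * (vr V z * vr V z)) by ring.
  by apply: ler_wpM2r => //; rewrite expr2; nra.
apply: RI_le => // z _ _; have := qd_ge0 V z; have /andP[] := d01 z.
rewrite /qd /=; set p := dpsi e (v0 V z) => p1 p0 q0.
have -> : p * vs V z * (p * vs V z) / H z + H z * (p * vr V z * (p * vr V z)) =
    p ^+ 2 * (vs V z * vs V z / H z + H z * (vr V z * vr V z)) by ring.
by rewrite ler_piMl //; rewrite expr2; nra.
Qed.

(** By [psi_bounds], the function [psi e (v0 V)] lies between the negative part of [V] and that
    negative part minus [e]. *)
Lemma NN_psi e (e0 : 0 < e) V : let W := c1psi e0 V in
  [/\ NN W W <= NN V V, - NN V W <= NN W W + e * mean W &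
   J (fun z => H z * Num.max (- v0 V z) 0) <= mean W + e * NN (c1cst 1) (c1cst 1)].
Proof.
move=> W.
have b z := psi_bounds (v0 V z) e0.
have n1 := @nd_cont W W; have n2 := @nd_cont V V; have n3 := @nd_cont V W.
have n4 := @nd_cont W (c1cst 1); have n5 := @nd_cont (c1cst 1) (c1cst 1).
have mm z : Num.max (- v0 V z) 0 ^+ 2 <= v0 V z ^+ 2 /\ Num.max (- v0 V z) 0 * psi e (v0 V z) = - v0 V z * psi e (v0 V z).
  have [h|h] := leP 0 (v0 V z).
    rewrite max_r ?oppr_le0 //; have [-> _] := psi_nneg e h.
    by rewrite !mulr0 expr0n /= sqr_ge0.
  by rewrite max_l ?sqrrN // oppr_ge0 ltW.
split.
- apply: RI_le => // z _ _; rewrite /nd -!expr2 /= ler_pM2l //.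
  have [p0 pm _ _] := b z; have [m2 _] := mm z.
  apply: le_trans m2; rewrite lerXn2r ?nnegrE //; exact: le_trans pm.
- have -> : - NN V W = J (fun z => (-1) * nd V W z + 0 * nd V W z).
    by rewrite RI_lin // mul0r addr0 mulN1r.
  have -> : NN W W + e * mean W = J (fun z => 1 * nd W W z + e * nd W (c1cst 1) z).
    by rewrite RI_lin // mul1r.
  apply: RI_le; [by cts|by cts|] => z _ _; rewrite /nd /=.
  have [p0 pm mp _] := b z; have [_ mE] := mm z.
  set p := psi e (v0 V z) in p0 pm mp mE *; set m := Num.max _ _ in pm mp mE.
  have -> : -1 * (H z * (v0 V z * p)) + 0 * (H z * (v0 V z * p)) = H z * (m * p).
    by rewrite mE; ring.
  have -> : 1 * (H z * (p * p)) + e * (H z * (p * 1)) = H z * ((p + e) * p) by ring.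
  by rewrite ler_pM2l // ler_wpM2r //; lra.
have -> : mean W + e * NN (c1cst 1) (c1cst 1) =
    J (fun z => 1 * nd W (c1cst 1) z + e * nd (c1cst 1) (c1cst 1) z).
  by rewrite RI_lin // mul1r.
apply: RI_le; [by cts|by cts|] => z _ _; rewrite /nd /=.
have [p0 pm mp _] := b z.
have -> : 1 * (H z * (psi e (v0 V z) * 1)) + e * (H z * (1 * 1)) = H z * (psi e (v0 V z) + e) by ring.
by rewrite ler_pM2l //; lra.
Qed.

(** With mean zero, the positive and the negative part have the same weighted integral. *)
Lemma abs_mean V : mean V = 0 ->
  J (fun z => H z * `|v0 V z|) = 2 * J (fun z => H z * Num.max (- v0 V z) 0).
Proof.
move=> m0; have n := @nd_cont V (c1cst 1).
have -> : J (fun z => H z * `|v0 V z|) = J (fun z => 1 * nd V (c1cst 1) z +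
    2 * (H z * Num.max (- v0 V z) 0)).
  apply: RI_eq => z _ _; rewrite /nd /=; have [h|h] := leP 0 (v0 V z).
    by rewrite max_r ?oppr_le0 // ger0_norm //; ring.
  by rewrite max_l ?oppr_ge0 ?ltW // ltr0_norm //; ring.
by rewrite RI_lin; [rewrite -/(NN V _) -/(mean V) m0 mulr0 add0r|exact: n|by cts].
Qed.

(** * No even function of mean zero below the odd level *)

Section EvenCase.
Variable V : c1.
Hypotheses (eV : c1even V) (mV : mean V = 0) (ltV : QQ V V < mu * NN V V).

Let S : set R := [set q | exists U, [/\ c1even U, mean U = 0, NN U U = 1 & q = QQ U U]].
(** Not assumed to be attained: [nu_cs] below plays the role of the Euler equation. *)
Let nu := inf S.

Let mean_lin a U b U' : mean (c1lin a U b U') = a * mean U + b * mean U'.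
Proof. exact: NN_lin. Qed.

Let V_gt0 : 0 < NN V V.
Proof.
rewrite lt_neqAle NN_ge0 andbT eq_sym; apply/eqP => n0.
by have := QQ_ge0 V; rewrite leNgt -[X in QQ V V < X](mulr0 mu) -n0 ltV.
Qed.

Let S_inf : has_inf S.
Proof.
split; last by exists 0 => _ [U [_ _ _ ->]]; exact: QQ_ge0.
have [a a1 _] := normalize V_gt0.
exists (QQ (c1lin a V 0 V) (c1lin a V 0 V)), (c1lin a V 0 V).
by split => //; [exact: c1even_lin|rewrite mean_lin mV !mulr0 addr0|rewrite NN_scale].
Qed.

Let nu_le U : c1even U -> mean U = 0 -> nu * NN U U <= QQ U U.
Proof.
move=> eU mU; have [n0|n0] := ltP 0 (NN U U); last first.
  have -> : NN U U = 0 by apply/eqP; rewrite eq_le n0 NN_ge0.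
  by rewrite mulr0 QQ_ge0.
have [a a1 a2] := normalize n0.
have : nu <= QQ (c1lin a U 0 U) (c1lin a U 0 U).
  apply: ge_inf; first by have [] := S_inf.
  exists (c1lin a U 0 U).
  by split => //; [exact: c1even_lin|rewrite mean_lin mU !mulr0 addr0|rewrite NN_scale].
by rewrite QQ_scale a2 mulrC ler_pdivlMr.
Qed.

(** The form [QQ - nu * NN] is nonnegative on even functions of mean zero, so Cauchy-Schwarz holds
    for it. Against a near-minimizer [U], the Euler equation holds up to the square root of the
    defect. *)
Let nu_cs U U' : c1even U -> mean U = 0 -> c1even U' -> mean U' = 0 ->
  (QQ U U' - nu * NN U U') ^+ 2 <=
  (QQ U U - nu * NN U U) * (QQ U' U' - nu * NN U' U').
Proof.
move=> eU mU eU' mU'; apply: cauchy_schwarz_form; last by rewrite subr_ge0; exact: nu_le.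
move=> t; have := @nu_le (c1lin 1 U t U') (c1even_lin _ _ eU eU').
rewrite mean_lin mU mU' !mulr0 addr0 => /(_ erefl).
rewrite !NN_lin !QQ_lin !NN_linr !QQ_linr (NNC U' U) (QQC U' U) -subr_ge0.
by congr (_ <= _); ring.
Qed.

Let nu_ge0 : 0 <= nu.
Proof.
apply: lb_le_inf; first by have [] := S_inf.
by move=> _ [U [_ _ _ ->]]; exact: QQ_ge0.
Qed.

Let nu_mu : nu < mu.
Proof.
have h := nu_le eV mV; rewrite -(ltr_pM2r V_gt0); exact: le_lt_trans h ltV.
Qed.

Let h0 := NN (c1cst 1) (c1cst 1).

Let h0_gt0 : 0 < h0.
Proof.
rewrite lt_neqAle NN_ge0 andbT eq_sym; apply/eqP => n0.
have [c0 [c2 [c00 c20 hb]]] := H_bounds.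
have : c0 * (L * delta) <= h0.
  have e : J (fun=> c0) = c0 * (L * delta).
    rewrite RI_fubini1; last exact: cont_cst.
    have L0' := ltW L0; have d0' := ltW d0.
    under eq_Rintegral do rewrite (Rintegral_Io_cst _ d0').
    by rewrite (Rintegral_Io_cst _ L0') !subr0; ring.
  rewrite -e; apply: RI_le; [exact: cont_cst|exact: nd_cont|].
  by move=> z z1 z2; have /andP[h _] := hb z z1 z2; rewrite /nd /= !mulr1.
by rewrite n0 leNgt !mulr_gt0.
Qed.

(** The defect is [e ^+ 2] so that its square root in [nu_cs] is [e]. If the extreme slice is
    nonpositive, [- w] replaces [w]. *)
Let near_min e : 0 < e -> exists w, [/\ c1even w, mean w = 0, NN w w = 1, QQ w w <= nu + e ^+ 2 &
  (forall s, 0 < s <= L / 2 -> exists2 r0, 0 <= r0 <= delta & v0 w (s, r0) = 0) \/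
   exists s0, [/\ 0 <= s0 <= L / 2,
     (forall s, s0 < s <= L / 2 -> exists2 r0, 0 <= r0 <= delta & v0 w (s, r0) = 0) &
     (forall r, 0 <= r <= delta -> 0 <= v0 w (s0, r))]].
Proof.
move=> e0; have e2 : 0 < e ^+ 2 by rewrite exprn_gt0.
have [_ [w [ew mw nw ->]] /ltW qw] := inf_adherent e2 S_inf.
have [Z|[s0 [h1 h2 [h3|h3]]]] := signed_slices w; [by exists w; split => //; left| |].
  by exists w; split => //; right; exists s0.
exists (c1lin (-1) w 0 w); split.
- exact: c1even_lin.
- by rewrite mean_lin mw !mulr0 addr0.
- by rewrite NN_scale nw sqrrN expr1n mul1r.
- by rewrite QQ_scale sqrrN expr1n mul1r.
right; exists s0; split => //.
  by move=> s /h2[r0 hr0 e']; exists r0 => //=; rewrite e'; ring.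
by move=> r /h3 /= h; lra.
Qed.

(** The approximate Euler equation is tested with the smoothed negative part [W]. Together with
    [QQ w W <= - QQ W W], [- NN w W <= NN W W + e * mean W] and [mu * NN W W <= QQ W W], it makes
    [(mu - nu) * NN W W] of order [e]. The mean-zero condition then carries the smallness from the
    negative part to the whole L1 norm. *)
Let psi_small e : 0 < e -> e <= 1 -> e < mu - nu -> exists w, [/\ NN w w = 1, QQ w w <= nu + 1 &
  J (fun z => H z * `|v0 w z|) ^+ 2 <=
    e * (4 * (2 * h0 * ((nu + 2) + nu * (1 + h0)) / (mu - nu) + 2 * h0 ^+ 2))].
Proof.
move=> e0 e1 emn.
have ee : e ^+ 2 <= e by rewrite expr2 ler_piMl // ltW.
have [w [ew mw nw qw cases]] := near_min e0.
have qw1 : QQ w w <= nu + 1 by lra.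
have qwm : QQ w w < mu by lra.
case: cases => [Z|[s0 [s0L Z wpos]]].
  exfalso; have L0' := L0.
  have ZL s : 0 < s < L -> exists2 r0, 0 <= r0 <= delta & v0 w (s, r0) = 0.
    move=> /andP[s1 s2]; have [sl|sl] := leP s (L / 2); first by apply: Z; rewrite s1.
    have [|r0 hr0 e'] := Z (L - s); first by apply/andP; split; lra.
    exists r0 => //; have [w1 _ _] := ew.
    by have := w1 (s, r0); rewrite /flip /= e'.
  have := rayl_slices (lexx 0) (ltW L0) (lexx L) ZL.
  by rewrite RI_rayl nw; lra.
exists w; split => //.
pose W := c1psi e0 w; have eW : c1even W := c1psi_even e0 ew.
have muW : mu * NN W W <= QQ W W := rayl_psi e0 s0L ew wpos Z.
have [q1 q2] := QQ_psi e0 w; rewrite -/W in q1 q2.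
have [n1 n2 n3] := NN_psi e0 w; rewrite -/W nw in n1 n2 n3.
(* The mean is subtracted to make [W] admissible in [nu_cs]. [QQ] ignores constants, and so does
   [NN w] since [mean w = 0]. *)
pose W' := c1lin 1 W (- (mean W / h0)) (c1cst 1).
have eW' : c1even W' by apply: c1even_lin => //; exact: c1even_cst.
have mW' : mean W' = 0.
  have mh : mean (c1cst 1) = h0 by [].
  by rewrite mean_lin mh mul1r mulNr divfK ?subrr // gt_eqF.
have QW' : QQ W' W' = QQ W W.
  rewrite /W' QQ_lin !QQ_linr !QQ_cst (QQC W (c1cst 1)) QQ_cst; ring.
have QwW' : QQ w W' = QQ w W by rewrite /W' QQ_linr (QQC w (c1cst 1)) QQ_cst; ring.
have NwW' : NN w W' = NN w W by rewrite /W' NN_linr [NN w (c1cst 1)]mw; ring.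
pose B := QQ w W - nu * NN w W.
have B2 : B ^+ 2 <= (QQ w w - nu * NN w w) * (QQ W' W' - nu * NN W' W').
  by rewrite /B -QwW' -NwW'; exact: nu_cs.
have QW0 := QQ_ge0 W; have NW0 := NN_ge0 W; have NW'0 := NN_ge0 W'.
have B3 : B ^+ 2 <= e ^+ 2 * QQ W W.
  apply: le_trans B2 _; apply: ler_pM.
  - by rewrite subr_ge0; exact: nu_le.
  - by rewrite subr_ge0; exact: nu_le.
  - by rewrite nw mulr1 lerBlDl.
  - by rewrite QW' gerBl mulr_ge0.
(* The estimate [Q <= (1 + Q) ^ 2] replaces a square root. *)
have B4 : - (e * (1 + QQ W W)) <= B.
  have p : 0 <= e * (1 + QQ W W) by rewrite mulr_ge0 ?addr_ge0 // ltW.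
  have : B ^+ 2 <= (e * (1 + QQ W W)) ^+ 2.
    apply: le_trans B3 _; rewrite exprMn ler_wpM2l ?sqr_ge0 //.
    have p2 := mulr_ge0 QW0 QW0.
    have -> : (1 + QQ W W) ^+ 2 = 1 + 2 * QQ W W + QQ W W * QQ W W by ring.
    lra.
  by rewrite !expr2; nra.
have mW2 : mean W ^+ 2 <= h0 * NN W W.
  by rewrite [h0 * _]mulrC; exact: NN_cauchy_schwarz.
have mW0 : 0 <= mean W.
  apply: RI_ge0 => z; rewrite /nd /= mulr1 mulr_ge0 //; first exact: ltW.
  by have [] := psi_bounds (v0 w z) e0.
have h0' := h0_gt0.
have mW1 : mean W <= 1 + h0.
  have m2 : mean W * mean W <= h0.
    by rewrite -expr2; apply: le_trans mW2 _; rewrite ler_piMr // ltW.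
  rewrite leNgt; apply/negP => lt; have hh := mulr_ge0 (ltW h0') (ltW h0').
  have p1 : 0 <= 1 + h0 by rewrite addr_ge0 // ltW.
  have := ler_pM p1 p1 (ltW lt) (ltW lt).
  by rewrite !mulrDl !mulrDr; lra.
have key : (mu - nu) * NN W W <= e * ((nu + 2) + nu * (1 + h0)).
  have t1 : nu * (- NN w W) <= nu * (NN W W + e * mean W) by rewrite ler_wpM2l.
  have t2 : e * (1 + QQ W W) <= e * (nu + 2) by rewrite ler_pM2l //; lra.
  have t3 : nu * (e * mean W) <= nu * (e * (1 + h0)) by rewrite ler_wpM2l // ler_pM2l.
  have e3 : - QQ w W = - B + nu * (- NN w W) by rewrite /B; ring.
  have e4 : nu * (NN W W + e * mean W) = nu * NN W W + nu * (e * mean W) by ring.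
  have e5 : e * ((nu + 2) + nu * (1 + h0)) = e * (nu + 2) + nu * (e * (1 + h0)) by ring.
  have e6 : (mu - nu) * NN W W = mu * NN W W - nu * NN W W by ring.
  lra.
set K1 := (nu + 2) + nu * (1 + h0) in key *.
have mn : 0 < mu - nu by rewrite subr_gt0.
have NWk : NN W W <= e * K1 / (mu - nu) by rewrite ler_pdivlMr // mulrC.
set tau := J _ in n3.
have tau0 : 0 <= tau.
  by apply: RI_ge0 => z; rewrite mulr_ge0 // ltW.
rewrite (abs_mean mw) -/tau exprMn.
have tau2 : tau ^+ 2 <= 2 * mean W ^+ 2 + 2 * (e * h0) ^+ 2.
  have : tau ^+ 2 <= (mean W + e * h0) ^+ 2.
    by rewrite lerXn2r ?nnegrE // addr_ge0 // mulr_ge0 // ltW.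
  by rewrite !expr2; have := sqr_ge0 (mean W - e * h0); rewrite expr2; lra.
have t1 : mean W ^+ 2 <= h0 * (e * K1 / (mu - nu)).
  by apply: le_trans mW2 _; rewrite ler_pM2l.
have t2 : (e * h0) ^+ 2 <= e * h0 ^+ 2 by rewrite exprMn ler_wpM2r ?sqr_ge0.
have e7 : e * (4 * (2 * h0 * K1 / (mu - nu) + 2 * h0 ^+ 2)) =
  4 * (2 * (h0 * (e * K1 / (mu - nu))) + 2 * (e * h0 ^+ 2)) by ring.
rewrite e7 (_ : 2 ^+ 2 = 4); last by ring.
by rewrite ler_pM2l //; lra.
Qed.

(** A small weighted L1 norm makes all cell averages small. In [grid_bound] the averages then
    contribute at most [1 / 4] and the energy at most [1 / 2], whereas the mass is 1. *)
Lemma even_case_absurd : False.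
Proof.
have mu0 := mu_ge0; have nm := nu_mu; have n0 := nu_ge0.
have e1 : 0 < 1 / (2 * (mu + 1)) by rewrite divr_gt0 //; lra.
have [c1 [Bs [c10 sB HB]]] := grid_bound e1.
have [c0 [c2 [c00 c20 hb]]] := H_bounds.
pose A1 := \sum_(B <- Bs) (area B)^-1.
have A0 B : List.In B Bs -> 0 < area B.
  by move=> /sB[_ h1 _ [_ h2 _]]; rewrite /area mulr_gt0 ?subr_gt0.
have A10 : 0 <= A1.
  rewrite /A1; elim: (Bs) (A0) => [|B l IH] hl; first by rewrite big_nil.
  rewrite big_cons addr_ge0 //; first by rewrite invr_ge0 ltW // hl //; left.
  by apply: IH => B' h; apply: hl; right.
set K2 := 4 * (2 * h0 * ((nu + 2) + nu * (1 + h0)) / (mu - nu) + 2 * h0 ^+ 2).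
have K20 : 0 <= K2.
  rewrite /K2 mulr_ge0 // addr_ge0 ?mulr_ge0 ?sqr_ge0 ?divr_ge0 ?invr_ge0 //; have := h0_gt0; try lra.
  by move=> ?; rewrite addr_ge0 ?mulr_ge0 //; lra.
pose C := c1 * (A1 / c0 ^+ 2).
have C0 : 0 <= C by rewrite mulr_ge0 ?divr_ge0 ?sqr_ge0 // ltW.
have CK : 0 <= C * K2 by rewrite mulr_ge0.
(* The first entry keeps [e < mu - nu]; the second bounds the contribution of the averages by
   [1 / 4]. *)
pose q := Num.min ((mu - nu) / 2) (1 / (4 * (C * K2 + 1))).
have q0 : 0 < q by rewrite lt_min !divr_gt0 //; lra.
pose e := Num.min 1 q.
have e0 : 0 < e by rewrite lt_min ltr01.
have e11 : e <= 1 by rewrite ge_min lexx.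
have eq1 : e <= (mu - nu) / 2 by rewrite !ge_min lexx orbT.
have eq2 : e <= 1 / (4 * (C * K2 + 1)) by rewrite !ge_min lexx !orbT.
have emn : e < mu - nu by lra.
have [w [nw qw tw]] := psi_small e0 e11 emn; rewrite -/K2 in tw.
set T := J _ in tw.
have T0 : 0 <= T by apply: RI_ge0 => z; rewrite mulr_ge0 // ltW.
have Bw B : List.In B Bs -> (BI B (v0 w)) ^+ 2 <= T ^+ 2 / c0 ^+ 2.
  move=> hB; have [b1 b2 b3 [b4 b5 b6]] := sB B hB.
  have cw := @cont_v0 _ _ _ w.
  have ca : continuous (fun z => `|v0 w z|) by cts.
  have h1 : `|BI B (v0 w)| <= BI B (fun z => `|v0 w z|).
    by apply: le_normr_Rintegral; [exact: measurable_Rc|exact: RI_integrable].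
  have h2 : BI B (fun z => `|v0 w z|) <= J (fun z => `|v0 w z|).
    apply: fine_le.
    - by apply: integrable_fin_num; [exact: measurable_Rc|exact: (RI_integrable _ _ _ _ ca)].
    - by apply: integrable_fin_num; [exact: measurable_Rc|exact: (RI_integrable _ _ _ _ ca)].
    apply: ge0_subset_integral; [exact: measurable_Rc|exact: measurable_Rc| | |].
    - by apply/measurable_EFinP; apply: measurable_funTS; exact: cont_measurable.
    - by move=> z _; rewrite lee_fin.
    move=> z /RcE[/andP[z1 z2] /andP[z3 z4]]; apply/RcE; split.
      by rewrite (le_lt_trans b1 z1) (le_trans z2 b3).
    by rewrite (le_lt_trans b4 z3) (le_trans z4 b6).
  have h3 : J (fun z => `|v0 w z|) <= T / c0.
    have -> : T / c0 = J (fun z => c0^-1 * (H z * `|v0 w z|) + 0 * `|v0 w z|).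
      by rewrite RI_lin; [rewrite mul0r addr0 mulrC|by cts|by cts].
    apply: RI_le; [exact: ca|by cts|] => z z1 z2; have /andP[h _] := hb z z1 z2.
    by rewrite mul0r addr0 mulrA ler_peMl // mulrC ler_pdivlMr // mul1r.
  rewrite -expr_div_n -(real_normK (num_real _)) lerXn2r ?nnegrE // ?divr_ge0 ?(ltW c00) //.
  by apply: le_trans h1 _; apply: le_trans h2 _.
have : NN w w <= C * T ^+ 2 + 1 / (2 * (mu + 1)) * QQ w w.
  apply: le_trans (HB w) _; rewrite lerD2r /C -mulrA ler_pM2l //.
  rewrite -mulrA mulrC -mulrA.
  have Hs : forall B, List.In B Bs -> (BI B (v0 w)) ^+ 2 / area B <= (T ^+ 2 / c0 ^+ 2) * (area B)^-1.
    by move=> B hB; rewrite ler_pM2r ?invr_gt0 ?A0 // Bw.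
  rewrite (_ : c0 ^- 2 * (T ^+ 2 * A1) = (T ^+ 2 / c0 ^+ 2) * A1); last by ring.
  rewrite /A1 mulr_sumr.
  elim: (Bs) Hs => [|B l IH] Hs; first by rewrite !big_nil.
  rewrite !big_cons lerD //; first by apply: Hs; left.
  by apply: IH => B' h; apply: Hs; right.
have k1 : 1 / (2 * (mu + 1)) * QQ w w <= 1 / 2.
  rewrite mulrC mul1r ler_pdivrMr; lra.
have k2 : C * T ^+ 2 <= C * (e * K2) by rewrite ler_wpM2l.
have k3 : C * (e * K2) <= 1 / 4.
  have -> : C * (e * K2) = e * (C * K2) by ring.
  apply: le_trans (_ : 1 / (4 * (C * K2 + 1)) * (C * K2) <= _); first by rewrite ler_wpM2r.
  rewrite mulrC mul1r ler_pdivrMr; lra.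
by rewrite nw; lra.
Qed.

End EvenCase.

(** Odd and even parts are orthogonal for both forms, and the odd part has mean zero, so the even
    part inherits mean zero from [V]. *)
Lemma rayleigh_mean_zero V : mean V = 0 -> mu * NN V V <= QQ V V.
Proof.
move=> mV.
have eQ := oddpart_evenpart QQ_lin QQC
  (fun V => QQ_odd_even (c1oddpart_odd V) (c1evenpart_even V)) QQ_flip V.
have eN := oddpart_evenpart NN_lin NNC
  (fun V => NN_odd_even (c1oddpart_odd V) (c1evenpart_even V)) NN_flip V.
rewrite eQ eN mulrDr lerD //; first by apply: mu_le; exact: c1oddpart_odd.
have eV := c1evenpart_even V.
have mE : mean (c1evenpart V) = 0.
  have : mean V = mean (c1oddpart V) + mean (c1evenpart V).
    by rewrite /mean /c1oddpart /c1evenpart !NN_lin; field.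
  by rewrite mV [mean (c1oddpart V)](NN_odd_even (c1oddpart_odd V) (c1even_cst 1)) add0r.
rewrite leNgt; apply/negP => lt; exact: (even_case_absurd eV mE lt).
Qed.

End Forms.

End Energy.
Export Energy.

(** * Transfer to the strip *)

Module Pullback.

Section ChainRule.
Context {R : realType}.

Lemma der_along (phi : R * R -> R) (a b : R -> R) (s a' b' : R) :
  differentiable phi (a s, b s) -> is_derive s 1 a a' -> is_derive s 1 b b' ->
  is_derive s 1 (fun t => phi (a t, b t))
    (a' * 'D_(@ex R) phi (a s, b s) + b' * 'D_(@ey R) phi (a s, b s)).
Proof.
move=> dp [da ea] [db eb].
have da' : differentiable a s by apply/derivable1_diffP.
have db' : differentiable b s by apply/derivable1_diffP.
have dg : differentiable (fun t => (a t, b t)) s by apply: differentiable_pair.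
have dc : differentiable (phi \o (fun t => (a t, b t))) s by apply: differentiable_comp.
apply: DeriveDef; first by apply/derivable1_diffP.
rewrite -[LHS]/('D_1 (phi \o (fun t => (a t, b t))) s) deriveE //.
rewrite (diff_comp dg dp) /= !deriveE //.
have -> : 'd (fun t => (a t, b t)) s 1 = a' *: @ex R + b' *: @ey R.
  rewrite diff_pair // -!deriveE // ea eb /ex /ey.
  by apply/pair_equal_spec; split; rewrite /= /GRing.scale /= !(mulr1, mulr0, addr0, add0r).
by rewrite linearD !linearZ.
Qed.

End ChainRule.

Section Transfer.
Context {R : realType} {L delta : R}.
Variable C : centerline L delta.
Local Notation mR := (measurableTypeR R).
Local Notation lebR := (@lebesgue_measure R).
Local Notation leb2 := (@lebesgue2 R).
Local Notation x := (cx C).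
Local Notation y := (cy C).
Local Notation x1 := (cx1 C).
Local Notation y1 := (cy1 C).
Local Notation k := (ck C).
Local Notation Phi := (Phi C).
Local Notation hh := (hh C).
Local Notation Om := (Om L delta).
Local Notation c1 := (c1fun L delta).
Local Notation J := (RI 0 L 0 delta).
Implicit Types (V W : c1) (F G : R * R -> R).

(** The Jacobian [hh] with clamped depth, which is positive and continuous on the whole plane as the
    abstract forms require. *)
Definition wt (z : R * R) := 1 + clamp 0 delta z.2 * k z.1.

Let cl_c : continuous (clamp 0 delta). Proof. exact: clamp_cont. Qed.
Let d0 : 0 < delta := delta_gt0 C.
Let L0 : 0 < L := L_gt0 C.

Lemma wt_cont : continuous wt.
Proof.
have c2 : continuous (fun z : R * R => clamp 0 delta z.2).
  exact: (@cont_comp _ _ _ (clamp 0 delta) snd cl_c cont_snd).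
rewrite /wt; cts.
Qed.

Lemma wt_gt0 z : 0 < wt z.
Proof. exact: (@hh_gt0 _ _ _ C z.1 (clamp 0 delta z.2) (clamp_in _ (ltW d0))). Qed.

Lemma wt_flip z : wt (@flip _ L z) = wt z.
Proof. by rewrite /wt /flip /= ck_sym. Qed.

Lemma wtE z : 0 <= z.2 <= delta -> wt z = hh z.
Proof. by move=> zd; rewrite /wt clamp_id. Qed.

Lemma wt_neq0 z : wt z != 0. Proof. by rewrite gt_eqF // wt_gt0. Qed.

Lemma wtV_cont : continuous (fun z => (wt z)^-1).
Proof. exact: (contV wt_neq0 wt_cont). Qed.

Lemma integral_Om_cont G : continuous G -> (forall z, 0 <= G z) ->
  (\int[leb2]_(z in Om) (G z)%:E = (J G)%:E)%E.
Proof.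
move=> cG G0; rewrite integral_Om //; last first.
  by apply/measurable_EFinP; exact: cont_measurable.
have inner s : (\int[lebR]_(r in (`]0%R, delta[%classic : set mR)) (G (s, r))%:E =
    (\int[lebR]_(r in Io 0 delta) G (s, r))%:E)%E.
  rewrite integral_itv_bndo_bndc; last first.
    apply/measurable_EFinP; apply: measurable_funTS.
    exact: (continuous_measurable_fun (@cont_row _ G s cG)).
  rewrite /Rintegral fineK //.
  have h := cont_integrable 0 delta (@cont_row _ G s cG).
  exact: (integrable_fin_num (measurable_Io 0 delta) h).
under eq_integral do rewrite inner.
have cI := @slice_cont _ 0 delta (fun s r => G (s, r)) (ltW d0) (eq_ind _ (fun f => continuous f) cG _
   (funext (fun z => esym (congr1 G (esym (surjective_pairing z)))))).
rewrite integral_itv_bndo_bndc; last first.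
  by apply/measurable_EFinP; apply: measurable_funTS; exact: (continuous_measurable_fun cI).
rewrite RI_fubini1 // [X in _ = X%:E]/Rintegral fineK //.
exact: (integrable_fin_num (measurable_Io 0 L) (cont_integrable 0 L cI)).
Qed.

Hypothesis inj : forall z z', Om z -> Om z' -> Phi z = Phi z' -> z = z'.
Local Notation D := (Dom C).
Local Notation Psi := (Psi C).

Lemma measurable_Dom : measurable (D : set (plane R)).
Proof. by apply: open_measurable_plane; exact: Dom_open. Qed.

Definition pb F : R * R -> R := fun p => F (Psi p).

Lemma pb_cont_at F p : continuous F -> D p -> {for p, continuous (pb F)}.
Proof.
move=> cF Dp; apply: (@continuous_comp _ _ _ Psi F); first exact: Psi_cont.
exact: cF.
Qed.

Lemma pb_measurable F : continuous F -> measurable_fun (D : set (plane R)) (pb F : plane R -> R).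
Proof.
move=> cF; apply: open_cont_measurable; first exact: Dom_open.
by move=> p Dp; exact: pb_cont_at.
Qed.

Lemma ge0_integral_Dom (f : R * R -> \bar R) :
  measurable_fun (D : set (plane R)) (f : plane R -> \bar R) -> (forall p, D p -> 0 <= f p)%E ->
  (\int[leb2]_(p in D) f p = \int[leb2]_(z in Om) ((hh z)%:E * f (Phi z)))%E.
Proof.
move=> mf f0; have mD := measurable_Dom.
have -> : (\int[leb2]_(p in D) f p = \int[leb2]_(p in D) ((f : plane R -> \bar R) \_ D) p)%E.
  by apply: eq_integral => p hp; rewrite patchE hp.
rewrite change_of_variables //.
- apply: eq_integral => z /set_mem hz; rewrite patchE mem_set //; by exists z.
- by apply/(measurable_restrictT _ _).1 => //.
- by move=> p; rewrite patchE; case: ifPn => // /set_mem; exact: f0.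
Qed.

Lemma integral_pb_ge0 G : continuous G -> (forall z, 0 <= G z) ->
  (\int[leb2]_(p in D) (pb G p)%:E = (J (fun z => wt z * G z))%:E)%E.
Proof.
move=> cG G0; rewrite ge0_integral_Dom; last 2 first.
- by apply/measurable_EFinP; exact: pb_measurable.
- by move=> p _; rewrite lee_fin; exact: G0.
rewrite -integral_Om_cont; last 2 first.
- by apply: contM => //; exact: wt_cont.
- by move=> z; rewrite mulr_ge0 // ltW // wt_gt0.
apply: eq_integral => z /set_mem hz; rewrite -EFinM /pb PhiK // wtE //.
by case: hz => _ /andP[/ltW-> /ltW->].
Qed.

Lemma pb_integrable G : continuous G -> leb2.-integrable D (EFin \o pb G).
Proof.
move=> cG; apply/integrableP; split; first by apply/measurable_EFinP; exact: pb_measurable.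
have e : (\int[leb2]_(p in D) `|(EFin \o pb G) p| = (J (fun z => wt z * `|G z|))%:E)%E.
  by rewrite -(integral_pb_ge0 (cont_norm cG)).
by rewrite e ltry.
Qed.

Lemma Rintegral_pb G : continuous G -> \int[leb2]_(p in D) pb G p = J (fun z => wt z * G z).
Proof.
move=> cG.
have cM := cont_max cG (@cont_cst (R * R)%type R 0).
have cN := cont_max (contN cG) (@cont_cst (R * R)%type R 0).
have e t : t = 1 * Num.max t 0 + -1 * Num.max (- t) 0 :> R.
  have [h|h] := leP 0 t; first by rewrite (max_r (_ : - t <= 0)); lra.
  by rewrite (max_l (_ : 0 <= - t)); lra.
have p0 F : continuous F -> (forall z, 0 <= F z) -> \int[leb2]_(p in D) pb F p = J (fun z => wt z * F z).
  by move=> cF F0; rewrite /Rintegral integral_pb_ge0.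
have -> : \int[leb2]_(p in D) pb G p = \int[leb2]_(p in D)
    (1 * pb (fun z => Num.max (G z) 0) p + -1 * pb (fun z => Num.max (- G z) 0) p).
  by congr Rintegral; apply/funext => p; rewrite /pb -e.
rewrite (Rintegral_lin measurable_Dom); last 2 first.
- exact: pb_integrable.
- exact: pb_integrable.
rewrite !p0 //; last 2 first.
- by move=> z; rewrite le_max lexx orbT.
- by move=> z; rewrite le_max lexx orbT.
rewrite -RI_lin; last 2 first.
- by apply: contM => //; exact: wt_cont.
- by apply: contM => //; exact: wt_cont.
by apply: RI_eq => z _ _; rewrite {3}(e (G z)); ring.
Qed.

Lemma pb_sq G : continuous G -> sq leb2 D (pb G).
Proof.
move=> cG; split; first exact: pb_measurable.
exact: (@pb_integrable (fun z => G z ^+ 2) (@contX _ _ 2 _ cG)).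
Qed.

Lemma pb_ip F G : continuous F -> continuous G ->
  ip leb2 D (pb F) (pb G) = J (fun z => wt z * (F z * G z)).
Proof. by move=> cF cG; rewrite /ip -(Rintegral_pb (contM cF cG)). Qed.

(** [gxd] and [gyd] are the Cartesian components of the gradient on the strip: [vs / wt] along the
    unit tangent [(x1, y1)] and [vr] along the normal [(y1, - x1)]. *)
Definition gxd V z := vs V z / wt z * x1 z.1 + vr V z * y1 z.1.
Definition gyd V z := vs V z / wt z * y1 z.1 - vr V z * x1 z.1.

Lemma gxd_cont V : continuous (gxd V).
Proof. by have h := wtV_cont; rewrite /gxd; cts. Qed.
Lemma gyd_cont V : continuous (gyd V).
Proof. by have h := wtV_cont; rewrite /gyd; cts. Qed.

Lemma pb_NN V W : ip leb2 D (pb (v0 V)) (pb (v0 W)) = NN wt V W.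
Proof. by rewrite pb_ip //; cts. Qed.

Lemma pb_mean V : \int[leb2]_(p in D) pb (v0 V) p = mean wt V.
Proof.
rewrite Rintegral_pb; last by cts.
by apply: RI_eq => z _ _; rewrite /nd /= mulr1.
Qed.

Lemma pb_QQ V W : ip leb2 D (pb (gxd V)) (pb (gxd W)) + ip leb2 D (pb (gyd V)) (pb (gyd W)) =
  QQ wt V W.
Proof.
have cw := wt_cont; have cxV := @gxd_cont V; have cyV := @gyd_cont V; have cxW := @gxd_cont W; have cyW := @gyd_cont W.
rewrite !pb_ip // -[X in X + _]mul1r -[X in _ + X]mul1r -RI_lin; [|by cts|by cts].
apply: RI_eq => z _ _; rewrite /qd /gxd /gyd.
have u := unit_speed C z.1; have w0 := wt_neq0 z.
have e : y1 z.1 ^+ 2 = 1 - x1 z.1 ^+ 2 by rewrite -u; ring.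
transitivity ((vs V z * vs W z / wt z + wt z * (vr V z * vr W z)) * (x1 z.1 ^+ 2 + y1 z.1 ^+ 2)).
  by field.
by rewrite u mulr1.
Qed.

Lemma test_notin phi p : test_function D phi -> ~ D p -> phi p = 0.
Proof.
move=> [_ _ sub] nD; apply/eqP; apply: contra_notT nD => h.
by apply: sub; apply: subset_closure.
Qed.

Lemma test_cont phi : test_function D phi -> [/\ continuous phi,
  continuous ('D_(@ex R) phi) & continuous ('D_(@ey R) phi)].
Proof.
move=> [sm _ _]; split => p; apply: differentiable_continuous.
- exact: (sm [::] p).
- exact: (sm [:: @ex R] p).
- exact: (sm [:: @ey R] p).
Qed.

(* With [(a, b)] the coordinates of a constant vector in the moving frame, this is the weak
   derivative along that vector. *)
Lemma weak_parts V phi (a b : R -> R) : test_function D phi ->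
  continuous a -> continuous b ->
  (forall s, 0 < s < L -> is_derive s 1 a (- (k s * b s))) ->
  J (fun z => wt z * (v0 V z * ((a z.1 * x1 z.1 + b z.1 * y1 z.1) * 'D_(@ex R) phi (Phi z) +
      (a z.1 * y1 z.1 - b z.1 * x1 z.1) * 'D_(@ey R) phi (Phi z)))) =
  - J (fun z => wt z * ((vs V z / wt z * a z.1 + vr V z * b z.1) * phi (Phi z))).
Proof.
move=> tf ca cb da.
have [cp cpx cpy] := test_cont tf; have cw := wt_cont; have cwV := wtV_cont.
have cPhi := @Phi_cont _ _ _ C; have chh := @hh_cont _ _ _ C.
have cF := @cont_comp _ _ _ phi Phi cp cPhi.
have cX := @cont_comp _ _ _ ('D_(@ex R) phi) Phi cpx cPhi.
have cY := @cont_comp _ _ _ ('D_(@ey R) phi) Phi cpy cPhi.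
pose Fs z := hh z * (x1 z.1 * 'D_(@ex R) phi (Phi z) + y1 z.1 * 'D_(@ey R) phi (Phi z)).
pose Fr z := y1 z.1 * 'D_(@ex R) phi (Phi z) - x1 z.1 * 'D_(@ey R) phi (Phi z).
(* [(P1, P2)] is a vector field with divergence [Q1 + Q2]. The curvature terms of [Q1] and [Q2]
   cancel, and the sum is the difference of the two sides. *)
pose P1 z := a z.1 * v0 V z * phi (Phi z).
pose P2 z := b z.1 * hh z * v0 V z * phi (Phi z).
pose Q1 z := a z.1 * (v0 V z * Fs z + vs V z * phi (Phi z)) - k z.1 * b z.1 * v0 V z * phi (Phi z).
pose Q2 z := b z.1 * (hh z * (v0 V z * Fr z + vr V z * phi (Phi z)) + k z.1 * v0 V z * phi (Phi z)).
have cA (F X Y : R * R -> R) : continuous F -> continuous X -> continuous Y ->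
  [/\ continuous (fun z => a z.1 * v0 V z * F z),
    continuous (fun z => b z.1 * hh z * v0 V z * F z),
    continuous (fun z => a z.1 * (v0 V z * (hh z * (x1 z.1 * X z + y1 z.1 * Y z)) + vs V z * F z)
      - k z.1 * b z.1 * v0 V z * F z),
    continuous (fun z => b z.1 * (hh z * (v0 V z * (y1 z.1 * X z - x1 z.1 * Y z) + vr V z * F z)
      + k z.1 * v0 V z * F z)) &
    continuous (fun z => wt z * (v0 V z * ((a z.1 * x1 z.1 + b z.1 * y1 z.1) * X z +
      (a z.1 * y1 z.1 - b z.1 * x1 z.1) * Y z))) /\
    continuous (fun z => wt z * ((vs V z / wt z * a z.1 + vr V z * b z.1) * F z))].
  by move=> cF0 cX0 cY0; clear -ca cb cw cwV chh cF0 cX0 cY0; split; [| | | |split]; cts.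
have [cP1 cP2 cQ1 cQ2 [cR1 cR2]] := cA _ _ _ cF cX cY.
have dF p : differentiable phi p by case: tf => sm _ _; exact: (sm [::] p).
have ds (s r : R) : 0 < s < L -> is_derive s 1 (fun t => phi (Phi (t, r))) (Fs (s, r)).
  move=> hs; have dx := der_cx C hs; have dy := der_cy C hs; have dx1 := der_cx1 C hs; have dy1 := der_cy1 C hs.
  have ha : is_derive s 1 (fun t => x t + r * y1 t) (x1 s + r * (k s * x1 s)) by dereq; ring.
  have hb : is_derive s 1 (fun t => y t - r * x1 t) (y1 s + r * (k s * y1 s)) by dereq; ring.
  apply: der_eq (@der_along _ phi _ _ s _ _ (dF _) ha hb) _.
  by rewrite /Fs /Tube.hh /Tube.Phi /=; ring.
have dr (s r : R) : is_derive r 1 (fun t => phi (Phi (s, t))) (Fr (s, r)).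
  have ha : is_derive r 1 (fun t => x s + t * y1 s) (y1 s) by dereq; ring.
  have hb : is_derive r 1 (fun t => y s - t * x1 s) (- x1 s) by dereq; ring.
  apply: der_eq (@der_along _ phi _ _ r _ _ (dF _) ha hb) _.
  by rewrite /Fr /Tube.Phi /=; ring.
(* [phi] vanishes on the image of the boundary of the rectangle, so integrating [Q1] and [Q2] along
   their variables leaves no boundary term. *)
have bd z : 0 <= z.1 <= L -> 0 <= z.2 <= delta -> ~ Om z -> phi (Phi z) = 0.
  by move=> h1 h2 h3; apply: test_notin tf _; exact: Phi_boundary_notin.
have J0 : J (fun=> 0) = 0 :> R by apply: RI_zero.
have nul (F : R * R -> R) : J F <= J (fun=> 0) -> J (fun=> 0) <= J F -> J F = 0.
  by rewrite J0 => h1 h2; apply/eqP; rewrite eq_le h1 h2.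
have z0 (a0 b0 : R) : a0 <= b0 -> \int[lebR]_(t in Io a0 b0) (0 : R) = 0.
  by move=> ab; rewrite (Rintegral_Io_cst 0 ab) mul0r.
have sl1 (r : R) : 0 < r < delta -> \int[lebR]_(s in Io 0 L) Q1 (s, r) = \int[lebR]_(s in Io 0 L) (0 : R).
  move=> hr; have hr' : 0 <= r <= delta by case/andP: hr => /ltW-> /ltW->.
  have dP t : 0 < t < L -> is_derive t 1 (fun s => P1 (s, r)) (Q1 (t, r)).
    move=> ht; have h1 := da t ht; have h2 := der_vs V ht hr; have h3 := ds t r ht.
    by rewrite /P1 /=; dereq; rewrite /Q1 /=; ring.
  rewrite (z0 0 L (ltW L0)).
  apply: etrans (Rintegral_der (ltW L0) (@cont_col _ P1 r cP1) (@cont_col _ Q1 r cQ1) dP) _.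
  rewrite /P1 /= !bd /= ?lexx ?(ltW L0) //; first by ring.
  - by case=> h _; move: h; rewrite /= ltxx ?andbF.
  - by case=> h _; move: h; rewrite /= ltxx ?andbF.
have sl2 (s : R) : 0 < s < L -> \int[lebR]_(r in Io 0 delta) Q2 (s, r) = \int[lebR]_(r in Io 0 delta) (0 : R).
  move=> hs; have hs' : 0 <= s <= L by case/andP: hs => /ltW-> /ltW->.
  have dP t : 0 < t < delta -> is_derive t 1 (fun r => P2 (s, r)) (Q2 (s, t)).
    move=> ht; have h2 := der_vr V hs ht; have h3 := dr s t.
    by rewrite /P2 /Tube.hh /=; dereq; rewrite /Q2 /Tube.hh /=; ring.
  rewrite (z0 0 delta (ltW d0)).
  apply: etrans (Rintegral_der (ltW d0) (@cont_row _ P2 s cP2) (@cont_row _ Q2 s cQ2) dP) _.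
  rewrite /P2 /= !bd /= ?lexx ?(ltW d0) //; first by ring.
  - by case=> _ h; move: h; rewrite /= ltxx ?andbF.
  - by case=> _ h; move: h; rewrite /= ltxx ?andbF.
have cz : continuous (fun _ : R * R => 0 : R) by exact: cont_cst.
have J1 : J Q1 = 0.
  by apply: nul; apply: RI_slice_le2 => //; rewrite ?(ltW L0) // => r hr; rewrite /= sl1.
have J2 : J Q2 = 0.
  by apply: nul; apply: RI_slice_le1 => //; rewrite ?(ltW d0) // => s hs; rewrite /= sl2.
apply/eqP; rewrite -subr_eq0 opprK -[X in X + _]mul1r -[X in _ + X]mul1r -RI_lin; [|exact: cR1|exact: cR2].
rewrite (_ : J _ = J (fun z => 1 * Q1 z + 1 * Q2 z)); first by rewrite RI_lin // J1 J2 !mulr0 addr0.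
apply: RI_eq => z _ /andP[z1 z2].
have ew : wt z = hh z by rewrite wtE // (ltW z1) z2.
have w0 : hh z != 0 by rewrite -ew wt_neq0.
by rewrite /Q1 /Q2 /Fs /Fr ew; field.
Qed.

(** [weak_parts] for the two coordinate vectors, whose coordinates in the moving frame are
    [(x1, y1)] and [(y1, - x1)]. *)
Lemma pb_H1 V : H1 D (pb (v0 V)) (pb (gxd V)) (pb (gyd V)).
Proof.
have mD := measurable_Dom.
have cv := @cont_v0 _ _ _ V; have cgx := @gxd_cont V; have cgy := @gyd_cont V.
split; [exact/L2P/pb_sq|exact/L2P/pb_sq|exact/L2P/pb_sq| |] => phi tf;
  have [cp cpx cpy] := test_cont tf; have cPhi := @Phi_cont _ _ _ C.
- have cF := @cont_comp _ _ _ phi Phi cp cPhi.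
  have cX := @cont_comp _ _ _ ('D_(@ex R) phi) Phi cpx cPhi.
  transitivity (\int[leb2]_(p in D) pb (fun z => v0 V z * 'D_(@ex R) phi (Phi z)) p).
    by apply: eq_Rintegral => p /set_mem Dp; rewrite /pb (PsiP Dp).2.
  transitivity (- \int[leb2]_(p in D) pb (fun z => gxd V z * phi (Phi z)) p); last first.
    by congr (- _); apply: eq_Rintegral => p /set_mem Dp; rewrite /pb (PsiP Dp).2.
  rewrite !Rintegral_pb; [|by cts|by cts].
  rewrite -(weak_parts V tf (@cx1_cont _ _ _ C) (@cy1_cont _ _ _ C) (@der_cx1 _ _ _ C)).
  apply: RI_eq => z _ _; have u := unit_speed C z.1.
  by rewrite -!expr2 u; ring.
- have cF := @cont_comp _ _ _ phi Phi cp cPhi.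
  have cY := @cont_comp _ _ _ ('D_(@ey R) phi) Phi cpy cPhi.
  transitivity (\int[leb2]_(p in D) pb (fun z => v0 V z * 'D_(@ey R) phi (Phi z)) p).
    by apply: eq_Rintegral => p /set_mem Dp; rewrite /pb (PsiP Dp).2.
  transitivity (- \int[leb2]_(p in D) pb (fun z => gyd V z * phi (Phi z)) p); last first.
    by congr (- _); apply: eq_Rintegral => p /set_mem Dp; rewrite /pb (PsiP Dp).2.
  have cx1N : continuous (fun s => - x1 s) by cts.
  have dy s : 0 < s < L -> is_derive s 1 y1 (- (k s * - x1 s)).
    by move=> hs; apply: der_eq (der_cy1 C hs) _; ring.
  rewrite !Rintegral_pb; [|by cts|by cts].
  have e : J (fun z => wt z * (gyd V z * phi (Phi z))) =
     J (fun z => wt z * ((vs V z / wt z * y1 z.1 + vr V z * - x1 z.1) * phi (Phi z))).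
    by apply: RI_eq => z _ _; rewrite /gyd; ring.
  rewrite e -(weak_parts V tf (@cy1_cont _ _ _ C) cx1N dy).
  apply: RI_eq => z _ _; have u := unit_speed C z.1.
  rewrite (_ : (y1 z.1 * x1 z.1 + - x1 z.1 * y1 z.1) = 0); last by ring.
  rewrite (_ : y1 z.1 * y1 z.1 - - x1 z.1 * x1 z.1 = x1 z.1 ^+ 2 + y1 z.1 ^+ 2); last by ring.
  by rewrite u; ring.
Qed.

End Transfer.

End Pullback.
Export Pullback.

(** * Density in H1 *)

Section DominatedConvergence.
Context d (T : measurableType d) (R : realType).
Variables (m : {measure set T -> \bar R}) (D : set T).
Hypothesis mD : measurable D.
Implicit Types (f g h : T -> R).

Lemma dominated_ip (f : nat -> T -> R) g : (forall n, measurable_fun D (f n)) -> sq m D g ->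
  (forall n x, D x -> `|f n x| <= g x) -> (forall x, D x -> f n x @[n --> \oo] --> (0 : R)) ->
  forall e, 0 < e -> exists n0, forall n, (n0 <= n)%N -> ip m D (f n) (f n) <= e.
Proof.
move=> mf sg fg f0 e e0.
have [] := @dominated_convergence _ _ _ m D mD (fun n x => (f n x ^+ 2)%:E) (cst 0%E)
  (fun x => (g x ^+ 2)%:E).
- by move=> n; apply/measurable_EFinP; exact: measurable_funX.
- exact: measurable_cst.
- apply: aeW => x Dx; apply/cvg_EFin; first by apply: nearW.
  have h := f0 x Dx; have c := cvgM h h; rewrite mulr0 in c.
  exact: (c _).
- exact: sg.2.
- apply: aeW => x n Dx; rewrite gee0_abs ?lee_fin ?sqr_ge0 //.
  by rewrite -(real_normK (num_real _)) lerXn2r // ?nnegrE // ?(le_trans (normr_ge0 _) (fg n x Dx)) //; exact: fg.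
move=> _ _; rewrite integral0 => /fine_cvg /cvgrPdist_le /(_ e e0) [n0 _ hn0].
exists n0 => n nn; have := hn0 n nn; rewrite /= sub0r normrN => h.
exact: le_trans (ler_norm _) h.
Qed.

Lemma ip_le2 f g h : sq m D f -> sq m D g -> sq m D h ->
  (forall x, D x -> f x ^+ 2 <= g x ^+ 2 + h x ^+ 2) -> ip m D f f <= ip m D g g + ip m D h h.
Proof.
move=> sf sg sh le.
have [ig ih] := (sg.2, sh.2).
rewrite -[X in X + _]mul1r -[X in _ + X]mul1r /ip -(Rintegral_lin mD).
- apply: le_Rintegral => //; first exact: sf.2.
  + exact: (integrable_lin mD 1 1 (sq_integrable mD sg sg) (sq_integrable mD sh sh)).
  + by move=> x Dx; rewrite !mul1r -!expr2; exact: le.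
- exact: (sq_integrable mD sg sg).
- exact: (sq_integrable mD sh sh).
Qed.

Lemma ip_le f g : sq m D f -> sq m D g -> (forall x, D x -> f x ^+ 2 <= g x ^+ 2) ->
  ip m D f f <= ip m D g g.
Proof.
move=> sf sg le; have s0 : sq m D (fun=> 0) by apply: (sq_eq mD _ (sqZ mD 0 sg)) => x _; rewrite mul0r.
have := ip_le2 sf sg s0; rewrite (_ : ip m D (fun=> 0) (fun=> 0) = 0) ?addr0; first apply.
  by move=> x Dx; rewrite expr0n addr0; exact: le.
by rewrite /ip mul0r /Rintegral integral0.
Qed.

Hypothesis finD : (m D < +oo)%E.

Lemma sq_bounded f (M : R) : measurable_fun D f -> (forall x, D x -> `|f x| <= M) -> sq m D f.
Proof.
move=> mf fM; have s1 : sq m D (fun=> 1).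
  split; first exact: measurable_cst.
  apply/integrableP; split; first exact: measurable_cst.
  under eq_integral do rewrite expr1n abse1.
  by rewrite integral_cst // mul1e.
apply: (sq_bound mD (M := M) mf s1) => x Dx; rewrite normr1 mulr1; exact: fM.
Qed.

End DominatedConvergence.

(** * Density of bounded continuous functions in L2 *)

Section ContinuousDense.
Import HBNNSimple.
Context {R : realType}.
Local Notation leb2 := (@lebesgue2 R).
Local Notation pl := (plane R).
Variable D : set pl.
Hypothesis mD : measurable D.
Hypothesis finD : (leb2 D < +oo)%E.
Local Notation nsq f := (ip leb2 D f f).
Implicit Types (A B : set pl) (u v g : R * R -> R).

Definition approximable u := sq leb2 D u /\ forall e, 0 < e -> exists g,
  [/\ continuous g, (exists M, forall z, `|g z| <= M) & nsq (fun z => u z - g z) <= e].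

Let mcont g : continuous g -> measurable_fun D (g : pl -> R).
Proof. by move=> cg; apply: measurable_funTS; exact: cont_measurable. Qed.

Let sqcont g (M : R) : continuous g -> (forall z, `|g z| <= M) -> sq leb2 D g.
Proof. by move=> cg gM; apply: (sq_bounded mD finD (mcont cg) (M := M)) => z _; exact: gM. Qed.

(** The range [[0, 1]] of the approximants makes them square integrable on [D], and makes the
    maximum of two of them an approximant for a union. *)
Let good A := measurable A /\ forall e, 0 < e -> exists g, [/\ continuous g,
  forall z, 0 <= g z <= 1 & nsq (fun z => \1_A z - g z) <= e].

Let sqind A : measurable A -> sq leb2 D (\1_A : pl -> R).
Proof.
move=> mA; apply: (sq_bounded mD finD (M := 1)).
  by apply: measurable_funTS; exact: measurable_indic.
by move=> z _; rewrite indicE; case: (_ \in _); rewrite ?normr1 ?normr0.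
Qed.

Let sq01 g : continuous g -> (forall z, 0 <= g z <= 1) -> sq leb2 D g.
Proof.
by move=> cg g01; apply: (sqcont (M := 1) cg) => z; have /andP[h1 h2] := g01 z; rewrite ger0_norm.
Qed.

Let nsq0 u : (forall z, u z = 0) -> nsq u = 0.
Proof.
move=> u0; rewrite /ip (_ : (fun x => u x * u x) = fun=> 0) ?/Rintegral ?integral0 //.
by apply/funext => z; rewrite u0 mul0r.
Qed.

Let good0 : good set0.
Proof.
split=> // e e0; exists (fun=> 0); split; [exact: cont_cst|by move=> z; rewrite lexx ler01|].
by rewrite nsq0 ?ltW // => z; rewrite indicE in_set0 subr0.
Qed.

Let goodC A : good A -> good (setT `\` A).
Proof.
move=> [mA gA]; split; first by rewrite setTD; exact: measurableC.
move=> e e0; have [g [cg g01 ge]] := gA e e0; exists (fun z => 1 - g z); split.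
- by move=> z; apply: cvgB; [exact: cvg_cst|exact: cg].
- by move=> z; have /andP[? ?] := g01 z; apply/andP; split; lra.
rewrite (_ : nsq _ = nsq (fun z => \1_A z - g z)) //; apply: eq_Rintegral => z _.
by rewrite setTD !indicE in_setC; case: (z \in A) => /=; ring.
Qed.

Let goodU A B : good A -> good B -> good (A `|` B).
Proof.
move=> [mA gA] [mB gB]; split; first exact: measurableU.
move=> e e0; have e20 : 0 < e / 2 by rewrite divr_gt0.
have [g [cg g01 ge]] := gA _ e20; have [h [ch h01 he]] := gB _ e20.
exists (fun z => Num.max (g z) (h z)); have cm := cont_max cg ch.
have m01 z : 0 <= Num.max (g z) (h z) <= 1.
  have /andP[a1 a2] := g01 z; have /andP[b1 b2] := h01 z.
  by rewrite le_max a1 /= ge_max a2.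
split=> //; have mU := measurableU _ _ mA mB.
apply: le_trans (_ : nsq (fun z => \1_A z - g z) + nsq (fun z => \1_B z - h z) <= e); last first.
  by rewrite [e]splitr lerD.
apply: ip_le2 => //; [| | |].
- by apply: sqB => //; [exact: sqind|exact: sq01].
- by apply: sqB => //; [exact: sqind|exact: sq01].
- by apply: sqB => //; [exact: sqind|exact: sq01].
move=> z _; have /andP[a1 a2] := g01 z; have /andP[b1 b2] := h01 z.
rewrite !indicE in_setU.
by have [gh|gh] := leP (g z) (h z); case: (z \in A) => /=; case: (z \in B) => /=; nra.
Qed.

Let good_lim A (F : nat -> set pl) : measurable A -> (forall n, good (F n)) ->
  (forall z, \1_(F n) z @[n --> \oo] --> (\1_A z : R)) -> good A.
Proof.
move=> mA gF FA; split=> // e e0; have e40 : 0 < e / 4 by rewrite divr_gt0.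
have mI n : measurable_fun D (fun z => \1_A z - \1_(F n) z : R).
  by apply: measurable_funB; apply: measurable_funTS; apply: measurable_indic => //; exact: (gF n).1.
have b n z : D z -> `|\1_A z - \1_(F n) z : R| <= 1.
  by move=> _; rewrite !indicE; case: (_ \in _) => /=; case: (_ \in _) => /=;
     rewrite ?subrr ?subr0 ?sub0r ?normrN ?normr1 ?normr0.
have s1 : sq leb2 D (fun=> 1).
  by apply: (sq_bounded mD finD (M := 1)) => [|z _]; [exact: measurable_cst|rewrite normr1].
have [] := dominated_ip mD mI s1 b _ e40.
  by move=> z _; rewrite -(subrr (\1_A z)); apply: cvgB; [exact: cvg_cst|exact: FA].
move=> n /(_ n (leqnn n)) h; have [g [cg g01 ge]] := (gF n).2 _ e40.
exists g; split=> //.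
have e1 : (fun z => \1_A z - g z) = (fun z => (\1_A z - \1_(F n) z) + (\1_(F n) z - g z)).
  by apply/funext => z; ring.
rewrite e1; apply: le_trans (ipDx2_le mD _ _) _.
- by apply: sqB => //; apply: sqind => //; exact: (gF n).1.
- by apply: sqB => //; [apply: sqind; exact: (gF n).1|exact: sq01].
lra.
Qed.

Let good_bigcup (F : nat -> set pl) : (forall n, good (F n)) -> good (\bigcup_n F n).
Proof.
move=> gF; pose U n := \big[setU/set0]_(i < n) F i.
apply: (@good_lim _ U).
- by apply: bigcup_measurable => n _; exact: (gF n).1.
- by elim=> [|n IH]; rewrite /U ?big_ord0 // big_ord_recr /=; exact: goodU.
move=> z; have [Uz|nUz] := pselect ((\bigcup_n F n) z).
  have [N _ FN] := Uz; apply: cvg_near_cst; exists N.+1 => // n /= Nn.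
  rewrite !indicE !mem_set //; rewrite /U -bigcup_mkord; exists N => //.
apply: cvg_near_cst; apply: nearW => n; rewrite !indicE !memNset // => Uz; apply: nUz.
by move: Uz; rewrite /U -bigcup_mkord => -[i _ Fi]; exists i.
Qed.

Let good_ray (f : R * R -> R) (a : R) : continuous f -> good (f @^-1` `]a, +oo[%classic).
Proof.
move=> cf; pose g n (z : R * R) := Num.min 1 (n%:R * Num.max (f z - a) 0).
set A := _ @^-1` _.
have mA : measurable A.
  by rewrite -[A]setTI; apply: (cont_measurable cf) => //; exact: measurable_itv.
have cg n : continuous (g n) by rewrite /g; cts.
have g01 n z : 0 <= g n z <= 1.
  by rewrite /g le_min ler01 mulr_ge0 //= ?ge_min ?lexx // le_max lexx orbT.
split=> // e e0.
have mI n : measurable_fun D (fun z => \1_A z - g n z : R).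
  by apply: measurable_funB; [apply: measurable_funTS; exact: measurable_indic|exact: mcont].
have b n z : D z -> `|\1_A z - g n z : R| <= 1.
  move=> _; have /andP[? ?] := g01 n z; rewrite indicE ler_norml.
  by case: (_ \in _) => /=; apply/andP; split; lra.
have s1 : sq leb2 D (fun=> 1).
  by apply: (sq_bounded mD finD (M := 1)) => [|z _]; [exact: measurable_cst|rewrite normr1].
have [] := dominated_ip mD mI s1 b _ e0.
  move=> z _; have [az|az] := ltP a (f z); last first.
    apply: cvg_near_cst; apply: nearW => n; rewrite indicE memNset ?/g; last first.
      by rewrite /A /= in_itv /= andbT; apply/negP; rewrite -leNgt.
    by rewrite max_r ?mulr0 ?min_r ?subrr ?subr_le0.
  have fa : 0 < f z - a by rewrite subr_gt0.
  apply: cvg_near_cst; have [N _ hN] := near_infty_natSinv_lt (PosNum fa).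
  exists N.+1 => // n /= Nn; rewrite indicE mem_set; last by rewrite /A /= in_itv /= andbT.
  rewrite /g max_l ?ltW // min_l ?subrr //.
  have := hN N (leqnn N) => /=; rewrite -div1r ltr_pdivrMr // => h.
  apply: le_trans (ltW h) _; rewrite mulrC ler_wpM2r ?(ltW fa) // ler_nat //; exact: ltnW.
by move=> n /(_ n (leqnn n)) h; exists (g n).
Qed.

(** The good sets form a sigma-algebra, and they contain the preimages of rays under both
    coordinates, which generate the measurable sets. *)
Let good_measurable A : measurable A -> good A.
Proof.
suff : g_sigma_preimageU (fst : R * R -> measurableTypeR R) (snd : R * R -> measurableTypeR R) `<=` good by exact.
have sg : sigma_algebra setT good.
  by split=> [|B|F]; [exact: good0|exact: goodC|exact: good_bigcup].
have pre (f : R * R -> R) : continuous f -> forall B : set (measurableTypeR R), measurable B -> good (f @^-1` B).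
  move=> cf B; rewrite RGenOInfty.measurableE.
  have s2 : sigma_algebra setT [set B | good (f @^-1` B)].
    split=> /=; [by rewrite preimage_set0|move=> B0 h|move=> F h].
    - by rewrite setTD preimage_setC -setTD; exact: goodC.
    - by rewrite preimage_bigcup; exact: good_bigcup.
  suff h : <<s RGenOInfty.G (R := R) >> `<=` [set B | good (f @^-1` B)] by exact: h.
  by apply: smallest_sub => // _ [a ->] /=; exact: good_ray.
apply: smallest_sub => //; rewrite subUset; split => _ [B mB <-]; rewrite setTI; apply: pre => //.
- exact: cont_fst.
- exact: cont_snd.
Qed.

Let approx_lin u v (a b : R) : approximable u -> approximable v ->
  approximable (fun z => a * u z + b * v z).
Proof.
move=> [su hu] [sv hv]; split; first exact: sq_lin.
move=> e e0; pose c := 4 * (a ^+ 2 + b ^+ 2 + 1).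
have c0 : 0 < c by rewrite /c; have := sqr_ge0 a; have := sqr_ge0 b; lra.
have ec : 0 < e / c by rewrite divr_gt0.
have [g [cg [Mg gM] ge]] := hu _ ec; have [h [ch [Mh hM] he]] := hv _ ec.
exists (fun z => a * g z + b * h z); split; first by cts.
  exists (`|a| * Mg + `|b| * Mh) => z; apply: le_trans (ler_normD _ _) _.
  by rewrite !normrM lerD // ler_wpM2l.
have e1 : (fun z => a * u z + b * v z - (a * g z + b * h z)) =
    (fun z => a * (u z - g z) + b * (v z - h z)) by apply/funext => z; ring.
have [sg sh] := (sqcont cg gM, sqcont ch hM).
have [sug svh] := (sqB mD su sg, sqB mD sv sh).
rewrite e1; apply: le_trans (ipDx2_le mD (sqZ mD a sug) (sqZ mD b svh)) _.
have sc (w : R * R -> R) (c' : R) : sq leb2 D w -> nsq (fun z => c' * w z) = c' ^+ 2 * nsq w.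
  by move=> sw; rewrite (ipZ mD c' sw (sqZ mD c' sw)) ipC (ipZ mD c' sw sw) mulrA expr2.
rewrite !sc //.
have n1 := ip_ge0 leb2 D (fun z => u z - g z); have n2 := ip_ge0 leb2 D (fun z => v z - h z).
have ee : e = c * (e / c) by rewrite mulrCA divff ?mulr1 // gt_eqF.
have k1 : a ^+ 2 * nsq (fun z => u z - g z) <= a ^+ 2 * (e / c) by rewrite ler_wpM2l // sqr_ge0.
have k2 : b ^+ 2 * nsq (fun z => v z - h z) <= b ^+ 2 * (e / c) by rewrite ler_wpM2l // sqr_ge0.
have fin (A B k N1 N2 : R) : A * N1 <= A * k -> B * N2 <= B * k -> 0 <= A * k -> 0 <= B * k ->
  0 <= k -> 2 * (A * N1) + 2 * (B * N2) <= 4 * (A + B + 1) * k by lra.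
by rewrite [X in _ <= X]ee; apply: fin => //;
  [exact: mulr_ge0 (sqr_ge0 _) (ltW ec)|exact: mulr_ge0 (sqr_ge0 _) (ltW ec)|exact: ltW].
Qed.

Let approx_ind A : measurable A -> approximable (\1_A).
Proof.
move=> mA; split; first exact: sqind.
move=> e e0; have [g [cg g01 ge]] := (good_measurable mA).2 e e0; exists g; split=> //.
by exists 1 => z; have /andP[h1 h2] := g01 z; rewrite ger0_norm.
Qed.

Let approx_ge0 v : sq leb2 D v -> (forall z, 0 <= v z) -> approximable v.
Proof.
move=> sv v0; split=> // e e0; have e40 : 0 < e / 4 by rewrite divr_gt0.
have mv : measurable_fun D (EFin \o v) by apply/measurable_EFinP; exact: sv.1.
pose s n (z : pl) : R := nnsfun_approx mD mv n z.
have v0' z : D z -> (0 <= (EFin \o v) z)%E by move=> _; rewrite lee_fin.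
have sle n z : D z -> 0 <= s n z <= v z.
  move=> Dz; rewrite /s nnsfun_approxE; apply/andP; split; last first.
    by have := @le_approx _ _ _ D (EFin \o v) n z v0' Dz; rewrite lee_fin.
  by rewrite -nnsfun_approxE; exact: fun_ge0.
have mI n : measurable_fun D (fun z => v z - s n z : R).
  by apply: measurable_funB; [exact: sv.1|apply: measurable_funTS; exact: measurable_funP].
have [] := dominated_ip mD mI sv _ _ e40.
- by move=> n z Dz; have /andP[? ?] := sle n z Dz; rewrite ger0_norm; lra.
- move=> z Dz; rewrite -(subrr (v z)); apply: cvgB; first exact: cvg_cst.
  by have /fine_cvg := cvg_nnsfun_approx mD mv v0' Dz.
move=> n /(_ n (leqnn n)) h.
have [ss hs] : approximable (s n).
  pose f := nnsfun_approx mD mv n.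
  have -> : s n = fun z => \sum_(y <- finmap.enum_fset (fset_set (range f))) (y * \1_(f @^-1` [set y]) z).
    by apply/funext => z; rewrite /s [LHS]fimfunE fsbig_finite.
  elim: (finmap.enum_fset _) => [|y l IH].
    under eq_fun do rewrite big_nil.
    have h0 := approx_ind (@measurable0 _ pl).
    by have := approx_lin 0 0 h0 h0; under eq_fun do rewrite !mul0r addr0.
  under eq_fun do rewrite big_cons -[X in _ + X]mul1r.
  by apply: approx_lin => //; apply: approx_ind.
have [g [cg [M gM] ge]] := hs _ e40; exists g; split=> //; first by exists M.
have e1 : (fun z => v z - g z) = (fun z => (v z - s n z) + (s n z - g z)).
  by apply/funext => z; ring.
rewrite e1; apply: le_trans (ipDx2_le mD (sqB mD sv ss) (sqB mD ss (sqcont cg gM))) _.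
lra.
Qed.

Lemma continuous_dense v : sq leb2 D v -> approximable v.
Proof.
move=> sv.
have mM (f : R * R -> R) : sq leb2 D f -> sq leb2 D (fun z => Num.max (f z) 0).
  move=> sf; apply: (sq_bound mD (M := 1) (g := f) _ sf).
    by apply: measurable_maxr; [exact: sf.1|exact: measurable_cst].
  by move=> z _; rewrite mul1r; have [h|h] := leP (f z) 0; rewrite ?normr0.
have sN : sq leb2 D (fun z => - v z) by apply: (sq_eq mD _ (sqZ mD (-1) sv)) => z _; rewrite mulN1r.
have -> : v = fun z => 1 * Num.max (v z) 0 + -1 * Num.max (- v z) 0.
  apply/funext => z; have [h|h] := leP 0 (v z); first by rewrite (max_r (_ : - v z <= 0)); lra.
  by rewrite (max_l (_ : 0 <= - v z)); lra.
by apply: approx_lin; apply: approx_ge0; do ?exact: mM; move=> z; rewrite le_max lexx orbT.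
Qed.

End ContinuousDense.

(** * Smooth functions flat at 0 *)

Section Bump.
Context {R : realType}.
Implicit Types (t : R).

(** The classical function [exp (- 1 / t)], divided by [t ^ n]. Derivatives of members of the family
    are combinations of members, which yields all orders at once. *)
Definition flat n t : R := if 0 < t then t ^- n * expR (- t^-1) else 0.

Lemma flat_shift n t : flat n t = t * flat n.+1 t.
Proof.
rewrite /flat; case: ifPn => t0; last by rewrite mulr0.
by rewrite exprS invfM !mulrA divff ?mul1r // gt_eqF.
Qed.

Lemma flat_ge0 n t : 0 <= flat n t.
Proof. by rewrite /flat; case: ifPn => // t0; rewrite mulr_ge0 ?expR_ge0 // invr_ge0 exprn_ge0 ?ltW. Qed.

(** From [u <= expR u] at [u = (n.+1%:R * t)^-1], raised to the power [n]; taking [n.+1] instead of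
    [n] covers [n = 0]. *)
Lemma flat_le n t : flat n t <= n.+1%:R ^+ n.
Proof.
rewrite /flat; case: ifPn => t0; last by rewrite exprn_ge0.
have n0 : 0 < n.+1%:R :> R by rewrite ltr0n.
have h : (n.+1%:R * t)^-1 <= expR (n.+1%:R * t)^-1.
  by apply: le_trans (expR_ge1Dx _); rewrite lerDr.
have h2 : (n.+1%:R * t)^-1 ^+ n <= expR t^-1.
  apply: le_trans (_ : expR (n.+1%:R * t)^-1 ^+ n <= _).
    by rewrite lerXn2r ?nnegrE ?expR_ge0 // invr_ge0 mulr_ge0 ?ltW.
  rewrite -expRM_natl ler_expR invfM mulrA ger_pMl ?invr_gt0 //.
  by rewrite ler_pdivrMr // mul1r ler_nat.
rewrite expRN -ler_pdivlMr ?invr_gt0 ?expR_gt0 // invrK.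
have h3 : n.+1%:R ^+ n * (n.+1%:R * t)^-1 ^+ n <= n.+1%:R ^+ n * expR t^-1.
  by rewrite ler_wpM2l // exprn_ge0 // ltW.
apply: le_trans h3; rewrite exprVn exprMn invfM mulrA divff ?mul1r //.
Qed.

Lemma flat_cont0 n : {for (0 : R), continuous (flat n)}.
Proof.
have f0 : flat n 0 = 0 by rewrite /flat ltxx.
apply/cvgrPdist_le => e e0; rewrite f0.
have c0 : 0 < n.+2%:R ^+ n.+1 :> R by rewrite exprn_gt0 // ltr0n.
have H : \forall t \near (0 : R), `|t| <= e / n.+2%:R ^+ n.+1.
  apply/nbhs_ballP; exists (e / n.+2%:R ^+ n.+1); first by rewrite /= divr_gt0.
  by move=> t; rewrite /ball /= sub0r normrN => /ltW.
near=> t; rewrite sub0r normrN ger0_norm ?flat_ge0 // flat_shift.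
apply: le_trans (_ : `|t| * n.+2%:R ^+ n.+1 <= e).
  by apply: le_trans (ler_norm _) _; rewrite normrM ler_wpM2l // ger0_norm ?flat_ge0 ?flat_le.
rewrite -ler_pdivlMr //; near: t.
exact: H.
Unshelve. all: end_near. Qed.

Lemma der_flat n t : is_derive t 1 (flat n) (- n%:R * flat n.+1 t + flat n.+2 t).
Proof.
have [t0|t0|->] := ltgtP t 0.
- have e : - n%:R * flat n.+1 t + flat n.+2 t = 0 :> R.
    by rewrite /flat !ifN -?leNgt ?ltW // mulr0 addr0.
  rewrite e; apply: (@near_der _ (fun=> 0) _ (t - 1) 0); first by apply/andP; split; lra.
    by move=> y /andP[_ y0]; rewrite /flat ifN // -leNgt ltW.
- apply: (@near_der _ (fun t => (t^-1) ^+ n * expR (- t^-1)) _ 0 (t + 1)).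
  + by apply/andP; split; lra.
  + by move=> y /andP[y0 _]; rewrite /flat y0 exprVn.
  have tn : t != 0 by rewrite gt_eqF.
  have dV : is_derive t 1 (fun t => t^-1) (- 1 / t ^+ 2) by apply: (@derV _ id t 1 tn (der_id t)).
  have dE := @der_comp _ expR (fun t => - t^-1) t _ _ (is_derive_expR _) (derN dV).
  dereq; rewrite /flat t0 !exprVn; case: n => [|n]; first by rewrite /= !exprS !expr0; field.
  rewrite -pred_Sn !exprS expr0; have := expf_neq0 n tn.
  by move: (t ^+ n) (n.+1%:R : R) => T N T0; field; rewrite ?tn ?T0.
- have e : - n%:R * flat n.+1 0 + flat n.+2 0 = flat n.+1 0 :> R.
    by rewrite /flat ltxx mulr0 addr0.
  rewrite e; apply: (@der_at0 _ (flat n) (flat n.+1)); first exact: flat_shift.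
  exact: flat_cont0.
Qed.

(** A class of expressions stable under differentiation: membership alone gives derivatives of every
    order. [sm2] does the same in two variables with sums of products, and leads to [smooth2]. *)
Inductive sm1 : (R -> R) -> Prop :=
| sm1_id : sm1 id
| sm1_cst c : sm1 (fun=> c)
| sm1_add f g : sm1 f -> sm1 g -> sm1 (fun t => f t + g t)
| sm1_mul f g : sm1 f -> sm1 g -> sm1 (fun t => f t * g t)
| sm1_flat n f : sm1 f -> sm1 (fun t => flat n (f t)).

Lemma sm1_der f : sm1 f -> exists2 g, sm1 g & forall t, is_derive t 1 f (g t).
Proof.
elim=> {f} [|c|f g sf [f' sf' df] sg [g' sg' dg]|f g sf [f' sf' df] sg [g' sg' dg]|n f sf [f' sf' df]].
- by exists (fun=> 1); [exact: sm1_cst|move=> t; exact: der_id].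
- by exists (fun=> 0); [exact: sm1_cst|move=> t; exact: der_cst].
- by exists (fun t => f' t + g' t); [exact: sm1_add|move=> t; exact: derD].
- exists (fun t => f t * g' t + g t * f' t); last by move=> t; exact: derM.
  by apply: sm1_add; exact: sm1_mul.
- exists (fun t => f' t * (- n%:R * flat n.+1 (f t) + flat n.+2 (f t))).
    apply: sm1_mul => //; apply: sm1_add; last exact: sm1_flat.
    by apply: (@sm1_mul (fun=> _)); [exact: sm1_cst|exact: sm1_flat].
  by move=> t; exact: (@der_comp _ (flat n) f t _ _ (der_flat _ _) (df t)).
Qed.

Inductive sm2 : (R * R -> R) -> Prop :=
| sm2_prod f g : sm1 f -> sm1 g -> sm2 (fun z => f z.1 * g z.2)
| sm2_add F G : sm2 F -> sm2 G -> sm2 (fun z => F z + G z).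

Lemma diff_comp_fst (U V W : normedModType R) (f : V -> U) (z : V * W) :
  differentiable f z.1 -> differentiable (fun z : V * W => f z.1) z.
Proof.
move=> df; have c : continuous (fst : V * W -> V) by exact: cont_fst.
by apply: (@differentiable_comp _ _ _ _ fst f); first exact: linear_differentiable.
Qed.

Lemma diff_comp_snd (U V W : normedModType R) (f : W -> U) (z : V * W) :
  differentiable f z.2 -> differentiable (fun z : V * W => f z.2) z.
Proof.
move=> df; have c : continuous (snd : V * W -> W) by exact: cont_snd.
by apply: (@differentiable_comp _ _ _ _ snd f); first exact: linear_differentiable.
Qed.

Lemma diff_prod (f g : R -> R) (z : R * R) (a b : R) :
  is_derive z.1 1 f a -> is_derive z.2 1 g b ->
  differentiable (fun z : R * R => f z.1 * g z.2) z /\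
  forall e : R * R, 'D_e (fun z : R * R => f z.1 * g z.2) z = e.1 * a * g z.2 + f z.1 * (e.2 * b).
Proof.
move=> hf hg; have [df _] := hf; have [dg _] := hg.
have df' : differentiable f z.1 by apply/derivable1_diffP.
have dg' : differentiable g z.2 by apply/derivable1_diffP.
have dF := @diff_comp_fst _ _ R f z df'.
have dG := @diff_comp_snd _ R _ g z dg'.
have d : differentiable (fun z : R * R => f z.1 * g z.2) z by exact: (differentiableM dF dG).
split=> // e.
have z1 : (z.1, z.2) = z by case: (z).
have hx' : is_derive z.1 1 (fun t => f t * g z.2) (a * g z.2) by dereq; ring.
have hy' : is_derive z.2 1 (fun t => f z.1 * g t) (f z.1 * b) by dereq; ring.
have hx := @der_along _ (fun z : R * R => f z.1 * g z.2) (fun t => t) (fun=> z.2) z.1 1 0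
  (eq_ind_r (fun z0 => differentiable _ z0) d z1) (der_id _) (der_cst _ _).
have hy := @der_along _ (fun z : R * R => f z.1 * g z.2) (fun=> z.1) (fun t => t) z.2 0 1
  (eq_ind_r (fun z0 => differentiable _ z0) d z1) (der_cst _ _) (der_id _).
rewrite z1 !(mul1r, mul0r, addr0, add0r) in hx hy.
have ex1 : 'D_(@ex R) (fun z : R * R => f z.1 * g z.2) z = a * g z.2.
  by have [_ <-] := hx'; have [_ <-] := hx.
have ey1 : 'D_(@ey R) (fun z : R * R => f z.1 * g z.2) z = f z.1 * b.
  by have [_ <-] := hy'; have [_ <-] := hy.
rewrite deriveE //; have ee : e = e.1 *: @ex R + e.2 *: @ey R.
  rewrite {1}(surjective_pairing e) /ex /ey; apply/pair_equal_spec.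
  by split; rewrite /= /GRing.scale /= !(mulr1, mulr0, addr0, add0r).
rewrite {1}ee linearD !linearZ -!deriveE // ex1 ey1.
by transitivity (e.1 * (a * g z.2) + e.2 * (f z.1 * b)); [by []|ring].
Qed.

Lemma sm2_der F : sm2 F -> (forall z, differentiable F z) /\ forall e, sm2 ('D_e F).
Proof.
elim=> {F} [f g sf sg|F G sF [dF hF] sG [dG hG]].
  have [f' sf' df] := sm1_der sf; have [g' sg' dg] := sm1_der sg.
  split=> [z|e]; first by have [] := diff_prod (df z.1) (dg z.2).
  have -> : 'D_e (fun z : R * R => f z.1 * g z.2) =
     (fun z => (e.1 * f' z.1) * g z.2 + f z.1 * (e.2 * g' z.2)).
    by apply/funext => z; have [_ ->] := diff_prod (df z.1) (dg z.2).
  apply: sm2_add.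
    by apply: (@sm2_prod (fun t => e.1 * f' t)) => //; apply: sm1_mul => //; exact: sm1_cst.
  by apply: (@sm2_prod f (fun t => e.2 * g' t)) => //; apply: sm1_mul => //; exact: sm1_cst.
split=> [z|e]; first exact: differentiableD.
have -> : 'D_e (fun z => F z + G z) = (fun z => 'D_e F z + 'D_e G z).
  by apply/funext => z; rewrite -[LHS]/('D_e (F + G) z) deriveD //; exact: diff_derivable.
exact: sm2_add.
Qed.

Lemma sm2_smooth F : sm2 F -> smooth2 F.
Proof.
move=> sF vs; suff : sm2 (iter_derive vs F) by move=> /sm2_der[].
by elim: vs => [//|e vs IH] /=; exact: (sm2_der IH).2.
Qed.

End Bump.

(** * Mollification by a product kernel *)

Section Kernel.
Context {R : realType}.
Local Notation mR := (measurableTypeR R).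
Local Notation leb := (@lebesgue_measure R).
Local Notation leb2 := (@lebesgue2 R).
Local Notation pl := (plane R).
Variable rho : R.
Hypothesis rho0 : 0 < rho.
Implicit Types (t : R) (p q : R * R).

(** A bump supported in [[- rho, rho]]; the shape of its argument follows the constructors of
    [sm1]. *)
Definition th t : R := flat 0 (rho ^+ 2 + -1 * (t * t)).
Definition th1 t : R := -1 * (t + t) * flat 2 (rho ^+ 2 + -1 * (t * t)).

Lemma der_th t : is_derive t 1 th (th1 t).
Proof.
have h : is_derive t 1 (fun t => rho ^+ 2 + -1 * (t * t)) (-1 * (t + t)) by dereq; ring.
apply: der_eq (@der_comp _ (flat 0) _ t _ _ (der_flat _ _) h) _.
by rewrite /th1; ring.
Qed.

Lemma th_even t : th (- t) = th t. Proof. by rewrite /th mulrNN. Qed.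

Lemma th_ge0 t : 0 <= th t. Proof. exact: flat_ge0. Qed.

Lemma th_le1 t : th t <= 1. Proof. by have := flat_le 0 (rho ^+ 2 + -1 * (t * t)); rewrite expr0. Qed.

Lemma flat_neg n t : rho <= `|t| -> flat n (rho ^+ 2 + -1 * (t * t)) = 0.
Proof.
move=> h; rewrite /flat ifN // -leNgt mulN1r subr_le0 -expr2 -(real_normK (num_real t)).
by rewrite lerXn2r // ?nnegrE // ltW.
Qed.

Lemma th_supp t : th t != 0 -> `|t| < rho.
Proof. by apply: contraNT; rewrite -leNgt => h; rewrite /th flat_neg. Qed.

Lemma th_gt0 t : `|t| < rho -> 0 < th t.
Proof.
move=> h; rewrite /th /flat ifT; last first.
  rewrite mulN1r subr_gt0 -expr2 -(real_normK (num_real t)).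
  by rewrite ltrXn2r // ?nnegrE // ltW.
by rewrite expr0 invr1 mul1r expR_gt0.
Qed.

Lemma th1_le t : `|th1 t| <= 18 * rho.
Proof.
have [h|h] := leP rho `|t|; first by rewrite /th1 flat_neg // mulr0 normr0 mulr_ge0 // ltW.
rewrite /th1 normrM (ger0_norm (flat_ge0 _ _)).
have h2 := flat_le 2 (rho ^+ 2 + -1 * (t * t)); have h3 := flat_ge0 2 (rho ^+ 2 + -1 * (t * t)).
have h1 : `|-1 * (t + t)| <= 2 * rho.
  by rewrite mulN1r normrN; apply: le_trans (ler_normD _ _) _; lra.
apply: le_trans (ler_pM (normr_ge0 _) h3 h1 h2) _.
rewrite -natrX; lra.
Qed.

Lemma th_cont : continuous th.
Proof. by move=> t; exact: (der_cont (der_th t)). Qed.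

Lemma th1_cont : continuous th1.
Proof.
have c2 : continuous (fun t => flat 2 (rho ^+ 2 + -1 * (t * t))).
  apply: cont_comp; last by cts.
  by move=> t; exact: (der_cont (der_flat 2 t)).
by rewrite /th1; cts.
Qed.

Lemma th_lip s t : `|th s - th t| <= 18 * rho * `|s - t|.
Proof.
wlog st : s t / s <= t.
  by move=> W; have [/W//|/ltW/W] := leP s t; rewrite distrC (distrC t).
have b u := th1_le u.
have cth := th_cont.
have d u := der_th u.
have h1 : 18 * rho * s - th s <= 18 * rho * t - th t.
  apply: (@der_le _ (fun u => 18 * rho * u - th u) (fun u => 18 * rho - th1 u)) => //.
  - by cts.
  - by move=> u _; have h := d u; dereq; ring.
  - by move=> u _; have := b u; rewrite ler_norml subr_ge0 => /andP[].
have h2 : 18 * rho * s + th s <= 18 * rho * t + th t.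
  apply: (@der_le _ (fun u => 18 * rho * u + th u) (fun u => 18 * rho + th1 u)) => //.
  - by cts.
  - by move=> u _; have h := d u; dereq; ring.
  - by move=> u _; have := b u; rewrite ler_norml => /andP[]; lra.
have -> : `|s - t| = t - s by rewrite distrC ger0_norm // subr_ge0.
by rewrite ler_norml; apply/andP; split; lra.
Qed.

Definition cth : R := \int[leb]_(t in Io (- rho) rho) th t.

Lemma cth_gt0 : 0 < cth.
Proof.
have rr : - rho < rho by have h := rho0; lra.
have [F cF dF] := primitive_exists rr th_cont.
rewrite /cth (Rintegral_der (ltW rr) cF th_cont dF) subr_gt0.
apply: (der_lt rr cF dF) => x /andP[h1 h2]; apply: th_gt0.
by rewrite ltr_norml h1.
Qed.

Lemma integral_th : (\int[leb]_t (th t)%:E = cth%:E)%E.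
Proof.
rewrite /cth /Rintegral fineK; last first.
  exact: (integrable_fin_num (measurable_Io _ _) (cont_integrable _ _ th_cont)).
rewrite [RHS]integral_mkcond; apply: eq_integral => t _; rewrite patchE.
case: ifPn => //; rewrite notin_setE /Io /= in_itv /= => h.
congr EFin; apply/eqP; apply: contra_notT h => /th_supp.
by rewrite ltr_norml => /andP[-> /ltW->].
Qed.

Lemma integral_th_shift (a : R) : (\int[leb]_t (th (a - t))%:E = cth%:E)%E.
Proof.
have ab : a - rho < a + rho by have h := rho0; lra.
have c1 : continuous (fun t => a - t) by cts.
have c2 : continuous (fun _ : R => -1 : R) by exact: cont_cst.
have d (s : R) : a - rho < s < a + rho -> is_derive s 1 (fun t => a - t) (-1) by move=> _; dereq; ring.
have sgn : (forall s, a - rho < s < a + rho -> 0 < -1 :> R) \/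
    (forall s, a - rho < s < a + rho -> -1 < 0 :> R) by right => s _; lra.
have mth : measurable_fun setT (EFin \o th : mR -> \bar R).
  by apply/measurable_EFinP; exact: (continuous_measurable_fun th_cont).
have th0 t : (0 <= (EFin \o th) t)%E by rewrite lee_fin th_ge0.
have su t : (EFin \o th) t != 0%E -> exists2 s, a - rho < s < a + rho & a - s = t.
  rewrite /= => h; exists (a - t); last by ring.
  have /th_supp : th t != 0 by apply: contraNneq h => ->.
  by rewrite ltr_norml => /andP[? ?]; apply/andP; split; lra.
rewrite -integral_th -[RHS](substitution ab c1 c2 d sgn mth th0 su).
rewrite [RHS]integral_mkcond; apply: eq_integral => t _; rewrite patchE.
case: ifPn => [_|]; first by rewrite normrN normr1 mul1e.
rewrite notin_setE /= in_itv /= => h.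
congr EFin; apply/eqP; apply: contra_notT h => /th_supp.
by rewrite ltr_norml => /andP[? ?]; apply/andP; split; lra.
Qed.

(** Normalized to mass 1 and supported in the square of half-side [rho] around [p]. [Ker1] and
    [Ker2] are its derivatives in [p], hence opposite to those in [q]. *)
Definition Ker p q : R := cth^-1 ^+ 2 * (th (p.1 - q.1) * th (p.2 - q.2)).
Definition Ker1 p q : R := cth^-1 ^+ 2 * (th1 (p.1 - q.1) * th (p.2 - q.2)).
Definition Ker2 p q : R := cth^-1 ^+ 2 * (th (p.1 - q.1) * th1 (p.2 - q.2)).
Definition kc : R := cth^-1 ^+ 2.

Let kc0 : 0 < kc. Proof. by rewrite exprn_gt0 // invr_gt0 cth_gt0. Qed.

Lemma Ker_ge0 p q : 0 <= Ker p q.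
Proof. by rewrite mulr_ge0 // ?(ltW kc0) // mulr_ge0 // th_ge0. Qed.

Lemma KerC p q : Ker p q = Ker q p.
Proof. by rewrite /Ker -th_even opprB -(th_even (p.2 - q.2)) opprB. Qed.

Lemma Ker_supp p q : Ker p q != 0 -> `|p.1 - q.1| < rho /\ `|p.2 - q.2| < rho.
Proof.
by rewrite /Ker !mulf_eq0 !negb_or => /and3P[_ /th_supp h1 /th_supp h2].
Qed.

Lemma Ker_le p q : Ker p q <= kc.
Proof.
rewrite /Ker -/kc ler_piMr ?(ltW kc0) //.
by rewrite mulr_ile1 ?th_ge0 ?th_le1.
Qed.

Lemma Ker12_le p q : `|Ker1 p q| <= kc * (18 * rho) /\ `|Ker2 p q| <= kc * (18 * rho).
Proof.
rewrite /Ker1 /Ker2 -/kc !(normrM kc) (ger0_norm (ltW kc0)).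
split; rewrite ler_wpM2l ?(ltW kc0) // normrM (ger0_norm (th_ge0 _)).
  by rewrite -[leRHS]mulr1 ler_pM ?th_ge0 ?th_le1 ?th1_le.
by rewrite -[leRHS]mul1r ler_pM ?th_ge0 ?th_le1 ?th1_le.
Qed.

Lemma Ker_lip p p' q :
  `|Ker p q - Ker p' q| <= kc * (18 * rho) * (`|p.1 - p'.1| + `|p.2 - p'.2|).
Proof.
rewrite /Ker -/kc -mulrBr normrM (ger0_norm (ltW kc0)) -mulrA ler_wpM2l ?(ltW kc0) //.
have -> : th (p.1 - q.1) * th (p.2 - q.2) - th (p'.1 - q.1) * th (p'.2 - q.2) =
   (th (p.1 - q.1) - th (p'.1 - q.1)) * th (p.2 - q.2) +
   th (p'.1 - q.1) * (th (p.2 - q.2) - th (p'.2 - q.2)) by ring.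
apply: le_trans (ler_normD _ _) _; rewrite [leRHS]mulrDr !normrM !(ger0_norm (th_ge0 _)).
have e1 : p.1 - q.1 - (p'.1 - q.1) = p.1 - p'.1 by ring.
have e2 : p.2 - q.2 - (p'.2 - q.2) = p.2 - p'.2 by ring.
have h1 := th_lip (p.1 - q.1) (p'.1 - q.1); have h2 := th_lip (p.2 - q.2) (p'.2 - q.2).
rewrite e1 in h1; rewrite e2 in h2.
apply: lerD.
  by rewrite -[leRHS]mulr1 ler_pM ?th_ge0 ?th_le1.
by rewrite -[leRHS]mul1r ler_pM ?th_ge0 ?th_le1.
Qed.

Let thc1 := th_cont.
Let th1c1 := th1_cont.

Let contAB (f g : R -> R) (p : R * R) : continuous f -> continuous g ->
  continuous (fun q : R * R => kc * (f (p.1 - q.1) * g (p.2 - q.2))).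
Proof.
move=> cf cg.
have c1 : continuous (fun q : R * R => f (p.1 - q.1)) by apply: (cont_comp cf); cts.
have c2 : continuous (fun q : R * R => g (p.2 - q.2)) by apply: (cont_comp cg); cts.
by cts.
Qed.

Lemma Ker_cont p : continuous (Ker p). Proof. exact: contAB. Qed.
Lemma Ker1_cont p : continuous (Ker1 p). Proof. exact: contAB. Qed.
Lemma Ker2_cont p : continuous (Ker2 p). Proof. exact: contAB. Qed.

Lemma Ker_mass p : (\int[leb2]_q (Ker p q)%:E = 1)%E.
Proof.
rewrite tonelli1; last 2 first.
- by apply/measurable_EFinP; apply: cont_measurable; exact: Ker_cont.
- by move=> q; rewrite lee_fin Ker_ge0.
have mth (a : R) : measurable_fun setT (fun t : mR => (th (a - t))%:E).
  apply/measurable_EFinP; have h : continuous (fun t => th (a - t)) by apply: (cont_comp thc1); cts.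
  exact: (continuous_measurable_fun h).
have inner s : (\int[leb]_r (Ker p (s, r))%:E = (kc * cth)%:E * (th (p.1 - s))%:E)%E.
  transitivity (\int[leb]_r ((kc * th (p.1 - s))%:E * (th (p.2 - r))%:E))%E.
    by apply: eq_integral => r _; rewrite /Ker /= -EFinM -/kc; congr EFin; ring.
  rewrite ge0_integralZl //.
  - by rewrite integral_th_shift -!EFinM; congr EFin; ring.
  - by move=> r _; rewrite lee_fin th_ge0.
  - by rewrite lee_fin mulr_ge0 // ?(ltW kc0) // th_ge0.
under eq_integral do rewrite inner.
rewrite ge0_integralZl //.
- rewrite integral_th_shift -EFinM; congr EFin; rewrite /kc.
  by have h : cth != 0 by [rewrite gt_eqF // cth_gt0]; field.
- by move=> r _; rewrite lee_fin th_ge0.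
- by rewrite lee_fin mulr_ge0 // ?(ltW kc0) // ltW // cth_gt0.
Qed.

Lemma Ker_smooth p : smooth2 (Ker p).
Proof.
apply: sm2_smooth.
rewrite (_ : Ker p = fun q => (kc * th (p.1 + -1 * q.1)) * th (p.2 + -1 * q.2)); last first.
  by apply/funext => q; rewrite /Ker -/kc !mulN1r; ring.
have h (a : R) : sm1 (fun t => th (a + -1 * t)).
  have hl : sm1 (fun t => a + -1 * t).
    apply: (@sm1_add _ (fun=> a)); first exact: sm1_cst.
    by apply: (@sm1_mul _ (fun=> -1)); [exact: sm1_cst|exact: sm1_id].
  apply: sm1_flat; apply: (@sm1_add _ (fun=> _)); first exact: sm1_cst.
  by apply: (@sm1_mul _ (fun=> _)); [exact: sm1_cst|exact: sm1_mul].
apply: (@sm2_prod _ (fun t => kc * th (p.1 + -1 * t)) (fun t => th (p.2 + -1 * t))) => //.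
by apply: sm1_mul => //; exact: sm1_cst.
Qed.

Lemma der_Ker p q : 'D_(@ex R) (Ker p) q = - Ker1 p q /\ 'D_(@ey R) (Ker p) q = - Ker2 p q.
Proof.
have e : Ker p = fun q => (kc * th (p.1 - q.1)) * th (p.2 - q.2).
  by apply/funext => z; rewrite /Ker -/kc; ring.
have d (a s : R) : is_derive s 1 (fun t => th (a - t)) (- th1 (a - s)).
  have h : is_derive s 1 (fun t => a - t) (-1) by dereq; ring.
  by apply: der_eq (@der_comp _ th _ s _ _ (der_th _) h) _; ring.
have d1 := d p.1 q.1; have d2 := d p.2 q.2.
have d1' : is_derive q.1 1 (fun t => kc * th (p.1 - t)) (- (kc * th1 (p.1 - q.1))) by dereq; ring.
rewrite e; have [_ h] := @diff_prod _ (fun t => kc * th (p.1 - t)) (fun t => th (p.2 - t)) q _ _ d1' d2.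
by rewrite !h /ex /ey /= /Ker1 /Ker2 -/kc; split; ring.
Qed.

Lemma der_Ker_curve (a b : R -> R) (s a' b' : R) q : is_derive s 1 a a' -> is_derive s 1 b b' ->
  is_derive s 1 (fun t => Ker (a t, b t) q) (a' * Ker1 (a s, b s) q + b' * Ker2 (a s, b s) q).
Proof.
move=> da db; rewrite /Ker /=.
have ha : is_derive s 1 (fun t => a t - q.1) a' by dereq; ring.
have hb : is_derive s 1 (fun t => b t - q.2) b' by dereq; ring.
have h1 := @der_comp _ th (fun t => a t - q.1) s _ _ (der_th _) ha.
have h2 := @der_comp _ th (fun t => b t - q.2) s _ _ (der_th _) hb.
by dereq; rewrite /Ker1 /Ker2 /=; ring.
Qed.

Section Mollifier.
Variable D : set pl.
Hypothesis mD : measurable D.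
Hypothesis finD : (leb2 D < +oo)%E.
Implicit Types (g u : R * R -> R).

Definition moll g p := \int[leb2]_(q in D) (Ker p q * g q).
Definition norm1 g := \int[leb2]_(q in D) `|g q|.

Let one_sq : sq leb2 D (fun=> 1).
Proof. by apply: (sq_bounded mD finD (M := 1)) => [|z _]; [exact: measurable_cst|rewrite normr1]. Qed.

Let sq_int g : sq leb2 D g -> leb2.-integrable D (EFin \o g).
Proof.
move=> sg; have := sq_integrable mD sg one_sq; rewrite (_ : EFin \o _ = EFin \o g) //.
by apply/funext => z; rewrite /= mulr1.
Qed.

Let mcont (f : R * R -> R) : continuous f -> measurable_fun D (f : pl -> R).
Proof. by move=> cf; apply: measurable_funTS; exact: cont_measurable. Qed.

Let prod_int (f g : R * R -> R) (M : R) : continuous f -> (forall z, `|f z| <= M) -> sq leb2 D g ->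
  leb2.-integrable D (EFin \o (fun q => f q * g q)).
Proof.
move=> cf fM sg; have sf := sq_bounded mD finD (mcont cf) (fun z _ => fM z).
exact: sq_integrable.
Qed.

Let absKer p q : `|Ker p q| <= kc. Proof. by rewrite ger0_norm ?Ker_ge0 ?Ker_le. Qed.

Lemma moll_int g p : sq leb2 D g -> leb2.-integrable D (EFin \o (fun q => Ker p q * g q)).
Proof. by move=> sg; apply: prod_int (@Ker_cont p) _ sg => q; exact: absKer. Qed.

Lemma moll_lip g p p' : sq leb2 D g ->
  `|moll g p - moll g p'| <= kc * (18 * rho) * (`|p.1 - p'.1| + `|p.2 - p'.2|) * norm1 g.
Proof.
move=> sg; set c := _ * (_ + _).
have ig := sq_int sg.
have -> : moll g p - moll g p' = \int[leb2]_(q in D) (1 * (Ker p q * g q) + -1 * (Ker p' q * g q)).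
  by rewrite (Rintegral_lin mD) ?mul1r ?mulN1r //; exact: moll_int.
have il := integrable_lin mD 1 (-1) (moll_int p sg) (moll_int p' sg).
apply: le_trans (le_normr_Rintegral mD il) _.
have ia : leb2.-integrable D (EFin \o (fun q => `|g q|)) by exact: integrable_norm.
have e1 : c * norm1 g = \int[leb2]_(q in D) (c * `|g q| + 0 * `|g q|).
  by rewrite (Rintegral_lin mD) // mul0r addr0.
rewrite e1; apply: le_Rintegral => //.
- exact: (integrable_norm il).
- exact: integrable_lin.
- move=> q _; rewrite mul0r addr0 mul1r mulN1r -mulrBl normrM ler_wpM2r //.
  exact: Ker_lip.
Qed.

Lemma moll_cont g : sq leb2 D g -> continuous (moll g).
Proof.
move=> sg p; apply/cvgrPdist_le => e e0.
pose c := kc * (18 * rho) * norm1 g.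
have n0 : 0 <= norm1 g by apply: Rintegral_ge0.
have k0 := ltW kc0; have r0 := ltW rho0.
have c0 : 0 <= c by rewrite /c; do ![apply: mulr_ge0 => //].
have c1 : 0 < c + 1 by lra.
suff H : \forall p' \near p, `|moll g p - moll g p'| <= e by exact: H.
apply/nbhs_ballP; exists (e / (2 * (c + 1))); first by rewrite /= divr_gt0 // mulr_gt0.
move=> p' /ball_box[h1 h2] /=; apply: le_trans (moll_lip p p' sg) _.
have -> : kc * (18 * rho) * (`|p.1 - p'.1| + `|p.2 - p'.2|) * norm1 g = c * (`|p.1 - p'.1| + `|p.2 - p'.2|).
  by rewrite /c; ring.
apply: le_trans (_ : c * (e / (c + 1)) <= e); last first.
  by rewrite mulrA ler_pdivrMr // mulrC ler_pM2l //; lra.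
rewrite ler_wpM2l //; apply: le_trans (lerD (ltW h1) (ltW h2)) _.
by rewrite invfM; have h : (c + 1)^-1 = (c + 1)^-1 by []; lra.
Qed.

(** Cauchy-Schwarz after writing the kernel as the square of [s], whose own squared norm on [D] is
    at most the mass 1. *)
Lemma moll_jensen g p : sq leb2 D g ->
  moll g p ^+ 2 <= \int[leb2]_(q in D) (Ker p q * g q ^+ 2).
Proof.
move=> sg; pose s q := Num.sqrt (Ker p q).
have ss q : s q * s q = Ker p q by rewrite -expr2 sqr_sqrtr // Ker_ge0.
have ms : measurable_fun D s.
  by apply: mcont => q; apply: (continuous_comp (@Ker_cont p q)); exact: sqrt_continuous.
have s1 q : `|s q| <= 1 + kc.
  rewrite ger0_norm ?sqrtr_ge0 //; have := ss q; have := Ker_le p q; have : 0 <= s q by exact: sqrtr_ge0.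
  by move=> h1 h2 h3; have k0 := kc0; nra.
have sqs : sq leb2 D s := sq_bounded mD finD ms (fun q _ => s1 q).
have sqsg : sq leb2 D (fun q => s q * g q).
  apply: (sq_bound mD (M := 1 + kc) _ sg) => [|q _]; last by rewrite normrM ler_wpM2r.
  by apply: measurable_funM => //; exact: sg.1.
have cs := ip_cauchy_schwarz mD sqs sqsg.
have e1 : ip leb2 D s (fun q => s q * g q) = moll g p.
  by apply: eq_Rintegral => q _; rewrite mulrA ss.
have e2 : ip leb2 D (fun q => s q * g q) (fun q => s q * g q) =
    \int[leb2]_(q in D) (Ker p q * g q ^+ 2).
  by apply: eq_Rintegral => q _; rewrite -ss; ring.
have e3 : ip leb2 D s s <= 1.
  have iK : leb2.-integrable D (EFin \o Ker p).
    by have := sq_integrable mD sqs sqs; rewrite (_ : EFin \o _ = EFin \o Ker p) //; apply/funext => q /=; rewrite ss.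
  rewrite -lee_fin (_ : ip leb2 D s s = \int[leb2]_(q in D) Ker p q); last first.
    by apply: eq_Rintegral => q _; rewrite ss.
  rewrite /Rintegral fineK; last exact: (integrable_fin_num mD iK).
  rewrite -(Ker_mass p); apply: ge0_subset_integral => //.
  - by apply/measurable_EFinP; apply: cont_measurable; exact: Ker_cont.
  - by move=> q _; rewrite lee_fin Ker_ge0.
rewrite e1 e2 in cs; apply: le_trans cs _.
by rewrite ler_piMl // Rintegral_ge0 // => q _; rewrite mulr_ge0 ?sqr_ge0 ?Ker_ge0.
Qed.

Definition moll1 g p := \int[leb2]_(q in D) (Ker1 p q * g q).
Definition moll2 g p := \int[leb2]_(q in D) (Ker2 p q * g q).

Lemma der_moll g (a b a' b' : R -> R) (u v s M : R) : sq leb2 D g -> u < s < v ->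
  (forall t, u < t < v -> is_derive t 1 a (a' t)) ->
  (forall t, u < t < v -> is_derive t 1 b (b' t)) ->
  (forall t, u < t < v -> `|a' t| <= M /\ `|b' t| <= M) ->
  is_derive s 1 (fun t => moll g (a t, b t))
    (a' s * moll1 g (a s, b s) + b' s * moll2 g (a s, b s)).
Proof.
move=> sg hs da db hM; have k0 := ltW kc0; have r0 := ltW rho0.
pose f t q := Ker (a t, b t) q * g q.
have df t q : u < t < v -> is_derive t 1 (f ^~ q)
    ((a' t * Ker1 (a t, b t) q + b' t * Ker2 (a t, b t) q) * g q).
  move=> ht; have h := der_Ker_curve q (da t ht) (db t ht).
  by rewrite /f; dereq; ring.
pose G q := 2 * M * (kc * (18 * rho)) * `|g q|.
have M0 : 0 <= M by have [h _] := hM s hs; exact: le_trans (normr_ge0 _) h.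
have G0 q : 0 <= G q by rewrite /G; do ![apply: mulr_ge0 => //].
have intG : leb2.-integrable D (EFin \o G).
  have ia : leb2.-integrable D (EFin \o (fun q => `|g q|)) by exact: (integrable_norm (sq_int sg)).
  have := integrable_lin mD (2 * M * (kc * (18 * rho))) 0 ia ia.
  by rewrite (_ : EFin \o _ = EFin \o G) //; apply/funext => q /=; rewrite mul0r addr0.
have is_in t : (`]u, v[%classic : set R) t -> u < t < v by rewrite /= in_itv.
have Is : (`]u, v[%classic : set R) s by rewrite /= in_itv.
have intf t : (`]u, v[%classic : set R) t -> leb2.-integrable D (EFin \o f t).
  by move=> _; exact: moll_int.
have derf t q : (`]u, v[%classic : set R) t -> D q -> derivable (f ^~ q) t 1.
  by move=> /is_in ht _; have [] := df t q ht.
have Gub t q : (`]u, v[%classic : set R) t -> D q -> `|partial1of2 f t q| <= G q.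
  move=> /is_in ht _; rewrite partial1of2E; have [_ ->] := df t q ht.
  rewrite normrM /G ler_wpM2r //; apply: le_trans (ler_normD _ _) _; rewrite (normrM (a' t)) (normrM (b' t)).
  have [h1 h2] := hM t ht; have [h3 h4] := Ker12_le (a t, b t) q.
  have := ler_pM (normr_ge0 _) (normr_ge0 _) h1 h3; have := ler_pM (normr_ge0 _) (normr_ge0 _) h2 h4.
  lra.
apply: DeriveDef.
  exact: (@derivable_under_integral _ _ _ leb2 f D mD s u v Is intf derf G G0 intG Gub).
rewrite -derive1E (@differentiation_under_integral _ _ _ leb2 f D mD s u v Is intf derf G G0 intG Gub).
rewrite -(Rintegral_lin mD); last 2 first.
- by apply: prod_int (@Ker1_cont _) _ sg => q; exact: (Ker12_le _ _).1.
- by apply: prod_int (@Ker2_cont _) _ sg => q; exact: (Ker12_le _ _).2.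
apply: eq_Rintegral => q _; rewrite partial1of2E; have [_ ->] := df s q hs.
by ring.
Qed.

Definition cbox p : set (R * R) := [set q | `|p.1 - q.1| <= rho /\ `|p.2 - q.2| <= rho].

Lemma Ker_test p : cbox p `<=` D -> test_function D (Ker p).
Proof.
move=> pD.
have cl : closure [set q | Ker p q != 0] `<=` cbox p.
  have cb : closed (cbox p).
    have -> : cbox p = (fun q : R * R => `|p.1 - q.1|) @^-1` [set t | t <= rho] `&`
                       (fun q : R * R => `|p.2 - q.2|) @^-1` [set t | t <= rho] by [].
    have c1 : continuous (fun q : R * R => `|p.1 - q.1|) by apply: cont_norm; cts.
    have c2 : continuous (fun q : R * R => `|p.2 - q.2|) by apply: cont_norm; cts.
    by apply: closedI; apply: closed_comp; do ?[exact: closed_le|move=> q _; exact: c1|move=> q _; exact: c2].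
  have /closure_id ec := cb; rewrite [X in _ `<=` X]ec; apply: closure_subset => q.
  by move=> /Ker_supp[/ltW ? /ltW ?].
split; [exact: Ker_smooth| |exact: subset_trans cl pD].
have sub : cbox p `<=` `[p.1 - rho, p.1 + rho] `*` `[p.2 - rho, p.2 + rho].
  move=> q [h1 h2]; split; rewrite /= in_itv /=; move: h1 h2; rewrite !ler_norml;
  by move=> /andP[? ?] /andP[? ?]; apply/andP; split; lra.
apply: (@subclosed_compact _ _ (`[p.1 - rho, p.1 + rho] `*` `[p.2 - rho, p.2 + rho])).
- exact: closed_closure.
- exact: compact_box.
- exact: subset_trans cl sub.
Qed.

(** When its square lies in [D], the kernel is itself a test function; the definition of the weak
    derivative then moves the derivative from the kernel to [u], the signs in [p] and [q]
    cancelling. *)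
Lemma moll_weak u ux uy p : sq leb2 D u -> cbox p `<=` D ->
  weak_derivative D (@ex R) u ux -> weak_derivative D (@ey R) u uy ->
  moll1 u p = moll ux p /\ moll2 u p = moll uy p.
Proof.
move=> su pD wx wy; have t := Ker_test pD.
have aux (f f' h : R * R -> R) : (forall q, f q = - f' q) ->
    leb2.-integrable D (EFin \o (fun q => f' q * u q)) ->
    (\int[leb2]_(q in D) (u q * f q) = - \int[leb2]_(q in D) (h q * Ker p q)) ->
    (\int[leb2]_(q in D) (f' q * u q) = \int[leb2]_(q in D) (Ker p q * h q)).
  move=> ff' i e.
  have -> : \int[leb2]_(q in D) (Ker p q * h q) = \int[leb2]_(q in D) (h q * Ker p q).
    by apply: eq_Rintegral => q _; rewrite mulrC.
  rewrite -[RHS]opprK -e.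
  have -> : \int[leb2]_(q in D) (u q * f q) =
     \int[leb2]_(q in D) (-1 * (f' q * u q) + 0 * (f' q * u q)).
    by apply: eq_Rintegral => q _; rewrite ff'; ring.
  by rewrite (Rintegral_lin mD) // mul0r addr0 mulN1r opprK.
split; [apply: aux (wx _ t)|apply: aux (wy _ t)].
- by move=> q; exact: (der_Ker p q).1.
- by apply: prod_int (@Ker1_cont _) _ su => q; exact: (Ker12_le _ _).1.
- by move=> q; exact: (der_Ker p q).2.
- by apply: prod_int (@Ker2_cont _) _ su => q; exact: (Ker12_le _ _).2.
Qed.

End Mollifier.
End Kernel.

Section PlaneMeasure.
Context {R : realType}.
Local Notation pl := (plane R).
Lemma lebesgue2_sigma_finite : sigma_finite setT (@lebesgue2 R).
Proof.
have /sigma_finiteP[F [TF ndF Foo]] := @sigma_finiteT _ _ _ (@lebesgue_measure R).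
exists (fun n => F n `*` F n).
 rewrite -setXTT TF predeqE => -[x y]; split.
    move=> [/= [n _ Fnx] [k _ Gky]]; exists (maxn n k) => //; split.
    - by move: x Fnx; exact/subsetPset/ndF/leq_maxl.
    - by move: y Gky; exact/subsetPset/ndF/leq_maxr.
  by move=> [n _ []/= ? ?]; split; exists n.
move=> k; have [m1 h] := Foo k.
split; first exact: measurableX.
have -> : (@lebesgue2 R (F k `*` F k) = @lebesgue_measure R (F k) * @lebesgue_measure R (F k))%E.
  exact: product_measure1E.
by rewrite lte_mul_pinfty // ge0_fin_numE.
Qed.
(** A copy of [lebesgue2] that carries sigma-finiteness, as Tonelli's theorem for pairs of points of
    the plane requires. *)
Definition plane_measure : set pl -> \bar R := @lebesgue2 R.
HB.instance Definition _ := Measure.on plane_measure.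
HB.instance Definition _ := Measure_isSigmaFinite.Build _ _ _ plane_measure lebesgue2_sigma_finite.
End PlaneMeasure.

Lemma RI_scale (R : realType) (a b c d u : R) (F : R * R -> R) : continuous F ->
  RI a b c d (fun z => u * F z) = u * RI a b c d F.
Proof.
move=> cF; rewrite -[RHS]addr0 -(mul0r (RI a b c d F)) -RI_lin //.
by apply: RI_eq => z _ _; ring.
Qed.

Lemma eq_lee (R : realType) (a b : \bar R) : a = b -> (a <= b)%E.
Proof. by move=> ->. Qed.

(** * Contraction of the rectangle towards its centre *)

Section Contraction.
Context {R : realType}.
Local Notation leb := (@lebesgue_measure R).
Implicit Types (t s r L delta : R) (F : R * R -> R).

Definition ctr L t s := L / 2 + t * (s - L / 2).

Lemma ctr_cont L t : continuous (ctr L t). Proof. by rewrite /ctr; cts. Qed.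

Lemma ctr_in L t s : 0 < L -> 0 < t < 1 -> 0 <= s <= L -> 0 < ctr L t s < L.
Proof.
move=> L0 /andP[t0 t1] /andP[s0 sL]; rewrite /ctr.
have h : 0 <= t * s by rewrite mulr_ge0 // ltW.
have h2 : 0 <= t * (L - s) by rewrite mulr_ge0 ?subr_ge0 // ltW.
have h3 : 0 < (1 - t) * L by rewrite mulr_gt0 // subr_gt0.
by apply/andP; split; lra.
Qed.

Lemma der_ctr L t s : is_derive s 1 (ctr L t) t.
Proof. by rewrite /ctr; dereq; ring. Qed.

(** By substitution, the left side is the integral of [f] over the contracted interval. *)
Lemma ctr_line L t (f : R -> R) : 0 < L -> 0 < t < 1 -> continuous f -> (forall s, 0 <= f s) ->
  \int[leb]_(s in Io 0 L) (t * f (ctr L t s)) <= \int[leb]_(s in Io 0 L) f s.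
Proof.
move=> L0 t01 cf f0; have [F cF dF] := primitive_exists L0 cf.
have cc := @ctr_cont L t; have cfc := cont_comp cf cc; have cFc := cont_comp cF cc.
have d s : 0 < s < L -> is_derive s 1 (fun s => F (ctr L t s)) (t * f (ctr L t s)).
  move=> /andP[s0 sL]; apply: (@der_comp _ F (ctr L t)); last exact: der_ctr.
  by apply: dF; apply: ctr_in => //; rewrite !ltW.
rewrite (Rintegral_der (ltW L0) cF cf dF).
have ctf : continuous (fun s => t * f (ctr L t s)) by cts.
have e := Rintegral_der (ltW L0) cFc ctf d; rewrite e.
have i0 : 0 < ctr L t 0 < L by apply: ctr_in => //; rewrite lexx ltW.
have i1 : 0 < ctr L t L < L by apply: ctr_in => //; rewrite lexx ltW.
have m a b : 0 <= a -> a <= b -> b <= L -> F a <= F b.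
  move=> a0 ab bL; apply: (der_le ab cF (f' := f)) => // x /andP[ax xb].
  by apply: dF; rewrite (le_lt_trans a0 ax) (lt_le_trans xb bL).
move: i0 i1 => /andP[/ltW a1 /ltW a2] /andP[/ltW b1 /ltW b2].
by apply: lerB; apply: m.
Qed.

Definition ctr2 L delta t (z : R * R) : R * R := (ctr L t z.1, ctr delta t z.2).

Lemma ctr2_cont L delta t : continuous (ctr2 L delta t).
Proof. by rewrite /ctr2 /ctr; cts. Qed.

Lemma ctr2_in L delta t z : 0 < L -> 0 < delta -> 0 < t < 1 -> 0 <= z.1 <= L -> 0 <= z.2 <= delta ->
  Om L delta (ctr2 L delta t z).
Proof. by move=> L0 d0 t01 h1 h2; split; exact: ctr_in. Qed.

Lemma ctr_RI L delta t F : 0 < L -> 0 < delta -> 0 < t < 1 -> continuous F -> (forall z, 0 <= F z) ->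
  t ^+ 2 * RI 0 L 0 delta (fun z => F (ctr2 L delta t z)) <= RI 0 L 0 delta F.
Proof.
move=> L0 d0 t01 cF F0; have c2 := @ctr2_cont L delta t.
have /andP[t0 _] := t01.
have c1 : continuous (fun z : R * R => (ctr L t z.1, z.2)) by rewrite /ctr; cts.
have cF2 := cont_comp cF c2; have cF1 := cont_comp cF c1.
have -> : t ^+ 2 * RI 0 L 0 delta (fun z => F (ctr2 L delta t z)) =
    RI 0 L 0 delta (fun z => t * (t * F (ctr2 L delta t z))).
  rewrite -RI_scale //.
  by apply: RI_eq => z _ _; ring.
apply: (@le_trans _ _ (RI 0 L 0 delta (fun z => t * F (ctr L t z.1, z.2)))).
  apply: RI_slice_le1; rewrite ?(ltW d0) //; [by cts|by cts|].
  move=> s _ /=.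
  have cr : continuous (fun r => t * F (ctr L t s, r)).
    by have h := @cont_row _ F (ctr L t s) cF; cts.
  by apply: (ctr_line d0 t01 cr) => r; rewrite mulr_ge0 // ltW.
apply: RI_slice_le2; rewrite ?(ltW L0) //; first by cts.
move=> r _ /=; apply: (ctr_line (f := fun s => F (s, r)) L0 t01) => //.
exact: cont_col.
Qed.

End Contraction.

(** * Mollification read in the tubular coordinates *)

Section Smoothing.
Context {R : realType} {L delta : R}.
Variable C : centerline L delta.
Local Notation leb2 := (@lebesgue2 R).
Local Notation pl := (plane R).
Local Notation x := (cx C).
Local Notation y := (cy C).
Local Notation x1 := (cx1 C).
Local Notation y1 := (cy1 C).
Local Notation k := (ck C).
Local Notation Phi := (Phi C).
Local Notation hh := (hh C).
Local Notation Om := (Om L delta).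
Local Notation c1 := (c1fun L delta).
Local Notation J := (RI 0 L 0 delta).
Local Notation wt := (wt C).
Local Notation D := (Dom C).
Hypothesis inj : forall z z', Om z -> Om z' -> Phi z = Phi z' -> z = z'.
Local Notation pb := (pb C).
Local Notation nsq f := (ip leb2 D f f).
Implicit Types (g u v : R * R -> R) (t rho : R).

Let L0 : 0 < L := L_gt0 C.
Let d0 : 0 < delta := delta_gt0 C.
Let mD : measurable (D : set pl) := measurable_Dom inj.
Let cPhi : continuous Phi := @Phi_cont _ _ _ C.

Lemma Dom_fin : (leb2 (D : set pl) < +oo)%E.
Proof.
have := integral_pb_ge0 inj (@cont_cst (R * R)%type R 1) (fun=> ler01).
have -> : (\int[leb2]_(p in D) (pb (fun=> 1) p)%:E = leb2 (D : set pl))%E.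
  by rewrite -[RHS]mul1e -integral_cst.
by move=> ->; rewrite ltry.
Qed.

Local Notation A := (ctr2 L delta).

(** The mollified function is evaluated at a point pulled inside the strip, where for small [rho]
    the support of the kernel stays in [D]: nothing has to be extended across the boundary. *)
Definition smear rho t g : R * R -> R := fun z => moll rho D g (Phi (A t z)).

Lemma smear_cont rho t g : 0 < rho -> sq leb2 D g -> continuous (smear rho t g).
Proof.
move=> r0 sg; apply: cont_comp; first exact: (moll_cont r0 mD Dom_fin sg).
by apply: cont_comp => //; exact: ctr2_cont.
Qed.

(** The contraction costs a factor at most 4, the change of variables a factor [1 / c0], and the
    kernel has mass 1: the bound depends on none of [rho], [t] and [q]. *)
Lemma Ker_contracted : exists2 c : R, 0 < c & forall rho t q, 0 < rho -> 1 / 2 <= t < 1 ->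
  J (fun z => Ker rho (Phi (A t z)) q) <= c.
Proof.
have [c0 [c1' [c00 _ hb]]] := @H_bounds R L delta _ (@wt_cont _ _ _ C) (wt_gt0 C).
exists (4 / c0); first by rewrite divr_gt0.
move=> rho t q r0 /andP[t2 t1]; have t0 : 0 < t by lra.
have t01 : 0 < t < 1 by rewrite t0.
have cK : continuous (fun p => Ker rho p q).
  by rewrite (_ : (fun p => _) = Ker rho q); [exact: Ker_cont|apply/funext => p; rewrite KerC].
have cF : continuous (fun z => Ker rho (Phi z) q) by apply: (cont_comp cK cPhi).
have F0 z : 0 <= Ker rho (Phi z) q by exact: Ker_ge0.
have h := ctr_RI L0 d0 t01 cF F0.
have h1 : J (fun z => Ker rho (Phi z) q) <= c0^-1.
  have cw := @wt_cont _ _ _ C.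
  have h2 : c0 * J (fun z => Ker rho (Phi z) q) <= J (fun z => wt z * Ker rho (Phi z) q).
    rewrite -RI_scale //.
    apply: RI_le; [by cts|by cts|] => z z1 z2; rewrite ler_wpM2r //.
    by have /andP[] := hb z z1 z2.
  have h3 : J (fun z => wt z * Ker rho (Phi z) q) <= 1.
    rewrite -lee_fin -(integral_pb_ge0 inj cF F0) -(Ker_mass r0 q).
    apply: (@le_trans _ _ (\int[leb2]_(p in D) (Ker rho q p)%:E)%E).
      apply: eq_lee; apply: eq_integral => p /set_mem Dp.
      by rewrite /Pullback.pb (PsiP Dp).2 KerC.
    apply: ge0_subset_integral => //.
    - by apply/measurable_EFinP; apply: cont_measurable; exact: Ker_cont.
    - by move=> p _; rewrite lee_fin Ker_ge0.
  by rewrite -[leRHS]mul1r ler_pdivlMr // mulrC (le_trans h2).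
have t4 : 1 / 4 <= t ^+ 2 by rewrite expr2; nra.
have J0 : 0 <= J (fun z => Ker rho (Phi (A t z)) q) by apply: RI_ge0 => z; exact: Ker_ge0.
have h5 : 1 / 4 * J (fun z => Ker rho (Phi (A t z)) q) <= c0^-1.
  by apply: le_trans h1; apply: le_trans h; rewrite ler_wpM2r.
by move: h5; clear; move: (J _) (c0^-1) => X Y; lra.
Qed.

Lemma integral_Ker_Om rho t q (c : \bar R) : 0 < rho -> (0 <= c)%E ->
  (\int[leb2]_z ((\1_Om z * Ker rho (Phi (A t z)) q)%:E * c) =
   (J (fun z => Ker rho (Phi (A t z)) q))%:E * c)%E.
Proof.
move=> r0 c0; have cA : continuous (fun z => Phi (A t z)) by apply: (cont_comp cPhi); exact: ctr2_cont.
have cq : continuous (fun p => Ker rho p q).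
  by rewrite (_ : (fun p => _) = Ker rho q); [exact: Ker_cont|apply/funext => p; rewrite KerC].
have cK := cont_comp cq cA.
have mI : measurable_fun setT (\1_Om : pl -> R) by apply: measurable_indic; exact: measurable_Om.
have m1 : measurable_fun setT (fun z : pl => (\1_Om z * Ker rho (Phi (A t z)) q)%:E).
  by apply/measurable_EFinP; apply: measurable_funM => //; exact: cont_measurable.
have K0 z : (0 <= (\1_Om z * Ker rho (Phi (A t z)) q)%:E)%E.
  by rewrite lee_fin mulr_ge0 // Ker_ge0.
under eq_integral do rewrite muleC.
rewrite ge0_integralZl // muleC; congr (_ * _)%E.
rewrite -(integral_Om_cont C cK (fun z => Ker_ge0 r0 _ _)) [RHS]integral_mkcond.
apply: eq_integral => z _; rewrite patchE indicE.
by case: ifPn => _; rewrite ?mul1r ?mul0r.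
Qed.

(** Schur's test: Jensen's inequality against the kernel in [q], then Tonelli and [Ker_contracted]
    for the integral in [z]. Uniformity in [rho] and [t] is what extends convergence from continuous
    functions to L2. *)
Lemma smear_bound : exists2 c : R, 0 < c & forall rho t g, 0 < rho -> 1 / 2 <= t < 1 ->
  sq leb2 D g -> nsq (pb (smear rho t g)) <= c * nsq g.
Proof.
have [c0 [c1' [_ c10 hb]]] := @H_bounds R L delta _ (@wt_cont _ _ _ C) (wt_gt0 C).
have [B B0 hB] := Ker_contracted.
exists (c1' * B); first by rewrite mulr_gt0.
move=> rho t g r0 t2 sg; have cS := smear_cont (t := t) r0 sg.
rewrite pb_ip // -mulrA.
have cw := @wt_cont _ _ _ C.
apply: (@le_trans _ _ (c1' * J (fun z => smear rho t g z ^+ 2))).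
  rewrite -RI_scale; last by cts.
  apply: RI_le; [by cts|by cts|] => z z1 z2; rewrite -expr2 ler_wpM2r ?sqr_ge0 //.
  by have /andP[] := hb z z1 z2.
rewrite ler_pM2l //.
have cA : continuous (fun z => Phi (A t z)) by apply: (cont_comp cPhi); exact: ctr2_cont.
have cS2 : continuous (fun z => smear rho t g z ^+ 2) by cts.
rewrite -lee_fin -(integral_Om_cont C cS2 (fun z => sqr_ge0 _)).
have mI : measurable_fun setT (\1_Om : pl -> R) by apply: measurable_indic; exact: measurable_Om.
pose gD : pl -> \bar R := (EFin \o (fun q => g q ^+ 2) : pl -> \bar R) \_ D.
have gD0 q : (0 <= gD q)%E by rewrite /gD patchE; case: ifPn => // _; rewrite lee_fin sqr_ge0.
have mgD : measurable_fun setT gD.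
  by apply/(measurable_restrictT _ _).1 => //; apply/measurable_EFinP; exact: measurable_funX sg.1.
pose F (w : pl * pl) : \bar R := ((\1_Om w.1 * Ker rho (Phi (A t w.1)) w.2)%:E * gD w.2)%E.
have F0 w : (0 <= F w)%E by rewrite mule_ge0 // lee_fin mulr_ge0 // Ker_ge0.
have mF : measurable_fun setT F.
  apply: emeasurable_funM; last by apply: (measurableT_comp mgD); exact: measurable_snd.
  apply/measurable_EFinP; apply: measurable_funM.
    by apply: (@measurableT_comp _ _ _ _ _ _ (\1_Om : pl -> R)); [exact: mI|exact: measurable_fst].
  have mth : measurable_fun setT (th rho : measurableTypeR R -> R).
    exact: (continuous_measurable_fun (@th_cont _ rho)).
  have cA1 : continuous (fun z => (Phi (A t z)).1) by apply: (cont_comp (@cont_fst _ _) cA).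
  have cA2 : continuous (fun z => (Phi (A t z)).2) by apply: (cont_comp (@cont_snd _ _) cA).
  rewrite /Ker; apply: measurable_funM; first exact: measurable_cst.
  apply: measurable_funM.
    apply: (measurableT_comp mth); apply: measurable_funB.
      by apply: (@measurableT_comp _ _ _ _ _ _ (fun z : pl => (Phi (A t z)).1)); [exact: cont_measurable|exact: measurable_fst].
    by apply: (@measurableT_comp _ _ _ _ _ _ (fst : pl -> R)); [exact: measurable_fst|exact: measurable_snd].
  apply: (measurableT_comp mth); apply: measurable_funB.
    by apply: (@measurableT_comp _ _ _ _ _ _ (fun z : pl => (Phi (A t z)).2)); [exact: cont_measurable|exact: measurable_fst].
  by apply: (@measurableT_comp _ _ _ _ _ _ (snd : pl -> R)); [exact: measurable_snd|exact: measurable_snd].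
pose sf : {sigma_finite_measure set pl -> \bar R} := @plane_measure R.
have lhs : (\int[leb2]_(z in Om) (smear rho t g z ^+ 2)%:E <= \int[leb2]_z \int[leb2]_q F (z, q))%E.
  rewrite integral_mkcond; apply: ge0_le_integral => //.
  - by move=> z _; rewrite patchE; case: ifPn => // _; rewrite lee_fin sqr_ge0.
  - apply: measurable_patch; first exact: measurable_Om.
    by apply/measurable_EFinP; exact: cont_measurable.
  - exact: (@measurable_fun_fubini_tonelli_F _ _ _ _ _ sf F mF F0).
  move=> z _; rewrite patchE; case: ifPn => hz; last first.
    apply: le_trans (_ : 0 <= _)%E => //; exact: integral_ge0.
  have js := moll_jensen r0 mD Dom_fin (Phi (A t z)) sg.
  apply: le_trans (_ : (_ : R)%:E <= _)%E; first by rewrite lee_fin; exact: js.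
  have iK : leb2.-integrable D (EFin \o (fun q => Ker rho (Phi (A t z)) q * g q ^+ 2)).
    have i2 : leb2.-integrable D (EFin \o (fun q => kc rho * g q ^+ 2 + 0 * g q ^+ 2)).
      exact: (integrable_lin mD _ _ sg.2 sg.2).
    apply: (integrable_bound mD _ i2) => [|q _].
      apply: measurable_funM; last exact: measurable_funX sg.1.
      by apply: measurable_funTS; apply: cont_measurable; exact: Ker_cont.
    rewrite mul0r addr0 normrM !ger0_norm ?sqr_ge0 ?Ker_ge0 // ler_wpM2r ?sqr_ge0 //.
    exact: Ker_le.
  rewrite /Rintegral fineK; last exact: (integrable_fin_num mD iK).
  rewrite integral_mkcond; apply: eq_lee; apply: eq_integral => q _.
  rewrite /F /gD !patchE /= indicE hz mul1r; case: ifPn => _ //; by rewrite mule0.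
have ft : (\int[leb2]_z \int[leb2]_q F (z, q) = \int[leb2]_q \int[leb2]_z F (z, q))%E.
  exact: (@fubini_tonelli _ _ _ _ _ sf sf F mF F0).
apply: le_trans lhs _; rewrite ft.
have rhs q : (\int[leb2]_z F (z, q) <= B%:E * gD q)%E.
  apply: le_trans (eq_lee (integral_Ker_Om t q r0 (gD0 q))) _.
  by apply: lee_wpmul2r; [exact: gD0|rewrite lee_fin; exact: hB].
apply: le_trans (_ : \int[leb2]_q (B%:E * gD q) <= _)%E.
  apply: ge0_le_integral.
  - exact: measurableT.
  - by move=> q _; apply: integral_ge0 => z _; exact: F0.
  - exact: (@measurable_fun_fubini_tonelli_G _ _ _ _ _ sf F mF F0).
  - exact: measurable_funeM.
  - by move=> q _; exact: rhs.
clear ft rhs sf mF F0.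
rewrite ge0_integralZl ?lee_fin ?(ltW B0) // EFinM lee_wpmul2l ?lee_fin ?(ltW B0) //.
rewrite /gD -integral_mkcond /ip /Rintegral.
have i2 := sg.2; rewrite fineK; last by have := sq_integrable mD sg sg => h; exact: (integrable_fin_num mD h).
by apply: eq_lee; apply: eq_integral => q _; rewrite /= expr2.
Qed.

Lemma unif_param (F : R * (R * R) -> R) e : continuous F -> 0 < e ->
  exists2 eta, 0 < eta & forall t z, 0 <= z.1 <= L -> 0 <= z.2 <= delta ->
    1 - eta < t <= 1 -> `|F (t, z) - F (1, z)| < e.
Proof.
move=> cF e0.
have cA : compact (`[0, 1] `*` (`[0, L] `*` `[0, delta]) : set (R * (R * R))).
  by apply: compact_setX; [exact: segment_compact|exact: compact_box].
have [d dp hd] := unif_cont_compact cA cF e0.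
exists d => // t z z1 z2 /andP[t1 t2]; rewrite distrC; apply: hd.
  by split; rewrite /= ?in_itv /= ?lexx ?ler01 //; split; rewrite /= in_itv.
split; last exact: ballxx.
by rewrite /ball /= ger0_norm ?subr_ge0 //; lra.
Qed.

Definition admissible rho t := forall z, 0 <= z.1 <= L -> 0 <= z.2 <= delta ->
  cbox rho (Phi (A t z)) `<=` D.

(** The contraction sends the closed rectangle to a compact subset of the open set [D], which leaves
    a uniform margin. *)
Lemma admissible_exists t : 0 < t < 1 ->
  exists2 rho0, 0 < rho0 & forall rho, 0 < rho <= rho0 -> admissible rho t.
Proof.
move=> t01; pose K : set (R * R) := `[0, L] `*` `[0, delta].
pose P (r : R) (z : R * R) := cbox r (Phi (A t z)) `<=` D.
have cA : continuous (fun z => Phi (A t z)) by apply: (cont_comp cPhi); exact: ctr2_cont.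
have /compact_near_coveringP/(_ R (0^'+) P _) cov := @compact_box _ 0 L 0 delta.
have AP : \forall d \near 0^'+, K `<=` P d.
  apply: cov => z [/= z1 z2]; rewrite !in_itv /= in z1 z2.
  have DA : D (Phi (A t z)) by exists (A t z) => //; exact: ctr2_in.
  have := Dom_open inj; rewrite openE => /(_ _ DA) /nbhs_ballP[e /= e0 he].
  have e20 : 0 < e / 2 by rewrite divr_gt0.
  have /cvg_ballP/(_ _ e20) cz := cA z.
  exists ([set z' | ball (Phi (A t z)) (e / 2) (Phi (A t z'))], [set d | 0 < d < e / 2]).
    split => /=; first exact: cz.
    near=> d => /=; apply/andP; split; near: d.
      exact: nbhs_right_gt.
    exact: nbhs_right_lt.
  move=> [z' d] /= [hz /andP[dp de]] q [q1 q2]; apply: he.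
  rewrite (splitr e); apply: ball_triangle hz _; apply/ball_box.
  by split; [exact: le_lt_trans q1 de|exact: le_lt_trans q2 de].
have [d [dp hd]] := filter_ex (filterI (nbhs_right_gt (0 : R)) AP).
exists d => // rho /andP[r0 rd] z z1 z2 q [q1 q2]; apply: (hd z) => /=.
  by split; rewrite /= in_itv.
by split; [exact: le_trans q1 rd|exact: le_trans q2 rd].
Unshelve. all: by end_near. Qed.

Let dfin := Dom_fin.

Let bsq (phi : R * R -> R) (M : R) : continuous phi -> (forall z, `|phi z| <= M) -> sq leb2 D phi.
Proof.
by move=> c b; apply: (sq_bounded mD dfin (M := M)) => [|z _] //; apply: measurable_funTS; exact: cont_measurable.
Qed.

Lemma Ker_mass_D rho p : 0 < rho -> cbox rho p `<=` D ->
  leb2.-integrable D (EFin \o Ker rho p) /\ \int[leb2]_(q in D) Ker rho p q = 1.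
Proof.
move=> r0 pD.
have s1 : sq leb2 D (fun=> 1) by apply: (bsq (M := 1)) => [|z]; [exact: cont_cst|rewrite normr1].
have iK : leb2.-integrable D (EFin \o Ker rho p).
  have := moll_int r0 mD dfin p s1; rewrite (_ : EFin \o _ = EFin \o Ker rho p) //.
  by apply/funext => q /=; rewrite mulr1.
split=> //; rewrite /Rintegral.
rewrite (_ : (\int[leb2]_(q in D) (Ker rho p q)%:E)%E = 1%E) // -(Ker_mass r0 p).
rewrite integral_mkcond; apply: eq_integral => q _; rewrite patchE; case: ifPn => //.
rewrite notin_setE => nD; congr EFin; apply/esym/eqP; apply: contra_notT nD => /Ker_supp[//|h1 h2].
by apply: pD; split; exact: ltW.
Qed.

Lemma smear_uniform phi (M e : R) : continuous phi -> (forall z, `|phi z| <= M) -> 0 < e ->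
  exists2 eta, 0 < eta & forall rho t, 1 - eta < t < 1 -> 0 < rho < eta -> admissible rho t ->
    forall z, 0 <= z.1 <= L -> 0 <= z.2 <= delta -> `|phi (Phi z) - smear rho t phi z| <= e.
Proof.
move=> cp pM e0.
have cK : compact (Phi @` (`[0, L] `*` `[0, delta])).
  by apply: continuous_compact (@compact_box _ 0 L 0 delta); exact: cont_within.
have [d dp hd] := unif_cont_compact cK cp e0.
have d20 : 0 < d / 2 by rewrite divr_gt0.
have cB : continuous (fun w : R * (R * R) => Phi (A w.1 w.2)).
  apply: (cont_comp cPhi); rewrite /ctr2 /ctr.
  have c1 : continuous (fun w : R * (R * R) => w.2.1) by apply: cont_comp; [exact: cont_fst|exact: cont_snd].
  have c2 : continuous (fun w : R * (R * R) => w.2.2) by apply: cont_comp; [exact: cont_snd|exact: cont_snd].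
  by cts.
have [e1 e10 h1] := unif_param (cont_comp (@cont_fst _ _) cB) d20.
have [e2 e20 h2] := unif_param (cont_comp (@cont_snd _ _) cB) d20.
have A1 z : A 1 z = z by rewrite (surjective_pairing z) /ctr2 /ctr /=; congr pair; ring.
exists (Num.min (Num.min e1 e2) (d / 2)); first by rewrite !lt_min e10 e20 d20.
move=> rho t /andP[t1 t2] /andP[r0]; rewrite !lt_min => /andP[/andP[r1 r2] rd] adm z z1 z2.
have te1 : 1 - e1 < t <= 1.
  rewrite (ltW t2) andbT; apply: le_lt_trans t1; rewrite lerB // !ge_min lexx //.
have te2 : 1 - e2 < t <= 1.
  by rewrite (ltW t2) andbT; apply: le_lt_trans t1; rewrite lerB // !ge_min lexx ?orbT.
have g1 : `|(Phi (A t z)).1 - (Phi z).1| < d / 2.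
  by rewrite -[X in _ - (Phi X).1](A1 z); exact: h1 t z z1 z2 te1.
have g2 : `|(Phi (A t z)).2 - (Phi z).2| < d / 2.
  by rewrite -[X in _ - (Phi X).2](A1 z); exact: h2 t z z1 z2 te2.
have pD := adm z z1 z2; set p' := Phi (A t z) in pD g1 g2 *.
have [iK K1] := Ker_mass_D r0 pD.
have sp := bsq cp pM; have ip := moll_int r0 mD dfin p' sp.
have e3 : phi (Phi z) - smear rho t phi z =
    \int[leb2]_(q in D) (phi (Phi z) * Ker rho p' q + -1 * (Ker rho p' q * phi q)).
  by rewrite (Rintegral_lin mD) // K1 mulr1 mulN1r.
have il := integrable_lin mD (phi (Phi z)) (-1) iK ip.
rewrite e3; apply: le_trans (le_normr_Rintegral mD il) _.
have e4 : e = \int[leb2]_(q in D) (e * Ker rho p' q + 0 * Ker rho p' q).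
  by rewrite (Rintegral_lin mD) // K1; ring.
rewrite [leRHS]e4; apply: le_Rintegral => //.
- exact: (integrable_norm il).
- exact: (integrable_lin mD e 0 iK iK).
move=> q _; rewrite mul0r addr0.
have -> : phi (Phi z) * Ker rho p' q + -1 * (Ker rho p' q * phi q) =
   (phi (Phi z) - phi q) * Ker rho p' q by ring.
rewrite normrM (ger0_norm (Ker_ge0 _ _ _)) //.
have [->|nz] := eqVneq (Ker rho p' q) 0; first by rewrite !mulr0.
have [q1 q2] := Ker_supp r0 nz.
rewrite ler_wpM2r ?Ker_ge0 // ltW // hd //.
  by exists z => //; split; rewrite /= in_itv.
apply/ball_box; split; rewrite (splitr d).
  rewrite (_ : _ - _ = (p'.1 - q.1) - (p'.1 - (Phi z).1)); last by ring.
  by apply: le_lt_trans (ler_normB _ _) _; rewrite ltrD // (lt_trans q1 rd).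
rewrite (_ : _ - _ = (p'.2 - q.2) - (p'.2 - (Phi z).2)); last by ring.
by apply: le_lt_trans (ler_normB _ _) _; rewrite ltrD // (lt_trans q2 rd).
Qed.

(** Three terms: [g] minus a continuous [phi]; [phi] minus its smearing, which is uniformly small;
    and the smearing of [g - phi], controlled by [smear_bound]. *)
Lemma smear_cvg g e : sq leb2 D g -> 0 < e ->
  exists2 eta, 0 < eta & forall rho t, 1 - eta < t < 1 -> 0 < rho < eta -> admissible rho t ->
    nsq (fun p => g p - pb (smear rho t g) p) <= e.
Proof.
move=> sg e0; have [c c0 hc] := smear_bound.
have [_ dense] := continuous_dense mD dfin sg.
(* The final estimate is [2 * nsq a + 4 * nsq b + 4 * nsq d] with [nsq d <= c * nsq a]; this choice
   leaves [e / 2] for the term in [b]. *)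
have e10 : 0 < e / (4 + 8 * c) by rewrite divr_gt0 // addr_gt0 // mulr_gt0.
have [phi [cp [M pM] gp]] := dense _ e10.
have s1 : sq leb2 D (fun=> 1) by apply: (bsq (M := 1)) => [|z]; [exact: cont_cst|rewrite normr1].
pose vol := nsq (fun=> 1); have vol0 : 0 <= vol by exact: ip_ge0.
pose e2 := Num.sqrt (e / (8 * (vol + 1))).
have v8 : 0 < 8 * (vol + 1) by rewrite mulr_gt0 // ltr_wpDl.
have e20 : 0 < e2 by rewrite sqrtr_gt0 divr_gt0.
have [eta eta0 hu] := smear_uniform cp pM e20.
exists (Num.min eta (1 / 2)); first by rewrite lt_min eta0 divr_gt0.
move=> rho t /andP[t1 t2] /andP[r0]; rewrite lt_min => /andP[re _] adm.
have th : 1 / 2 <= t < 1.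
  rewrite t2 andbT; apply: ltW; apply: le_lt_trans t1.
  have : Num.min eta (1 / 2) <= 1 / 2 by rewrite ge_min lexx orbT.
  lra.
have te : 1 - eta < t < 1.
  rewrite t2 andbT; apply: le_lt_trans t1.
  have : Num.min eta (1 / 2) <= eta by rewrite ge_min lexx.
  lra.
have sp := bsq cp pM.
have rer : 0 < rho < eta by rewrite r0.
have hu' := hu rho t te rer adm.
have sgp := sqB mD sg sp.
have sS h : sq leb2 D h -> sq leb2 D (pb (smear rho t h)).
  by move=> sh; apply: (pb_sq inj); exact: smear_cont.
have slin p : D p -> pb (smear rho t (fun q => g q - phi q)) p = pb (smear rho t g) p - pb (smear rho t phi) p.
  move=> Dp.
  have i1 := moll_int r0 mD dfin (Phi (A t (Psi C p))) sg.
  have i2 := moll_int r0 mD dfin (Phi (A t (Psi C p))) sp.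
  have := Rintegral_lin mD 1 (-1) i1 i2; rewrite mul1r mulN1r => e9.
  by rewrite /Pullback.pb /smear /moll -e9; apply: eq_Rintegral => q _; ring.
pose a p := g p - phi p; pose b p := phi p - pb (smear rho t phi) p.
pose d p := pb (smear rho t (fun q => g q - phi q)) p.
have sb : sq leb2 D b by apply: (sqB mD sp); exact: sS.
have sd : sq leb2 D d by exact: sS.
have nb : nsq b <= e2 ^+ 2 * vol.
  have -> : e2 ^+ 2 * vol = nsq (fun=> e2 * 1).
    by rewrite (ipZ mD e2 s1 (sqZ mD e2 s1)) ipC (ipZ mD e2 s1 s1) mulrA expr2.
  apply: (ip_le mD sb (sqZ mD e2 s1)) => p Dp; rewrite mulr1.
  rewrite -(real_normK (num_real (b p))) lerXn2r ?nnegrE // ?(ltW e20) //.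
  have [Op ep] := PsiP Dp; have := hu' (Psi C p); rewrite ep; apply.
    by case: Op => /andP[/ltW-> /ltW->].
  by case: Op => _ /andP[/ltW-> /ltW->].
have nd : nsq d <= c * nsq a by exact: hc.
have -> : nsq (fun p => g p - pb (smear rho t g) p) = nsq (fun p => a p + (b p - d p)).
  by apply: ip_eq => p Dp; rewrite /a /b /d slin //; ring.
have sbd := sqB mD sb sd.
have h1 := ipDx2_le mD sgp sbd.
have sdN : sq leb2 D (fun p => -1 * d p) by exact: sqZ.
have h2 := ipDx2_le mD sb sdN.
have e5 : nsq (fun p => b p + -1 * d p) = nsq (fun p => b p - d p).
  by apply: ip_eq => p _; ring.
have e6 : nsq (fun p => -1 * d p) = nsq d by apply: eq_Rintegral => p _; ring.
rewrite e5 e6 in h2.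
apply: le_trans h1 _.
have e7 : e2 ^+ 2 * vol <= e / 8.
  rewrite sqr_sqrtr; last by rewrite ltW // divr_gt0.
  rewrite mulrAC ler_pdivrMr // (_ : e / 8 * (8 * (vol + 1)) = e * (vol + 1)); last by field.
  by rewrite ler_pM2l // lerDl ler01.
have e8 : (4 + 8 * c) * nsq a <= e.
  by rewrite mulrC -ler_pdivlMr ?addr_gt0 ?mulr_gt0.
have na := ip_ge0 leb2 D a.
move: na nb nd e7 e8 h2; move: (nsq a) (nsq b) (nsq d) (nsq (fun p => b p - d p)) (e2 ^+ 2 * vol).
by clear; move=> X Y Z W T *; lra.
Qed.

Let rect (z : R * R) : R * R := (clamp 0 L z.1, clamp 0 delta z.2).

Let rect_cont : continuous rect.
Proof.
have h1 := @clamp_cont _ 0 L; have h2 := @clamp_cont _ 0 delta.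
rewrite /rect; apply: cont_pair; [exact: (cont_comp h1 (@cont_fst _ _))|exact: (cont_comp h2 (@cont_snd _ _))].
Qed.

Let rect_in z : 0 <= (rect z).1 <= L /\ 0 <= (rect z).2 <= delta.
Proof. by split; apply: clamp_in; exact: ltW. Qed.

Let rectE z : 0 <= z.1 <= L -> 0 <= z.2 <= delta -> rect z = z.
Proof. by move=> h1 h2; rewrite (surjective_pairing z) /rect !clamp_id. Qed.

(** * The C1 approximant and its derivatives *)

Section Approximant.
Variables (u ux uy : R * R -> R) (rho t : R).
Hypotheses (su : sq leb2 D u) (sux : sq leb2 D ux) (suy : sq leb2 D uy).
Hypotheses (wx : weak_derivative D (@ex R) u ux) (wy : weak_derivative D (@ey R) u uy).
Hypotheses (rho0 : 0 < rho) (t01 : 0 < t < 1) (adm : admissible rho t).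

Let B z := A t (rect z).
Let B_cont : continuous B.
Proof. by apply: (cont_comp _ rect_cont); exact: ctr2_cont. Qed.

(** [ap_s] and [ap_r] come from the chain rule: [t] from the contraction, [hh (B z)] from the speed
    of [Phi] in [s], and the smeared [ux], [uy] from commuting mollification with the weak
    gradient. *)
Definition ap_s z := t * hh (B z) * (x1 (B z).1 * smear rho t ux (rect z) + y1 (B z).1 * smear rho t uy (rect z)).
Definition ap_r z := t * (y1 (B z).1 * smear rho t ux (rect z) - x1 (B z).1 * smear rho t uy (rect z)).

Let cB1 : continuous (fun z => (B z).1) := cont_comp (@cont_fst _ _) B_cont.
Let cx1' : continuous (fun z => x1 (B z).1) := cont_comp (@cx1_cont _ _ _ C) cB1.
Let cy1' : continuous (fun z => y1 (B z).1) := cont_comp (@cy1_cont _ _ _ C) cB1.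
Let chB : continuous (fun z => hh (B z)) := cont_comp (@hh_cont _ _ _ C) B_cont.
Let cS v : sq leb2 D v -> continuous (fun z => smear rho t v (rect z)).
Proof. by move=> sv; apply: (cont_comp _ rect_cont); exact: smear_cont. Qed.

Let weak z : moll1 rho D u (Phi (B z)) = smear rho t ux (rect z) /\
  moll2 rho D u (Phi (B z)) = smear rho t uy (rect z).
Proof. by apply: moll_weak => //; have [h1 h2] := rect_in z; exact: adm. Qed.

Let inL s : 0 < s < L -> 0 <= s <= L. Proof. by case/andP => /ltW-> /ltW->. Qed.
Let ind r : 0 < r < delta -> 0 <= r <= delta. Proof. by case/andP => /ltW-> /ltW->. Qed.

Let BE s r : 0 < s < L -> 0 < r < delta -> B (s, r) = (ctr L t s, ctr delta t r).
Proof. by move=> hs hr; rewrite /B rectE //; [exact: inL|exact: ind]. Qed.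

Let unit_le s : `|x1 s| <= 1 /\ `|y1 s| <= 1.
Proof.
have h := unit_speed C s; have a2 := sqr_ge0 (x1 s); have b2 := sqr_ge0 (y1 s).
split; rewrite -(@ler_pXn2r _ 2) ?nnegrE // real_normK ?num_real // expr1n; lra.
Qed.

Let ap_der_s s r : 0 < s < L -> 0 < r < delta ->
  is_derive s 1 (fun s' => smear rho t u (rect (s', r))) (ap_s (s, r)).
Proof.
move=> hs hr; pose r' := ctr delta t r.
pose a s' := x (ctr L t s') + r' * y1 (ctr L t s').
pose b s' := y (ctr L t s') - r' * x1 (ctr L t s').
pose a' s' := t * hh (ctr L t s', r') * x1 (ctr L t s').
pose b' s' := t * hh (ctr L t s', r') * y1 (ctr L t s').
have cin s' : 0 < s' < L -> 0 < ctr L t s' < L by move=> h; apply: ctr_in => //; exact: inL.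
have dc s' := der_ctr L t s'.
have da s' : 0 < s' < L -> is_derive s' 1 a (a' s').
  move=> h; have hc := cin s' h.
  have dx := @der_comp _ x (ctr L t) s' _ _ (der_cx C hc) (dc s').
  have dy := @der_comp _ y1 (ctr L t) s' _ _ (der_cy1 C hc) (dc s').
  by rewrite /a; dereq; rewrite /a' /Tube.hh /=; ring.
have db s' : 0 < s' < L -> is_derive s' 1 b (b' s').
  move=> h; have hc := cin s' h.
  have dx := @der_comp _ y (ctr L t) s' _ _ (der_cy C hc) (dc s').
  have dy := @der_comp _ x1 (ctr L t) s' _ _ (der_cx1 C hc) (dc s').
  by rewrite /b; dereq; rewrite /b' /Tube.hh /=; ring.
have ch : continuous (fun z : R * R => hh z) := @hh_cont _ _ _ C.
have [M M0 hM] := cont_bounded (@compact_box _ 0 L 0 delta) ch.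
have bM s' : 0 < s' < L -> `|a' s'| <= M /\ `|b' s'| <= M.
  move=> h; have hc := cin s' h; have [u1 u2] := unit_le (ctr L t s').
  have rin : 0 < r' < delta by apply: ctr_in => //; exact: ind.
  have hb : `|hh (ctr L t s', r')| <= M.
    by apply: hM; split; rewrite /= in_itv /=; [exact: inL|exact: ind].
  have tb : `|t| <= 1 by case/andP: t01 => t0 t1; rewrite ger0_norm ltW.
  have thM : `|t * hh (ctr L t s', r')| <= M.
    by rewrite normrM -[leRHS]mul1r ler_pM.
  by split; rewrite /a' /b' normrM -[leRHS]mulr1 ler_pM.
have h := @der_moll _ _ rho0 D mD dfin u a b a' b' 0 L s M su hs da db bM.
apply: (@near_der _ (fun s' => moll rho D u (a s', b s')) _ 0 L); first exact: hs.
  by move=> s' hs'; rewrite /smear -/(B (s', r)) BE.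
apply: der_eq h _; have [w1 w2] := weak (s, r).
have eP : (a s, b s) = Phi (B (s, r)) by rewrite BE.
by rewrite eP w1 w2 /ap_s BE //= /a' /b' /r'; ring.
Qed.

Let ap_der_r s r : 0 < s < L -> 0 < r < delta ->
  is_derive r 1 (fun r' => smear rho t u (rect (s, r'))) (ap_r (s, r)).
Proof.
move=> hs hr; pose s' := ctr L t s.
pose a r' := x s' + ctr delta t r' * y1 s'.
pose b r' := y s' - ctr delta t r' * x1 s'.
pose a' (r' : R) := t * y1 s'.
pose b' (r' : R) := - (t * x1 s').
have dc r' := der_ctr delta t r'.
have da r' : 0 < r' < delta -> is_derive r' 1 a (a' r').
  by move=> _; have h := dc r'; rewrite /a; dereq; rewrite /a'; ring.
have db r' : 0 < r' < delta -> is_derive r' 1 b (b' r').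
  by move=> _; have h := dc r'; rewrite /b; dereq; rewrite /b'; ring.
have bM r' : 0 < r' < delta -> `|a' r'| <= 1 /\ `|b' r'| <= 1.
  move=> _; have [u1 u2] := unit_le s'.
  have tb : `|t| <= 1 by case/andP: t01 => t0 t1; rewrite ger0_norm ltW.
  by split; rewrite /a' /b' ?normrN normrM mulr_ile1.
have h := @der_moll _ _ rho0 D mD dfin u a b a' b' 0 delta r 1 su hr da db bM.
apply: (@near_der _ (fun r' => moll rho D u (a r', b r')) _ 0 delta); first exact: hr.
  by move=> r' hr'; rewrite /smear -/(B (s, r')) BE.
apply: der_eq h _; have [w1 w2] := weak (s, r).
have eP : (a r, b r) = Phi (B (s, r)) by rewrite BE.
by rewrite eP w1 w2 /ap_r BE //= /a' /b' /s'; ring.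
Qed.

Let ap_s_cont : continuous ap_s.
Proof. by have c2 := cS sux; have c3 := cS suy; rewrite /ap_s; cts. Qed.

Let ap_r_cont : continuous ap_r.
Proof. by have c2 := cS sux; have c3 := cS suy; rewrite /ap_r; cts. Qed.

Lemma approximant : exists V : c1, [/\ forall z, Om z -> v0 V z = smear rho t u z,
  forall z, Om z -> vs V z = t * hh (A t z) * (x1 (A t z).1 * smear rho t ux z + y1 (A t z).1 * smear rho t uy z) &
  forall z, Om z -> vr V z = t * (y1 (A t z).1 * smear rho t ux z - x1 (A t z).1 * smear rho t uy z)].
Proof.
exists (C1fun (cS su) ap_s_cont ap_r_cont ap_der_s ap_der_r).
have e z : Om z -> rect z = z by move=> [h1 h2]; apply: rectE; [exact: inL|exact: ind].
by split=> z Oz; rewrite /= ?/ap_s ?/ap_r /B e.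
Qed.

End Approximant.

(** Entries of the matrix taking the smeared weak gradient to the gradient of the approximant. It
    accounts for the frame at [A t z] differing from the one at [z], and is the identity at
    [t = 1]. *)
Let coef (f1 f2 g1 g2 : R -> R) (e : R) (w : R * (R * R)) :=
  w.1 * (hh (A w.1 w.2) * (wt w.2)^-1 * f1 (A w.1 w.2).1 * f2 w.2.1 +
         e * (g1 (A w.1 w.2).1 * g2 w.2.1)).
Let alpha := coef x1 x1 y1 y1 1.
Let beta := coef y1 x1 x1 y1 (-1).
Let gamm := coef y1 y1 x1 x1 1.
Let beta2 := coef x1 y1 y1 x1 (-1).

Let coef_cont : [/\ continuous alpha, continuous beta, continuous gamm & continuous beta2].
Proof.
have c21 : continuous (fun w : R * (R * R) => w.2.1) by apply: cont_comp; [exact: cont_fst|exact: cont_snd].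
have c22 : continuous (fun w : R * (R * R) => w.2.2) by apply: cont_comp; [exact: cont_snd|exact: cont_snd].
have cA : continuous (fun w : R * (R * R) => A w.1 w.2) by rewrite /ctr2 /ctr; cts.
have ch := cont_comp (@hh_cont _ _ _ C) cA.
have cA1 := cont_comp (@cont_fst _ _) cA.
have a1 := cont_comp (@cx1_cont _ _ _ C) cA1; have a2 := cont_comp (@cy1_cont _ _ _ C) cA1.
have b1 := cont_comp (@cx1_cont _ _ _ C) c21; have b2 := cont_comp (@cy1_cont _ _ _ C) c21.
have cwv : continuous (fun w : R * (R * R) => (wt w.2)^-1).
  exact: (cont_comp (@wtV_cont _ _ _ C) (@cont_snd _ _)).
have mk (f g h1 h2 h3 h4 : R * (R * R) -> R) (e : R) : continuous f -> continuous g -> continuous h1 ->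
    continuous h2 -> continuous h3 -> continuous h4 ->
    continuous (fun w : R * (R * R) => w.1 * (f w * g w * h1 w * h2 w + e * (h3 w * h4 w))).
  move=> k1 k2 k3 k4 k5 k6; apply: contM; first exact: cont_fst.
  apply: contD; first by do ![apply: contM].
  by apply: contM; [exact: cont_cst|exact: contM].
by split; exact: mk.
Qed.

Let coef_one z : 0 <= z.1 <= L -> 0 <= z.2 <= delta ->
  [/\ alpha (1, z) = 1, beta (1, z) = 0, gamm (1, z) = 1 & beta2 (1, z) = 0].
Proof.
move=> z1 z2; have A1 : A 1 z = z.
  by rewrite (surjective_pairing z) /ctr2 /ctr /=; congr pair; ring.
have u1 := unit_speed C z.1; have w0 := wt_neq0 C z.
have ew := wtE C z2.
rewrite /alpha /beta /gamm /beta2 /coef -[(1, z).1]/1 -[(1, z).2]/z A1 -ew !divff //.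
by split; rewrite -?[RHS]u1; ring.
Qed.

Lemma nsq_comb v f g (a b : R * R -> R) (e M : R) : sq leb2 D v -> sq leb2 D f -> sq leb2 D g ->
  sq leb2 D (fun p => v p - (a p * f p + b p * g p)) ->
  (forall p, D p -> `|a p - 1| <= e /\ `|b p| <= e) ->
  nsq (fun p => v p - (a p * f p + b p * g p)) <= 2 * nsq (fun p => v p - f p) +
     8 * e ^+ 2 * (nsq f + nsq g).
Proof.
move=> sv sf sg sw hab.
have ar2 (X Y Z S T : R) : X <= S -> Y <= T -> 0 <= Z -> 0 <= S -> 0 <= T ->
    2 * X + 2 * Y - Z <= 4 * S + 4 * T by lra.
have svf := sqB mD sv sf.
pose h p := v p - (a p * f p + b p * g p) - (v p - f p).
have sh : sq leb2 D h by apply: sqB.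
have eq1 : nsq (fun p => v p - (a p * f p + b p * g p)) = nsq (fun p => (v p - f p) + h p).
  by apply: ip_eq => p _; rewrite /h; ring.
rewrite eq1; apply: le_trans (ipDx2_le mD svf sh) _; rewrite lerD2l.
have sef := sqZ mD (2 * e) sf; have seg := sqZ mD (2 * e) sg.
have hb : nsq h <= nsq (fun p => 2 * e * f p) + nsq (fun p => 2 * e * g p).
  apply: (ip_le2 mD sh sef seg) => p Dp; have [h1 h2] := hab p Dp.
  have k1 : (a p - 1) ^+ 2 <= e ^+ 2.
    by rewrite -(real_normK (num_real (a p - 1))) lerXn2r // nnegrE // (le_trans _ h1).
  have k2 : b p ^+ 2 <= e ^+ 2.
    by rewrite -(real_normK (num_real (b p))) lerXn2r // nnegrE // (le_trans _ h2).
  have k3 := ler_wpM2r (sqr_ge0 (f p)) k1; have k4 := ler_wpM2r (sqr_ge0 (g p)) k2.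
  have k5 : 0 <= ((a p - 1) * f p - b p * g p) ^+ 2 by exact: sqr_ge0.
  have k6 := mulr_ge0 (sqr_ge0 e) (sqr_ge0 (f p)); have k7 := mulr_ge0 (sqr_ge0 e) (sqr_ge0 (g p)).
  have -> : h p ^+ 2 = 2 * ((a p - 1) ^+ 2 * f p ^+ 2) + 2 * (b p ^+ 2 * g p ^+ 2) -
      ((a p - 1) * f p - b p * g p) ^+ 2 by rewrite /h; ring.
  have -> : (2 * e * f p) ^+ 2 = 4 * (e ^+ 2 * f p ^+ 2) by ring.
  have -> : (2 * e * g p) ^+ 2 = 4 * (e ^+ 2 * g p ^+ 2) by ring.
  exact: ar2.
have sc w : sq leb2 D w -> nsq (fun p => 2 * e * w p) = 4 * e ^+ 2 * nsq w.
  by move=> sw'; rewrite (ipZ mD _ sw' (sqZ mD _ sw')) ipC (ipZ mD _ sw' sw'); ring.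
rewrite !sc // in hb; apply: (@le_trans _ _ (2 * (4 * e ^+ 2 * nsq f + 4 * e ^+ 2 * nsq g))).
  by rewrite ler_pM2l.
by rewrite [leLHS](_ : _ = 8 * e ^+ 2 * (nsq f + nsq g)) //; ring.
Qed.

(** The gradient of the approximant is the smeared weak gradient up to a matrix close to the
    identity. The contraction [t] is fixed before [rho], since the admissible radii depend on
    [t]. *)
Lemma approx_H1 u ux uy e : H1 D u ux uy -> 0 < e -> exists V : c1,
  [/\ nsq (fun p => u p - pb (v0 V) p) <= e, nsq (fun p => ux p - pb (gxd C V) p) <= e &
      nsq (fun p => uy p - pb (gyd C V) p) <= e].
Proof.
move=> [/(L2P _ mD) su /(L2P _ mD) sux /(L2P _ mD) suy wx wy] e0.
have ar1 X Y : X <= e / 4 -> Y <= e / 2 -> 2 * X + Y <= e by lra.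
have e40 : 0 < e / 4 by rewrite divr_gt0.
have [c c0 hc] := smear_bound.
have [n1 n10 h1] := smear_cvg su e40.
have [n2 n20 h2] := smear_cvg sux e40.
have [n3 n30 h3] := smear_cvg suy e40.
pose N := c * (nsq ux + nsq uy) + 1.
have N0 : 0 < N.
  by have a1 := ip_ge0 leb2 D ux; have a2 := ip_ge0 leb2 D uy; rewrite ltr_wpDl // mulr_ge0 ?addr_ge0 // ltW.
(* [N] bounds the squared norms of the smeared derivatives, so that the matrix error
   [8 * e2 ^+ 2 * N] equals [e / 2]. *)
pose e2 := Num.sqrt (e / (16 * N)).
have e20 : 0 < e2 by rewrite sqrtr_gt0 divr_gt0 // mulr_gt0.
have [ca cb cg cb2] := coef_cont.
have [m1 m10 k1] := unif_param ca e20.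
have [m2 m20 k2] := unif_param cb e20.
have [m3 m30 k3] := unif_param cg e20.
have [m4 m40 k4] := unif_param cb2 e20.
pose q1 := Num.min (Num.min n1 n2) (Num.min n3 (1 / 2)).
pose q2 := Num.min (Num.min m1 m2) (Num.min m3 m4).
pose q := Num.min q1 q2.
have q0 : 0 < q by rewrite !lt_min n10 n20 n30 m10 m20 m30 m40 /= divr_gt0.
have [qn1 qn2 qn3 qh] : [/\ q <= n1, q <= n2, q <= n3 & q <= 1 / 2].
  by rewrite /q /q1 !ge_min !lexx ?orbT.
have [qm1 qm2 qm3 qm4] : [/\ q <= m1, q <= m2, q <= m3 & q <= m4].
  by rewrite /q /q2 !ge_min !lexx ?orbT.
pose t := 1 - q / 2.
have t1 : t < 1 by rewrite /t; lra.
have th : 1 / 2 <= t < 1 by rewrite t1 andbT /t; lra.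
have t01 : 0 < t < 1 by rewrite t1 andbT /t; lra.
have tn n : q <= n -> 1 - n < t < 1 by move=> h; rewrite t1 andbT /t; lra.
have tm n : q <= n -> 1 - n < t <= 1 by move=> h; rewrite (ltW t1) andbT /t; lra.
have [r1 r10 hr] := admissible_exists t01.
pose rho := Num.min r1 (q / 2).
have rho0 : 0 < rho by rewrite lt_min r10 divr_gt0.
have rq : rho < q by apply: (@le_lt_trans _ _ (q / 2)); [rewrite ge_min lexx orbT|lra].
have adm : admissible rho t by apply: hr; rewrite rho0 ge_min lexx.
have rn n : q <= n -> 0 < rho < n by move=> h; rewrite rho0 (lt_le_trans rq h).
have [V [V0 Vs Vr]] := approximant su sux suy wx wy rho0 t01 adm.
have Sx : sq leb2 D (pb (smear rho t ux)) by apply: (pb_sq inj); exact: smear_cont.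
have Sy : sq leb2 D (pb (smear rho t uy)) by apply: (pb_sq inj); exact: smear_cont.
have b1 := hc rho t ux rho0 th sux; have b2 := hc rho t uy rho0 th suy.
have x1h := h2 rho t (tn _ qn2) (rn _ qn2) adm; have y1h := h3 rho t (tn _ qn3) (rn _ qn3) adm.
have inO z : Om z -> 0 <= z.1 <= L /\ 0 <= z.2 <= delta.
  by move=> [/andP[/ltW-> /ltW->] /andP[/ltW-> /ltW->]].
have gx z : Om z -> gxd C V z = alpha (t, z) * smear rho t ux z + beta (t, z) * smear rho t uy z.
  by move=> Oz; rewrite /gxd Vs // Vr // /alpha /beta /coef /=; ring.
have gy z : Om z -> gyd C V z = gamm (t, z) * smear rho t uy z + beta2 (t, z) * smear rho t ux z.
  by move=> Oz; rewrite /gyd Vs // Vr // /gamm /beta2 /coef /=; ring.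
have fin X Y Z : X <= e / 4 -> Y <= c * nsq ux -> Z <= c * nsq uy ->
    2 * X + 8 * e2 ^+ 2 * (Y + Z) <= e.
  move=> hX hY hZ.
  have hYZ : Y + Z <= N by rewrite /N mulrDr; apply: le_trans (lerD hY hZ) _; rewrite lerDl ler01.
  have he2 : e2 ^+ 2 = e / (16 * N) by rewrite sqr_sqrtr // ltW // divr_gt0 // mulr_gt0.
  have : 8 * e2 ^+ 2 * (Y + Z) <= 8 * e2 ^+ 2 * N.
    by rewrite ler_pM2l // mulr_gt0 // exprn_gt0.
  have -> : 8 * e2 ^+ 2 * N = e / 2 by rewrite he2; have N1 : N != 0 by [rewrite gt_eqF]; field.
  by move=> h; apply: ar1 hX h.
exists V; split.
- have := h1 rho t (tn _ qn1) (rn _ qn1) adm => h.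
  have ee p : D p -> u p - pb (v0 V) p = u p - pb (smear rho t u) p.
    by move=> Dp; rewrite /Pullback.pb V0 //; exact: (PsiP Dp).1.
  rewrite (ip_eq leb2 ee ee); apply: le_trans h _.
  by rewrite ler_pdivrMr // ler_peMr ?ltW // ltr1n.
- pose a p := alpha (t, Psi C p); pose b p := beta (t, Psi C p).
  have ee p : D p -> ux p - pb (gxd C V) p = ux p - (a p * pb (smear rho t ux) p + b p * pb (smear rho t uy) p).
    by move=> Dp; rewrite /Pullback.pb gx //; exact: (PsiP Dp).1.
  rewrite (ip_eq leb2 ee ee); apply: le_trans (nsq_comb (e := e2) 0 sux Sx Sy _ _) _.
  + apply: (sq_eq mD ee); apply: (sqB mD sux); apply: (pb_sq inj); exact: gxd_cont.
  + move=> p Dp; have [i1 i2] := inO _ (PsiP Dp).1.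
    have [oa ob oc od] := coef_one i1 i2.
    split; apply: ltW; first by rewrite -oa; exact: k1 (tm _ qm1).
    by rewrite -[b p]subr0 -ob; exact: k2 (tm _ qm2).
  exact: fin.
- pose a p := gamm (t, Psi C p); pose b p := beta2 (t, Psi C p).
  have ee p : D p -> uy p - pb (gyd C V) p = uy p - (a p * pb (smear rho t uy) p + b p * pb (smear rho t ux) p).
    by move=> Dp; rewrite /Pullback.pb gy //; exact: (PsiP Dp).1.
  rewrite (ip_eq leb2 ee ee); apply: le_trans (nsq_comb (e := e2) 0 suy Sy Sx _ _) _.
  + apply: (sq_eq mD ee); apply: (sqB mD suy); apply: (pb_sq inj); exact: gyd_cont.
  + move=> p Dp; have [i1 i2] := inO _ (PsiP Dp).1.
    have [oa ob oc od] := coef_one i1 i2.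
    split; apply: ltW; first by rewrite -oc; exact: k3 (tm _ qm3).
    by rewrite -[b p]subr0 -od; exact: k4 (tm _ qm4).
  by rewrite [X in _ + _ * X]addrC; exact: fin.
Qed.
End Smoothing.

(** * The spectrum of the strip *)

Section MeanSquareLimits.
Context d (T : measurableType d) (R : realType).
Variables (m : {measure set T -> \bar R}) (D : set T).
Hypothesis mD : measurable D.
Local Notation nsq f := (ip m D f f).
Implicit Types (f g : nat -> T -> R) (u w v : T -> R).

Definition cvg2 f u := nsq (fun x => f n x - u x) @[n --> \oo] --> (0 : R).

Lemma cvg2P f u : (forall e, 0 < e -> exists N, forall n, (N <= n)%N ->
  nsq (fun x => f n x - u x) <= e) -> cvg2 f u.
Proof.
move=> h; apply/cvgrPdist_le => e e0; have [N hN] := h e e0.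
by exists N => // n Nn; rewrite sub0r normrN ger0_norm ?ip_ge0 //; exact: hN.
Qed.

Lemma ip_cvg f u g w : (forall n, sq m D (f n)) -> (forall n, sq m D (g n)) -> sq m D u ->
  sq m D w -> cvg2 f u -> cvg2 g w -> ip m D (f n) (g n) @[n --> \oo] --> ip m D u w.
Proof.
move=> sf sg su sw cf cg.
pose a n := Num.sqrt (nsq (fun x => f n x - u x)).
pose b n := Num.sqrt (nsq (fun x => g n x - w x)).
have a0 : a n @[n --> \oo] --> (0 : R).
  by rewrite -(@sqrtr0 R); apply: (continuous_cvg _ (@sqrt_continuous R 0)).
have b0 : b n @[n --> \oo] --> (0 : R).
  by rewrite -(@sqrtr0 R); apply: (continuous_cvg _ (@sqrt_continuous R 0)).
have cs v v' : sq m D v -> sq m D v' -> `|ip m D v v'| <= Num.sqrt (nsq v) * Num.sqrt (nsq v').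
  move=> sv sv'; rewrite -sqrtrM ?ip_ge0 // -sqrtr_sqr ler_sqrt ?mulr_ge0 ?ip_ge0 //.
  exact: ip_cauchy_schwarz.
have lim0 : a n * b n + a n * Num.sqrt (nsq w) + Num.sqrt (nsq u) * b n @[n --> \oo] --> (0 : R).
  rewrite (_ : 0 = 0 * 0 + 0 * Num.sqrt (nsq w) + Num.sqrt (nsq u) * 0 :> R); last by ring.
  apply: cvgD; first apply: cvgD.
  - exact: cvgM.
  - by apply: cvgM => //; exact: cvg_cst.
  - by apply: cvgM => //; exact: cvg_cst.
suff h : (ip m D (f n) (g n) - ip m D u w) @[n --> \oo] --> (0 : R).
  exact/subr_cvg0.
apply: norm_cvg0; apply: (squeeze_cvgr (f := fun=> 0) (h := fun n =>
  a n * b n + a n * Num.sqrt (nsq w) + Num.sqrt (nsq u) * b n)) lim0; last exact: cvg_cst.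
apply: nearW => n; rewrite normr_ge0 /=.
have sa := sqB mD (sf n) su; have sb := sqB mD (sg n) sw.
have e1 : ip m D (f n) (g n) - ip m D u w = ip m D (fun x => f n x - u x) (fun x => g n x - w x) +
    ip m D (fun x => f n x - u x) w + ip m D u (fun x => g n x - w x).
  rewrite (ipB mD (sf n) su sb) (ipB mD (sf n) su sw) !(ipC _ _ _ (fun x => g n x - w x)).
  by rewrite !(ipB mD (sg n) sw) // (ipC _ _ (g n)) (ipC _ _ (g n) u) (ipC _ _ w u) (ipC _ _ w (f n)); ring.
rewrite e1; apply: le_trans (ler_normD _ _) _; apply: lerD; last exact: cs.
by apply: le_trans (ler_normD _ _) _; apply: lerD; exact: cs.
Qed.

Lemma ip_cvgl f u v : (forall n, sq m D (f n)) -> sq m D u -> sq m D v -> cvg2 f u ->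
  ip m D (f n) v @[n --> \oo] --> ip m D u v.
Proof.
move=> sf su sv cf; apply: (ip_cvg (g := fun=> v)) => //.
rewrite /cvg2 (_ : (fun n => _) = (fun=> 0)); first exact: cvg_cst.
apply/funext => n; rewrite /ip (_ : (fun x => _) = (fun=> 0)) ?/Rintegral ?integral0 //.
by apply/funext => x; rewrite subrr mul0r.
Qed.

Lemma ip_null u : sq m D u -> {ae m, forall x, D x -> u x = 0} -> ip m D u u = 0.
Proof.
move=> su u0; have mu2 : measurable_fun D (fun x => (u x * u x)%:E).
  by apply/measurable_EFinP; apply: measurable_funM; exact: su.1.
have h : ae_eq m D (fun x => (u x * u x)%:E) (cst 0%E).
  by apply: filterS u0 => x hx Dx /=; rewrite hx // mul0r.
have := (ae_eq_integral_abs m mD mu2).2 h => e.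
rewrite /ip /Rintegral (_ : (\int[m]_(x in D) (u x * u x)%:E = 0)%E) // -e.
apply: eq_integral => x _; rewrite gee0_abs // lee_fin -expr2 sqr_ge0 //.
Qed.

End MeanSquareLimits.

Section Spectrum.
Context {R : realType} {L delta : R}.
Variable C : centerline L delta.
Local Notation leb := (@lebesgue_measure R).
Local Notation leb2 := (@lebesgue2 R).
Local Notation pl := (plane R).
Local Notation Phi := (Phi C).
Local Notation Om := (Om L delta).
Local Notation c1 := (c1fun L delta).
Local Notation wt := (wt C).
Local Notation D := (Dom C).
Local Notation pb := (pb C).
Local Notation mu := (@mu R L delta wt).
Local Notation QQ := (QQ wt).
Local Notation NN := (NN wt).
Local Notation mean := (mean wt).
Local Notation nsq f := (ip leb2 D f f).
Hypothesis inj : forall z z', Om z -> Om z' -> Phi z = Phi z' -> z = z'.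
Hypothesis sne : exists V : c1, c1odd V /\ 0 < NN V V.
Hypothesis Hslice : forall s (g g1 : R -> R), 0 < s < L -> continuous g -> continuous g1 ->
  (forall r, 0 < r < delta -> is_derive r 1 g (g1 r)) ->
  (exists2 r0, 0 <= r0 <= delta & g r0 = 0) ->
  mu * \int[leb]_(r in Io 0 delta) (wt (s, r) * g r ^+ 2) <=
  \int[leb]_(r in Io 0 delta) (wt (s, r) * g1 r ^+ 2).

Let L0 : 0 < L := L_gt0 C.
Let d0 : 0 < delta := delta_gt0 C.
Let mD : measurable (D : set pl) := measurable_Dom inj.
Let cw := @wt_cont _ _ _ C.
Let w0 := wt_gt0 C.
Let wf := wt_flip C.

Let su (V : c1) : sq leb2 D (pb (v0 V)). Proof. exact: (pb_sq inj (@cont_v0 _ _ _ V)). Qed.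
Let sx (V : c1) : sq leb2 D (pb (gxd C V)). Proof. exact: (pb_sq inj (@gxd_cont _ _ _ C V)). Qed.
Let sy (V : c1) : sq leb2 D (pb (gyd C V)). Proof. exact: (pb_sq inj (@gyd_cont _ _ _ C V)). Qed.

Definition pbone := pb (fun=> 1).
Let s1 : sq leb2 D pbone. Proof. exact: (pb_sq inj (@cont_cst (R * R)%type R 1)). Qed.

Let one : c1 := c1cst 1.
Let h0 := NN one one.
Let h0_gt0 : 0 < h0.
Proof.
have [c0 [c1' [c00 _ hb]]] := @H_bounds R L delta _ cw w0.
rewrite /h0; apply: (@lt_le_trans _ _ (c0 * (delta * L))); first by rewrite !mulr_gt0.
have c1c : continuous (fun _ : R * R => c0) by exact: cont_cst.
have -> : c0 * (delta * L) = RI 0 L 0 delta (fun=> c0).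
  rewrite RI_fubini1 //; apply: esym.
  rewrite (_ : (fun s : R => _) = fun=> c0 * (delta - 0)); last first.
    by apply/funext => s; rewrite Rintegral_Io_cst // ltW.
  by rewrite Rintegral_Io_cst ?ltW // !subr0 mulrA.
apply: RI_le => //; first exact: nd_cont.
by move=> z z1 z2; rewrite /nd /= !mulr1; have /andP[] := hb z z1 z2.
Qed.

Let center (V : c1) := c1lin 1 V (- (mean V / h0)) one.

Let center_mean (V : c1) : mean (center V) = 0.
Proof.
by rewrite /Energy.mean NN_lin // -/(Energy.mean wt V) -/h0 mul1r mulNr divfK ?subrr // gt_eqF.
Qed.

Let QQ_center (V : c1) : QQ (center V) (center V) = QQ V V.
Proof.
rewrite QQ_lin // QQ_linr // QQ_linr // !QQ_cst // (QQC _ V) // QQ_cst //; ring.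
Qed.

Let NN_center (V : c1) : NN (center V) (center V) = NN V V - mean V ^+ 2 / h0.
Proof.
rewrite NN_lin // NN_linr // NN_linr // (NNC _ one V) -/(Energy.mean wt V) -/h0.
by have h : h0 != 0 by [rewrite gt_eqF]; field.
Qed.

(** A version free of the mean-zero condition, which approximating sequences do not preserve. The
    correction is continuous and disappears in the limit. *)
Let rayleigh (V : c1) : mu * (NN V V - mean V ^+ 2 / h0) <= QQ V V.
Proof.
rewrite -NN_center -QQ_center.
exact: (rayleigh_mean_zero L0 d0 cw w0 wf sne Hslice (center_mean V)).
Qed.

Let mean_ip (V : c1) : mean V = ip leb2 D (pb (v0 V)) pbone.
Proof. by rewrite -(pb_mean inj V); apply: eq_Rintegral => p _; rewrite /pbone /Pullback.pb mulr1. Qed.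

(** An odd function has integral 0 over the rectangle, so [poincare_rectangle] without its mean term
    bounds mass by energy with a uniform constant. *)
Lemma mu_gt0 : 0 < mu.
Proof.
have [c0 [c1' [c00 c10 hb]]] := @H_bounds R L delta _ cw w0.
have [W [Wodd W1 Wmu _]] := minimizing_sequence L0 d0 cw w0 sne.
have odd_bound (V : c1) : c1odd V -> NN V V <= c1' * (L ^+ 2 * c1' + delta ^+ 2 / c0) * QQ V V.
  move=> [oV _ _].
  have p := @poincare_rectangle _ 0 L 0 delta (v0 V) (vs V) (vr V) L0 d0 (@cont_v0 _ _ _ V)
    (@cont_vs _ _ _ V) (@cont_vr _ _ _ V) (@der_vs _ _ _ V) (@der_vr _ _ _ V).
  rewrite (RI_odd0 L0 (@cont_v0 _ _ _ V) oV) expr0n mul0r add0r !subr0 in p.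
  have cqd : continuous (qd wt V V) by exact: qd_cont.
  have ks : RI 0 L 0 delta (fun z => vs V z ^+ 2) <= c1' * QQ V V.
    rewrite -RI_scale //; apply: RI_le; [by cts|by cts|] => z z1 z2.
    have /andP[b1 b2] := hb z z1 z2; have wz := w0 z.
    rewrite /qd mulrDr; apply: ler_wpDr; first by apply: mulr_ge0; [exact: ltW|apply: mulr_ge0; [exact: ltW|rewrite -expr2 sqr_ge0]].
    rewrite -expr2 mulrA ler_pdivlMr // mulrC ler_wpM2r // sqr_ge0 //.
  have kr : RI 0 L 0 delta (fun z => vr V z ^+ 2) <= c0^-1 * QQ V V.
    rewrite -RI_scale //; apply: RI_le; [by cts|by cts|] => z z1 z2.
    have /andP[b1 b2] := hb z z1 z2; have wz := w0 z.
    rewrite /qd mulrDr; apply: ler_wpDl.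
      by rewrite mulr_ge0 ?invr_ge0 ?(ltW c00) // divr_ge0 ?(ltW wz) // -expr2 sqr_ge0.
    rewrite -expr2 mulrA ler_peMl ?sqr_ge0 //.
    by rewrite mulrC ler_pdivlMr // mul1r.
  have kn : NN V V <= c1' * RI 0 L 0 delta (fun z => v0 V z ^+ 2).
    rewrite -RI_scale; last by cts.
    apply: RI_le; [exact: nd_cont|by cts|] => z z1 z2.
    by have /andP[b1 b2] := hb z z1 z2; rewrite /nd -expr2 ler_wpM2r // sqr_ge0.
  apply: le_trans kn _; rewrite -mulrA ler_wpM2l ?(ltW c10) //; apply: le_trans p _.
  have k1 := ler_wpM2l (sqr_ge0 L) ks; have k2 := ler_wpM2l (sqr_ge0 delta) kr.
  apply: le_trans (lerD k1 k2) _; rewrite mulrDl !mulrA //.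
have K0 : 0 < c1' * (L ^+ 2 * c1' + delta ^+ 2 / c0).
  by rewrite mulr_gt0 // addr_gt0 ?divr_gt0 ?mulr_gt0 ?exprn_gt0.
set K := _ * (_ + _) in K0 odd_bound.
have m0 := mu_ge0 cw w0 sne.
rewrite lt_neqAle m0 andbT eq_sym; apply/eqP => mu0.
have e0 : 0 < (2 * K)^-1 by rewrite invr_gt0 mulr_gt0.
have [I hI] := Wmu _ e0; have := hI I (leqnn I); rewrite mu0 add0r => h1.
have := odd_bound _ (Wodd I); rewrite W1 => h2.
have := ler_wpM2l (ltW K0) h1; rewrite invfM mulrCA divff ?gt_eqF // mulr1 => h3.
by have := le_trans h2 h3; lra.
Qed.

Section Limits.
Variables (f : nat -> c1) (u ux uy : R * R -> R).
Hypotheses (lu : sq leb2 D u) (lx : sq leb2 D ux) (ly : sq leb2 D uy).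
Hypotheses (cu : cvg2 leb2 D (fun n => pb (v0 (f n))) u)
  (cx : cvg2 leb2 D (fun n => pb (gxd C (f n))) ux)
  (cy : cvg2 leb2 D (fun n => pb (gyd C (f n))) uy).

Lemma NN_lim : NN (f n) (f n) @[n --> \oo] --> nsq u.
Proof.
rewrite (_ : (fun n => _) = (fun n => nsq (pb (v0 (f n))))); first exact: ip_cvg.
by apply/funext => n; rewrite pb_NN.
Qed.

Lemma NN_liml (V : c1) : NN (f n) V @[n --> \oo] --> ip leb2 D u (pb (v0 V)).
Proof.
rewrite (_ : (fun n => _) = (fun n => ip leb2 D (pb (v0 (f n))) (pb (v0 V)))); first exact: ip_cvgl.
by apply/funext => n; rewrite pb_NN.
Qed.

Lemma QQ_lim : QQ (f n) (f n) @[n --> \oo] --> nsq ux + nsq uy.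
Proof.
rewrite (_ : (fun n => _) = (fun n => nsq (pb (gxd C (f n))) + nsq (pb (gyd C (f n))))).
  by apply: cvgD; exact: ip_cvg.
by apply/funext => n; rewrite pb_QQ.
Qed.

Lemma QQ_liml (V : c1) : QQ (f n) V @[n --> \oo] --> ip leb2 D ux (pb (gxd C V)) + ip leb2 D uy (pb (gyd C V)).
Proof.
rewrite (_ : (fun n => _) = (fun n => ip leb2 D (pb (gxd C (f n))) (pb (gxd C V)) +
  ip leb2 D (pb (gyd C (f n))) (pb (gyd C V)))).
  by apply: cvgD; exact: ip_cvgl.
by apply/funext => n; rewrite pb_QQ.
Qed.

Lemma mean_lim : mean (f n) @[n --> \oo] --> \int[leb2]_(p in D) u p.
Proof.
rewrite (_ : \int[leb2]_(p in D) u p = ip leb2 D u pbone); last first.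
  by apply: eq_Rintegral => p _; rewrite /pbone /Pullback.pb mulr1.
rewrite (_ : (fun n => _) = (fun n => ip leb2 D (pb (v0 (f n))) pbone)); first exact: ip_cvgl.
by apply/funext => n; rewrite mean_ip.
Qed.

Let weak_lim (e : R * R) g : (forall n, sq leb2 D (pb (g n))) -> forall w, sq leb2 D w ->
  cvg2 leb2 D (fun n => pb (g n)) w ->
  (e = @ex R \/ e = @ey R) ->
  (forall n, weak_derivative D e (pb (v0 (f n))) (pb (g n))) -> weak_derivative D e u w.
Proof.
move=> sg w sw cg ee wd phi tp; have [cp cpx cpy] := test_cont tp.
have cPhi := @Phi_cont _ _ _ C.
have mk (h : R * R -> R) : continuous h -> sq leb2 D h.
  move=> ch; apply: (sq_eq mD (f := pb (fun z => h (Phi z)))).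
    by move=> p Dp; rewrite /Pullback.pb (PsiP Dp).2.
  exact: (pb_sq inj (cont_comp ch cPhi)).
have s2 : sq leb2 D phi by exact: mk.
have s3 : sq leb2 D ('D_e phi) by case: ee => ->; [exact: (mk _ cpx)|exact: (mk _ cpy)].
have l1 := ip_cvgl mD (fun n => su (f n)) lu s3 cu.
have l2 := ip_cvgl mD sg sw s2 cg.
have l3 : ip leb2 D (pb (v0 (f n))) ('D_e phi) @[n --> \oo] --> - ip leb2 D w phi.
  rewrite (_ : (fun n => _) = (fun n => - ip leb2 D (pb (g n)) phi)); first exact: cvgN.
  by apply/funext => n; exact: wd.
exact: (cvg_unique _ l1 l3).
Qed.

Lemma H1_lim : H1 D u ux uy.
Proof.
split; [exact/L2P|exact/L2P|exact/L2P| |].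
- apply: (weak_lim (g := fun n => gxd C (f n))) => //; first by left.
  by move=> n; have [] := pb_H1 inj (f n).
- apply: (weak_lim (g := fun n => gyd C (f n))) => //; first by right.
  by move=> n; have [] := pb_H1 inj (f n).
Qed.

End Limits.

Lemma H1_approx_seq v vx vy : H1 D v vx vy -> exists f : nat -> c1,
  [/\ cvg2 leb2 D (fun n => pb (v0 (f n))) v, cvg2 leb2 D (fun n => pb (gxd C (f n))) vx &
      cvg2 leb2 D (fun n => pb (gyd C (f n))) vy].
Proof.
move=> Hv; have [/(L2P _ mD) sv /(L2P _ mD) svx /(L2P _ mD) svy _ _] := Hv.
have h n : exists V : c1, [/\ nsq (fun p => v p - pb (v0 V) p) <= n.+1%:R^-1,
    nsq (fun p => vx p - pb (gxd C V) p) <= n.+1%:R^-1 &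
    nsq (fun p => vy p - pb (gyd C V) p) <= n.+1%:R^-1].
  by apply: (approx_H1 inj Hv); rewrite invr_gt0 ltr0n.
have [f hf] := choice h; exists f.
have sym (a b : R * R -> R) : nsq (fun p => a p - b p) = nsq (fun p => b p - a p).
  by apply: eq_Rintegral => p _; ring.
have mk (g : nat -> R * R -> R) w : (forall n, nsq (fun p => w p - g n p) <= n.+1%:R^-1) -> cvg2 leb2 D g w.
  move=> gw; apply: cvg2P => e e0; have [N _ hN] := near_infty_natSinv_lt (PosNum e0).
  by exists N => n Nn; rewrite sym; apply: le_trans (gw n) _; apply: ltW; exact: hN.
by split; apply: mk => n; have [] := hf n.
Qed.

Lemma rayleigh_H1 v vx vy : H1 D v vx vy -> \int[leb2]_(p in D) v p = 0 ->
  mu * nsq v <= nsq vx + nsq vy.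
Proof.
move=> Hv m0; have [f [cu cx cy]] := H1_approx_seq Hv.
have [/(L2P _ mD) sv /(L2P _ mD) svx /(L2P _ mD) svy _ _] := Hv.
have lN := NN_lim sv cu; have lQ := QQ_lim svx svy cx cy.
have lm := mean_lim sv cu; rewrite m0 in lm.
have lL : mu * (NN (f n) (f n) - mean (f n) * mean (f n) / h0) @[n --> \oo] -->
    mu * (nsq v - 0 * 0 / h0).
  apply: cvgM; first exact: cvg_cst.
  apply: cvgB => //; apply: cvgM; last exact: cvg_cst.
  exact: cvgM.
rewrite !mul0r subr0 in lL.
apply: (ler_cvg_to lL lQ); apply: nearW => n; rewrite -expr2; exact: rayleigh.
Qed.

Let sum_Rint v vx w wx : sq leb2 D v -> sq leb2 D vx -> sq leb2 D w -> sq leb2 D wx ->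
  \int[leb2]_(p in D) (v p * vx p + w p * wx p) = ip leb2 D v vx + ip leb2 D w wx.
Proof.
move=> h1 h2 h3 h4.
have := Rintegral_lin mD 1 1 (sq_integrable mD h1 h2) (sq_integrable mD h3 h4).
rewrite !mul1r => <-; apply: eq_Rintegral => p _; ring.
Qed.

Let ip_cvgr (g : nat -> R * R -> R) w v : (forall n, sq leb2 D (g n)) -> sq leb2 D w -> sq leb2 D v ->
  cvg2 leb2 D g w -> ip leb2 D v (g n) @[n --> \oo] --> ip leb2 D v w.
Proof.
move=> sg sw sv cg; rewrite ipC; have := ip_cvgl mD sg sw sv cg.
by rewrite (_ : (fun n => ip leb2 D (g n) v) = (fun n => ip leb2 D v (g n))) //; apply/funext => n; rewrite ipC.
Qed.

(** The weak equation holds against all of H1, not only against odd functions, because [mu] also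
    bounds the quotient of every function of mean zero. Oddness holds at every point of [D] by the
    last clause of [square_integrable_complete]. *)
Lemma odd_minimizer : exists u ux uy, [/\ H1 D u ux uy, nsq u = 1, nsq ux + nsq uy = mu,
  \int[leb2]_(p in D) u p = 0 & (forall p, D p -> u (- p.1, p.2) = - u p) /\
  forall v vx vy, H1 D v vx vy -> ip leb2 D ux vx + ip leb2 D uy vy = mu * ip leb2 D u v].
Proof.
have [W [Wodd W1 Wmu Wcau]] := minimizing_sequence L0 d0 cw w0 sne.
pose dif i j := c1lin 1 (W i) (-1) (W j).
have eN i j : nsq (fun p => pb (v0 (W i)) p - pb (v0 (W j)) p) = NN (dif i j) (dif i j).
  by rewrite -(pb_NN inj); apply: ip_eq => p _; rewrite /Pullback.pb /=; ring.
have eQ i j : nsq (fun p => pb (gxd C (W i)) p - pb (gxd C (W j)) p) +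
    nsq (fun p => pb (gyd C (W i)) p - pb (gyd C (W j)) p) = QQ (dif i j) (dif i j).
  by rewrite -(pb_QQ inj); congr (_ + _); apply: ip_eq => p _; rewrite /Pullback.pb /gxd /gyd /=; ring.
have [] := square_integrable_complete mD (fun n => su (W n)).
  move=> e e0; have [I hI] := Wcau e e0; exists I => i j hi hj.
  by rewrite eN; have [] := hI i j hi hj.
move=> u [lu /cvg2P cu ou].
have [] := square_integrable_complete mD (fun n => sx (W n)).
  move=> e e0; have [I hI] := Wcau e e0; exists I => i j hi hj.
  have [_ h] := hI i j hi hj; apply: le_trans h; rewrite -/(dif i j) -eQ lerDl; exact: ip_ge0.
move=> ux [lx /cvg2P cx _].
have [] := square_integrable_complete mD (fun n => sy (W n)).
  move=> e e0; have [I hI] := Wcau e e0; exists I => i j hi hj.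
  have [_ h] := hI i j hi hj; apply: le_trans h; rewrite -/(dif i j) -eQ lerDr; exact: ip_ge0.
move=> uy [ly /cvg2P cy _].
have Wmean n : mean (W n) = 0 by apply: (NN_odd_even L0 cw wf (Wodd n)); exact: c1even_cst.
have Qge n : mu <= QQ (W n) (W n) by have := mu_le cw w0 sne (Wodd n); rewrite W1 mulr1.
have Qmu : QQ (W n) (W n) @[n --> \oo] --> mu.
  apply/cvgrPdist_le => e e0; have [I hI] := Wmu e e0; exists I => // n In.
  by rewrite distrC ger0_norm ?subr_ge0 // lerBlDl; exact: hI.
have u1 : nsq u = 1.
  have lN := NN_lim lu cu.
  have c : NN (W n) (W n) @[n --> \oo] --> (1 : R) by apply: cvg_near_cst; apply: nearW => n; exact: W1.
  exact: (cvg_unique _ lN c).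
have umu : nsq ux + nsq uy = mu by exact: (cvg_unique _ (QQ_lim lx ly cx cy) Qmu).
have um : \int[leb2]_(p in D) u p = 0.
  have c : mean (W n) @[n --> \oo] --> (0 : R) by apply: cvg_near_cst; apply: nearW => n; exact: Wmean.
  exact: (cvg_unique _ (mean_lim lu cu) c).
have HH := H1_lim lu lx ly cu cx cy.
(* [E n] is the error in the Euler equation. Cauchy-Schwarz for [QQ - mu * NN] on functions of mean
   zero bounds its square by [(QQ (W n) (W n) - mu) * K], which tends to 0. *)
have EL (V : c1) : ip leb2 D ux (pb (gxd C V)) + ip leb2 D uy (pb (gyd C V)) = mu * ip leb2 D u (pb (v0 V)).
  pose E n := QQ (W n) V - mu * NN (W n) V.
  have lE : E n @[n --> \oo] --> ip leb2 D ux (pb (gxd C V)) + ip leb2 D uy (pb (gyd C V)) - mu * ip leb2 D u (pb (v0 V)).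
    apply: cvgB; first exact: QQ_liml.
    by apply: cvgM; [exact: cvg_cst|exact: NN_liml].
  (* Subtracting a constant from [V] does not change [E n], as [W n] has mean zero. *)
  have [V' mV' EV'] : exists2 V', mean V' = 0 & forall n, E n = QQ (W n) V' - mu * NN (W n) V'.
    exists (center V) => // n.
    rewrite /center QQ_linr // NN_linr // (QQC _ (W n) one) // QQ_cst // -/(Energy.mean wt (W n)) Wmean /E.
    by ring.
  pose K := QQ V' V' - mu * NN V' V'.
  have K0 : 0 <= K.
    by rewrite subr_ge0; exact: (rayleigh_mean_zero L0 d0 cw w0 wf sne Hslice mV').
  have cs n : E n * E n <= (QQ (W n) (W n) - mu) * K.
    rewrite -expr2; apply: cauchy_schwarz_form => // t.
    pose Z := c1lin 1 (W n) t V'.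
    have mZ : mean Z = 0 by rewrite /Energy.mean NN_lin // -/(Energy.mean wt (W n)) -/(Energy.mean wt V') Wmean mV'; ring.
    have := rayleigh_mean_zero L0 d0 cw w0 wf sne Hslice mZ; rewrite -subr_ge0.
    rewrite /Z QQ_lin // !QQ_linr // NN_lin // !NN_linr // W1 (QQC _ V' (W n)) // (NNC _ V' (W n)).
    by rewrite EV' /K => h; apply: le_trans h _; rewrite le_eqVlt; apply/orP; left; apply/eqP; ring.
  have l2 : (QQ (W n) (W n) - mu) * K @[n --> \oo] --> (mu - mu) * K.
    by apply: cvgM; [apply: cvgB => //; exact: cvg_cst|exact: cvg_cst].
  rewrite subrr mul0r in l2.
  set X := (X in _ --> X) in lE.
  have h : X ^+ 2 <= 0 by rewrite expr2; apply: (ler_cvg_to (cvgM lE lE) l2); apply: nearW.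
  by apply/eqP; rewrite -subr_eq0 -sqrf_eq0 eq_le h sqr_ge0.
exists u, ux, uy; split=> //; split.
  move=> p Dp; have [Op ep] := PsiP Dp.
  have ef : Phi (@flip _ L (Psi C p)) = (- p.1, p.2).
    by rewrite /flip Phi_sym -surjective_pairing ep.
  have Of : Om (@flip _ L (Psi C p)).
    by move: Op => [/andP[? ?] h]; split => //=; apply/andP; split; lra.
  apply: ou => //; first by exists (@flip _ L (Psi C p)).
  by move=> n; rewrite /Pullback.pb -ef PhiK //; have [h _ _] := Wodd n; exact: h.
move=> v vx vy Hv; have [f [cu' cx' cy']] := H1_approx_seq Hv.
have [/(L2P _ mD) sv /(L2P _ mD) svx /(L2P _ mD) svy _ _] := Hv.
have a1 := ip_cvgr (fun n => sx (f n)) svx lx cx'.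
have a2 := ip_cvgr (fun n => sy (f n)) svy ly cy'.
have a3 := ip_cvgr (fun n => su (f n)) sv lu cu'.
have l1 : mu * ip leb2 D u (pb (v0 (f n))) @[n --> \oo] --> ip leb2 D ux vx + ip leb2 D uy vy.
  rewrite (_ : (fun n => _) = (fun n => ip leb2 D ux (pb (gxd C (f n))) + ip leb2 D uy (pb (gyd C (f n))))).
    exact: cvgD.
  by apply/funext => n; rewrite -EL.
have l2 : mu * ip leb2 D u (pb (v0 (f n))) @[n --> \oo] --> mu * ip leb2 D u v.
  by apply: cvgM => //; exact: cvg_cst.
exact: (cvg_unique _ l1 l2).
Qed.

Lemma spectrum : is_mu1 D mu /\ is_mu1_odd D mu.
Proof.
have [u [ux [uy [HH u1 umu um [uo EL]]]]] := odd_minimizer.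
have [/(L2P _ mD) lu /(L2P _ mD) lx /(L2P _ mD) ly _ _] := HH.
have sqI (v : R * R -> R) : \int[leb2]_(p in D) (v p ^+ 2) = nsq v by [].
have nn v : sq leb2 D v -> nsq v <> 0 -> ~ null_on D v.
  by move=> sv h n; apply: h; exact: (ip_null mD sv n).
have nn' v : sq leb2 D v -> ~ null_on D v -> 0 < nsq v.
  move=> sv h; rewrite lt_neqAle ip_ge0 andbT eq_sym; apply/eqP => e; apply: h.
  exact: (ip_eq0 mD sv e).
have un : ~ null_on D u by apply: nn => //; rewrite u1; apply/eqP; exact: oner_neq0.
split; split.
- exists u, ux, uy; split=> //.
  rewrite sqI u1 divr1 -umu -(sum_Rint lx lx ly ly).
  by apply: eq_Rintegral => p _; rewrite !expr2.
- move=> q [v [vx [vy [Hv vn vm ->]]]].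
  have [/(L2P _ mD) sv /(L2P _ mD) svx /(L2P _ mD) svy _ _] := Hv.
  rewrite sqI ler_pdivlMr ?nn' //; apply: le_trans (rayleigh_H1 Hv vm) _.
  rewrite -(sum_Rint svx svx svy svy) le_eqVlt; apply/orP; left; apply/eqP.
  by apply: eq_Rintegral => p _; rewrite !expr2.
- split; first by rewrite gt_eqF // mu_gt0.
  exists u; split; last by apply: aeW => p Dp; exact: uo.
  exists ux, uy; split=> // v vx vy Hv.
  have [/(L2P _ mD) sv /(L2P _ mD) svx /(L2P _ mD) svy _ _] := Hv.
  by rewrite sum_Rint //; exact: EL Hv.
- move=> q [q0 [v [[vx [vy [Hv vn vEL]]] _]]].
  have [/(L2P _ mD) sv /(L2P _ mD) svx /(L2P _ mD) svy _ _] := Hv.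
  (* Testing the equation with the constant 1: an eigenfunction with nonzero eigenvalue has mean
     zero. *)
  have vm : \int[leb2]_(p in D) v p = 0.
    have := vEL _ _ _ (pb_H1 inj one).
    rewrite sum_Rint //.
    have z (h : R * R -> R) : (forall p, h p = 0) -> forall w, ip leb2 D w h = 0.
      move=> h0' w; rewrite /ip (_ : (fun p => _) = (fun=> 0)) ?/Rintegral ?integral0 //.
      by apply/funext => p; rewrite h0' mulr0.
    rewrite !z; last 2 first.
    - by move=> p; rewrite /Pullback.pb /gyd /= !mul0r subr0.
    - by move=> p; rewrite /Pullback.pb /gxd /= !mul0r addr0.
    rewrite addr0 => /esym/eqP; rewrite mulf_eq0 (negbTE q0) /= => /eqP h.
    by rewrite -[RHS]h; apply: eq_Rintegral => p _; rewrite /Pullback.pb /= mulr1.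
  have e := vEL _ _ _ Hv; rewrite sum_Rint // in e.
  have := rayleigh_H1 Hv vm; rewrite e.
  by rewrite ler_pM2r // nn'.
Qed.

End Spectrum.

(** * The inequality on a normal segment *)

Section SliceInequality.
Context {R : realType} {L delta : R}.
Variable C : centerline L delta.
Local Notation leb := (@lebesgue_measure R).
Local Notation k := (ck C).
Local Notation wt := (wt C).

(** A zero of [g] gives [g ^ 2 <= delta * I1], and bounds [c1 <= wt <= c2] on the slice cost a
    factor [c2 / c1]. The resulting constant is [delta ^+ 2 * (1 + delta * k s)] or
    [delta ^+ 2 / (1 + delta * k s)] according to the sign of [k s], at most [M] in both cases. *)
Lemma slice_inequality (s M : R) (g g1 : R -> R) : continuous g -> continuous g1 ->
  (forall r, 0 < r < delta -> is_derive r 1 g (g1 r)) ->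
  (exists2 r0, 0 <= r0 <= delta & g r0 = 0) ->
  (0 <= k s /\ delta ^+ 2 * (2 + delta * k s) ^+ 2 <= M) \/
  (k s <= 0 /\ 4 * delta ^+ 2 / (1 + delta * k s) ^+ 2 <= M) ->
  \int[leb]_(r in Io 0 delta) (wt (s, r) * g r ^+ 2) <=
  M * \int[leb]_(r in Io 0 delta) (wt (s, r) * g1 r ^+ 2).
Proof.
move=> cg cg1 dg [r0 r0in g0] HM.
have d0 := delta_gt0 C; have hp := h_delta_gt0 C s.
have cw : continuous (fun r => wt (s, r)) by apply: (@cont_row _ wt s); exact: wt_cont.
pose I1 := \int[leb]_(r in Io 0 delta) (g1 r ^+ 2).
pose I2 := \int[leb]_(r in Io 0 delta) (wt (s, r) * g1 r ^+ 2).
have gb r : 0 < r < delta -> g r ^+ 2 <= delta * I1.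
  move=> /andP[ra rb]; have := @osc_der _ 0 delta r r0 g g1 cg cg1 dg; rewrite g0 !subr0; apply => //.
  by rewrite !ltW.
have cst_mul (c : R) (f : R -> R) : continuous f ->
    \int[leb]_(r in Io 0 delta) (c * f r) = c * \int[leb]_(r in Io 0 delta) f r.
  move=> cf; have := Rintegral_Io_lin 0 delta c 0 cf cf; rewrite mul0r addr0 => <-.
  by apply: eq_Rintegral => r _; rewrite mul0r addr0.
have cg2 : continuous (fun r => g1 r ^+ 2) by cts.
have cwg : continuous (fun r => wt (s, r) * g1 r ^+ 2) by cts.
have I10 : 0 <= I1 by apply: Rintegral_ge0 => r _; exact: sqr_ge0.
have I20 : 0 <= I2 by apply: Rintegral_ge0 => r _; rewrite mulr_ge0 ?sqr_ge0 // ltW // wt_gt0.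
have wE r : 0 < r < delta -> wt (s, r) = 1 + r * k s.
  by move=> /andP[a b]; rewrite /Pullback.wt /= clamp_id // !ltW.
have main (c1 c2 : R) : 0 < c1 -> (forall r, 0 < r < delta -> c1 <= wt (s, r) <= c2) ->
    c1 * \int[leb]_(r in Io 0 delta) (wt (s, r) * g r ^+ 2) <= delta ^+ 2 * c2 * I2.
  move=> c10 wb.
  have h1 : c1 * I1 <= I2.
    rewrite -cst_mul //; apply: Rintegral_Io_le => //; first by cts.
    by move=> r hr; rewrite ler_wpM2r ?sqr_ge0 //; have /andP[] := wb r hr.
  have h2 : \int[leb]_(r in Io 0 delta) (wt (s, r) * g r ^+ 2) <= (c2 * (delta * I1)) * (delta - 0).
    apply: Rintegral_Io_le_cst; [exact: ltW|by cts|] => r hr.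
    have /andP[_ h] := wb r hr.
    by apply: ler_pM; rewrite ?sqr_ge0 ?gb // ltW // wt_gt0.
  have c20 : 0 <= c2.
    have hm : 0 < delta / 2 < delta by apply/andP; split; lra.
    by have /andP[a b] := wb _ hm; apply: le_trans (le_trans (ltW c10) a) b.
  apply: le_trans (ler_wpM2l (ltW c10) h2) _; rewrite subr0.
  have -> : c1 * (c2 * (delta * I1) * delta) = delta ^+ 2 * c2 * (c1 * I1) by ring.
  by rewrite ler_wpM2l // mulr_ge0 // sqr_ge0.
rewrite -/I2; case: HM => -[ks hM].
  have dk : 0 <= delta * k s by rewrite mulr_ge0 // ltW.
  have := main 1 (1 + delta * k s) ltr01; rewrite mul1r => h; apply: le_trans (h _) _.
    move=> r hr; rewrite wE //; have /andP[ra rb] := hr.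
    have e1 : 0 <= r * k s by rewrite mulr_ge0 // ltW.
    have e2 : r * k s <= delta * k s by rewrite ler_wpM2r // ltW.
    by apply/andP; split; lra.
  rewrite ler_wpM2r //; apply: le_trans hM; rewrite ler_wpM2l ?sqr_ge0 //.
  have := sqr_ge0 (delta * k s); rewrite !expr2; nra.
have dk : delta * k s <= 0 by rewrite mulr_ge0_le0 // ltW.
have := main (1 + delta * k s) 1 hp; rewrite mulr1 => h.
have {}h : (1 + delta * k s) * \int[leb]_(r in Io 0 delta) (wt (s, r) * g r ^+ 2) <= delta ^+ 2 * I2.
  apply: h => r hr; rewrite wE //; have /andP[ra rb] := hr.
  have e1 : r * k s <= 0 by rewrite mulr_ge0_le0 // ltW.
  have e2 : delta * k s <= r * k s by rewrite ler_wnM2r // ltW.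
  by apply/andP; split; lra.
rewrite mulrC -ler_pdivlMr // in h; apply: le_trans h _.
rewrite mulrAC ler_wpM2r //; apply: le_trans hM.
set c := 1 + delta * k s in hp *; have c1 : c <= 1 by rewrite /c; lra.
rewrite ler_pdivlMr ?exprn_gt0 //.
have -> : delta ^+ 2 / c * c ^+ 2 = delta ^+ 2 * c by have cn : c != 0 by [rewrite gt_eqF]; field.
by have := sqr_ge0 delta; nra.
Qed.

End SliceInequality.

(** * The odd test function and the ratio of the statement *)

Section Cosine.
Context {R : realType} {L delta : R}.
Variable C : centerline L delta.
Local Notation leb := (@lebesgue_measure R).
Local Notation k := (ck C).
Local Notation wt := (wt C).
Local Notation J := (RI 0 L 0 delta).
Local Notation mu := (@mu R L delta wt).

Let L0 : 0 < L := L_gt0 C.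
Let d0 : 0 < delta := delta_gt0 C.
Let Ln : L != 0. Proof. by rewrite gt_eqF. Qed.

Let cl1 : continuous (fun z : R * R => pi / L * z.1). Proof. by cts. Qed.
Let ccos : continuous (fun z : R * R => cos (pi / L * z.1)).
Proof. exact: (cont_comp (@continuous_cos R) cl1). Qed.
Let csin : continuous (fun z : R * R => - (pi / L) * sin (pi / L * z.1)).
Proof. have c := cont_comp (@continuous_sin R) cl1; cts. Qed.

Let dcos s r : 0 < s < L -> 0 < r < delta ->
  is_derive s 1 (fun t => cos (pi / L * t)) (- (pi / L) * sin (pi / L * s)).
Proof.
move=> _ _; have h : is_derive s 1 (fun t => pi / L * t) (pi / L) by dereq; ring.
by apply: der_eq (der_cos h) _; ring.
Qed.

Let dzero s r : 0 < s < L -> 0 < r < delta ->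
  is_derive r 1 (fun _ : R => cos (pi / L * s)) 0.
Proof. by move=> _ _; exact: der_cst. Qed.

Definition cosine : c1fun L delta := C1fun ccos csin (@cont_cst (R * R)%type R 0) dcos dzero.

Lemma cosine_odd : c1odd cosine.
Proof.
have e (t : R) : pi / L * (L - t) = pi - pi / L * t by field; exact: Ln.
split=> z /=; rewrite ?oppr0 // e.
- by rewrite addrC cosDpi cosN.
- by rewrite addrC sinDpi sinN opprK.
Qed.

Definition num := J (fun z => cos (pi / L * z.1) ^+ 2 * wt z).
Definition den := J (fun z => sin (pi / L * z.1) ^+ 2 * (1 / wt z)).

Lemma cosine_NN : NN wt cosine cosine = num.
Proof. by apply: RI_eq => z _ _; rewrite /nd /=; ring. Qed.

Lemma cosine_QQ : QQ wt cosine cosine = (pi / L) ^+ 2 * den.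
Proof.
have cs := cont_comp (@continuous_sin R) cl1; have cv := @wtV_cont _ _ _ C.
rewrite /den -RI_scale; last by rewrite (_ : (fun z => _) = (fun z => sin (pi / L * z.1) ^+ 2 * (wt z)^-1)); [cts|apply/funext => z; rewrite div1r].
by apply: RI_eq => z _ _; rewrite /qd /= mul0r mulr0 addr0; have w0 := wt_neq0 C z; field; rewrite ?w0 ?Ln.
Qed.

(** Positivity is read near [s = 0], where the square of the cosine exceeds [1 / 2]. *)
Lemma num_gt0 : 0 < num.
Proof.
have [c0 [c1' [c00 _ hb]]] := @H_bounds R L delta _ (@wt_cont _ _ _ C) (wt_gt0 C).
have cl : continuous (fun s : R => pi / L * s) by cts.
have c1 : continuous (fun s : R => cos (pi / L * s)) by exact: (cont_comp (@continuous_cos R) cl).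
have c2 : continuous (fun s : R => cos (pi / L * s) ^+ 2) by cts.
have /cvgrPdist_lt/(_ (1 / 2)) := c2 0; rewrite mulr0 cos0 expr1n divr_gt0 // => /(_ isT).
move=> /nbhs_ballP[e /= e0 he].
pose m := Num.min (e / 2) L.
have m0 : 0 < m by rewrite lt_min L0 divr_gt0.
have mL : m <= L by rewrite ge_min lexx orbT.
have me : m < e by apply: (@le_lt_trans _ _ (e / 2)); [rewrite ge_min lexx|lra].
have cF : continuous (fun z => cos (pi / L * z.1) ^+ 2 * wt z) by have h := @wt_cont _ _ _ C; cts.
have mm : 0 <= m <= L by rewrite ltW.
rewrite /num (RI_split1 0 delta mm cF); apply: ltr_wpDr.
  by apply: RI_ge0 => z; rewrite mulr_ge0 ?sqr_ge0 // ltW // wt_gt0.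
apply: (@lt_le_trans _ _ (RI 0 m 0 delta (fun=> 1 / 2 * c0))).
  have cc : continuous (fun _ : R * R => 1 / 2 * c0) by exact: cont_cst.
  rewrite RI_fubini1 // (_ : (fun s : R => _) = fun=> 1 / 2 * c0 * (delta - 0)); last first.
    by apply/funext => s; rewrite Rintegral_Io_cst // ltW.
  by rewrite Rintegral_Io_cst ?ltW // !subr0 !mulr_gt0 // divr_gt0.
apply: RI_le => // [|z z1 z2]; first exact: cont_cst.
have /andP[za zb] := z1.
have zL : 0 < z.1 <= L by rewrite za (le_trans zb).
have /andP[h _] := hb z zL z2.
apply: ler_pM; rewrite ?(ltW c00) ?divr_ge0 //.
have : ball 0 e z.1 by rewrite /ball /= sub0r normrN ger0_norm ?ltW // (le_lt_trans zb me).
by move=> /he; rewrite ltr_norml => /andP[? ?]; lra.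
Qed.

Lemma mu_ratio : mu * (L ^+ 2 / pi ^+ 2 * (num / den)) <= 1.
Proof.
have sne : exists V : c1fun L delta, c1odd V /\ 0 < NN wt V V.
  by exists cosine; split; [exact: cosine_odd|rewrite cosine_NN num_gt0].
have := mu_le (@wt_cont _ _ _ C) (wt_gt0 C) sne cosine_odd.
have m0 := mu_ge0 (@wt_cont _ _ _ C) (wt_gt0 C) sne.
rewrite cosine_NN cosine_QQ => h.
have p0 := @pi_gt0 R; have pn : pi != 0 :> R by rewrite gt_eqF.
(* For a nonpositive [den] the ratio would be nonpositive and the inequality immediate, so
   positivity of [den] need not be established. *)
have [den0|den0] := ltP 0 den; last first.
  have : num / den <= 0.
    by rewrite mulr_ge0_le0 ?invr_le0 // ltW // num_gt0.
  move=> h2; apply: le_trans ler01; rewrite mulr_ge0_le0 // mulr_ge0_le0 // divr_ge0 ?exprn_ge0 // ltW //.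
have -> : mu * (L ^+ 2 / pi ^+ 2 * (num / den)) = (mu * num) / ((pi / L) ^+ 2 * den).
  have alg (m N S l p : R) : S != 0 -> l != 0 -> p != 0 ->
      m * (l ^+ 2 / p ^+ 2 * (N / S)) = m * N / ((p / l) ^+ 2 * S).
    by move=> h1 h2 h3; field; rewrite ?h1 ?h2 ?h3.
  by apply: alg => //; rewrite gt_eqF.
by rewrite ler_pdivrMr ?mul1r // mulr_gt0 // exprn_gt0 // divr_gt0.
Qed.

End Cosine.

(** * Reduction to the clamped curve *)

Section Reduction.
(** Four derivatives are listed because the derivative of the curvature involves [x3] and [y3], and
    its continuity comes from their differentiability. *)
Context {R : realType} {L delta : R} {x x1 x2 x3 x4 y y1 y2 y3 y4 k : R -> R}.
Local Notation dseq f f1 := (forall s : R, 0 <= s <= L -> is_derive s 1 f (f1 s)).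
Hypotheses (L0 : 0 < L) (d0 : 0 < delta)
  (dx0 : dseq x x1) (dx1 : dseq x1 x2) (dx2 : dseq x2 x3) (dx3 : dseq x3 x4)
  (dy0 : dseq y y1) (dy1 : dseq y1 y2) (dy2 : dseq y2 y3) (dy3 : dseq y3 y4)
  (kE : forall s, k s = x1 s * y2 s - y1 s * x2 s)
  (arc : forall s, 0 <= s <= L -> x1 s ^+ 2 + y1 s ^+ 2 = 1)
  (simple : forall s t, 0 <= s <= L -> 0 <= t <= L -> (x s, y s) = (x t, y t) -> s = t)
  (xsym : forall s, 0 <= s <= L / 2 -> x (L - s) = - x s)
  (ysym : forall s, 0 <= s <= L / 2 -> y (L - s) = y s)
  (kconc : concave_on_segment L k)
  (dk : forall s, 0 <= s <= L -> 0 < 1 + delta * k s).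

Let cl := clamp 0 L.
Let cl_in s : 0 <= cl s <= L. Proof. exact/clamp_in/ltW. Qed.
Let cl_cont : continuous cl. Proof. exact: clamp_cont. Qed.
Let clE s : 0 < s < L -> cl s = s. Proof. by move=> /andP[/ltW a /ltW b]; apply: clamp_id; rewrite a. Qed.
Let cl_sym s : cl (L - s) = L - cl s.
Proof.
rewrite /cl /clamp; have l0 := L0.
by rewrite /Num.max /Num.min; do !case: ifPn => //=; rewrite -?leNgt; lra.
Qed.

Let cont_n (f f1 : R -> R) : dseq f f1 -> continuous (fun s => f (cl s)).
Proof.
move=> sf s; apply: (@continuous_comp _ _ _ cl f); first exact: cl_cont.
exact: (der_cont (sf _ (cl_in s))).
Qed.

(** The symmetries of the derivatives are obtained by differentiating inside []0, L[]; continuity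
    carries them to the endpoints, where the clamped functions take their values. *)
Let ext_eq (f g : R -> R) : continuous (fun s => f (cl s)) -> continuous (fun s => g (cl s)) ->
  (forall s, 0 < s < L -> f s = g s) -> forall s, f (cl s) = g (cl s).
Proof.
move=> cf cg fg.
have cf' : continuous (fun s => f (cl (L - s))) by apply: (@cont_comp _ _ _ (fun s => f (cl s)) (fun s => L - s)) => //; cts.
have cg' : continuous (fun s => g (cl (L - s))) by apply: (@cont_comp _ _ _ (fun s => g (cl s)) (fun s => L - s)) => //; cts.
have h2 : 0 < L / 2 by rewrite divr_gt0.
have hL := L0.
have at0 (u : R -> R) : continuous u -> (forall s, 0 < s <= L / 2 -> u s = 0) -> u 0 = 0.
  move=> cu u0; apply/eqP; rewrite eq_le; apply/andP; split.
    rewrite -oppr_ge0; apply: (cont_ge_left (f := fun s => - u s) h2); first by cts.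
    by move=> s hs; rewrite u0 // oppr0.
  by apply: (cont_ge_left (f := u) h2) => // s hs; rewrite u0.
have e0 : f 0 = g 0.
  have := at0 (fun s => f (cl s) - g (cl s)); rewrite /cl clamp_id ?lexx ?ltW // => h.
  apply/eqP; rewrite -subr_eq0; apply/eqP; apply: h; first by cts.
  move=> s /andP[s0 sL]; have hs : 0 < s < L by apply/andP; split; lra.
  by rewrite -/cl clE // fg // subrr.
have eL : f L = g L.
  have := at0 (fun s => f (cl (L - s)) - g (cl (L - s))); rewrite subr0 /cl clamp_id ?lexx ?ltW // => h.
  apply/eqP; rewrite -subr_eq0; apply/eqP; apply: h; first by cts.
  move=> s /andP[s0 sL]; have hs : 0 < L - s < L by apply/andP; split; lra.
  by rewrite -/cl clE // fg // subrr.
move=> s; have /andP[] := cl_in s; rewrite le_eqVlt => /predU1P[<- //|c0].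
by rewrite le_eqVlt => /predU1P[-> //|c1]; apply: fg; rewrite c0.
Qed.

Let xsymL s : 0 <= s <= L -> x (L - s) = - x s.
Proof.
move=> /andP[s0 sL]; have [h|h] := leP s (L / 2); first by apply: xsym; rewrite s0.
have hs : 0 <= L - s <= L / 2 by apply/andP; split; lra.
by have := xsym hs; rewrite (_ : L - (L - s) = s) => [->|]; [rewrite opprK|ring].
Qed.

Let ysymL s : 0 <= s <= L -> y (L - s) = y s.
Proof.
move=> /andP[s0 sL]; have [h|h] := leP s (L / 2); first by apply: ysym; rewrite s0.
have hs : 0 <= L - s <= L / 2 by apply/andP; split; lra.
by have := ysym hs; rewrite (_ : L - (L - s) = s) => [->|]; [|ring].
Qed.

Let inL s : 0 < s < L -> 0 <= s <= L. Proof. by move=> /andP[/ltW-> /ltW->]. Qed.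
Let inLs s : 0 < s < L -> 0 < L - s < L. Proof. by move=> /andP[? ?]; apply/andP; split; lra. Qed.

Let sym_der (f f1 : R -> R) (sg : R) : (forall s, 0 <= s <= L -> is_derive s 1 f (f1 s)) ->
  (forall s, 0 < s < L -> f (L - s) = sg * f s) -> forall s, 0 < s < L -> f1 (L - s) = - sg * f1 s.
Proof.
move=> df fs s hs.
have h1 := df s (inL hs); have h2 := df (L - s) (inL (inLs hs)).
have h3 : is_derive s 1 (fun t => L - t) (-1) by dereq; ring.
have [_ e1] := @der_comp _ f (fun t => L - t) s _ _ h2 h3.
have h4 : is_derive s 1 (fun t => f (L - t)) (sg * f1 s).
  apply: (@near_der _ (fun t => sg * f t) _ 0 L) => //; by move=> t ht; rewrite fs.
have [_ e2] := h4.
have e3 : -1 * f1 (L - s) = sg * f1 s by rewrite -e1 -e2.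
by have -> : - sg * f1 s = - (sg * f1 s) by [ring]; rewrite -e3; ring.
Qed.

Let x1s s : 0 < s < L -> x1 (L - s) = x1 s.
Proof.
move=> hs; rewrite (sym_der (sg := -1) dx0 _ hs) ?opprK ?mul1r // => t ht.
by rewrite mulN1r xsymL //; exact: inL.
Qed.
Let y1s s : 0 < s < L -> y1 (L - s) = - y1 s.
Proof.
move=> hs; rewrite (sym_der (sg := 1) dy0 _ hs) ?mulN1r // => t ht.
by rewrite mul1r ysymL //; exact: inL.
Qed.
Let x2s s : 0 < s < L -> x2 (L - s) = - x2 s.
Proof. by move=> hs; rewrite (sym_der (sg := 1) dx1 _ hs) ?mulN1r // => t ht; rewrite mul1r x1s. Qed.
Let y2s s : 0 < s < L -> y2 (L - s) = y2 s.
Proof. by move=> hs; rewrite (sym_der (sg := -1) dy1 _ hs) ?opprK ?mul1r // => t ht; rewrite mulN1r y1s. Qed.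

Let ksym s : 0 < s < L -> k (L - s) = k s.
Proof. by move=> hs; rewrite !kE x1s // y1s // x2s // y2s //; ring. Qed.

Let perp s : 0 < s < L -> x1 s * x2 s + y1 s * y2 s = 0.
Proof.
move=> hs; have h1 := dx1 (inL hs); have h2 := dy1 (inL hs).
have h3 : is_derive s 1 (fun t => x1 t ^+ 2 + y1 t ^+ 2) (2 * (x1 s * x2 s + y1 s * y2 s)).
  by dereq; rewrite /= !expr1; ring.
have h4 : is_derive s 1 (fun t => x1 t ^+ 2 + y1 t ^+ 2) 0.
  by apply: (@near_der _ (fun=> 1) _ 0 L) => // t ht; rewrite arc //; exact: inL.
have [_ e3] := h3; have [_ e4] := h4; move: e3; rewrite e4 => e3; lra.
Qed.

Let frenet s : 0 < s < L -> x2 s = - (k s * y1 s) /\ y2 s = k s * x1 s.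
Proof.
move=> hs; have p := perp hs; have a := arc (inL hs).
rewrite kE; split.
- have -> : - ((x1 s * y2 s - y1 s * x2 s) * y1 s) =
    x2 s * (x1 s ^+ 2 + y1 s ^+ 2) - x1 s * (x1 s * x2 s + y1 s * y2 s) by ring.
  by rewrite p a; ring.
- have -> : (x1 s * y2 s - y1 s * x2 s) * x1 s =
    y2 s * (x1 s ^+ 2 + y1 s ^+ 2) - y1 s * (x1 s * x2 s + y1 s * y2 s) by ring.
  by rewrite p a; ring.
Qed.

Let curv' s := x1 s * y3 s - y1 s * x3 s.

Let dk_der s : 0 <= s <= L -> is_derive s 1 k (curv' s).
Proof.
move=> hs; have h1 := dx1 hs; have h2 := dy1 hs; have h3 := dx2 hs; have h4 := dy2 hs.
rewrite (_ : k = fun s => x1 s * y2 s - y1 s * x2 s); last by apply/funext => t; rewrite kE.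
by dereq; rewrite /curv'; ring.
Qed.

Let ck_c : continuous (fun s => k (cl s)).
Proof. exact: cont_n dk_der. Qed.

Let ck1_c : continuous (fun s => curv' (cl s)).
Proof.
have c1 := cont_n dx1; have c2 := cont_n dy1; have c3 := cont_n dx3; have c4 := cont_n dy3.
by rewrite /curv'; cts.
Qed.

(** [a] is a convex combination of [b] and [L - b], where [k] takes the same value by symmetry;
    concavity gives [k a >= k b]. *)
Let k_nincr a b : L / 2 < a -> a <= b -> b < L -> k b <= k a.
Proof.
move=> a2 ab bL; have hL := L0.
have den : 0 < 2 * b - L by lra.
pose t := (a - (L - b)) / (2 * b - L).
have t0 : 0 <= t by rewrite divr_ge0 //; lra.
have t1 : t <= 1 by rewrite ler_pdivrMr //; lra.
have b_in : b \in (`[0, L]%classic : set R) by rewrite inE /= in_itv /=; apply/andP; split; lra.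
have b'_in : L - b \in (`[0, L]%classic : set R) by rewrite inE /= in_itv /=; apply/andP; split; lra.
have kc := kconc (Itv01 t0 t1) b_in b'_in.
have ec := convRE b (L - b) (Itv01 t0 t1).
have ek := convRE (- k b) (- k (L - b)) (Itv01 t0 t1).
rewrite /unstable.onem /= in ec ek.
have h : - k (t * b + (1 - t) * (L - b)) <= t * - k b + (1 - t) * - k (L - b).
  by rewrite -ec -ek; exact: kc.
have ea : t * b + (1 - t) * (L - b) = a.
  by have dn : 2 * b - L != 0 by [rewrite gt_eqF]; rewrite /t; field.
rewrite ea in h.
have hb : 0 < b < L by apply/andP; split; lra.
rewrite ksym // in h.
have e : t * - k b + (1 - t) * - k b = - k b by ring.
by rewrite e lerN2 in h.
Qed.

Let k1_le0 s : L / 2 < s < L -> curv' (cl s) <= 0.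
Proof.
move=> /andP[s2 sL]; rewrite leNgt; apply/negP => pos; have hL := L0.
have /cvgrPdist_lt/(_ _ pos) := @ck1_c s; move=> /nbhs_ballP[e /= e0 he].
pose b := Num.min (s + e / 2) ((s + L) / 2).
have sb : s < b by rewrite lt_min; apply/andP; split; lra.
have bL : b < L by apply: (@le_lt_trans _ _ ((s + L) / 2)); [rewrite ge_min lexx orbT|lra].
have be : b <= s + e / 2 by rewrite ge_min lexx.
have : k (cl s) < k (cl b).
  apply: (@der_lt _ (fun u => k (cl u)) (fun u => curv' (cl u)) s b sb ck_c).
    move=> u /andP[u1 u2]; have hu : 0 < u < L by apply/andP; split; lra.
    apply: (@near_der _ k _ 0 L) => //; first by move=> v hv; rewrite clE.
    by rewrite clE //; apply: dk_der; exact: inL.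
  move=> u /andP[u1 u2]; have bu : ball s e u by rewrite /ball /= ltr_norml; apply/andP; split; lra.
  by have := he u bu; rewrite ltr_norml => /andP[? ?]; lra.
have h1 : 0 < s < L by apply/andP; split; lra.
have h2 : 0 < b < L by apply/andP; split; lra.
by rewrite !clE // ltNge k_nincr // ltW.
Qed.

Let o1 s : 0 < s < L -> is_derive s 1 (fun s => x (cl s)) (x1 (cl s)).
Proof.
move=> hs; apply: (@near_der _ x _ 0 L) => //; first by move=> v hv; rewrite clE.
by rewrite clE //; exact: (dx0 (inL hs)).
Qed.
Let o2 s : 0 < s < L -> is_derive s 1 (fun s => y (cl s)) (y1 (cl s)).
Proof.
move=> hs; apply: (@near_der _ y _ 0 L) => //; first by move=> v hv; rewrite clE.
by rewrite clE //; exact: (dy0 (inL hs)).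
Qed.
Let o3 s : 0 < s < L -> is_derive s 1 (fun s => x1 (cl s)) (- (k (cl s) * y1 (cl s))).
Proof.
move=> hs; apply: (@near_der _ x1 _ 0 L) => //; first by move=> v hv; rewrite clE.
by rewrite clE // -(frenet hs).1; exact: (dx1 (inL hs)).
Qed.
Let o4 s : 0 < s < L -> is_derive s 1 (fun s => y1 (cl s)) (k (cl s) * x1 (cl s)).
Proof.
move=> hs; apply: (@near_der _ y1 _ 0 L) => //; first by move=> v hv; rewrite clE.
by rewrite clE // -(frenet hs).2; exact: (dy1 (inL hs)).
Qed.
Let o5 s : 0 < s < L -> is_derive s 1 (fun s => k (cl s)) (curv' (cl s)).
Proof.
move=> hs; apply: (@near_der _ k _ 0 L) => //; first by move=> v hv; rewrite clE.
by rewrite clE //; apply: dk_der; exact: inL.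
Qed.
Let o6 s : x1 (cl s) ^+ 2 + y1 (cl s) ^+ 2 = 1. Proof. exact: arc. Qed.
Let o7 s : x (cl (L - s)) = - x (cl s). Proof. by rewrite cl_sym xsymL. Qed.
Let o8 s : y (cl (L - s)) = y (cl s). Proof. by rewrite cl_sym ysymL. Qed.

Let cont_flip (f : R -> R) : continuous (fun s => f (cl s)) -> continuous (fun s => f (L - cl s)).
Proof.
move=> cf; rewrite (_ : (fun s => _) = (fun s => f (cl (L - s)))); last by apply/funext => t; rewrite cl_sym.
by apply: (@cont_comp _ _ _ (fun s => f (cl s)) (fun s => L - s)) => //; cts.
Qed.

Let o9 s : x1 (cl (L - s)) = x1 (cl s).
Proof.
rewrite cl_sym; have c := cont_n dx1.
exact: (@ext_eq (fun s => x1 (L - s)) x1 (cont_flip c) c x1s).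
Qed.
Let o10 s : y1 (cl (L - s)) = - y1 (cl s).
Proof.
rewrite cl_sym; have c := cont_n dy1.
exact: (@ext_eq (fun s => y1 (L - s)) (fun s => - y1 s) (cont_flip c) (contN c) y1s).
Qed.
Let o11 s : k (cl (L - s)) = k (cl s).
Proof. by rewrite cl_sym; exact: (@ext_eq (fun s => k (L - s)) k (cont_flip ck_c) ck_c ksym). Qed.
(** If [x s = 0], the parameters [s] and [L - s] give the same point, and simplicity of the curve
    forces [s = L / 2]. *)
Let o12 s : L / 2 < s <= L -> x (cl s) <> 0.
Proof.
move=> /andP[s2 sL] e0; have hL := L0.
have hs : 0 <= s <= L by apply/andP; split; lra.
have hs' : 0 <= L - s <= L by apply/andP; split; lra.
rewrite /cl clamp_id // in e0.
have := simple hs' hs; rewrite xsymL // ysymL // e0 oppr0 => /(_ erefl); lra.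
Qed.
Let o13 s : 0 < 1 + delta * k (cl s). Proof. by apply: dk; exact: cl_in. Qed.

Definition clamped_centerline : centerline L delta := @Centerline R L delta
  (fun s => x (cl s)) (fun s => y (cl s)) (fun s => x1 (cl s)) (fun s => y1 (cl s))
  (fun s => k (cl s)) (fun s => curv' (cl s)) L0 d0 (cont_n dx0) (cont_n dy0) (cont_n dx1)
  (cont_n dy1) ck_c o1 o2 o3 o4 o5 o6 o7 o8 o9 o10 o11 k1_le0 o12 o13.

Let C := clamped_centerline.
Let strp : set (R * R) := [set p | exists s r, [/\ 0 < s < L, 0 < r < delta &
  p = (x s + r * y1 s, y s - r * x1 s)]].

Lemma strip_Dom : strp = Dom C.
Proof.
apply/seteqP; split=> p.
  move=> [s [r [hs hr ->]]]; exists (s, r); first by split.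
  by rewrite /Tube.Phi /= clE.
move=> [[s r] [hs hr] <-]; exists s, r; split=> //.
by rewrite /Tube.Phi /= clE.
Qed.

Lemma curv_clamped s : 0 <= s <= L -> ck C s = k s.
Proof. by move=> hs; rewrite /= /cl clamp_id. Qed.

Lemma max_on_segment_ub (f : R -> R) s : continuous (fun s => f (cl s)) -> 0 <= s <= L ->
  f s <= max_on_segment L f.
Proof.
move=> cf hs; have [M M0 hM] := cont_bounded (@compact_box _ 0 L 0 1) (cont_comp cf (@cont_fst _ _)).
have hb t : 0 <= t <= L -> f t <= M.
  move=> ht; have := hM (t, 0); rewrite /= /cl clamp_id // => h.
  apply: le_trans (ler_norm _) (h _); split; rewrite /= in_itv //=.
  by rewrite lexx ler01.
apply: sup_upper_bound; last by exists s => //; rewrite /= in_itv.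
split; first by exists (f s), s => //; rewrite /= in_itv.
by exists M => _ [t ht <-]; apply: hb; move: ht; rewrite /= in_itv.
Qed.

Lemma strip_ratio_num_den : strip_ratio L delta k = L ^+ 2 / pi ^+ 2 * (num C / den C).
Proof.
have itv (f : R -> R) (a b : R) : continuous f ->
    \int[lebesgue_measure]_(t in `[a, b]) f t = \int[lebesgue_measure]_(t in Io a b) f t.
  move=> cf; rewrite /Io Rintegral_itv_obnd_cbnd //.
  exact: cont_integrable.
have both (F : R -> R -> R) (G : R * R -> R) : continuous G ->
    (forall s r, 0 <= s <= L -> 0 <= r <= delta -> F s r = G (s, r)) ->
    \int[lebesgue_measure]_(s in `[0, L]) \int[lebesgue_measure]_(r in `[0, delta]) F s r =
    RI 0 L 0 delta G.
  move=> cG FG; rewrite RI_fubini1 //.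
  have cI := @slice_cont _ 0 delta (fun s r => G (s, r)) (ltW d0) (eq_ind _ (fun f => continuous f) cG _
    (funext (fun z => esym (congr1 G (esym (surjective_pairing z)))))).
  rewrite -itv //; apply: eq_Rintegral => s /set_mem; rewrite /= in_itv /= => hs.
  rewrite -itv; last exact: (@cont_row _ G s cG).
  by apply: eq_Rintegral => r /set_mem; rewrite /= in_itv /= => hr; exact: FG.
have cw := @wt_cont _ _ _ C; have cv := @wtV_cont _ _ _ C.
have cl1 : continuous (fun z : R * R => pi / L * z.1) by cts.
have ccos := cont_comp (@continuous_cos R) cl1; have csin := cont_comp (@continuous_sin R) cl1.
have wE s r : 0 <= s <= L -> 0 <= r <= delta -> 1 + r * k s = wt C (s, r).
  by move=> hs hr; rewrite -(curv_clamped hs) /wt [(s, r).2]/= clamp_id.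
rewrite /strip_ratio /num /den; congr (_ * (_ / _)).
- by apply: both => [|s r hs hr]; [by cts|rewrite wE].
- apply: both => [|s r hs hr]; last by rewrite wE.
  by rewrite (_ : (fun z => _) = (fun z => sin (pi / L * z.1) ^+ 2 * (wt C z)^-1)); [cts|apply/funext => z; rewrite div1r].
Qed.

Let pos s : 0 < 1 + delta * k (cl s). Proof. exact/dk/cl_in. Qed.

(** The alternatives are used slice by slice: at each [s], the maximum matching the sign of [k s] is
    below the ratio. Since [mu] times the ratio is at most 1 by [mu_ratio], the constant of
    [slice_inequality] is absorbed. *)
Lemma spectrum_strip :
  simply_connected R (strp) ->
  (forall s, 0 <= s <= L ->
    (0 <= k s /\ max_on_segment L (fun s => delta ^+ 2 * (2 + delta * k s) ^+ 2) < strip_ratio L delta k) \/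
    (k s <= 0 /\ max_on_segment L (fun s => 4 * delta ^+ 2 / (1 + delta * k s) ^+ 2) < strip_ratio L delta k)) ->
  exists mu : R, is_mu1 (strp) mu /\ is_mu1_odd (strp) mu.
Proof.
rewrite strip_Dom => sc alt.
have sne : exists V : c1fun L delta, c1odd V /\ 0 < NN (wt C) V V.
  by exists cosine; split; [exact: cosine_odd|rewrite cosine_NN num_gt0].
have mr := mu_ratio C; rewrite -strip_ratio_num_den in mr.
have m0 := mu_ge0 (@wt_cont _ _ _ C) (wt_gt0 C) sne.
exists (@mu R L delta (wt C)); apply: spectrum => //.
  by move=> z z'; exact: Phi_inj.
move=> s g g1 hs cg cg1 dg gz.
have hs' := inL hs.
have c1 : continuous (fun s => delta ^+ 2 * (2 + delta * k (cl s)) ^+ 2) by have c := ck_c; cts.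
have c2 : continuous (fun s => 4 * delta ^+ 2 / (1 + delta * k (cl s)) ^+ 2).
  have c := ck_c; have ci : continuous (fun s => ((1 + delta * k (cl s)) ^+ 2)^-1).
    by apply: contV; [move=> u; rewrite expf_neq0 // gt_eqF|cts].
  by cts.
have [M [hM MR]] : exists M, ((0 <= ck C s /\ delta ^+ 2 * (2 + delta * ck C s) ^+ 2 <= M) \/
    (ck C s <= 0 /\ 4 * delta ^+ 2 / (1 + delta * ck C s) ^+ 2 <= M)) /\ M < strip_ratio L delta k.
  rewrite curv_clamped //; have [[ks h]|[ks h]] := alt s hs'.
    exists (max_on_segment L (fun s => delta ^+ 2 * (2 + delta * k s) ^+ 2)); split=> //.
    left; split=> //; exact: (@max_on_segment_ub (fun s => delta ^+ 2 * (2 + delta * k s) ^+ 2)).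
  exists (max_on_segment L (fun s => 4 * delta ^+ 2 / (1 + delta * k s) ^+ 2)); split=> //.
  right; split=> //; exact: (@max_on_segment_ub (fun s => 4 * delta ^+ 2 / (1 + delta * k s) ^+ 2)).
have si := slice_inequality cg cg1 dg gz hM.
apply: le_trans (ler_wpM2l m0 si) _; rewrite mulrA.
rewrite -[leRHS]mul1r ler_wpM2r //.
  by apply: Rintegral_ge0 => r _; rewrite mulr_ge0 ?sqr_ge0 // ltW // wt_gt0.
by apply: le_trans mr; rewrite ler_wpM2l // ltW.
Qed.

End Reduction.

Theorem proposition3p2 (R : realType) (L delta : R) (x y : R -> R)
  (L_gt0 : 0 < L)
  (x_smooth : smooth_on_segment L x)
  (y_smooth : smooth_on_segment L y)
  (arc_length : forall s, 0 <= s <= L -> derive1 x s ^+ 2 + derive1 y s ^+ 2 = 1)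
  (non_closed : (x 0, y 0) <> (x L, y L))
  (simple : forall s t, 0 <= s <= L -> 0 <= t <= L ->
     (x s, y s) = (x t, y t) -> s = t)
  (x_sym : forall s, 0 <= s <= L / 2 -> x (L - s) = - x s)
  (y_sym : forall s, 0 <= s <= L / 2 -> y (L - s) = y s)
  (k := curvature x y)
  (k_concave : concave_on_segment L k)
  (delta_gt0 : 0 < delta)
  (delta_k : forall s, 0 <= s <= L -> 0 < 1 + delta * k s)
  (D := strip L delta x y)
  (D_simply_connected : simply_connected R D)
  (M1 := max_on_segment L (fun s => delta ^+ 2 * (2 + delta * k s) ^+ 2))
  (M2 := max_on_segment L (fun s => 4 * delta ^+ 2 / (1 + delta * k s) ^+ 2))
  (alternatives :
     [\/ (forall s, 0 <= s <= L -> 0 <= k s) /\ M1 < strip_ratio L delta k,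
         (forall s, 0 <= s <= L -> k s < 0) /\ M2 < strip_ratio L delta k |
         [/\ exists s, 0 <= s <= L /\ k s < 0,
             exists s, 0 <= s <= L /\ 0 < k s &
             Num.max M1 M2 < strip_ratio L delta k]]) :
  exists mu : R, is_mu1 D mu /\ is_mu1_odd D mu.
Proof.
have der_n (f : R -> R) n s : smooth_on_segment L f -> 0 <= s <= L ->
    is_derive s 1 (derive1n n f) (derive1n n.+1 f s).
  move=> [e e0 h] /andP[s0 sL]; apply: DeriveDef; last by rewrite -derive1E.
  by apply: h; apply/andP; split; lra.
apply: (spectrum_strip L_gt0 delta_gt0 (fun s => der_n x 0 s x_smooth) (fun s => der_n x 1 s x_smooth)
  (fun s => der_n x 2 s x_smooth) (fun s => der_n x 3 s x_smooth) (fun s => der_n y 0 s y_smooth)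
  (fun s => der_n y 1 s y_smooth) (fun s => der_n y 2 s y_smooth) (fun s => der_n y 3 s y_smooth)
  (fun s => erefl) arc_length simple x_sym y_sym k_concave delta_k D_simply_connected).
move=> s hs; case: alternatives => [[h1 h2]|[h1 h2]|[_ _]].
- by left; split=> //; exact: h1.
- by right; split=> //; apply: ltW; exact: h1.
(* Both maxima are below the ratio here, so the sign of [k s] at the given point decides which one
   is used. *)
- rewrite gt_max => /andP[h1 h2]; have [ks|/ltW ks] := leP 0 (k s); first by left.
  by right.
Qed.
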